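(* Let $\Omega\subset\mathbb{R}^2$ be a bounded polygonal domain satisfying the regularity assumption (with constant $C_{1,2}$) stated in the context. Then there is a constant $C$, depending only on $C_2^{(1)},C_2^{(2)}$ and $C_{1,2}$ (and in particular independent of $h$, $R$, $f$ and the geometric properties of the triangulation), such that the following holds. Let $\mathcal{T}_h$ be any proper triangulation of $\Omega$ with $C_2^{(2)}R\le1$, let $f\in L^2(\Omega)$, let $(\mathbf p,u)\in H(\mathrm{div},\Omega)\times L^2(\Omega)$ be the exact solution of the mixed variational problem, and let $(\mathbf p_h,u_h^{RT})\in\mathbf S_h^{RT}\times S_h^C$ be the solution of the Raviart--Thomas finite element method. Then $$|\mathbf p-\mathbf p_h|_{0,\Omega}\le C R\,|f|_{0,\Omega},\qquad |u-u_h^{RT}|_{0,\Omega}\le C(R+h)\,|f|_{0,\Omega}.$$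
   Context: Notation: $|\cdot|_{k,\Omega}$ is the $H^k(\Omega)$ seminorm, i.e. the square root of the sum of the squared $L^2$ norms of all order-$k$ derivatives ($|\cdot|_{0,\Omega}$ is the $L^2$ norm), and $\|v\|_{k,\Omega}^2=\sum_{m\le k}|v|_{m,\Omega}^2$; for vector fields, sums over components are taken. $H(\mathrm{div},\Omega)=\{\mathbf w\in(L^2(\Omega))^2:\mathrm{div}\,\mathbf w\in L^2(\Omega)\}$ with norm $(\|\mathbf w\|_{0,\Omega}^2+\|\mathrm{div}\,\mathbf w\|_{0,\Omega}^2)^{1/2}$. Proper triangulation: a finite set $\mathcal{T}_h$ of closed triangles with $\overline\Omega=\bigcup_{K\in\mathcal{T}_h}K$ such that two distinct members have intersection that is empty, a common vertex, or a common edge. $h_K=\mathrm{diam}\,K$, $R_K$ is the circumradius of $K$, $h=\max_K h_K$, $R=\max_K R_K$. Regularity assumption: for every $f\in L^2(\Omega)$ the unique weak solution $u\in H_0^1(\Omega)$ of $-\Delta u=f$ in $\Omega$, $u=0$ on $\partial\Omega$, belongs to $H^2(\Omega)$ and $\|u\|_{2,\Omega}\le C_{1,2}\|f\|_{0,\Omega}$, with $C_{1,2}$ independent of $f$. Constants $C_2^{(1)},C_2^{(2)}$: for a triangle $K$ with edges $e_1,e_2,e_3$ and unit outer normal $\mathbf n$, let $X_2^{(1)}(K)=\{v\in H^1(K):\int_K v\,d\mathbf x=0\}$, $\mathbf X_2^{(2)}(K)=\{\mathbf q\in(H^1(K))^2:\int_{e_i}\mathbf q\cdot\mathbf n\,ds=0,\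 i=1,2,3\}$, $B_2^{(1)}(K)=\sup_{0\neq v\in X_2^{(1)}(K)}|v|_{0,K}/|v|_{1,K}$ and $B_2^{(2)}(K)=\sup_{0\neq\mathbf q\in\mathbf X_2^{(2)}(K)}|\mathbf q|_{0,K}/|\mathbf q|_{1,K}$. $C_2^{(1)},C_2^{(2)}>0$ are fixed constants, independent of $K$, such that $B_2^{(1)}(K)\le C_2^{(1)}h_K$ and $B_2^{(2)}(K)\le C_2^{(2)}R_K$ for every triangle $K$ with vertices $(0,0)^\top,(\alpha,0)^\top,(\beta s,\beta t)^\top$, $0<\beta\le\alpha$, $s^2+t^2=1$, $t>0$, whose longest edge joins the last two vertices (every triangle in the plane is congruent to such a $K$). Mixed variational problem: find $(\mathbf p,u)\in H(\mathrm{div},\Omega)\times L^2(\Omega)$ with $(\mathbf p,\mathbf q)_\Omega+(u,\mathrm{div}\,\mathbf q)_\Omega=0$ for all $\mathbf q\in H(\mathrm{div},\Omega)$ and $(\mathrm{div}\,\mathbf p,v)_\Omega+(f,v)_\Omega=0$ for all $v\in L^2(\Omega)$ (it is uniquely solvable). Raviart--Thomas method: $\mathcal{RT}_0=\{a\mathbf x+\mathbf b: a\in\mathbb{R},\mathbf b\in\mathbb{R}^2\}$, $\mathbf S_h^{RT}=\{\mathbf p_h\in H(\mathrm{div},\Omega):\mathbf p_h|_K\in\mathcal{RT}_0\ \forall K\in\mathcal{T}_h\}$, $S_h^C=\{v_h\in L^2(\Omega): v_h|_K \text{ is constant } \forall K\in\mathcal{T}_h\}$. The solution $(\mathbf p_h,u_h^{RT})\in\mathbf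 S_h^{RT}\times S_h^C$ satisfies $(\mathbf p_h,\mathbf q_h)_\Omega+(u_h^{RT},\mathrm{div}\,\mathbf q_h)_\Omega=0$ for all $\mathbf q_h\in\mathbf S_h^{RT}$ and $(\mathrm{div}\,\mathbf p_h,v_h)_\Omega+(f,v_h)_\Omega=0$ for all $v_h\in S_h^C$. *)

(* Defs.v *)
From HB Require Import structures.
From mathcomp Require Import all_boot all_order all_algebra.
From mathcomp Require Import all_classical all_reals all_analysis.

Set Implicit Arguments.
Unset Strict Implicit.
Unset Printing Implicit Defensive.

Import Order.TTheory GRing.Theory Num.Theory numFieldNormedType.Exports.
Local Open Scope classical_set_scope.
Local Open Scope ring_scope.

(* The library norm on [R * R] is the sup norm; Euclidean distances and
   scalar products are therefore introduced explicitly. *)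
Notation pt R := (R * R)%type.
Notation leb1 R := (@lebesgue_measure R).
Notation leb2 R := (@lebesgue_measure R \x @lebesgue_measure R)%E.

Definition dot {R : realType} (x y : pt R) : R := x.1 * y.1 + x.2 * y.2.

Definition edist {R : realType} (x y : pt R) : R :=
  Num.sqrt ((x.1 - y.1) ^+ 2 + (x.2 - y.2) ^+ 2).

Definition fst_of {R : realType} (q : pt R -> pt R) : pt R -> R := fun x => (q x).1.
Definition snd_of {R : realType} (q : pt R -> pt R) : pt R -> R := fun x => (q x).2.

(** * Square-integrable functions *)

(* Functions are representatives of L^2 classes: only their values almost
   everywhere in [U] matter. *)
Definition L2 {R : realType} (U : set (pt R)) (v : pt R -> R) : Prop :=
  measurable_fun U v /\ (leb2 R).-integrable U (fun x => ((v x) ^+ 2)%:E).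

Definition L2v {R : realType} (U : set (pt R)) (q : pt R -> pt R) : Prop :=
  L2 U (fst_of q) /\ L2 U (snd_of q).

Definition ip {R : realType} (U : set (pt R)) (v w : pt R -> R) : R :=
  \int[leb2 R]_(x in U) (v x * w x).

Definition ipv {R : realType} (U : set (pt R)) (p q : pt R -> pt R) : R :=
  \int[leb2 R]_(x in U) dot (p x) (q x).

Definition norm0 {R : realType} (U : set (pt R)) (v : pt R -> R) : R :=
  Num.sqrt (ip U v v).

Definition norm0v {R : realType} (U : set (pt R)) (q : pt R -> pt R) : R :=
  Num.sqrt (norm0 U (fst_of q) ^+ 2 + norm0 U (snd_of q) ^+ 2).

(** * Test functions and weak derivatives *)

Definition d1 {R : realType} (f : pt R -> R) : pt R -> R := 'D_((1, 0) : pt R) f.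
Definition d2 {R : realType} (f : pt R -> R) : pt R -> R := 'D_((0, 1) : pt R) f.

Fixpoint Ck {R : realType} (k : nat) (f : pt R -> R) : Prop :=
  continuous f /\
  if k is k'.+1 then
    [/\ forall x, derivable f x (1, 0) /\ derivable f x (0, 1),
        Ck k' (d1 f) & Ck k' (d2 f)]
  else True.

Definition smooth {R : realType} (f : pt R -> R) : Prop := forall k, Ck k f.

Definition test_fun {R : realType} (U : set (pt R)) (phi : pt R -> R) : Prop :=
  let supp := closure [set x | phi x != 0] in
  [/\ smooth phi, compact supp & supp `<=` U].

Definition pderiv {R : realType} (a : nat * nat) (phi : pt R -> R) : pt R -> R :=
  iter a.1 d1 (iter a.2 d2 phi).

Definition is_weak_deriv {R : realType} (U : set (pt R)) (a : nat * nat)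
    (v g : pt R -> R) : Prop :=
  L2 U g /\ forall phi, test_fun U phi ->
    ip U v (pderiv a phi) = (-1) ^+ (a.1 + a.2) * ip U g phi.

(* Weak derivatives are unique almost everywhere; [wD] picks a representative
   (and is junk when there is none). *)
Definition wD {R : realType} (U : set (pt R)) (a : nat * nat) (v : pt R -> R) :
    pt R -> R :=
  xget (cst 0) [set g | is_weak_deriv U a v g].

Definition wgrad {R : realType} (U : set (pt R)) (v : pt R -> R) : pt R -> pt R :=
  fun x => (wD U (1%N, 0%N) v x, wD U (0%N, 1%N) v x).

Definition is_weak_div {R : realType} (U : set (pt R)) (w : pt R -> pt R)
    (d : pt R -> R) : Prop :=
  L2 U d /\ forall phi, test_fun U phi ->
    ipv U w (fun x => (d1 phi x, d2 phi x)) = - ip U d phi.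

Definition wdiv {R : realType} (U : set (pt R)) (w : pt R -> pt R) : pt R -> R :=
  xget (cst 0) [set d | is_weak_div U w d].

(** * Sobolev spaces *)

Definition Hdiv {R : realType} (U : set (pt R)) (w : pt R -> pt R) : Prop :=
  L2v U w /\ exists d, is_weak_div U w d.

Definition Hk {R : realType} (k : nat) (U : set (pt R)) (v : pt R -> R) : Prop :=
  L2 U v /\
  forall a : nat * nat, (a.1 + a.2 <= k)%N -> exists g, is_weak_deriv U a v g.

Definition Hkv {R : realType} (k : nat) (U : set (pt R)) (q : pt R -> pt R) : Prop :=
  Hk k U (fst_of q) /\ Hk k U (snd_of q).

(* The sum runs over the multi-indices of order [k]. *)
Definition seminorm {R : realType} (k : nat) (U : set (pt R)) (v : pt R -> R) : R :=
  Num.sqrt (\sum_(i < k.+1) norm0 U (wD U (nat_of_ord i, (k - i)%N) v) ^+ 2).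

Definition seminormv {R : realType} (k : nat) (U : set (pt R))
    (q : pt R -> pt R) : R :=
  Num.sqrt (seminorm k U (fst_of q) ^+ 2 + seminorm k U (snd_of q) ^+ 2).

Definition normH {R : realType} (k : nat) (U : set (pt R)) (v : pt R -> R) : R :=
  Num.sqrt (\sum_(m < k.+1) seminorm m U v ^+ 2).

Definition H10 {R : realType} (U : set (pt R)) (v : pt R -> R) : Prop :=
  Hk 1 U v /\
  exists phi : nat -> pt R -> R,
    (forall n, test_fun U (phi n)) /\
    (fun n => normH 1 U (v \- phi n)) @ \oo --> (0 : R).

(** * Triangles and triangulations *)

(* A triangle is given by its three vertices. *)
Notation triangle R := (pt R * pt R * pt R)%type.

Definition vertices {R : realType} (K : triangle R) : seq (pt R) :=
  [:: K.1.1; K.1.2; K.2].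

Definition nondegenerate {R : realType} (K : triangle R) : Prop :=
  let a := K.1.1 in let b := K.1.2 in let c := K.2 in
  (b.1 - a.1) * (c.2 - a.2) - (b.2 - a.2) * (c.1 - a.1) != 0.

Definition hull {R : realType} (K : triangle R) : set (pt R) :=
  [set x | exists r s t : R, [/\ 0 <= r, 0 <= s, 0 <= t, r + s + t = 1 &
     x = r *: K.1.1 + s *: K.1.2 + t *: K.2]].

Definition edge_at {R : realType} (a b : pt R) (t : R) : pt R := a + t *: (b - a).

Definition segment {R : realType} (a b : pt R) : set (pt R) :=
  [set edge_at a b t | t in `[0, 1]].

Definition diam {R : realType} (A : set (pt R)) : R :=
  sup [set d | exists x y, [/\ A x, A y & d = edist x y]].

Definition hK {R : realType} (K : triangle R) : R := diam (hull K).

(* For a nondegenerate triangle there is exactly one such radius. *)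
Definition circumradius {R : realType} (K : triangle R) : R :=
  xget 0 [set r | exists o, forall x, x \in vertices K -> edist o x = r].

Definition proper_triangulation {R : realType} (Omega : set (pt R))
    (T : seq (triangle R)) : Prop :=
  [/\ forall K, K \in T -> nondegenerate K,
      closure Omega = \bigcup_(K in [set` T]) hull K &
      forall K L, K \in T -> L \in T -> hull K <> hull L ->
        [\/ hull K `&` hull L = set0,
            exists x, [/\ x \in vertices K, x \in vertices L &
                          hull K `&` hull L = [set x]] |
            exists x y, [/\ x != y, x \in vertices K /\ y \in vertices K,
                            x \in vertices L /\ y \in vertices L &
                            hull K `&` hull L = segment x y]]].

Definition mesh_h {R : realType} (T : seq (triangle R)) : R :=
  \big[Num.max/0]_(K <- T) hK K.

Definition mesh_R {R : realType} (T : seq (triangle R)) : R :=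
  \big[Num.max/0]_(K <- T) circumradius K.

(* Holes and points where several boundary components meet are allowed; the
   condition [Omega = (closure Omega)^°] only excludes slits and punctures, i.e.
   parts of the boundary having [Omega] on both sides. *)
Definition polygonal_domain {R : realType} (Omega : set (pt R)) : Prop :=
  [/\ open Omega /\ connected Omega, Omega !=set0, bounded_set Omega,
      Omega = interior (closure Omega) &
      exists s : seq (pt R * pt R),
        (forall e, e \in s -> e.1 != e.2) /\
        closure Omega `\` Omega = \bigcup_(e in [set` s]) segment e.1 e.2].

(** * Traces and edge integrals *)

Definition edge_int {R : realType} (a b : pt R) (g : pt R -> R) : R :=
  edist a b * \int[leb1 R]_(t in `[0, 1]) g (edge_at a b t).

Definition L2_edge {R : realType} (a b : pt R) (g : pt R -> R) : Prop :=
  measurable_fun (`[0, 1] : set R) (g \o edge_at a b) /\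
  (leb1 R).-integrable `[0, 1] (fun t => ((g (edge_at a b t)) ^+ 2)%:E).

(* [g] is the trace of [v : H^1(U)] on the edge [[a, b]] of [U]: the trace map
   is the continuous extension of the restriction of smooth functions. *)
Definition is_trace {R : realType} (U : set (pt R)) (a b : pt R)
    (v g : pt R -> R) : Prop :=
  L2_edge a b g /\
  exists phi : nat -> pt R -> R,
    [/\ forall n, smooth (phi n),
        (fun n => normH 1 U (v \- phi n)) @ \oo --> (0 : R) &
        (fun n => Num.sqrt (edge_int a b (fun x => (g x - phi n x) ^+ 2)))
          @ \oo --> (0 : R)].

(* The edges of [K] with their end points and the opposite vertex. *)
Definition edges {R : realType} (K : triangle R) : seq (triangle R) :=
  let a := K.1.1 in let b := K.1.2 in let c := K.2 in
  [:: (a, b, c); (b, c, a); (c, a, b)].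

(* Unit normal to [[a, b]] pointing away from [c]. *)
Definition outer_normal {R : realType} (a b c : pt R) : pt R :=
  let d := b - a in
  let m := (edist a b)^-1 *: ((d.2, - d.1) : pt R) in
  if dot m (c - a) < 0 then m else - m.

Definition zero_flux {R : realType} (K : triangle R) (q : pt R -> pt R) : Prop :=
  forall a b c, (a, b, c) \in edges K ->
    exists g : pt R -> pt R,
      [/\ is_trace (interior (hull K)) a b (fst_of q) (fst_of g),
          is_trace (interior (hull K)) a b (snd_of q) (snd_of g) &
          edge_int a b (fun x => dot (g x) (outer_normal a b c)) = 0].

(** * The interpolation constants *)

Definition X21 {R : realType} (K : triangle R) (v : pt R -> R) : Prop :=
  Hk 1 (interior (hull K)) v /\ \int[leb2 R]_(x in interior (hull K)) v x = 0.

Definition X22 {R : realType} (K : triangle R) (q : pt R -> pt R) : Prop :=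
  Hkv 1 (interior (hull K)) q /\ zero_flux K q.

Definition B21 {R : realType} (K : triangle R) : \bar R :=
  let U := interior (hull K) in
  ereal_sup [set (norm0 U v / seminorm 1 U v)%:E
            | v in [set v | X21 K v /\ norm0 U v != 0]].

Definition B22 {R : realType} (K : triangle R) : \bar R :=
  let U := interior (hull K) in
  ereal_sup [set (norm0v U q / seminormv 1 U q)%:E
            | q in [set q | X22 K q /\ norm0v U q != 0]].

Definition standard_triangle {R : realType} (K : triangle R) : Prop :=
  exists alpha beta s t : R,
    [/\ 0 < beta /\ beta <= alpha, s ^+ 2 + t ^+ 2 = 1, 0 < t,
        K = ((0, 0), (alpha, 0), (beta * s, beta * t)) &
        edist K.1.1 K.1.2 <= edist K.1.2 K.2 /\
        edist K.1.1 K.2 <= edist K.1.2 K.2].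

(** * The Poisson problem, its mixed form and the Raviart-Thomas method *)

Definition weak_poisson {R : realType} (Omega : set (pt R)) (f u : pt R -> R) : Prop :=
  H10 Omega u /\
  forall v, H10 Omega v -> ipv Omega (wgrad Omega u) (wgrad Omega v) = ip Omega f v.

Definition regularity {R : realType} (Omega : set (pt R)) (C12 : R) : Prop :=
  forall f, L2 Omega f ->
    exists u, [/\ weak_poisson Omega f u, Hk 2 Omega u &
                  normH 2 Omega u <= C12 * norm0 Omega f].

Definition mixed_solution {R : realType} (Omega : set (pt R)) (f : pt R -> R)
    (p : pt R -> pt R) (u : pt R -> R) : Prop :=
  [/\ Hdiv Omega p, L2 Omega u,
      forall q, Hdiv Omega q -> ipv Omega p q + ip Omega u (wdiv Omega q) = 0 &
      forall v, L2 Omega v -> ip Omega (wdiv Omega p) v + ip Omega f v = 0].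

Definition S_RT {R : realType} (Omega : set (pt R)) (T : seq (triangle R))
    (q : pt R -> pt R) : Prop :=
  Hdiv Omega q /\
  forall K, K \in T -> exists (a : R) (b : pt R),
    {ae leb2 R, forall x, hull K x -> q x = a *: x + b}.

Definition S_C {R : realType} (Omega : set (pt R)) (T : seq (triangle R))
    (v : pt R -> R) : Prop :=
  L2 Omega v /\
  forall K, K \in T -> exists c : R, {ae leb2 R, forall x, hull K x -> v x = c}.

Definition RT_solution {R : realType} (Omega : set (pt R)) (T : seq (triangle R))
    (f : pt R -> R) (ph : pt R -> pt R) (uh : pt R -> R) : Prop :=
  [/\ S_RT Omega T ph, S_C Omega T uh,
      forall q, S_RT Omega T q -> ipv Omega ph q + ip Omega uh (wdiv Omega q) = 0 &
      forall v, S_C Omega T v -> ip Omega (wdiv Omega ph) v + ip Omega f v = 0].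

(* Main.v *)
Require Import Defs.
From HB Require Import structures.
From mathcomp Require Import all_boot all_order all_algebra.
From mathcomp Require Import all_classical all_reals all_analysis.
From mathcomp Require Import measurable_realfun ring lra.
Import Order.TTheory GRing.Theory Num.Theory numFieldNormedType.Exports.
Local Open Scope classical_set_scope.
Local Open Scope ring_scope.
Set Implicit Arguments.
Unset Strict Implicit.
Unset Printing Implicit Defensive.

(* On a triangle K = (a, b, c) the mean normal flux through the edge [a, b] is
   read off from volume integrals: for q of class H^1, the integral over K of
   2 q + (x - c) . grad q is det(a, b, c) times the mean of q on [a, b]
   (divergence theorem for q (x - c), which is tangential on the other edges).
   Defining the Raviart-Thomas interpolant with these means avoids traces.

   Local error: the interpolant is compared with the mean of q.  Its deviation
   is controlled at the vertex c opposite to the longest edge, where the product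
   of the two short edges over |det| is 2 R_K divided by the longest edge; a
   Poincaré inequality with a universal constant (difference sets of a triangle
   have at most six times its area) handles q minus its mean.

   Conformity: two triangles sharing an edge see the same flux, because a test
   field that is radial from c on one side and from c' on the other, cut off
   away from the two end points, can be inserted in the definition of the weak
   derivative.  The flux terms over oriented edges therefore cancel in pairs, and
   the piecewise interpolant belongs to H(div).

   Global error: by orthogonality |p - p_h| <= |p - I p|, and the error of u is
   treated by duality, with the Poisson problem whose right-hand side is the
   difference of the cell means of u and of u_h. *)

(** A weak derivative is known only through its pairings with test functions, while the fields one
    would like to insert are discontinuous across edges. Smooth cut-offs replace them, designed so
    that the large derivative of a cut-off only multiplies a quantity vanishing at the same rate;
    dominated convergence then applies. The regularity assumption speaks of a Poisson solution and
    not of p: uniqueness for the mixed problem identifies p with its weak gradient, and the weak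
    Hessian supplies the derivatives in the flux formula. The divergence of the interpolant is the
    cell mean of the exact divergence; therefore the interpolant minus p_h is divergence free, which
    is the source of the orthogonality. In the duality argument the interpolated dual flux has norm
    at most (1 + 36 R) |C12| times the norm of the data, and C22 R <= 1 turns the factor R into 1 /
    C22; this is how the constant depends on C22. The given list may contain a triangle repeatedly,
    so one positively oriented representative per hull is kept; neighbours then run through a common
    edge in opposite directions. *)

Local Notation edist := Defs.edist.
Local Notation nondegenerate := Defs.nondegenerate.

(** * Smooth cut-off functions *)

Section OneVar.
Variable R : realType.
Implicit Types (g f : R -> R) (x : R).

(** The derivative is an existential witness, so that sums, products, inverses and affine
    substitutions are differentiated by exhibiting the formula and never by evaluating ['D_1]. *)
Fixpoint C1k (k : nat) g : Prop :=
  if k is k'.+1 then exists2 g', (forall x, is_derive x 1 g (g' x)) & C1k k' g'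
  else continuous g.

Definition smooth1 g := forall k, C1k k g.

Lemma C1k_cont k g : C1k k g -> continuous g.
Proof.
case: k => [//|k] /= [g' dg _] x.
by apply: differentiable_continuous; apply/derivable1_diffP; case: (dg x).
Qed.

Lemma C1kW k g : C1k k.+1 g -> C1k k g.
Proof.
elim: k g => [g /C1k_cont //|k IH g [g' dg cg]].
by exists g' => //; exact: IH.
Qed.

Lemma C1k_ext k f g : f =1 g -> C1k k f -> C1k k g.
Proof. by move=> /funext ->. Qed.

Lemma C1kD k f g : C1k k f -> C1k k g -> C1k k (fun x => f x + g x).
Proof.
elim: k f g => [f g cf cg x /=|k IH f g [f' df cf] [g' dg cg]].
  by apply: cvgD; [exact: cf|exact: cg].
by exists (fun x => f' x + g' x); [move=> x; exact: is_deriveD|exact: IH].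
Qed.

Lemma C1kM k f g : C1k k f -> C1k k g -> C1k k (fun x => f x * g x).
Proof.
elim: k f g => [f g cf cg x /=|k IH f g [f' df cf] [g' dg cg]].
  by apply: cvgM; [exact: cf|exact: cg].
exists (fun x => f x * g' x + g x * f' x).
  by move=> x; exact: is_deriveM.
apply: C1kD; apply: IH => //; apply: C1kW; [by exists f'|by exists g'].
Qed.

Lemma C1k_cst k c : C1k k (fun _ => c).
Proof.
elim: k c => [c x|k IH c /=]; first exact: cvg_cst.
by exists (fun _ => 0) => // x; exact: is_derive_cst.
Qed.

Lemma C1kV k f : (forall x, f x != 0) -> C1k k f -> C1k k (fun x => (f x)^-1).
Proof.
move=> f0; elim: k => [cf x|k IH cf].
  by apply: cvgV; [exact: f0|exact: cf].
have cfk := C1kW cf; case: cf => f' df cf.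
exists (fun x => (- 1) * ((f x)^-1 * (f x)^-1) * f' x).
  move=> x; have := is_deriveV (f0 x) (df x).
  by congr is_derive; rewrite mulN1r -invfM -expr2.
by apply: C1kM => //; apply: C1kM; [exact: C1k_cst|apply: C1kM; exact: IH].
Qed.

Lemma C1k_affine k f a b : C1k k f -> C1k k (fun x => f (a * x + b)).
Proof.
have da x : is_derive x 1 (fun x : R => a * x + b) a.
  rewrite -[X in is_derive _ _ _ X]addr0; apply: is_deriveD.
  by rewrite -[X in is_derive _ _ _ X]mulr1; exact: is_deriveZ.
elim: k f => [f cf x|k IH f [f' df cf]].
  apply: (@continuous_comp _ _ _ (fun x : R => a * x + b) f); last exact: cf.
  by apply: differentiable_continuous; apply/derivable1_diffP; case: (da x).
exists (fun x => f' (a * x + b) * a).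
  by move=> x; apply: (@is_derive1_comp _ f (fun x : R => a * x + b)).
by apply: C1kM; [exact: IH|exact: C1k_cst].
Qed.

(** The classical function [exp (- 1 / x)], extended by zero. The factor [x^-1 ^+ k] makes the
    family stable under differentiation, so that smoothness for all [k] follows by one induction. *)
Definition flat (k : nat) x : R := if 0 < x then x^-1 ^+ k * expR (- x^-1) else 0.

Lemma flat_ge0 k x : 0 <= flat k x.
Proof.
rewrite /flat; case: ifP => // x0.
by rewrite mulr_ge0 ?expR_ge0// exprn_ge0// invr_ge0 ltW.
Qed.

(** With [y = 1 / x] and [m = k + 2], [exp y = exp (y / m) ^ m >= (y / m) ^ m]. The two spare powers
    leave the factor [x ^+ 2], which forces the derivative at zero to vanish. *)
Lemma flat_le k x : flat k x <= k.+2%:R ^+ k.+2 * x ^+ 2.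
Proof.
rewrite /flat; case: ifP => x0; last by rewrite mulr_ge0 ?sqr_ge0// exprn_ge0.
set y := x^-1; have y0 : 0 < y by rewrite invr_gt0.
have H : (y / k.+2%:R) ^+ k.+2 <= expR y.
  have -> : expR y = expR (y / k.+2%:R) ^+ k.+2 by rewrite -expRM_natl mulrC mulfVK ?pnatr_eq0.
  have le1 : y / k.+2%:R <= expR (y / k.+2%:R).
    by rewrite (le_trans _ (expR_ge1Dx _))// lerDr.
  apply: lerXn2r le1; rewrite nnegrE ?expR_ge0//.
  by rewrite divr_ge0// ltW.
rewrite expRN ler_pdivrMr ?expR_gt0//.
have -> : x ^+ 2 = (y ^+ 2)^-1 by rewrite /y exprVn invrK.
rewrite expr_div_n ler_pdivrMr ?exprn_gt0// in H.
rewrite mulrAC ler_pdivlMr ?exprn_gt0//.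
by rewrite -exprD addn2 mulrC.
Qed.

Lemma flat_derive0 k : is_derive (0:R) 1 (flat k) 0.
Proof.
have H : h^-1 *: ((flat k \o shift 0) (h *: 1) - flat k 0) @[h --> (0:R)^'] --> (0 : R).
  have f0 : flat k 0 = 0 by rewrite /flat ltxx.
  apply: norm_cvg0.
  set M : R := k.+2%:R ^+ k.+2.
  apply: (@squeeze_cvgr _ _ _ _ (cst 0) (fun h => M * `|h|)).
  - near=> h; rewrite normr_ge0/= f0 subr0 /= /shift/= addr0 scaler1.
    rewrite /GRing.scale/= normrM normfV ler_pdivrMl ?normr_gt0; last first.
      by near: h; exact: nbhs_dnbhs_neq.
    by rewrite ger0_norm ?flat_ge0// (le_trans (flat_le _ _))// -/M -[h ^+ 2]real_normK ?num_real// expr2 mulrCA.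
  - exact: cvg_cst.
  - apply: cvg_trans; last first.
      have : M * `|h| @[h --> (0:R)^'] --> M * `|0 : R|.
        apply: cvgM; first exact: cvg_cst.
        by apply: cvg_norm; exact: nbhs_dnbhs.
      by rewrite normr0 mulr0; apply.
    by [].
apply: DeriveDef; first by apply/cvg_ex; exists 0.
exact: cvg_lim.
Unshelve. all: by end_near. Qed.

Lemma flat_derive k x : is_derive x 1 (flat k) (flat k.+2 x - k%:R * flat k.+1 x).
Proof.
have [x0|x0|->] := ltgtP x 0.
- rewrite /flat !ltNge ltW//= mulr0 subr0.
  have H : {near x, cst 0 =1 flat k}.
    near=> z; rewrite /flat ltNge ltW//.
    by near: z; exact: lt_nbhsl.
  apply: DeriveDef; first by apply: (near_eq_derivable H); exact: derivable_cst.
  by rewrite -(near_eq_derive _ H) derive_cst.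
- have H : {near x, (fun x : R => x^-1 ^+ k * expR (- x^-1)) =1 flat k}.
    near=> z; rewrite /flat ifT//.
    by near: z; exact: lt_nbhsr.
  have xn : x != 0 by rewrite gt_eqF.
  have dV : is_derive x 1 (fun y : R => y^-1) (- x ^- 2).
    have := @is_deriveV _ id x 1 1 xn (is_derive_id _ _).
    by rewrite /GRing.scale/= mulr1.
  have D : is_derive x 1 (fun x : R => x^-1 ^+ k * expR (- x^-1))
     (flat k.+2 x - k%:R * flat k.+1 x).
    have dX : is_derive x 1 (fun y : R => y^-1 ^+ k) ((k%:R * x^-1 ^+ k.-1) *: (- x ^- 2)).
      have := @is_deriveX _ _ (fun y : R => y^-1) k x 1 _ dV.
      by congr is_derive; apply/funext => y; rewrite fctE.
    have dE : is_derive x 1 (fun y : R => expR (- y^-1)) (expR (- x^-1) * (x ^- 2)).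
      apply: (@is_derive1_comp _ expR (fun y => - y^-1)).
      by rewrite -[X in is_derive _ _ _ X]opprK; exact: is_deriveN.
    have := is_deriveM dX dE; congr is_derive.
    rewrite /flat x0 /GRing.scale/=.
    case: k {H dX} => [|k]; first by rewrite !mul0r subr0 !expr0 mulr0 addr0 mul1r exprVn mulrC.
    by rewrite /= !exprS; set t := x^-1 ^+ k; field.
  apply: DeriveDef; first by apply: (near_eq_derivable H); case: D.
  by rewrite -(near_eq_derive _ H); case: D.
- rewrite /flat ltxx mulr0 subr0; exact: flat_derive0.
Unshelve. all: by end_near. Qed.

Lemma flat_smooth k : smooth1 (flat k).
Proof.
move=> n; elim: n k => [k x|n IH k] /=.
  apply: differentiable_continuous; apply/derivable1_diffP.
  by case: (flat_derive k x).
exists (fun x => flat k.+2 x + (- k%:R) * flat k.+1 x).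
  by move=> x; rewrite mulNr; exact: flat_derive.
by apply: C1kD => //; apply: C1kM; [exact: C1k_cst|].
Qed.

Lemma flat0_gt0 x : 0 < x -> 0 < flat 0 x.
Proof. by move=> x0; rewrite /flat x0 expr0 mul1r expR_gt0. Qed.

Lemma flat_le0 k x : x <= 0 -> flat k x = 0.
Proof. by rewrite /flat leNgt; case: ifP. Qed.

(** The usual smooth transition from 0 on the negative axis to 1 beyond 1; the denominator never
    vanishes because [x] or [1 - x] is positive. *)
Definition step x := flat 0 x / (flat 0 x + flat 0 (1 - x)).

Lemma step_den x : 0 < flat 0 x + flat 0 (1 - x).
Proof.
have [x0|x0] := ltrP 0 x; first by rewrite ltr_pwDl ?flat0_gt0 ?flat_ge0.
by rewrite ltr_wpDl ?flat_ge0// flat0_gt0// subr_gt0 (le_lt_trans x0).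
Qed.

Lemma step_smooth : smooth1 step.
Proof.
move=> k; apply: C1kM; first exact: flat_smooth.
apply: C1kV; first by move=> x; rewrite gt_eqF ?step_den.
apply: C1kD; first exact: flat_smooth.
apply: (@C1k_ext k (fun x => flat 0 ((-1) * x + 1))).
  by move=> x; rewrite mulN1r addrC.
by apply: C1k_affine; exact: flat_smooth.
Qed.

Lemma step_ge0 x : 0 <= step x.
Proof. by rewrite divr_ge0 ?flat_ge0// ltW ?step_den. Qed.

Lemma step_le1 x : step x <= 1.
Proof. by rewrite ler_pdivrMr ?step_den// mul1r lerDl flat_ge0. Qed.

Lemma step_le0 x : x <= 0 -> step x = 0.
Proof. by move=> x0; rewrite /step flat_le0// mul0r. Qed.

Lemma step_ge1 x : 1 <= x -> step x = 1.
Proof.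
move=> x1; rewrite /step (@flat_le0 _ (1 - x)) ?subr_le0// addr0 divff//.
by rewrite gt_eqF// flat0_gt0// (lt_le_trans _ x1).
Qed.

Lemma step_gt0 x : step x != 0 -> 0 < x.
Proof. by rewrite ltNge; apply: contra => /step_le0 ->. Qed.

Definition step' := 'D_1 step.

Lemma step_derive x : is_derive x 1 step (step' x).
Proof.
apply: DeriveDef => //.
by have [g' /(_ x) []] := step_smooth 1.
Qed.

Lemma step'_smooth : smooth1 step'.
Proof.
move=> k; have [g' dg cg] := step_smooth k.+1.
apply: C1k_ext cg => x; have [_ <-] := dg x; by [].
Qed.

Lemma step'_le0 x : x < 0 -> step' x = 0.
Proof.
move=> x0; rewrite /step'.
have H : {near x, cst 0 =1 step}.
  near=> z; rewrite step_le0// ltW//.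
  by near: z; exact: lt_nbhsl.
by rewrite -(near_eq_derive _ H) derive_cst.
Unshelve. all: by end_near. Qed.

Lemma step'_ge1 x : 1 < x -> step' x = 0.
Proof.
move=> x1; rewrite /step'.
have H : {near x, cst 1 =1 step}.
  near=> z; rewrite step_ge1// ltW//.
  by near: z; exact: lt_nbhsr.
by rewrite -(near_eq_derive _ H) derive_cst.
Unshelve. all: by end_near. Qed.

(** [step'] is continuous and vanishes off the unit interval, so its maximum there is global. This
    bound supplies the dominating functions for the limits of cut-off fields. *)
Lemma step'_bounded : exists2 M, 0 < M & forall x, `|step' x| <= M.
Proof.
have c : {within `[(0:R), 1], continuous (fun x => `|step' x|)}.
  apply: continuous_subspaceT => x; apply: cvg_norm.
  exact: (C1k_cont (step'_smooth 0)).
have [c0 _ Hc] := EVT_max ler01 c.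
exists (`|step' c0| + 1); first by rewrite ltr_wpDl.
move=> x; have [x0|x0] := ltrP x 0; first by rewrite step'_le0// normr0 addr_ge0.
have [x1|x1] := ltrP 1 x; first by rewrite step'_ge1// normr0 addr_ge0.
by rewrite (le_trans (Hc x _)) ?lerDl// in_itv/= x0.
Qed.

End OneVar.

Section TwoVar.
Variable R : realType.
Implicit Types (f g : pt R -> R) (p x a : pt R) (l : R * R * R).

(** Both difference quotients are the same function of the increment; this is how one-variable
    theorems reach partial derivatives. *)
Lemma is_derive1P f p d :
  is_derive p ((1, 0) : pt R) f d <-> is_derive p.1 1 (fun s => f (s, p.2)) d.
Proof.
have E : (fun h : R => h^-1 *: ((f \o shift p) (h *: ((1, 0) : pt R)) - f p)) =
    (fun h : R => h^-1 *: (((fun s => f (s, p.2)) \o shift p.1) (h *: (1 : R)) - f (p.1, p.2))).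
  apply/funext => h; rewrite /shift/= -surjective_pairing; congr (_ *: (f _ - _)).
  by apply: injective_projections; rewrite /= ?/GRing.scale/= ?mulr0 ?add0r.
by split=> -[dd <-]; split; rewrite /derivable /derive ?E// in dd *; rewrite -E.
Qed.

Lemma is_derive2P f p d :
  is_derive p ((0, 1) : pt R) f d <-> is_derive p.2 1 (fun s => f (p.1, s)) d.
Proof.
have E : (fun h : R => h^-1 *: ((f \o shift p) (h *: ((0, 1) : pt R)) - f p)) =
    (fun h : R => h^-1 *: (((fun s => f (p.1, s)) \o shift p.2) (h *: (1 : R)) - f (p.1, p.2))).
  apply/funext => h; rewrite /shift/= -surjective_pairing; congr (_ *: (f _ - _)).
  by apply: injective_projections; rewrite /= ?/GRing.scale/= ?mulr0 ?add0r.
by split=> -[dd <-]; split; rewrite /derivable /derive ?E// in dd *; rewrite -E.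
Qed.

Lemma CkS k f f1 f2 : continuous f ->
  (forall x, is_derive x ((1, 0) : pt R) f (f1 x)) ->
  (forall x, is_derive x ((0, 1) : pt R) f (f2 x)) ->
  Ck k f1 -> Ck k f2 -> Ck k.+1 f.
Proof.
move=> cf df1 df2 c1 c2; split => //; split.
- by move=> x; split; [case: (df1 x)|case: (df2 x)].
- by have -> : d1 f = f1 by apply/funext => x; apply: derive_val.
- by have -> : d2 f = f2 by apply/funext => x; apply: derive_val.
Qed.

Lemma Ck_cont k f : Ck k f -> continuous f.
Proof. by case: k => [|k] []. Qed.

Lemma Ck_d1 k f : Ck k.+1 f -> Ck k (d1 f).
Proof. by move=> [_ []]. Qed.

Lemma Ck_d2 k f : Ck k.+1 f -> Ck k (d2 f).
Proof. by move=> [_ []]. Qed.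

Lemma Ck_is_d1 k f x : Ck k.+1 f -> is_derive x ((1, 0) : pt R) f (d1 f x).
Proof. by move=> [_ [H _ _]]; apply: DeriveDef; [exact: (H x).1|exact: erefl]. Qed.

Lemma Ck_is_d2 k f x : Ck k.+1 f -> is_derive x ((0, 1) : pt R) f (d2 f x).
Proof. by move=> [_ [H _ _]]; apply: DeriveDef; [exact: (H x).2|exact: erefl]. Qed.

Lemma CkW k f : Ck k.+1 f -> Ck k f.
Proof.
elim: k f => [f [] //|k IH f cf].
apply: (@CkS _ _ (d1 f) (d2 f)); first exact: Ck_cont cf.
- by move=> x; exact: Ck_is_d1 cf.
- by move=> x; exact: Ck_is_d2 cf.
- by apply: IH; exact: Ck_d1.
- by apply: IH; exact: Ck_d2.
Qed.

Lemma CkD k f g : Ck k f -> Ck k g -> Ck k (fun x => f x + g x).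
Proof.
elim: k f g => [f g [cf _] [cg _]|k IH f g cf cg].
  by split=> // x; apply: cvgD; [exact: cf|exact: cg].
apply: (@CkS _ _ (fun x => d1 f x + d1 g x) (fun x => d2 f x + d2 g x)).
- by move=> x; apply: cvgD; [exact: Ck_cont cf x|exact: Ck_cont cg x].
- by move=> x; apply: is_deriveD; [exact: Ck_is_d1 cf|exact: Ck_is_d1 cg].
- by move=> x; apply: is_deriveD; [exact: Ck_is_d2 cf|exact: Ck_is_d2 cg].
- by apply: IH; exact: Ck_d1.
- by apply: IH; exact: Ck_d2.
Qed.

Lemma CkM k f g : Ck k f -> Ck k g -> Ck k (fun x => f x * g x).
Proof.
elim: k f g => [f g [cf _] [cg _]|k IH f g cf cg].
  by split=> // x; apply: cvgM; [exact: cf|exact: cg].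
apply: (@CkS _ _ (fun x => f x * d1 g x + g x * d1 f x) (fun x => f x * d2 g x + g x * d2 f x)).
- by move=> x; apply: cvgM; [exact: Ck_cont cf x|exact: Ck_cont cg x].
- by move=> x; apply: is_deriveM; [exact: Ck_is_d1 cf|exact: Ck_is_d1 cg].
- by move=> x; apply: is_deriveM; [exact: Ck_is_d2 cf|exact: Ck_is_d2 cg].
- apply: CkD; apply: IH; [exact: CkW|exact: Ck_d1|exact: CkW|exact: Ck_d1].
- apply: CkD; apply: IH; [exact: CkW|exact: Ck_d2|exact: CkW|exact: Ck_d2].
Qed.

Lemma Ck_cst k (c : R) : Ck k (fun _ : pt R => c).
Proof.
elim: k c => [c|k IH c]; first by split => // x; exact: cvg_cst.
apply: (@CkS _ _ (fun=> 0) (fun=> 0)) => // x; first exact: cvg_cst.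
Qed.

(** One encoding serves half-planes, barycentric coordinates and cut-offs; shifting and rescaling
    become arithmetic on triples. *)
Definition aff l x : R := l.1.1 + l.1.2 * x.1 + l.2 * x.2.

Lemma aff_cont l : continuous (aff l).
Proof.
move=> x; apply: cvgD; first apply: cvgD; first exact: cvg_cst.
- by apply: cvgM; [exact: cvg_cst|exact: cvg_fst].
- by apply: cvgM; [exact: cvg_cst|exact: cvg_snd].
Qed.

Lemma is_derive_affine1 (b c s : R) : is_derive s 1 (fun s => b + c * s) c.
Proof.
rewrite -[X in is_derive _ _ _ X]add0r; apply: is_deriveD.
by rewrite -[X in is_derive _ _ _ X]mulr1; exact: is_deriveZ.
Qed.

Lemma is_derive_comp_aff1 (g' : R) (g : R -> R) l x : is_derive (aff l x) 1 g g' ->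
  is_derive x ((1, 0) : pt R) (fun x => g (aff l x)) (l.1.2 * g').
Proof.
move=> dg; apply/is_derive1P; rewrite mulrC.
apply: (@is_derive1_comp _ g (fun s : R => aff l (s, x.2))) => /=.
have := is_derive_affine1 (l.1.1 + l.2 * x.2) l.1.2 x.1.
by congr is_derive; apply/funext => s; rewrite /aff/=; ring.
Qed.

Lemma is_derive_comp_aff2 (g' : R) (g : R -> R) l x : is_derive (aff l x) 1 g g' ->
  is_derive x ((0, 1) : pt R) (fun x => g (aff l x)) (l.2 * g').
Proof.
move=> dg; apply/is_derive2P; rewrite mulrC.
apply: (@is_derive1_comp _ g (fun s : R => aff l (x.1, s))) => /=.
have := is_derive_affine1 (l.1.1 + l.1.2 * x.1) l.2 x.2.
by congr is_derive; apply/funext => s; rewrite /aff/=; ring.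
Qed.

Lemma Ck_comp_aff k (g : R -> R) l : C1k k g -> Ck k (fun x => g (aff l x)).
Proof.
elim: k g => [g cg|k IH g cg].
  by split => // x; apply: continuous_comp; [exact: aff_cont|exact: cg].
have cc := C1k_cont cg; case: cg => g' dg cg.
apply: (@CkS _ _ (fun x => l.1.2 * g' (aff l x)) (fun x => l.2 * g' (aff l x))).
- by move=> x; apply: continuous_comp; [exact: aff_cont|exact: cc].
- by move=> x; exact: is_derive_comp_aff1.
- by move=> x; exact: is_derive_comp_aff2.
- by apply: CkM; [exact: Ck_cst|exact: IH].
- by apply: CkM; [exact: Ck_cst|exact: IH].
Qed.

Lemma smooth_aff l : smooth (aff l).
Proof.
move=> k; apply: (@Ck_comp_aff k id).
elim: k => [x|k _]; first exact: cvg_id.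
exists (fun=> 1); last exact: C1k_cst.
by move=> x; exact: is_derive_id.
Qed.

Lemma d1_aff l x : d1 (aff l) x = l.1.2.
Proof.
have h := @is_derive_comp_aff1 1 id l x (is_derive_id _ _).
by rewrite mulr1 in h; exact: derive_val.
Qed.

Lemma d2_aff l x : d2 (aff l) x = l.2.
Proof.
have h := @is_derive_comp_aff2 1 id l x (is_derive_id _ _).
by rewrite mulr1 in h; exact: derive_val.
Qed.

Lemma is_derive_shift f (v : pt R) x a d : is_derive (x + a) v f d ->
  is_derive x v (fun x => f (x + a)) d.
Proof.
have E : (fun h : R => h^-1 *: ((f \o shift (x + a)) (h *: v) - f (x + a))) =
   (fun h : R => h^-1 *: (((fun x => f (x + a)) \o shift x) (h *: v) - f (x + a))).
  by apply/funext => h; rewrite /shift/= addrA.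
by move=> -[dd <-]; split; rewrite /derivable /derive ?E// in dd *; rewrite -E.
Qed.

Lemma Ck_shift k f a : Ck k f -> Ck k (fun x => f (x + a)).
Proof.
have ca : continuous (fun x : pt R => x + a).
  by move=> x; apply: cvgD; [exact: cvg_id|exact: cvg_cst].
elim: k f => [f [cf _]|k IH f cf].
  by split => // x; apply: (@continuous_comp _ _ _ (fun x : pt R => x + a)); [exact: ca|exact: cf].
apply: (@CkS _ _ (fun x => d1 f (x + a)) (fun x => d2 f (x + a))).
- move=> x; apply: (@continuous_comp _ _ _ (fun x : pt R => x + a)); first exact: ca.
  exact: Ck_cont cf _.
- by move=> x; apply: is_derive_shift; exact: Ck_is_d1 cf.
- by move=> x; apply: is_derive_shift; exact: Ck_is_d2 cf.
- by apply: IH; exact: Ck_d1.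
- by apply: IH; exact: Ck_d2.
Qed.

Lemma d1_shift f a x : smooth f -> d1 (fun x => f (x + a)) x = d1 f (x + a).
Proof.
by move=> sf; have h := is_derive_shift (Ck_is_d1 (x + a) (sf 1%N)); exact: derive_val.
Qed.

Lemma d2_shift f a x : smooth f -> d2 (fun x => f (x + a)) x = d2 f (x + a).
Proof.
by move=> sf; have h := is_derive_shift (Ck_is_d2 (x + a) (sf 1%N)); exact: derive_val.
Qed.

Lemma smoothD f g : smooth f -> smooth g -> smooth (fun x => f x + g x).
Proof. by move=> sf sg k; exact: CkD. Qed.

Lemma smoothM f g : smooth f -> smooth g -> smooth (fun x => f x * g x).
Proof. by move=> sf sg k; exact: CkM. Qed.

Lemma smooth_cst c : smooth (fun _ : pt R => c).
Proof. by move=> k; exact: Ck_cst. Qed.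

Lemma smooth_comp_aff (g : R -> R) l : smooth1 g -> smooth (fun x => g (aff l x)).
Proof. by move=> sg k; exact: Ck_comp_aff. Qed.

Lemma smooth_d1 f : smooth f -> smooth (d1 f).
Proof. by move=> sf k; exact: Ck_d1. Qed.

Lemma smooth_d2 f : smooth f -> smooth (d2 f).
Proof. by move=> sf k; exact: Ck_d2. Qed.

Lemma smooth_cont f : smooth f -> continuous f.
Proof. by move=> /(_ 0%N)/Ck_cont. Qed.

Lemma d1M f g x : smooth f -> smooth g ->
  d1 (fun x => f x * g x) x = d1 f x * g x + f x * d1 g x.
Proof.
move=> sf sg; have h := is_deriveM (Ck_is_d1 x (sf 1%N)) (Ck_is_d1 x (sg 1%N)).
by rewrite [LHS](@derive_val _ _ _ _ _ _ _ h) /GRing.scale/= addrC mulrC.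
Qed.

Lemma d2M f g x : smooth f -> smooth g ->
  d2 (fun x => f x * g x) x = d2 f x * g x + f x * d2 g x.
Proof.
move=> sf sg; have h := is_deriveM (Ck_is_d2 x (sf 1%N)) (Ck_is_d2 x (sg 1%N)).
by rewrite [LHS](@derive_val _ _ _ _ _ _ _ h) /GRing.scale/= addrC mulrC.
Qed.

Lemma d1D f g x : smooth f -> smooth g ->
  d1 (fun x => f x + g x) x = d1 f x + d1 g x.
Proof.
move=> sf sg; have h := is_deriveD (Ck_is_d1 x (sf 1%N)) (Ck_is_d1 x (sg 1%N)).
exact: derive_val.
Qed.

Lemma d2D f g x : smooth f -> smooth g ->
  d2 (fun x => f x + g x) x = d2 f x + d2 g x.
Proof.
move=> sf sg; have h := is_deriveD (Ck_is_d2 x (sf 1%N)) (Ck_is_d2 x (sg 1%N)).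
exact: derive_val.
Qed.

(** The increment [h] may have either sign or vanish, which spares a case split at each use on a
    two-sided neighbourhood. *)
Lemma MVT_ball (u u' : R -> R) (s h : R) : (forall t : R, is_derive t 1 u (u' t)) ->
  exists2 c, `|c - s| <= `|h| & u (s + h) - u s = u' c * h.
Proof.
move=> du.
have cu A : {within A, continuous u}.
  apply: continuous_subspaceT => t; apply: differentiable_continuous.
  by apply/derivable1_diffP; case: (du t).
have [h0|h0|->] := ltgtP h 0.
- have [|c] := @MVT _ u u' (s + h) s _ (fun t _ => du t) (cu _).
    by rewrite gtrDl.
  rewrite in_itv/= => /andP[c1 c2] E.
  exists c; first by rewrite !ltr0_norm ?subr_lt0//; lra.
  by rewrite -[LHS]opprB E; ring.
- have [|c] := @MVT _ u u' s (s + h) _ (fun t _ => du t) (cu _).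
    by rewrite ltrDl.
  rewrite in_itv/= => /andP[c1 c2] E.
  exists c; first by rewrite !gtr0_norm ?subr_gt0//; lra.
  by rewrite E; ring.
- by exists s; rewrite ?subrr ?normr0// addr0 subrr mulr0.
Qed.

Lemma cont_eps (f : pt R -> R) p (e : R) : {for p, continuous f} -> 0 < e ->
  exists2 d : R, 0 < d & forall q, `|q.1 - p.1| < d -> `|q.2 - p.2| < d -> `|f q - f p| < e.
Proof.
move=> cf e0.
have /cvgrPdist_lt/(_ _ e0) := cf.
move=> /nbhs_ballP[d /= d0 H]; exists d => // q q1 q2.
by rewrite distrC; apply: H; split => /=; rewrite /ball/= distrC.
Qed.

(** The increment is split into a horizontal and a vertical move, each treated by the mean value
    theorem; continuity of the partial derivatives at [p] controls the intermediate points. *)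
Lemma is_derive_dir f p a : Ck 1 f ->
  is_derive (0 : R) 1 (fun t : R => f (p.1 + t * a.1, p.2 + t * a.2)) (a.1 * d1 f p + a.2 * d2 f p).
Proof.
move=> cf.
have c1 : {for p, continuous (d1 f)} by have [+ _] := Ck_d1 cf; apply.
have c2 : {for p, continuous (d2 f)} by have [+ _] := Ck_d2 cf; apply.
set u := fun t : R => _; set L := _ + _.
have H : h^-1 *: ((u \o shift 0) (h *: 1) - u 0) @[h --> (0:R)^'] --> L.
  apply/cvgrPdist_le => e e0.
  pose e' := e / (`|a.1| + `|a.2| + 1).
  have den0 : 0 < `|a.1| + `|a.2| + 1 by rewrite ltr_wpDl// addr_ge0.
  have e'0 : 0 < e' by rewrite divr_gt0.
  have [r1 r10 H1] := cont_eps c1 e'0; have [r2 r20 H2] := cont_eps c2 e'0.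
  pose r := Num.min r1 r2 / (`|a.1| + `|a.2| + 1).
  have r0 : 0 < r by rewrite divr_gt0// lt_min r10.
  near=> h.
  have hn0 : h != 0 by near: h; exact: nbhs_dnbhs_neq.
  have hr : `|h| < r.
    near: h; apply: nbhs_dnbhs; apply/nbhs_ballP; exists r => //= z.
    by rewrite /ball/= sub0r normrN.
  have rr (b : R) : `|b| <= `|a.1| + `|a.2| -> `|h * b| < Num.min r1 r2.
    move=> bl; rewrite normrM.
    have := hr; rewrite /r ltr_pdivlMr//; apply: le_lt_trans.
    by rewrite ler_wpM2l// (le_trans bl)// lerDl.
  have [x1 x1l E1] := @MVT_ball (fun s => f (s, p.2 + h * a.2)) (fun s => d1 f (s, p.2 + h * a.2)) p.1 (h * a.1)
     (fun t => (is_derive1P _ (_, _) _).1 (Ck_is_d1 _ cf)).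
  have [x2 x2l E2] := @MVT_ball (fun s => f (p.1, s)) (fun s => d2 f (p.1, s)) p.2 (h * a.2)
     (fun t => (is_derive2P _ (_, _) _).1 (Ck_is_d2 _ cf)).
  have Eu : h^-1 *: ((u \o shift 0) (h *: 1) - u 0) =
      a.1 * d1 f (x1, p.2 + h * a.2) + a.2 * d2 f (p.1, x2).
    rewrite /shift/= addr0 /GRing.scale/= mulr1 /u !mul0r !addr0.
    rewrite -(subrK (f (p.1, p.2 + h * a.2)) (f (p.1 + h * a.1, p.2 + h * a.2))).
    by rewrite E1 -addrA E2; field.
  rewrite Eu /L opprD addrACA -!mulrBr.
  have ll1 : `|a.1| <= `|a.1| + `|a.2| by rewrite lerDl.
  have ll2 : `|a.2| <= `|a.1| + `|a.2| by rewrite lerDr.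
  have B1 : `|d1 f p - d1 f (x1, p.2 + h * a.2)| <= e'.
    rewrite distrC ltW//; apply: H1 => /=.
      by rewrite (le_lt_trans x1l)// (lt_le_trans (rr _ ll1))// ge_min lexx.
    by rewrite addrC addKr (lt_le_trans (rr _ ll2))// ge_min lexx.
  have B2 : `|d2 f p - d2 f (p.1, x2)| <= e'.
    rewrite distrC ltW//; apply: H2 => /=.
      by rewrite subrr normr0.
    by rewrite (le_lt_trans x2l)// (lt_le_trans (rr _ ll2))// ge_min lexx orbT.
  rewrite (le_trans (ler_normD _ _))// !normrM.
  apply: (@le_trans _ _ ((`|a.1| + `|a.2|) * e')).
    by rewrite mulrDl lerD// ler_wpM2l.
  by rewrite /e' mulrA ler_pdivrMr// mulrC ler_pM2l// lerDl.
apply: DeriveDef; first by apply/cvg_ex; exists L.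
exact: cvg_lim.
Unshelve. all: by end_near. Qed.

Lemma is_derive_line f p a (t : R) : Ck 1 f ->
  is_derive t 1 (fun t : R => f (p.1 + t * a.1, p.2 + t * a.2))
    (a.1 * d1 f (p.1 + t * a.1, p.2 + t * a.2) + a.2 * d2 f (p.1 + t * a.1, p.2 + t * a.2)).
Proof.
move=> cf; have := is_derive_dir (p.1 + t * a.1, p.2 + t * a.2) a cf => /=.
set u := fun t0 => _ => h.
have du : is_derive (t - t) 1 u (a.1 * d1 f (p.1 + t * a.1, p.2 + t * a.2) + a.2 * d2 f (p.1 + t * a.1, p.2 + t * a.2)).
  by rewrite subrr.
have ds : is_derive t 1 (fun s : R => s - t) 1.
  by rewrite -[X in is_derive _ _ _ X]subr0; exact: is_deriveB.
have := @is_derive1_comp _ u (fun s => s - t) t _ _ du ds.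
rewrite mulr1; congr is_derive; apply/funext => s; rewrite /u/=.
by congr (f _); congr pair; ring.
Qed.

(** The mixed second difference over a small square, computed in two orders, is [h ^ 2] times each
    mixed derivative at some point near [p]; continuity closes the gap. It is needed for weak
    Hessians, where [pderiv] fixes one order of differentiation. *)
Lemma schwarz f : Ck 2 f -> d1 (d2 f) = d2 (d1 f).
Proof.
move=> cf; apply/funext => p.
have c1 : {for p, continuous (d1 (d2 f))} by have [+ _] := Ck_d1 (Ck_d2 cf); apply.
have c2 : {for p, continuous (d2 (d1 f))} by have [+ _] := Ck_d2 (Ck_d1 cf); apply.
apply/eqP; rewrite -subr_eq0 -normr_le0; apply/ler_addgt0Pr => e e0; rewrite add0r.
have e20 : 0 < e / 2 by rewrite divr_gt0.
have [r1 r10 H1] := cont_eps c1 e20; have [r2 r20 H2] := cont_eps c2 e20.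
pose h := Num.min r1 r2 / 2.
have h0 : 0 < h by rewrite divr_gt0// lt_min r10.
have hr1 : `|h| < r1.
  rewrite gtr0_norm// /h ltr_pdivrMr// (@le_lt_trans _ _ r1) ?ge_min ?lexx//.
  by rewrite ltr_pMr// ltr1n.
have hr2 : `|h| < r2.
  rewrite gtr0_norm// /h ltr_pdivrMr// (@le_lt_trans _ _ r2) ?ge_min ?lexx ?orbT//.
  by rewrite ltr_pMr// ltr1n.
have D1 (t y : R) : is_derive t 1 (fun s => f (s, y)) (d1 f (t, y)).
  exact: (is_derive1P f (t, y) _).1 (Ck_is_d1 _ cf).
have D2 (t y : R) : is_derive t 1 (fun s => f (y, s)) (d2 f (y, t)).
  exact: (is_derive2P f (y, t) _).1 (Ck_is_d2 _ cf).
have [x1 x1l E1] := @MVT_ball (fun s => f (s, p.2 + h) - f (s, p.2))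
   (fun s => d1 f (s, p.2 + h) - d1 f (s, p.2)) p.1 h
   (fun t => is_deriveB (D1 t (p.2 + h)) (D1 t p.2)).
have [y1 y1l F1] := @MVT_ball (fun s => d1 f (x1, s)) (fun s => d2 (d1 f) (x1, s)) p.2 h
   (fun t => (is_derive2P _ (_, _) _).1 (Ck_is_d2 _ (Ck_d1 cf))).
have [y2 y2l E2] := @MVT_ball (fun s => f (p.1 + h, s) - f (p.1, s))
   (fun s => d2 f (p.1 + h, s) - d2 f (p.1, s)) p.2 h
   (fun t => is_deriveB (D2 t (p.1 + h)) (D2 t p.1)).
have [x2 x2l F2] := @MVT_ball (fun s => d2 f (s, y2)) (fun s => d1 (d2 f) (s, y2)) p.1 h
   (fun t => (is_derive1P _ (_, _) _).1 (Ck_is_d1 _ (Ck_d2 cf))).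
(* Pure algebra: the two sides are the same second difference, from which [k] is divided out
   twice. *)
have key (A B u1 u2 u3 u4 v1 v2 w1 w2 k : R) : k != 0 -> v1 - v2 = A * k ->
    w1 - w2 = B * k -> (u1 - u2) - (u3 - u4) = (v1 - v2) * k ->
    (u1 - u3) - (u2 - u4) = (w1 - w2) * k -> A = B.
  move=> k0 e1 e2 e3 e4; apply: (mulIf k0); apply: (mulIf k0).
  by rewrite -e1 -e2 -e3 -e4; ring.
have E : d2 (d1 f) (x1, y1) = d1 (d2 f) (x2, y2).
  exact: key (lt0r_neq0 h0) F1 F2 E1 E2.
have A1 := H1 (x2, y2) (le_lt_trans x2l hr1) (le_lt_trans y2l hr1).
have A2 := H2 (x1, y1) (le_lt_trans x1l hr2) (le_lt_trans y1l hr2).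
rewrite -E in A1.
move: A1 A2; set A := d2 _ _; set B := d1 _ _; set C := d2 _ _.
move: A B C => A B C A1 A2.
have := ler_distD A B C; rewrite [`|B - A|]distrC.
by move: (`|B - C|) (`|A - B|) (`|A - C|) A1 A2 => u1 u2 u3; lra.
Qed.


Definition supp f := closure [set x | f x != 0].

Lemma supp0 f x : ~ supp f x -> f x = 0.
Proof.
by move=> n; apply/eqP; apply: contra_notT n => fx; exact: subset_closure.
Qed.

Lemma test_funP (U C : set (pt R)) f : smooth f -> compact C -> C `<=` U ->
  (forall x, f x != 0 -> C x) -> test_fun U f.
Proof.
move=> sf cC CU fC.
have clC : closed C by apply: compact_closed => //; exact: norm_hausdorff.
have sC : closure [set x | f x != 0] `<=` C.
  by rewrite [X in _ `<=` X]((closure_id C).1 clC); apply: closure_subset.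
split => //; first by apply: (subclosed_compact _ cC) => //; exact: closed_closure.
exact: subset_trans CU.
Qed.

Lemma d_near0 f x (v : pt R) : ~ supp f x -> 'D_v f x = 0.
Proof.
move=> nx.
have op : open (~` supp f) by apply: closed_openC; exact: closed_closure.
have H : {near x, cst 0 =1 f}.
  have : nbhs x (~` supp f) by apply: open_nbhs_nbhs; split.
  by apply: filterS => y /supp0.
by rewrite -(near_eq_derive _ H) derive_cst.
Qed.

Lemma test_fun_d1 U f : test_fun U f -> test_fun U (d1 f).
Proof.
move=> [sf cf fU]; apply: (test_funP (smooth_d1 sf) cf fU) => x.
by apply: contra_neqP => nx; exact: d_near0.
Qed.

Lemma test_fun_d2 U f : test_fun U f -> test_fun U (d2 f).
Proof.
move=> [sf cf fU]; apply: (test_funP (smooth_d2 sf) cf fU) => x.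
by apply: contra_neqP => nx; exact: d_near0.
Qed.

Lemma test_funM U f g : smooth f -> test_fun U g -> test_fun U (fun x => f x * g x).
Proof.
move=> sf [sg cg gU]; apply: (test_funP (smoothM sf sg) cg gU) => x.
by apply: contra_neqP => nx; rewrite (supp0 nx) mulr0.
Qed.

Lemma test_funD U f g : test_fun U f -> test_fun U g -> test_fun U (fun x => f x + g x).
Proof.
move=> [sf cf fU] [sg cg gU].
apply: (@test_funP _ (supp f `|` supp g)); first exact: smoothD.
- exact: compactU.
- by rewrite subUset.
- move=> x; apply: contra_neqP => /not_orP[n1 n2].
  by rewrite (supp0 n1) (supp0 n2) addr0.
Qed.

Lemma test_funS U V f : U `<=` V -> test_fun U f -> test_fun V f.
Proof. by move=> UV [sf cf fU]; split => //; exact: subset_trans UV. Qed.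

Lemma test_fun_out U f x : test_fun U f -> ~ U x -> f x = 0.
Proof. by move=> [_ _ fU] nU; apply: supp0 => /fU. Qed.

Lemma test_fun_shift U V f a : test_fun U f -> (forall x, U x -> V (x + a)) ->
  test_fun V (fun x => f (x - a)).
Proof.
move=> [sf cf fU] UV.
have ca : continuous (fun x : pt R => x + a).
  by move=> x; apply: cvgD; [exact: cvg_id|exact: cvg_cst].
apply: (@test_funP _ ((fun x => x + a) @` supp f)).
- by move=> k; exact: Ck_shift.
- by apply: continuous_compact => //; apply: continuous_subspaceT.
- by move=> _ [x /fU/UV Vx <-].
- by move=> x fx; exists (x - a); [exact: subset_closure|rewrite subrK].
Qed.

Lemma test_fun_bounded U f : test_fun U f -> exists2 M, 0 < M & forall x, `|f x| <= M.
Proof.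
move=> [sf cf _].
have : compact (f @` supp f).
  by apply: continuous_compact => //; apply: continuous_subspaceT; exact: smooth_cont.
move=> /compact_bounded[M [_ HM]].
exists (`|M| + 1); first by rewrite ltr_wpDl.
move=> x; have [sx|nsx] := pselect (supp f x).
  by apply: HM; [rewrite (le_lt_trans (ler_norm M))// ltrDl|exists x].
by rewrite (supp0 nsx) normr0 addr_ge0.
Qed.

End TwoVar.

(** * The plane Lebesgue measure and L^2 *)

Section Plane.
Variable R : realType.
Notation mu := (leb2 R).
Notation mpt := (measurableTypeR R * measurableTypeR R)%type.
Implicit Types (x y a : pt R) (l : R * R * R).

(** Measurability refers to the product sigma-algebra, so an open set has to be exhibited as a
    countable union of products: squares with rational centre and half-width [1 / (n + 1)]. *)
Lemma open_measurable2 (O : set (pt R)) : open O -> measurable O.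
Proof.
move=> oO.
pose B (q : rat * rat * nat) : set (pt R) :=
  (`]ratr q.1.1 - q.2.+1%:R^-1, ratr q.1.1 + q.2.+1%:R^-1[ : set R) `*`
  (`]ratr q.1.2 - q.2.+1%:R^-1, ratr q.1.2 + q.2.+1%:R^-1[ : set R).
have -> : O = \bigcup_(q in [set q | B q `<=` O]) B q.
  apply/seteqP; split; last by move=> x [q /= qO] /qO.
  move=> x Ox.
  have /nbhs_ballP[e /= e0 He] : nbhs x O by apply: open_nbhs_nbhs.
  (* A square of half-width [1 / (n + 1)] that contains [x] stays within [2 / (n + 1) < e] of [x] in
     each coordinate. *)
  pose n := Num.truncn (2 / e).
  have ne : 2 * n.+1%:R^-1 < e.
    rewrite ltr_pdivrMr// -ltr_pdivrMl// mulrC.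
    by rewrite truncnS_gt.
  have n0 : 0 < n.+1%:R^-1 :> R by rewrite invr_gt0.
  have [q1 /andP[a1 b1]] : exists q : rat, x.1 - n.+1%:R^-1 < ratr q < x.1 + n.+1%:R^-1.
    have [|q] := @rat_in_itvoo R (x.1 - n.+1%:R^-1) (x.1 + n.+1%:R^-1).
      by rewrite ltrBlDr -addrA ltrDl addr_gt0.
    by rewrite in_itv/= => H; exists q.
  have [q2 /andP[a2 b2]] : exists q : rat, x.2 - n.+1%:R^-1 < ratr q < x.2 + n.+1%:R^-1.
    have [|q] := @rat_in_itvoo R (x.2 - n.+1%:R^-1) (x.2 + n.+1%:R^-1).
      by rewrite ltrBlDr -addrA ltrDl addr_gt0.
    by rewrite in_itv/= => H; exists q.
  exists (q1, q2, n); last first.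
    by split; rewrite /= in_itv/=; apply/andP; split; rewrite ?ltrBlDr// -ltrBlDr.
  move=> y [/=]; rewrite !in_itv/= => /andP[c1 d1] /andP[c2 d2].
  by apply: He; split; rewrite /ball/= ltr_norml; apply/andP;
    move: ne a1 b1 c1 d1 a2 b2 c2 d2;
    move: (n.+1%:R^-1) (ratr q1 : R) (ratr q2 : R) => d u v *; split; lra.
rewrite bigcup_mkcond; apply: countable_bigcupT_measurable => // q.
by case: ifP => // _; apply: measurableX; exact: measurable_itv.
Qed.

Lemma closed_measurable2 (A : set (pt R)) : closed A -> measurable A.
Proof.
by move=> cA; rewrite -(setCK A); apply: measurableC; apply: open_measurable2; exact: closed_openC.
Qed.

Lemma continuous_measurable2 (f : pt R -> R) : continuous f -> measurable_fun setT f.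
Proof.
move=> cf; apply: (measurability _ (RGenOInfty.measurableE R)) => //.
move=> /= _ [_ [c ->] <-]; rewrite setTI.
by apply: open_measurable2; move/continuousP: cf; apply; exact: interval_open.
Qed.

Lemma measurable_aff l : measurable_fun setT (aff l).
Proof. by apply: continuous_measurable2; exact: aff_cont. Qed.

Lemma measurable_shift a : measurable_fun [set: pt R] (fun x : pt R => x + a).
Proof.
rewrite (_ : (fun x : pt R => x + a) = (fun x : pt R => (x.1 + a.1, x.2 + a.2))) //.
by apply: measurable_fun_pair; apply: measurable_funD.
Qed.

Lemma measurable_opp2 : measurable_fun [set: pt R] (fun x : pt R => - x).
Proof.
rewrite (_ : (fun x : pt R => - x) = (fun x : pt R => (- x.1, - x.2))) //.
by apply: measurable_fun_pair; apply: measurableT_comp.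
Qed.

Lemma lebesgue_measure_shift (c : R) (A : set R) : measurable A ->
  leb1 R ((fun t : R => t + c) @^-1` A) = leb1 R A.
Proof.
move=> mA.
have mf : measurable_fun [set: measurableTypeR R] ((fun t : R => t + c) : measurableTypeR R -> measurableTypeR R).
  by apply: measurable_funD => //; exact: measurable_id.
rewrite -[LHS]/(pushforward (leb1 R) ((fun t : R => t + c) : measurableTypeR R -> measurableTypeR R) A).
apply/esym/lebesgue_measure_unique => //= _ [[u v]] _ <-.
rewrite /pushforward.
have -> : (fun t : R => t + c) @^-1` `]u, v] = `]u - c, v - c]%classic.
  by apply/seteqP; split => t /=; rewrite !in_itv/= => /andP[h1 h2]; apply/andP; split; lra.
rewrite !lebesgue_measure_itv/= !lte_fin ltrD2r; case: ifP => // _.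
by congr EFin; ring.
Qed.

(** The push-forward agrees with the product measure on rectangles, hence everywhere by uniqueness
    of the product measure. *)
Lemma mu_shift a (A : set (pt R)) : measurable A ->
  mu ((fun x => x + a) @^-1` A) = mu A.
Proof.
move=> mA.
have mf := measurable_shift a.
rewrite -[LHS]/(pushforward mu ((fun x : pt R => (x + a)%R) : mpt -> mpt) A).
apply/esym/product_measure_unique => //= B C mB mC.
rewrite /pushforward.
have -> : (fun x : pt R => x + a) @^-1` (B `*` C) =
  ((fun t : R => t + a.1) @^-1` B) `*` ((fun t : R => t + a.2) @^-1` C) by [].
have mp (c : R) (D : set R) : measurable D -> measurable ((fun t : R => t + c) @^-1` D).
  by move=> mD; rewrite -[X in measurable X]setTI; apply: measurable_funD.
rewrite product_measure1E; [|exact: mp|exact: mp].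
by congr (_ * _)%E; exact: lebesgue_measure_shift.
Qed.

Lemma mu_opp (A : set (pt R)) : measurable A -> mu ((fun x => - x) @^-1` A) = mu A.
Proof.
move=> mA.
have mf := measurable_opp2.
rewrite -[LHS]/(pushforward mu ((fun x : pt R => - x) : mpt -> mpt) A).
apply/esym/product_measure_unique => //= B C mB mC.
rewrite /pushforward.
have -> : (fun x : pt R => - x) @^-1` (B `*` C) =
  ((fun t : R => - t) @^-1` B) `*` ((fun t : R => - t) @^-1` C) by [].
have mp (D : set R) : measurable D -> measurable ((fun t : R => - t) @^-1` D).
  by move=> mD; rewrite -[X in measurable X]setTI; apply: measurableT_comp.
rewrite product_measure1E; [|exact: mp|exact: mp].
by congr (_ * _)%E; exact: lebesgue_measureN.
Qed.

Lemma ge0_integral_shift a (f : pt R -> \bar R) : measurable_fun setT f ->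
  (forall x, (0 <= f x)%E) -> (\int[mu]_x f ((x : pt R) + a)%R = \int[mu]_x f x)%E.
Proof.
move=> mf f0; have ms := measurable_shift a.
transitivity (\int[pushforward mu ((fun x : pt R => (x + a)%R) : mpt -> mpt)]_x f x)%E.
  by rewrite ge0_integral_pushforward.
by apply: eq_measure_integral => A mA _; exact: mu_shift.
Qed.

Lemma integrable_shift a (f : pt R -> \bar R) : mu.-integrable setT f ->
  mu.-integrable setT (fun x => f (x + a)).
Proof.
move=> /integrableP[mf fi]; have ms := measurable_shift a.
apply/integrableP; split; first exact: measurableT_comp.
rewrite (ge0_integral_shift a (f := fun x => `|f x|%E))//.
exact: measurableT_comp.
Qed.

Lemma integral_shift a (f : pt R -> \bar R) : measurable_fun setT f ->
  (\int[mu]_x f ((x : pt R) + a)%R = \int[mu]_x f x)%E.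
Proof.
move=> mf; rewrite integralE [RHS]integralE; congr (_ - _)%E.
- transitivity (\int[mu]_x (f^\+)%E ((x : pt R) + a)%R)%E; first by apply: eq_integral => x _; rewrite ?funeposE ?funenegE.
  by apply: ge0_integral_shift => //; exact: measurable_funepos.
- transitivity (\int[mu]_x (f^\-)%E ((x : pt R) + a)%R)%E; first by apply: eq_integral => x _; rewrite ?funeposE ?funenegE.
  by apply: ge0_integral_shift => //; exact: measurable_funeneg.
Qed.

Definition line0 l := [set x | aff l x = 0].

Lemma measurable_aff_eq0 l : measurable (line0 l).
Proof.
have := @measurable_aff l measurableT [set 0] (measurable_set1 _).
by rewrite setTI.
Qed.

Lemma measurable_aff_gt0 l : measurable [set x | 0 < aff l x].
Proof.
apply: open_measurable2.
rewrite (_ : [set x | 0 < aff l x] = aff l @^-1` `]0, +oo[%classic); last first.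
  by apply/seteqP; split => x /=; rewrite in_itv/= andbT.
by move/continuousP: (@aff_cont R l); apply; exact: interval_open.
Qed.

Lemma open_aff_gt0 l : open [set x | 0 < aff l x].
Proof.
rewrite (_ : [set x | 0 < aff l x] = aff l @^-1` `]0, +oo[%classic); last first.
  by apply/seteqP; split => x /=; rewrite in_itv/= andbT.
by move/continuousP: (@aff_cont R l); apply; exact: interval_open.
Qed.

Lemma closed_aff_ge (c : R) l : closed [set x | c <= aff l x].
Proof.
rewrite (_ : [set x | c <= aff l x] = aff l @^-1` `[c, +oo[%classic); last first.
  by apply/seteqP; split => x /=; rewrite in_itv/= andbT.
by apply: (@closed_comp _ _ (aff l)); [move=> x _; exact: aff_cont|exact: interval_closed].
Qed.

(** A vertical line is a point times the real line; any other line meets each vertical section in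
    one point, so the section integral vanishes. *)
Lemma mu_line0 l : (l.1.2, l.2) <> (0, 0) -> mu (line0 l) = 0%E.
Proof.
move=> l0; have ml := measurable_aff_eq0 l.
have [l20|l20] := eqVneq l.2 0.
  have l10 : l.1.2 != 0 by apply: contra_notN l0 => /eqP ->; rewrite l20.
  have -> : line0 l = [set - l.1.1 / l.1.2] `*` setT.
    apply/seteqP; split => [x|[x y] [/= -> _]]; rewrite /line0/= /aff l20 mul0r addr0.
      move=> H; split => //=; apply: (mulIf l10); rewrite divfK//; lra.
    by rewrite /= mulrC divfK// subrr.
  rewrite product_measure1E; [|exact: measurable_set1|exact: measurableT].
  by rewrite [X in (X * _)%E](_ : _ = 0%E) ?mul0e//; exact: lebesgue_measure_set1.
rewrite /product_measure1 integral0_eq// => x _.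
rewrite /comp; suff -> : (xsection (line0 l) : R -> set R) x = [set - (l.1.1 + l.1.2 * x) / l.2].
  exact: lebesgue_measure_set1.
apply/seteqP; split => y; rewrite /xsection/= inE /line0/= /aff/= => H.
  by apply: (mulIf l20); rewrite divfK//; lra.
rewrite H; set u := l.1.1 + _; have -> : l.2 * (- u / l.2) = - u by rewrite mulrC divfK.
exact: subrr.
Qed.

Definition box (M : R) : set (pt R) := (`[- M, M] : set R) `*` (`[- M, M] : set R).

Lemma measurable_box M : measurable (box M).
Proof. by apply: measurableX; exact: measurable_itv. Qed.

Lemma mu_box M : (mu (box M) < +oo)%E.
Proof.
rewrite product_measure1E; [|exact: measurable_itv|exact: measurable_itv].
have h : (leb1 R (`[(- M)%R, M] : set R) < +oo)%E.
  by rewrite lebesgue_measure_itv/=; case: ifP => _; rewrite ltry.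
by apply: lte_mul_pinfty => //; rewrite ge0_fin_numE.
Qed.

Lemma compact_box M : compact (box M).
Proof. by apply: compact_setX; exact: segment_compact. Qed.

Lemma bounded_sub_box (A : set (pt R)) : bounded_set A -> exists M, A `<=` box M.
Proof.
move=> [M [_ H]]; exists (`|M| + 1) => x Ax.
have : `|x| <= `|M| + 1.
  by apply: (H (`|M| + 1)) => //; rewrite (le_lt_trans (ler_norm M))// ltrDl.
rewrite prod_normE ge_max => /andP[h1 h2].
by split; rewrite /= in_itv/= -ler_norml.
Qed.

Lemma bounded_mu (A : set (pt R)) M : measurable A -> A `<=` box M -> (mu A < +oo)%E.
Proof.
move=> mA AM; apply: le_lt_trans (mu_box M); apply: le_measure => //; rewrite inE//.
exact: measurable_box.
Qed.

End Plane.

Section AlmostEverywhere.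
Variable R : realType.
Notation mu := (leb2 R).
Notation mpt := (measurableTypeR R * measurableTypeR R)%type.
Implicit Types P Q S : pt R -> Prop.

Lemma ae_imp P Q : (forall x, P x -> Q x) -> {ae mu, forall x, P x} -> {ae mu, forall x, Q x}.
Proof. by move=> PQ; exact: (@filterS _ _ (ae_filter_ringOfSetsType mu)). Qed.

Lemma ae_imp2 P Q S : (forall x, P x -> Q x -> S x) ->
  {ae mu, forall x, P x} -> {ae mu, forall x, Q x} -> {ae mu, forall x, S x}.
Proof. by move=> PQ; exact: (@filterS2 _ _ (ae_filter_ringOfSetsType mu)). Qed.

Lemma ae_all P : (forall x, P x) -> {ae mu, forall x, P x}.
Proof. by move=> h; apply: (@filterE _ _ (ae_filter_ringOfSetsType mu)). Qed.

Lemma ae_null (N : set (pt R)) P : measurable (N : set mpt) -> mu N = 0%E ->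
  (forall x, ~ N x -> P x) -> {ae mu, forall x, P x}.
Proof.
move=> mN N0 h; exists N; split => // x /= nP.
by apply: contrapT => /h.
Qed.

End AlmostEverywhere.

Section L2space.
Variables (R : realType) (U : set (pt R)).
Notation mu := (leb2 R).
Notation mpt := (measurableTypeR R * measurableTypeR R)%type.
Hypothesis mU : measurable (U : set mpt).
Implicit Types (v w : pt R -> R) (p q : pt R -> pt R).

Lemma L2_mul_int v w : L2 U v -> L2 U w -> mu.-integrable U (EFin \o (fun x => v x * w x)).
Proof.
move=> [mv iv] [mw iw].
apply: (@le_integrable _ _ _ mu U mU _ (fun x => ((v x) ^+ 2)%:E + ((w x) ^+ 2)%:E)%E).
- by apply/measurable_EFinP; exact: measurable_funM.
- move=> x Ux; rewrite /= lee_fin normrM.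
  have h0 : 0 <= (v x) ^+ 2 + (w x) ^+ 2 by rewrite addr_ge0 ?sqr_ge0.
  rewrite (ger0_norm h0) -(real_normK (num_real (v x))) -(real_normK (num_real (w x))).
  have := sqr_ge0 (`|v x| - `|w x|).
  have := mulr_ge0 (normr_ge0 (v x)) (normr_ge0 (w x)).
  by move: (`|v x|) (`|w x|) => s t; rewrite !expr2; nra.
- exact: integrableD.
Qed.

Lemma L2_sq_int v : L2 U v -> mu.-integrable U (EFin \o (fun x => v x * v x)).
Proof. by move=> v2; exact: L2_mul_int. Qed.

Lemma L2_dom v (g : pt R -> R) : measurable_fun U v -> mu.-integrable U (EFin \o g) ->
  (forall x, U x -> v x ^+ 2 <= g x) -> L2 U v.
Proof.
move=> mv ig vg; split => //.
apply: (@le_integrable _ _ _ mu U mU _ (EFin \o g)) => //.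
- by apply/measurable_EFinP; exact: measurable_funX.
- move=> x Ux; rewrite /= lee_fin ger0_norm ?sqr_ge0//.
  by rewrite (le_trans (vg x Ux))// ler_norm.
Qed.

Lemma L2D v w : L2 U v -> L2 U w -> L2 U (v \+ w).
Proof.
move=> v2 w2; have iv := L2_sq_int v2; have iw := L2_sq_int w2; have ivw := L2_mul_int v2 w2.
apply: (@L2_dom _ (fun x => 2 * (v x * v x) + 2 * (w x * w x))).
- by apply: measurable_funD; [case: v2|case: w2].
- have -> : EFin \o (fun x => 2 * (v x * v x) + 2 * (w x * w x)) =
    (fun x => 2%:E * (v x * v x)%:E + 2%:E * (w x * w x)%:E)%E by [].
  by apply: integrableD => //; apply: integrableZl.
- move=> x _; have := sqr_ge0 (v x - w x) => /=.
  by move: (v x) (w x) => s t; rewrite !expr2; nra.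
Qed.

Lemma L2Z (c : R) v : L2 U v -> L2 U (fun x => c * v x).
Proof.
move=> v2; apply: (@L2_dom _ (fun x => c ^+ 2 * (v x * v x))).
- by apply: measurable_funM => //; case: v2.
- have -> : EFin \o (fun x => c ^+ 2 * (v x * v x)) =
    (fun x => (c ^+ 2)%:E * (v x * v x)%:E)%E by [].
  by apply: integrableZl => //; exact: L2_sq_int.
- by move=> x _; rewrite exprMn -expr2.
Qed.

Lemma L2N v : L2 U v -> L2 U (fun x => - v x).
Proof.
move=> /(L2Z (-1)); congr L2; apply/funext => x; exact: mulN1r.
Qed.

Lemma L2B v w : L2 U v -> L2 U w -> L2 U (v \- w).
Proof. by move=> v2 w2; apply: (L2D v2 (L2N w2)). Qed.

Lemma ipC v w : ip U v w = ip U w v.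
Proof. by apply: eq_Rintegral => x _; rewrite mulrC. Qed.

Lemma ipDl v v' w : L2 U v -> L2 U v' -> L2 U w -> ip U (v \+ v') w = ip U v w + ip U v' w.
Proof.
move=> v2 v'2 w2; rewrite /ip -RintegralD//; [|exact: L2_mul_int|exact: L2_mul_int].
by apply: eq_Rintegral => x _ /=; rewrite mulrDl.
Qed.

Lemma ipBl v v' w : L2 U v -> L2 U v' -> L2 U w -> ip U (v \- v') w = ip U v w - ip U v' w.
Proof.
move=> v2 v'2 w2; rewrite /ip -RintegralB//; [|exact: L2_mul_int|exact: L2_mul_int].
by apply: eq_Rintegral => x _ /=; rewrite mulrBl.
Qed.

Lemma ipZl c v w : L2 U v -> L2 U w -> ip U (fun x => c * v x) w = c * ip U v w.
Proof.
move=> v2 w2; rewrite /ip -RintegralZl//; last exact: L2_mul_int.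
by apply: eq_Rintegral => x _ /=; rewrite mulrA.
Qed.

Lemma ipNl v w : L2 U v -> L2 U w -> ip U (fun x => - v x) w = - ip U v w.
Proof.
move=> v2 w2; rewrite -mulN1r -ipZl//; congr ip; apply/funext => x; exact/esym/mulN1r.
Qed.

Lemma ipDr v v' w : L2 U v -> L2 U v' -> L2 U w -> ip U w (v \+ v') = ip U w v + ip U w v'.
Proof. by move=> *; rewrite ipC ipDl// !(ipC w). Qed.

Lemma ipBr v v' w : L2 U v -> L2 U v' -> L2 U w -> ip U w (v \- v') = ip U w v - ip U w v'.
Proof. by move=> *; rewrite ipC ipBl// !(ipC w). Qed.

Lemma ipZr c v w : L2 U v -> L2 U w -> ip U w (fun x => c * v x) = c * ip U w v.
Proof. by move=> *; rewrite ipC ipZl// ipC. Qed.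

Lemma ipNr v w : L2 U v -> L2 U w -> ip U w (fun x => - v x) = - ip U w v.
Proof. by move=> *; rewrite ipC ipNl// ipC. Qed.

Lemma ip_ge0 v : 0 <= ip U v v.
Proof. by apply: Rintegral_ge0 => x _; rewrite -expr2 sqr_ge0. Qed.

Lemma norm0_ge0 v : 0 <= norm0 U v.
Proof. exact: sqrtr_ge0. Qed.

Lemma norm0_sq v : norm0 U v ^+ 2 = ip U v v.
Proof. by rewrite sqr_sqrtr ?ip_ge0. Qed.

Lemma ip_CS v w : L2 U v -> L2 U w -> `|ip U v w| <= norm0 U v * norm0 U w.
Proof.
move=> v2 w2.
rewrite -ler_sqr ?nnegrE ?normr_ge0 ?mulr_ge0 ?norm0_ge0// exprMn !norm0_sq real_normK ?num_real//.
have H t : 0 <= ip U v v - 2 * t * ip U v w + t ^+ 2 * ip U w w.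
  have tw := L2Z t w2.
  have := ip_ge0 (v \- (fun x => t * w x)).
  rewrite ipBl ?ipBr ?ipZl ?ipZr//; last exact: L2B.
  by rewrite (ipC w v); congr (0 <= _); ring.
have [w0|w0] := eqVneq (ip U w w) 0.
  rewrite w0 mulr0; have [->|vw0] := eqVneq (ip U v w) 0; first by rewrite expr2 mul0r.
  (* When [w] has norm zero the quadratic is affine in [t]; at this [t] its value is -1, which
     contradicts [H]. *)
  have := H ((ip U v v + 1) / (2 * ip U v w)); rewrite w0 mulr0 addr0.
  rewrite (_ : 2 * _ * _ = ip U v v + 1); last by field.
  by move: (ip U v v) => s; lra.
have wp : 0 < ip U w w by rewrite lt_neqAle eq_sym w0 ip_ge0.
(* The quadratic is evaluated at its minimiser. *)
have := mulr_ge0 (H (ip U v w / ip U w w)) (ltW wp).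
rewrite (_ : (_ - _ + _) * _ = ip U v v * ip U w w - ip U v w ^+ 2); last by field.
by rewrite subr_ge0.
Qed.

Lemma norm0D v w : L2 U v -> L2 U w -> norm0 U (v \+ w) <= norm0 U v + norm0 U w.
Proof.
move=> v2 w2; have vw := L2D v2 w2.
rewrite -ler_sqr ?nnegrE ?addr_ge0 ?norm0_ge0// sqrrD !norm0_sq.
rewrite ipDl ?ipDr// (ipC w v).
have := le_trans (ler_norm _) (ip_CS v2 w2); rewrite mulr2n.
by move: (ip U v v) (ip U w w) (ip U v w) (_ * _) => *; lra.
Qed.

Lemma norm0N v : norm0 U (fun x => - v x) = norm0 U v.
Proof. by congr Num.sqrt; apply: eq_Rintegral => x _; rewrite mulrNN. Qed.

Lemma norm0B v w : L2 U v -> L2 U w -> norm0 U (v \- w) <= norm0 U v + norm0 U w.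
Proof.
move=> v2 w2; rewrite -(norm0N w); apply: (norm0D v2 (L2N w2)).
Qed.

Lemma ip_ae v v' w w' : L2 U v -> L2 U v' -> L2 U w -> L2 U w' ->
  {ae mu, forall x, U x -> v x = v' x} -> {ae mu, forall x, U x -> w x = w' x} ->
  ip U v w = ip U v' w'.
Proof.
move=> v2 v'2 w2 w'2 vv ww; congr fine; apply: ae_eq_integral => //.
- by have /integrableP[] := L2_mul_int v2 w2.
- by have /integrableP[] := L2_mul_int v'2 w'2.
- by apply: ae_imp2 vv ww => x h1 h2 Ux; rewrite h1// h2.
Qed.

Lemma norm0_ae v v' : L2 U v -> L2 U v' ->
  {ae mu, forall x, U x -> v x = v' x} -> norm0 U v = norm0 U v'.
Proof. by move=> v2 v'2 e; congr Num.sqrt; exact: ip_ae. Qed.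

Lemma ip_eq0_ae v : L2 U v -> ip U v v = 0 -> {ae mu, forall x, U x -> v x = 0}.
Proof.
move=> v2 v0; have iv := L2_sq_int v2.
have /integrableP[miv _] := iv.
have H : (\int[mu]_(x in U) `|(v x * v x)%:E| = 0)%E.
  transitivity (\int[mu]_(x in U) (EFin \o (fun x => v x * v x)%R) x)%E.
    by apply: eq_integral => x _; rewrite /= ger0_norm// -expr2 sqr_ge0.
  have /fineK <- := integrable_fin_num mU iv.
  by congr EFin; exact: v0.
have := (ae_eq_integral_abs mu mU miv).1 H.
by apply: ae_imp => x h Ux; have := h Ux; case=> /eqP; rewrite mulf_eq0 orbb => /eqP.
Qed.

Lemma ipv_sum p q : L2v U p -> L2v U q ->
  ipv U p q = ip U (fst_of p) (fst_of q) + ip U (snd_of p) (snd_of q).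
Proof.
by move=> [p1 p2] [q1 q2]; rewrite /ip -RintegralD//; exact: L2_mul_int.
Qed.

Lemma norm0v_ge0 q : 0 <= norm0v U q.
Proof. exact: sqrtr_ge0. Qed.

Lemma norm0v_sq q : norm0v U q ^+ 2 = norm0 U (fst_of q) ^+ 2 + norm0 U (snd_of q) ^+ 2.
Proof. by rewrite sqr_sqrtr// addr_ge0 ?sqr_ge0. Qed.

Lemma norm0v_sq_ipv q : L2v U q -> norm0v U q ^+ 2 = ipv U q q.
Proof. by move=> q2; rewrite norm0v_sq !norm0_sq ipv_sum. Qed.

Lemma ipv_CS p q : L2v U p -> L2v U q -> `|ipv U p q| <= norm0v U p * norm0v U q.
Proof.
move=> p2 q2; rewrite ipv_sum//; case: p2 q2 => [p1 p2] [q1 q2].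
apply: (le_trans (ler_normD _ _)); apply: (le_trans (lerD (ip_CS p1 q1) (ip_CS p2 q2))).
rewrite -ler_sqr ?nnegrE ?addr_ge0 ?mulr_ge0 ?norm0_ge0 ?norm0v_ge0// exprMn !norm0v_sq.
move: (norm0 U _) (norm0 U _) (norm0 U _) (norm0 U _) => a b c d.
by have := sqr_ge0 (a * d - c * b); rewrite !expr2; nra.
Qed.

Lemma L2vD p q : L2v U p -> L2v U q -> L2v U (p \+ q).
Proof. by move=> [p1 p2] [q1 q2]; split; [exact: (L2D p1 q1)|exact: (L2D p2 q2)]. Qed.

Lemma L2vB p q : L2v U p -> L2v U q -> L2v U (p \- q).
Proof. by move=> [p1 p2] [q1 q2]; split; [exact: (L2B p1 q1)|exact: (L2B p2 q2)]. Qed.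

Lemma ipvC p q : ipv U p q = ipv U q p.
Proof. by apply: eq_Rintegral => x _; rewrite /dot !(mulrC (_ (p x))). Qed.

Lemma ipvBl p q r : L2v U p -> L2v U q -> L2v U r ->
  ipv U (p \- q) r = ipv U p r - ipv U q r.
Proof.
move=> p2 q2 r2; rewrite !ipv_sum//; last exact: L2vB.
case: p2 q2 r2 => [p1 p2] [q1 q2] [r1 r2].
have := ipBl p1 q1 r1; have := ipBl p2 q2 r2.
rewrite /fst_of /snd_of => e2 e1; rewrite [X in X + _]e1 [X in _ + X]e2; ring.
Qed.

Lemma ipvBr p q r : L2v U p -> L2v U q -> L2v U r ->
  ipv U r (p \- q) = ipv U r p - ipv U r q.
Proof. by move=> *; rewrite ipvC ipvBl// !(ipvC r). Qed.

Lemma norm0vD p q : L2v U p -> L2v U q -> norm0v U (p \+ q) <= norm0v U p + norm0v U q.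
Proof.
move=> [p1 p2] [q1 q2].
rewrite -ler_sqr ?nnegrE ?addr_ge0 ?norm0v_ge0//.
have a1 := norm0D p1 q1; have a2 := norm0D p2 q2.
have b := ipv_CS (conj p1 p2) (conj q1 q2).
have d : norm0v U (p \+ q) ^+ 2 = ipv U p p + 2 * ipv U p q + ipv U q q.
  rewrite norm0v_sq_ipv; last exact: L2vD.
  rewrite ipv_sum; [|exact: L2vD|exact: L2vD].
  have := ipDl p1 q1 (L2D p1 q1); have := ipDl p2 q2 (L2D p2 q2).
  rewrite (ipDr p1 q1 p1) (ipDr p1 q1 q1) (ipDr p2 q2 p2) (ipDr p2 q2 q2).
  rewrite /fst_of /snd_of => e2 e1.
  rewrite [X in X + _]e1 [X in _ + X]e2 !ipv_sum// /fst_of /snd_of.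
  by rewrite (ipC (fun x => (q x).1)) (ipC (fun x => (q x).2)); ring.
rewrite d sqrrD !norm0v_sq_ipv//.
have := le_trans (ler_norm _) b; rewrite mulr2n.
by move: (ipv U p p) (ipv U q q) (ipv U p q) (_ * _) => *; lra.
Qed.

Lemma ipv_ae p q p' q' : L2v U p -> L2v U p' -> L2v U q -> L2v U q' ->
  {ae mu, forall x, U x -> p x = p' x} -> {ae mu, forall x, U x -> q x = q' x} ->
  ipv U p q = ipv U p' q'.
Proof.
move=> p2 p'2 q2 q'2 pp qq; rewrite !ipv_sum//.
case: p2 p'2 q2 q'2 => ? ? [? ?] [? ?] [? ?]; congr (_ + _); apply: ip_ae => //.
- by apply: ae_imp pp => x h Ux; rewrite /fst_of h.
- by apply: ae_imp qq => x h Ux; rewrite /fst_of h.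
- by apply: ae_imp pp => x h Ux; rewrite /snd_of h.
- by apply: ae_imp qq => x h Ux; rewrite /snd_of h.
Qed.

Lemma bounded_L2 v M : (mu U < +oo)%E -> measurable_fun U v ->
  (forall x, U x -> `|v x| <= M) -> L2 U v.
Proof.
move=> Uf mv vM; apply: (@L2_dom _ (cst (M ^+ 2))) => //.
  apply: measurable_bounded_integrable => //; exact: bounded_cst.
move=> x Ux; rewrite /cst -[leLHS]real_normK ?num_real// ler_sqr ?nnegrE//; first exact: vM.
exact: le_trans (vM _ Ux).
Qed.

End L2space.

(** * Integration by parts and density of test functions *)

Section IntegralDerivative.
Variable R : realType.
Notation mu := (leb2 R).
Notation mpt := (measurableTypeR R * measurableTypeR R)%type.
Implicit Types (U : set (pt R)) (f g w phi : pt R -> R).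

Lemma cont_slice1 f y : continuous f -> continuous (fun t : R => f (t, y)).
Proof.
move=> cf t; apply/cvgrPdist_lt => e e0; have [d d0 H] := cont_eps (cf (t, y)) e0.
near=> s; rewrite distrC; apply: H => /=; last by rewrite subrr normr0.
by near: s; apply/nbhs_ballP; exists d => //= z; rewrite /ball/= distrC.
Unshelve. all: by end_near. Qed.

Lemma cont_slice2 f y : continuous f -> continuous (fun t : R => f (y, t)).
Proof.
move=> cf t; apply/cvgrPdist_lt => e e0; have [d d0 H] := cont_eps (cf (y, t)) e0.
near=> s; rewrite distrC; apply: H => /=; first by rewrite subrr normr0.
by near: s; apply/nbhs_ballP; exists d => //= z; rewrite /ball/= distrC.
Unshelve. all: by end_near. Qed.

Lemma test_sub_box U phi : test_fun U phi ->
  exists2 M, 0 < M & forall x, phi x != 0 -> `|x.1| < M /\ `|x.2| < M.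
Proof.
move=> [_ cphi _]; have [M HM] := bounded_sub_box (compact_bounded cphi).
exists (`|M| + 1); first by rewrite ltr_wpDl.
move=> x px; have [] := HM x (@subset_closure _ [set x | phi x != 0] x px); rewrite /= !in_itv/= -!ler_norml => h1 h2.
have hM : M < `|M| + 1 by rewrite (le_lt_trans (ler_norm M))// ltrDl.
by split; [exact: le_lt_trans h1 hM|exact: le_lt_trans h2 hM].
Qed.

Lemma measurable_test U phi (V : set (pt R)) : test_fun U phi -> measurable_fun V phi.
Proof.
move=> [sp _ _]; apply: (@measurable_funTS _ _ _ _ V phi).
by apply: continuous_measurable2; exact: smooth_cont.
Qed.

Lemma integrable_indic_box M : mu.-integrable setT (EFin \o \1_(box M : set (pt R))).
Proof.
apply/integrableP; split.
  by apply/measurable_EFinP; apply: measurable_indic; exact: measurable_box.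
under eq_integral do rewrite /= ger0_norm//.
rewrite integral_indic//; last exact: measurable_box.
by rewrite setIT; exact: mu_box.
Qed.

Lemma test_sq_int U phi : test_fun U phi ->
  mu.-integrable setT (fun x => ((phi x) ^+ 2)%:E).
Proof.
move=> tp; have [B B0 HB] := test_fun_bounded tp; have [M M0 HM] := test_sub_box tp.
apply: (@le_integrable _ _ _ mu setT measurableT _ (fun x => (B ^+ 2)%:E * (EFin \o \1_(box M : set (pt R))) x)%E).
- by apply/measurable_EFinP/measurable_funX; exact: measurable_test tp.
- move=> x _; rewrite /= lee_fin ger0_norm ?sqr_ge0// ger0_norm; last first.
    by rewrite mulr_ge0 ?sqr_ge0.
  have [->|px] := eqVneq (phi x) 0; first by rewrite expr0n/= mulr_ge0 ?sqr_ge0.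
  have [h1 h2] := HM x px.
  rewrite indicE mem_set ?mulr1; last by split; rewrite /= in_itv/= -ler_norml ltW.
  by rewrite -[leLHS]real_normK ?num_real// ler_sqr ?nnegrE// ltW.
- by apply: integrableZl => //; exact: integrable_indic_box.
Qed.

Lemma test_L2 U phi (V : set (pt R)) : measurable (V : set mpt) -> test_fun U phi -> L2 V phi.
Proof.
move=> mV tp; split; first exact: measurable_test tp.
by apply: integrableS (test_sq_int tp).
Qed.

Lemma test_int U phi : test_fun U phi -> mu.-integrable setT (EFin \o phi).
Proof.
move=> tp; have [B B0 HB] := test_fun_bounded tp; have [M M0 HM] := test_sub_box tp.
apply: (@le_integrable _ _ _ mu setT measurableT _ (fun x => B%:E * (EFin \o \1_(box M : set (pt R))) x)%E).
- by apply/measurable_EFinP; exact: measurable_test tp.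
- move=> x _; rewrite /= lee_fin [leRHS]ger0_norm; last by rewrite mulr_ge0// ltW.
  have [->|px] := eqVneq (phi x) 0; first by rewrite normr0 mulr_ge0// ltW.
  have [h1 h2] := HM x px.
  by rewrite indicE mem_set ?mulr1//; split; rewrite /= in_itv/= -ler_norml ltW.
- by apply: integrableZl => //; exact: integrable_indic_box.
Qed.

Lemma integral_derive0 (u u' : R -> R) (M : R) : 0 < M -> continuous u' ->
  (forall t : R, is_derive t 1 u (u' t)) ->
  (forall t, M <= `|t| -> u t = 0) -> (forall t, M <= `|t| -> u' t = 0) ->
  (\int[leb1 R]_t (u' t)%:E = 0)%E.
Proof.
move=> M0 cu' du uM u'M.
have MM : - M < M by lra.
have -> : (\int[leb1 R]_t (u' t)%:E = \int[leb1 R]_(t in `[(- M)%R, M]) (u' t)%:E)%E.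
  rewrite [RHS]integral_mkcond; apply: eq_integral => t _; rewrite patchE.
  case: ifPn => //; rewrite notin_setE/= in_itv/= -ler_norml => /negP; rewrite -ltNge => h.
  by rewrite u'M// ltW.
have dcu t : {for t, continuous u}.
  by apply: differentiable_continuous; apply/derivable1_diffP; case: (du t).
rewrite (@continuous_FTC2 _ u' u) => //.
- by rewrite !uM ?normrN ?ler_norm// subee.
- exact: continuous_subspaceT.
- split.
  + by move=> t _; case: (du t).
  + by apply: cvg_at_right_filter; exact: dcu.
  + by apply: cvg_at_left_filter; exact: dcu.
- by move=> t _; rewrite derive1E; apply: derive_val.
Qed.

(** Fubini reduces the claim to horizontal lines, on which the derivative of a compactly supported
    function integrates to zero. *)
Lemma integral_d1_test U phi : test_fun U phi -> \int[mu]_x d1 phi x = 0.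
Proof.
move=> tp; have [M M0 HM] := test_sub_box tp.
have [M' M'0 HM'] := test_sub_box (test_fun_d1 tp).
have sp : smooth phi by case: tp.
rewrite /Rintegral -(integral21_prod_meas1 (test_int (test_fun_d1 tp))).
rewrite integral0_eq// => y _; rewrite /fubini_G /=.
apply: (@integral_derive0 (fun t => phi (t, y)) _ (Num.max M M')).
- by rewrite lt_max M0.
- by apply: cont_slice1; exact: smooth_cont (smooth_d1 sp).
- by move=> t; apply: (is_derive1P phi (t, y) _).1; apply: Ck_is_d1 (sp 1%N).
- move=> t; rewrite ge_max => /andP[h _]; apply: contraTeq h => /HM[/= h _].
  by rewrite -ltNge.
- move=> t; rewrite ge_max => /andP[_ h]; apply: contraTeq h => /HM'[/= h _].
  by rewrite -ltNge.
Qed.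

Lemma integral_d2_test U phi : test_fun U phi -> \int[mu]_x d2 phi x = 0.
Proof.
move=> tp; have [M M0 HM] := test_sub_box tp.
have [M' M'0 HM'] := test_sub_box (test_fun_d2 tp).
have sp : smooth phi by case: tp.
rewrite /Rintegral -(integral12_prod_meas1 (test_int (test_fun_d2 tp))).
rewrite integral0_eq// => y _; rewrite /fubini_F /=.
apply: (@integral_derive0 (fun t => phi (y, t)) _ (Num.max M M')).
- by rewrite lt_max M0.
- by apply: cont_slice2; exact: smooth_cont (smooth_d2 sp).
- by move=> t; apply: (is_derive2P phi (y, t) _).1; apply: Ck_is_d2 (sp 1%N).
- move=> t; rewrite ge_max => /andP[h _]; apply: contraTeq h => /HM[/= _ h].
  by rewrite -ltNge.
- move=> t; rewrite ge_max => /andP[_ h]; apply: contraTeq h => /HM'[/= _ h].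
  by rewrite -ltNge.
Qed.

Lemma Rintegral_supp U (F : pt R -> R) : (forall x, ~ U x -> F x = 0) ->
  \int[mu]_(x in U) F x = \int[mu]_x F x.
Proof.
move=> FU; rewrite Rintegral_mkcond; apply: eq_Rintegral => x _; rewrite patchE.
by case: ifPn => //; rewrite notin_setE => /FU.
Qed.

Lemma ip_test U w phi : test_fun U phi -> ip U w phi = \int[mu]_x (w x * phi x).
Proof. by move=> tp; apply: Rintegral_supp => x Ux; rewrite (test_fun_out tp)// mulr0. Qed.

(** The product of [w] and [phi] is again a test function, so its derivative has integral zero; the
    product rule then separates the two terms. *)
Lemma ibp1 U w phi : smooth w -> test_fun U phi ->
  ip U w (d1 phi) = - ip U (d1 w) phi.
Proof.
move=> sw tp; have sp : smooth phi by case: tp.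
have t1 := test_funM sw (test_fun_d1 tp); have t2 := test_funM (smooth_d1 sw) tp.
apply/eqP; rewrite -addr_eq0 (ip_test _ (test_fun_d1 tp)) (ip_test _ tp).
rewrite -RintegralD//; [|exact: test_int t1|exact: test_int t2].
rewrite -(integral_d1_test (test_funM sw tp)); apply/eqP; apply: eq_Rintegral => x _.
by rewrite d1M// addrC.
Qed.

Lemma ibp2 U w phi : smooth w -> test_fun U phi ->
  ip U w (d2 phi) = - ip U (d2 w) phi.
Proof.
move=> sw tp; have sp : smooth phi by case: tp.
have t1 := test_funM sw (test_fun_d2 tp); have t2 := test_funM (smooth_d2 sw) tp.
apply/eqP; rewrite -addr_eq0 (ip_test _ (test_fun_d2 tp)) (ip_test _ tp).
rewrite -RintegralD//; [|exact: test_int t1|exact: test_int t2].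
rewrite -(integral_d2_test (test_funM sw tp)); apply/eqP; apply: eq_Rintegral => x _.
by rewrite d2M// addrC.
Qed.

End IntegralDerivative.

(** * Open quadrants generate the measurable sets of the plane *)

Section RayGenerator.
Variable R : realType.
Notation mpt := (measurableTypeR R * measurableTypeR R)%type.

Definition rays : set (set (pt R)) :=
  [set A | exists a b : R, A = (`]a, +oo[ : set R) `*` (`]b, +oo[ : set R)].

Lemma rays_setI : setI_closed rays.
Proof.
move=> _ _ [a [b ->]] [c [d ->]]; exists (Num.max a c), (Num.max b d).
by apply/seteqP; split => -[x y] /=; rewrite !in_itv/= !andbT !gt_max;
  [move=> [[-> ->] [-> ->]]|move=> [/andP[-> ->] /andP[-> ->]]].
Qed.

(** Open quadrants are stable under intersection, as Dynkin's argument requires, and their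
    indicators are limits of products of two [step] functions. A half-plane is recovered by letting
    one bound of the corner tend to minus infinity. *)
Lemma rays_measurable : @measurable _ mpt = <<s rays >>.
Proof.
pose G := g_sigma_algebraType rays.
have m1 : measurable_fun setT (fst : G -> R).
  apply: (measurability _ (RGenOInfty.measurableE R)) => //.
  move=> /= _ [_ [c ->] <-]; rewrite setTI.
  rewrite (_ : _ @^-1` _ = \bigcup_(n in [set: nat]) ([set` `]c, +oo[] `*` [set` `](- n%:R), +oo[])); last first.
    apply/seteqP; split => [[x y]|[x y] [n _ []//]] /=; rewrite in_itv/= andbT => cx.
    exists (Num.truncn (- y)).+1 => //; split; rewrite /= in_itv/= andbT//.
    by rewrite ltrNl truncnS_gt.
  by apply: bigcupT_measurable => n; apply: sub_sigma_algebra; exists c, (- n%:R).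
have m2 : measurable_fun setT (snd : G -> R).
  apply: (measurability _ (RGenOInfty.measurableE R)) => //.
  move=> /= _ [_ [c ->] <-]; rewrite setTI.
  rewrite (_ : _ @^-1` _ = \bigcup_(n in [set: nat]) ([set` `](- n%:R), +oo[] `*` [set` `]c, +oo[])); last first.
    apply/seteqP; split => [[x y]|[x y] [n _ []//]] /=; rewrite in_itv/= andbT => cx.
    exists (Num.truncn (- x)).+1 => //; split; rewrite /= in_itv/= andbT//.
    by rewrite ltrNl truncnS_gt.
  by apply: bigcupT_measurable => n; apply: sub_sigma_algebra; exists (- n%:R), c.
rewrite measurable_prod_measurableType; apply/seteqP; split.
- apply: smallest_sub; first exact: smallest_sigma_algebra.
  move=> _ [A mA [B mB <-]].
  have -> : A `*` B = (fst @^-1` A) `&` (snd @^-1` B) by [].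
  have h1 : measurable ((fst : G -> R) @^-1` A).
    by rewrite -[X in measurable X]setTI; exact: m1.
  have h2 : measurable ((snd : G -> R) @^-1` B).
    by rewrite -[X in measurable X]setTI; exact: m2.
  exact: (measurableI _ _ h1 h2).
- apply: smallest_sub; first exact: smallest_sigma_algebra.
  move=> _ [a [b ->]]; apply: sub_sigma_algebra; exists `]a, +oo[%classic.
    exact: measurable_itv.
  by exists `]b, +oo[%classic => //; exact: measurable_itv.
Qed.

End RayGenerator.

Section DominatedConvergence.
Variable R : realType.
Notation mu := (leb2 R).
Notation mpt := (measurableTypeR R * measurableTypeR R)%type.

Lemma Rintegral_dct (D : set (pt R)) (f_ : nat -> pt R -> R) (f g : pt R -> R) :
  measurable (D : set mpt) -> (forall n, measurable_fun D (f_ n)) -> measurable_fun D f ->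
  {ae mu, forall x, D x -> f_ n x @[n --> \oo] --> f x} ->
  mu.-integrable D (EFin \o g) ->
  (forall n x, D x -> `|f_ n x| <= g x) ->
  \int[mu]_(x in D) f_ n x @[n --> \oo] --> \int[mu]_(x in D) f x.
Proof.
move=> mD mf_ mf cf ig fg.
have c' : {ae mu, forall x, D x -> (fun n => (f_ n x)%:E) @ \oo --> (f x)%:E}.
  apply: ae_imp cf => x h Dx; apply: cvg_EFin; first by apply: nearW.
  exact: h.
have g' : {ae mu, forall x n, D x -> (`|(f_ n x)%:E| <= (EFin \o g) x)%E}.
  by apply: ae_all => x n Dx; rewrite /= lee_fin; exact: fg.
have [if_ _ h] := @dominated_convergence _ _ _ mu D mD (fun n x => (f_ n x)%:E)
  (fun x => (f x)%:E) (EFin \o g) (fun n => (measurable_EFinP _ _).2 (mf_ n))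
  ((measurable_EFinP _ _).2 mf) c' ig g'.
apply: fine_cvg; rewrite fineK//.
exact: integrable_fin_num if_.
Qed.

End DominatedConvergence.

Import HBNNSimple.

(** * Density of test functions in L^2 *)

Section Density.
Variables (R : realType) (U : set (pt R)).
Notation mu := (leb2 R).
Notation mpt := (measurableTypeR R * measurableTypeR R)%type.
Implicit Types (v w phi zeta : pt R -> R).

(** Density is proved as a closure property: this class is stable under linear combinations and
    dominated limits, and it is enlarged from test functions to their products with indicators, then
    with simple functions, then to nonnegative functions. Working on the whole plane avoids tracking
    restrictions. *)
Definition apx w := L2 setT w /\
  forall e, 0 < e -> exists2 phi, test_fun U phi & ip setT (w \- phi) (w \- phi) < e.

Let mT : measurable ([set: pt R] : set mpt) := measurableT.

Lemma apx_test phi : test_fun U phi -> apx phi.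
Proof.
move=> tp; split; first exact: test_L2 tp.
move=> e e0; exists phi => //; rewrite (_ : ip _ _ _ = 0)//.
rewrite /ip (@eq_Rintegral _ _ _ _ _ (cst 0)); first by rewrite Rintegral_cst// mul0r.
by move=> x _; rewrite /= subrr mul0r.
Qed.

Lemma ip_sqD w w' : L2 setT w -> L2 setT w' ->
  ip setT (w \+ w') (w \+ w') <= 2 * ip setT w w + 2 * ip setT w' w'.
Proof.
move=> w2 w'2; have ww := L2D mT w2 w'2.
have := ip_ge0 setT (w \- w').
rewrite !(ipDl mT w2 w'2)// !(ipDr mT w2 w'2)// !(ipBl mT w2 w'2)//; last exact: L2B.
rewrite !(ipBr mT w2 w'2)// (ipC setT w').
by move: (ip _ w w) (ip _ w w') (ip _ w' w') => *; lra.
Qed.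

Lemma apxD w w' : apx w -> apx w' -> apx (w \+ w').
Proof.
move=> [w2 h] [w'2 h']; split; first exact: L2D.
move=> e e0; have e4 : 0 < e / 4 by rewrite divr_gt0.
have [phi tp hp] := h _ e4; have [phi' tp' hp'] := h' _ e4.
exists (phi \+ phi'); first exact: test_funD.
have p2 := test_L2 mT tp; have p'2 := test_L2 mT tp'.
have -> : (w \+ w') \- (phi \+ phi') = (w \- phi) \+ (w' \- phi').
  by apply/funext => x /=; rewrite opprD addrACA.
apply: (le_lt_trans (ip_sqD (L2B mT w2 p2) (L2B mT w'2 p'2))).
by move: (ip _ _ _) (ip _ _ _) hp hp' => *; lra.
Qed.

Lemma apxZ c w : apx w -> apx (fun x => c * w x).
Proof.
move=> [w2 h]; split; first exact: L2Z.
move=> e e0; have c0 : 0 < c ^+ 2 + 1 by rewrite ltr_wpDl// sqr_ge0.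
have e4 : 0 < e / (c ^+ 2 + 1) by rewrite divr_gt0.
have [phi tp hp] := h _ e4.
exists (fun x => c * phi x).
  by apply: (test_funM (f := fun=> c)) => //; exact: smooth_cst.
have p2 := L2B mT w2 (test_L2 mT tp).
have -> : (fun x => c * w x) \- (fun x => c * phi x) = (fun x => c * (w \- phi) x).
  by apply/funext => x /=; rewrite mulrBr.
rewrite ipZl//; last exact: L2Z.
rewrite ipZr// mulrA -expr2.
move: hp; rewrite ltr_pdivlMr// mulrC; apply: le_lt_trans.
by rewrite ler_wpM2r ?ip_ge0// lerDl.
Qed.

Lemma ip_dom_cvg0 (w_ : nat -> pt R -> R) w g : L2 setT g -> measurable_fun setT w ->
  (forall n, measurable_fun setT (w_ n)) ->
  (forall x, w_ n x @[n --> \oo] --> w x) ->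
  (forall n x, `|w_ n x| <= `|g x|) -> ip setT (w \- w_ n) (w \- w_ n) @[n --> \oo] --> 0.
Proof.
move=> g2 mw mw_ cw wg.
have wg' x : `|w x| <= `|g x|.
  by apply: (cvgr_to_le (cvg_norm (cw x))); apply: nearW => n; exact: wg.
have i0 : \int[mu]_(x in setT) (cst 0 x : R) = 0 by rewrite Rintegral_cst// mul0r.
rewrite -[X in _ --> X]i0.
apply: (@Rintegral_dct _ _ _ _ (fun x => 4 * (g x * g x))) => //.
- by move=> n; apply: measurable_funM; apply: measurable_funB.
- apply: ae_all => x _.
  rewrite -[X in _ --> X](mul0r (0 : R)) -(subrr (w x)).
  by apply: cvgM; apply: cvgB; [exact: cvg_cst|exact: cw|exact: cvg_cst|exact: cw].
- have -> : EFin \o (fun x => 4 * (g x * g x)) = (fun x => 4%:E * (g x * g x)%:E)%E by [].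
  by apply: integrableZl => //; exact: L2_sq_int.
- move=> n x _; rewrite /= normrM -expr2.
  have -> : 4 * (g x * g x) = (`|g x| + `|g x|) ^+ 2.
    by rewrite -expr2 -(real_normK (num_real (g x))); ring.
  rewrite ler_sqr ?nnegrE ?addr_ge0//.
  by rewrite (le_trans (ler_normB _ _))// lerD.
Qed.

(** Two approximations are composed: some [w_ N] is close to [w] by dominated convergence, and a
    test function is close to [w_ N]. *)
Lemma apx_dom (w_ : nat -> pt R -> R) w g : L2 setT g -> measurable_fun setT w ->
  (forall n, apx (w_ n)) ->
  (forall x, w_ n x @[n --> \oo] --> w x) ->
  (forall n x, `|w_ n x| <= `|g x|) -> apx w.
Proof.
move=> g2 mw aw cw wg.
have mw_ n : measurable_fun setT (w_ n) by case: (aw n) => -[].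
have wg' x : `|w x| <= `|g x|.
  by apply: (cvgr_to_le (cvg_norm (cw x))); apply: nearW => n; exact: wg.
have w2 : L2 setT w.
  apply: (L2_dom mT (g := fun x => g x * g x)) => //; first exact: L2_sq_int.
  move=> x _; rewrite -expr2 -[leLHS]real_normK ?num_real// -[leRHS]real_normK ?num_real//.
  by rewrite ler_sqr ?nnegrE.
split => // e e0.
have e4 : 0 < e / 4 by rewrite divr_gt0.
have /cvgrPdist_lt/(_ _ e4)[N _ /(_ N (leqnn N))] := ip_dom_cvg0 g2 mw mw_ cw wg.
rewrite /= sub0r normrN ger0_norm ?ip_ge0// => hN.
have [wN2 /(_ _ e4)[phi tp hp]] := aw N.
exists phi => //; have p2 := test_L2 mT tp.
have -> : w \- phi = (w \- w_ N) \+ (w_ N \- phi).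
  by apply/funext => x /=; rewrite addrA subrK.
apply: (le_lt_trans (ip_sqD (L2B mT w2 wN2) (L2B mT wN2 p2))).
by move: (ip _ _ _) (ip _ _ _) hp hN => *; lra.
Qed.

Lemma cvg_step (t : R) : step (n%:R * t) @[n --> \oo] --> (if 0 < t then 1 else 0 : R).
Proof.
case: ifPn => t0; last first.
  rewrite (_ : (fun n => _) = cst 0); first exact: cvg_cst.
  by apply/funext => n; rewrite step_le0// mulr_ge0_le0// leNgt.
apply: cvg_near_cst; near=> n; apply: step_ge1.
rewrite -ler_pdivrMr// mul1r.
by near: n; exact: nbhs_infty_ger.
Unshelve. all: by end_near. Qed.

(** The factor [zeta] keeps the supports in [U] and is itself the dominating function, so the sets
    [A] that work form a Dynkin system; it contains the quadrants because their indicators are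
    limits of smooth functions. *)
Lemma apx_test_indic zeta (A : set (pt R)) : test_fun U zeta ->
  measurable (A : set mpt) -> apx (fun x => zeta x * \1_A x).
Proof.
move=> tz mA.
have z2 := test_L2 mT tz.
have mz := measurable_test (V := setT) tz.
have mi (B : set (pt R)) : measurable (B : set mpt) -> measurable_fun setT (fun x => zeta x * \1_B x).
  by move=> mB; apply: measurable_funM => //; exact: measurable_indic.
have zl (B : set (pt R)) x : `|zeta x * \1_B x| <= `|zeta x|.
  by rewrite normrM ler_piMr// indicE; case: (_ \in _); rewrite ?normr1 ?normr0.
have := mA; rewrite (rays_measurable R) => h.
refine (@dynkin_induction _ mpt (@rays R) (fun A : set mpt => apx (fun x => zeta x * \1_(A : set (pt R)) x)) _ _ _ _ _ _ A h) => {A h mA}.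
- exact: rays_measurable.
- exact: rays_setI.
- by rewrite indicT; have := apx_test tz; congr apx; apply/funext => x; rewrite /cst mulr1.
- move=> _ [a [b ->]].
  pose w_ n x := zeta x * (step (n%:R * (x.1 - a)) * step (n%:R * (x.2 - b))).
  apply: (@apx_dom w_ _ zeta) => //.
  + by apply: mi; apply: measurableX; exact: measurable_itv.
  + move=> n; apply: apx_test.
    rewrite /w_ (_ : (fun x => _) = (fun x => (step (aff (- (n%:R * a), n%:R, 0) x) * step (aff (- (n%:R * b), 0, n%:R) x)) * zeta x)); last first.
      by apply/funext => x; rewrite mulrC; congr (step _ * step _ * _); rewrite /aff/=; ring.
    by apply: test_funM => //; apply: smoothM; apply: smooth_comp_aff; exact: step_smooth.
  + move=> x; apply: cvgM; first exact: cvg_cst.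
    have -> : \1_(`]a, +oo[ `*` `]b, +oo[) x = (if 0 < x.1 - a then 1 else 0) * (if 0 < x.2 - b then 1 else 0) :> R.
      rewrite indicE !subr_gt0.
      have [xa|xa] := ltrP a x.1; have [xb|xb] := ltrP b x.2; rewrite ?mul1r ?mul0r.
      - by rewrite mem_set// /setX /= !in_itv/= xa xb.
      - by rewrite memNset// /setX /= !in_itv/= !andbT => -[_]; rewrite ltNge xb.
      - by rewrite memNset// /setX /= !in_itv/= !andbT => -[]; rewrite ltNge xa.
      - by rewrite memNset// /setX /= !in_itv/= !andbT => -[]; rewrite ltNge xa.
    by apply: cvgM; exact: cvg_step.
  + move=> n x; rewrite /w_ normrM; apply: ler_piMr => //; rewrite ger0_norm.
      by apply: mulr_ile1; [exact: step_ge0|exact: step_ge0|exact: step_le1|exact: step_le1].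
    by apply: mulr_ge0; exact: step_ge0.
- move=> A mA apA.
  have -> : (fun x => zeta x * \1_(~` A) x) = zeta \+ (fun x => (- 1) * (zeta x * \1_A x)).
    by apply/funext => x /=; rewrite !indicE in_setC; case: (_ \in _) => /=; ring.
  by apply: apxD; [exact: apx_test|exact: apxZ].
- move=> F mF tF aF.
  pose w_ n x := zeta x * \1_(\big[setU/set0]_(k < n) F k) x.
  apply: (@apx_dom w_ _ zeta) => //.
  + by apply: mi; exact: bigcupT_measurable.
  + elim => [|n IH].
      rewrite /w_ big_ord0 indic0.
      have := apxZ 0 (apx_test tz); congr apx; apply/funext => x.
      by rewrite mul0r mulr0.
    have -> : w_ n.+1 = (w_ n) \+ (fun x => zeta x * \1_(F n) x).
      apply/funext => x; rewrite /w_ /= -mulrDr big_ord_recr/=; congr (_ * _).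
      have dj : (\big[setU/set0]_(i < n) F i) `&` F n = set0.
        rewrite -bigcup_mkord; apply/seteqP; split => // y [[k /= kn Fk] Fn].
        have E : k = n by apply: tF => //; exists y.
        by rewrite E ltnn in kn.
      by rewrite !indicE in_setU; have [xn|xn] := boolP (x \in F n);
        have [xb|xb] := boolP (x \in \big[setU/set0]_(i < n) F i) => //=; rewrite ?addr0 ?add0r//;
        move: xn xb; rewrite !inE => xn xb; have : set0 x by rewrite -dj.
    by apply: apxD.
  + move=> x; apply: cvgM; first exact: cvg_cst.
    have [[k _ Fk]|nF] := pselect ((\bigcup_k F k) x).
      rewrite [X in _ --> X]indicE mem_set//; last by exists k.
      apply: cvg_near_cst; near=> n; rewrite indicE mem_set//.
      rewrite -bigcup_mkord; exists k => //=; near: n; exact: nbhs_infty_gt.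
    rewrite [X in _ --> X]indicE memNset//.
    rewrite (_ : (fun n => _) = cst 0); first exact: cvg_cst.
    apply/funext => n; rewrite indicE memNset// -bigcup_mkord => -[k _ Fk].
    by apply: nF; exists k.
  + by move=> n x; exact: zl.
Unshelve. all: by end_near. Qed.

Lemma apx_sum (I : Type) (s : seq I) (F : I -> pt R -> R) : (forall i, apx (F i)) ->
  apx (fun x => \sum_(i <- s) F i x).
Proof.
move=> aF; elim: s => [|i s IH].
  rewrite (_ : (fun x => _) = (fun=> 0)); last by apply/funext => x; rewrite big_nil.
  apply: apx_test; apply: (@test_funP _ _ set0) => //; [exact: smooth_cst|exact: compact0|].
  by move=> x; rewrite eqxx.
rewrite (_ : (fun x => _) = F i \+ (fun x => \sum_(i <- s) F i x)); first exact: apxD.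
by apply/funext => x; rewrite big_cons.
Qed.

Lemma apx_test_nnsfun zeta (g : {nnsfun mpt >-> R}) : test_fun U zeta ->
  apx (fun x => zeta x * g x).
Proof.
move=> tz.
rewrite (_ : (fun x => _) =
    (fun x => \sum_(y <- finmap.enum_fset (fset_set (range g))) (y * (zeta x * \1_(g @^-1` [set y]) x)))).
  by apply: apx_sum => y; apply: apxZ; apply: apx_test_indic.
apply/funext => x; rewrite (fimfunE g) fsbig_finite//= mulr_sumr.
by apply: eq_bigr => y _; rewrite mulrCA.
Qed.

Hypothesis mU : measurable (U : set mpt).
Hypothesis exU : exists zeta_ : nat -> pt R -> R,
  [/\ forall n, test_fun U (zeta_ n), forall n x, 0 <= zeta_ n x <= 1 &
      forall x, U x -> zeta_ n x @[n --> \oo] --> (1 : R)].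

Lemma apx_nonneg v : L2 setT v -> (forall x, 0 <= v x) -> (forall x, ~ U x -> v x = 0) ->
  apx v.
Proof.
move=> v2 v0 vU; have [zeta_ [tz z01 cz]] := exU.
have mv : measurable_fun setT v by case: v2.
have mv' : measurable_fun [set: mpt] (EFin \o v) by apply/measurable_EFinP.
pose g_ := nnsfun_approx (measurableT : measurable [set: mpt]) mv'.
have cg x : g_ n x @[n --> \oo] --> v x.
  apply: (@fine_cvg _ _ _ _ (fun n => (g_ n x)%:E)).
  have f0 (y : mpt) : setT y -> (0 <= (EFin \o v) y)%E by rewrite /= lee_fin.
  exact: (cvg_nnsfun_approx measurableT mv' f0 (I : setT x)).
have gv n x : g_ n x <= v x.
  rewrite -lee_fin /g_ nnsfun_approxE.
  exact: (@le_approx _ _ _ setT (EFin \o v) n x (fun y _ => v0 y)).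
apply: (@apx_dom (fun n x => zeta_ n x * g_ n x) v v) => //.
- by move=> n; exact: apx_test_nnsfun.
- move=> x; have [Ux|nUx] := pselect (U x).
    by rewrite -[X in _ --> X]mul1r; apply: cvgM; [exact: cz|exact: cg].
  rewrite vU// (_ : (fun n => _) = cst 0); first exact: cvg_cst.
  by apply/funext => n; rewrite (test_fun_out (tz n))// mul0r.
- move=> n x; have /andP[z0 z1] := z01 n x.
  have g0 : 0 <= g_ n x by [].
  rewrite ger0_norm ?mulr_ge0// ger0_norm//.
  by rewrite (le_trans (ler_piMl g0 z1)).
Qed.

Lemma L2_density v e : L2 U v -> 0 < e ->
  exists2 phi, test_fun U phi & norm0 U (v \- phi) < e.
Proof.
move=> v2 e0.
pose V := v \_ U.
have V2 : L2 setT V.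
  split; first by apply/(measurable_restrictT _ mU); case: v2.
  have := v2.2; move=> /(integrable_mkcond _ mU).1.
  congr (mu.-integrable _ _); apply/funext => x; rewrite /V !patchE.
  by case: ifP => //; rewrite expr0n.
pose Vp x := Num.max (V x) 0; pose Vn x := Num.max (- V x) 0.
have VE : V = Vp \+ (fun x => (- 1) * Vn x).
  by apply/funext => x; rewrite /Vp /Vn /=; case: (leP (V x) 0); case: (leP (- V x) 0) => *; lra.
have hd w : measurable_fun setT w -> (forall x, `|w x| <= `|V x|) -> L2 setT w.
  move=> mw wV; apply: (L2_dom mT (g := fun x => V x * V x)) => //; first exact: L2_sq_int.
  move=> x _; rewrite -expr2 -[leLHS]real_normK ?num_real// -[leRHS]real_normK ?num_real//.
  by rewrite ler_sqr ?nnegrE.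
have V0 x : ~ U x -> V x = 0 by move=> nU; rewrite /V patchE memNset.
have mV : measurable_fun setT V by case: V2.
have [_ aV] : apx V.
  rewrite VE; apply: apxD; last apply: apxZ; apply: apx_nonneg.
  - apply: hd; first by apply: measurable_maxr => //; exact: measurable_cst.
    by move=> x; rewrite /Vp ger0_norm ?le_max ?lexx ?orbT// ge_max ler_norm normr_ge0.
  - by move=> x; rewrite /Vp le_max lexx orbT.
  - by move=> x /V0; rewrite /Vp => ->; rewrite maxxx.
  - apply: hd; first by apply: measurable_maxr; [exact: measurableT_comp|exact: measurable_cst].
    by move=> x; rewrite /Vn ger0_norm ?le_max ?lexx ?orbT// -[leRHS]normrN ge_max ler_norm normr_ge0.
  - by move=> x; rewrite /Vn le_max lexx orbT.
  - by move=> x /V0; rewrite /Vn => ->; rewrite oppr0 maxxx.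
have e2 : 0 < e ^+ 2 by rewrite exprn_gt0.
have [phi tp hp] := aV _ e2; exists phi => //.
rewrite -ltr_sqr ?nnegrE ?norm0_ge0 ?(ltW e0)// norm0_sq; apply: le_lt_trans hp.
rewrite /ip Rintegral_mkcond le_eqVlt; apply/orP; left; apply/eqP.
apply: eq_Rintegral => x _; rewrite patchE /V /= patchE; case: ifPn => // .
by rewrite notin_setE => nU; rewrite (test_fun_out tp)// subr0 mul0r.
Qed.

(** [v] is not an admissible test function, so it is replaced by a nearby one. This is how a norm is
    estimated when only pairings with test functions are accessible. *)
Lemma L2_dual_bound v B : L2 U v -> 0 <= B ->
  (forall psi, test_fun U psi -> `|ip U v psi| <= B * norm0 U psi) -> norm0 U v <= B.
Proof.
move=> v2 B0 h.
have [v0|vn] := eqVneq (norm0 U v) 0; first by rewrite v0.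
have vp : 0 < norm0 U v by rewrite lt_neqAle eq_sym vn norm0_ge0.
apply/ler_addgt0Pr => e e0.
(* Chosen so that the total error of the replacement, [(norm0 U v + B) * d], is exactly
   [e * norm0 U v]. *)
pose d := e * norm0 U v / (norm0 U v + B).
have nB : 0 < norm0 U v + B by rewrite ltr_pwDl.
have d0 : 0 < d by rewrite divr_gt0// mulr_gt0.
have [phi tp hp] := L2_density v2 d0.
have p2 := test_L2 mU tp; have r2 := L2B mU v2 p2.
have h1 : norm0 U v ^+ 2 = ip U v (v \- phi) + ip U v phi.
  by rewrite norm0_sq (ipBr mU v2 p2 v2) subrK.
have h2 : ip U v (v \- phi) <= norm0 U v * d.
  rewrite (le_trans (ler_norm _))// (le_trans (ip_CS mU v2 r2))//.
  by rewrite ler_wpM2l ?norm0_ge0// ltW.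
have h3 : norm0 U phi <= norm0 U v + d.
  have := norm0B mU v2 r2; rewrite (_ : v \- (v \- phi) = phi); last first.
    by apply/funext => x /=; rewrite subKr.
  by move/le_trans; apply; rewrite lerD2l ltW.
have h4 : ip U v phi <= B * (norm0 U v + d).
  rewrite (le_trans (ler_norm _))// (le_trans (h _ tp))//.
  by rewrite ler_wpM2l.
rewrite -(ler_pM2l vp) -expr2 h1 mulrDr.
have -> : norm0 U v * e = (norm0 U v + B) * d by rewrite /d mulrC [RHS]mulrC divfK// gt_eqF.
move: h2 h4; rewrite mulrDr mulrDl (mulrC B (norm0 U v)).
by move: (ip _ _ _) (ip _ _ _) (_ * B) (_ * d) (B * d) => *; lra.
Qed.

Lemma test_uniq v : L2 U v -> (forall psi, test_fun U psi -> ip U v psi = 0) ->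
  {ae mu, forall x, U x -> v x = 0}.
Proof.
move=> v2 h; apply: ip_eq0_ae => //; rewrite -norm0_sq.
have : norm0 U v <= 0.
  by apply: L2_dual_bound => // psi tp; rewrite h// normr0 mul0r.
by move=> n0; rewrite (le_anti (introT andP (conj n0 (norm0_ge0 _ _)))) expr0n.
Qed.

End Density.

(** * Convex polygons and their cut-off functions *)

Section Polygons.
Variable R : realType.
Notation mpt := (measurableTypeR R * measurableTypeR R)%type.
Implicit Types (s : seq (R * R * R)) (l : R * R * R).

(** Intersections of open half-planes are convex, stable under intersection and translation, and
    have explicit cut-offs, one factor per side. *)
Definition poly s : set (pt R) := [set x | all (fun l => 0 < aff l x) s].

Lemma poly_cons l s : poly (l :: s) = [set x | 0 < aff l x] `&` poly s.
Proof. by apply/seteqP; split => x; rewrite /poly/=; [move/andP|move=> [-> ->]]. Qed.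

Lemma open_poly s : open (poly s).
Proof.
elim: s => [|l s IH]; first by rewrite (_ : poly [::] = [set: pt R]); [exact: openT|apply/seteqP; split].
by rewrite poly_cons; apply: openI => //; exact: open_aff_gt0.
Qed.

Lemma measurable_poly s : measurable (poly s : set mpt).
Proof. by apply: open_measurable2; exact: open_poly. Qed.

Lemma poly_cutoff s : bounded_set (poly s) -> exists zeta_ : nat -> pt R -> R,
  [/\ forall n, test_fun (poly s) (zeta_ n), forall n x, 0 <= zeta_ n x <= 1 &
      forall x, poly s x -> zeta_ n x @[n --> \oo] --> (1 : R)].
Proof.
move=> /bounded_sub_box[M HM].
(* The shift by 1 puts the support where every [aff l] is at least [1 / (n + 1)], a compact part of
   the open polygon. *)
pose z n l x := step (n.+1%:R * aff l x - 1) : R.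
have zp n l x : z n l x != 0 -> 1 <= n.+1%:R * aff l x.
  by move/step_gt0; rewrite subr_gt0 => /ltW.
exists (fun n x => \prod_(l <- s) z n l x); split.
- move=> n; apply: (@test_funP _ _ (box M `&` [set x | all (fun l => n.+1%:R^-1 <= aff l x) s])).
  + elim: s {HM} => [|l s IH].
      rewrite (_ : (fun x => _) = (fun=> 1)); last by apply/funext => x; rewrite big_nil.
      exact: smooth_cst.
    rewrite (_ : (fun x => _) = (fun x => z n l x * \prod_(l <- s) z n l x)); last first.
      by apply/funext => x; rewrite big_cons.
    apply: smoothM => //.
    rewrite (_ : z n l = (fun x => step (aff (n.+1%:R * l.1.1 - 1, n.+1%:R * l.1.2, n.+1%:R * l.2) x))).
      by apply: smooth_comp_aff; exact: step_smooth.
    by apply/funext => x; congr step; rewrite /aff/=; ring.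
  + apply: (@subclosed_compact _ _ (box M)); last exact: subIsetl.
      apply: closedI; first by apply: compact_closed; [exact: norm_hausdorff|exact: compact_box].
      elim: s {HM} => [|l s IH]; first by rewrite (_ : [set x | _] = [set: pt R]); [exact: closedT|apply/seteqP; split].
      rewrite (_ : [set x | _] = [set x | n.+1%:R^-1 <= aff l x] `&` [set x | all (fun l => n.+1%:R^-1 <= aff l x) s]).
        by apply: closedI => //; exact: closed_aff_ge.
      by apply/seteqP; split => x /=; [move/andP|move=> [-> ->]].
    exact: compact_box.
  + move=> x [_ /=]; rewrite /poly/=; apply: sub_all => l; apply: lt_le_trans.
    by rewrite invr_gt0.
  + move=> x; rewrite prodf_seq_neq0 => /allP h.
    have al : all (fun l => n.+1%:R^-1 <= aff l x) s.
      apply/allP => l ls; have := zp _ _ _ (h l ls).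
      by rewrite mulrC -ler_pdivrMr// mul1r.
    split => //; apply: HM; rewrite /poly/=; apply: sub_all al => l; apply: lt_le_trans.
    by rewrite invr_gt0.
- move=> n x; elim: s {HM} => [|l s /andP[h0 h1]]; first by rewrite big_nil ler01 lexx.
  rewrite big_cons; apply/andP; split.
    by apply: mulr_ge0 => //; exact: step_ge0.
  by apply: mulr_ile1 => //; [exact: step_ge0|exact: step_le1].
- move=> x; elim: s {HM} => [_|l s IH].
    rewrite (_ : (fun n => _) = cst 1); first exact: cvg_cst.
    by apply/funext => n; rewrite big_nil.
  rewrite poly_cons => -[/= lx sx].
  rewrite (_ : (fun n => _) = (fun n => z n l x * \prod_(l <- s) z n l x)); last first.
    by apply/funext => n; rewrite big_cons.
  rewrite -[X in _ --> X]mulr1; apply: cvgM; last exact: IH.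
  apply: cvg_near_cst; near=> n; apply: step_ge1.
  rewrite lerBrDr -ler_pdivrMr//.
  apply: (@le_trans _ _ n%:R); last by rewrite ler_nat.
  by near: n; exact: nbhs_infty_ger.
Unshelve. all: by end_near. Qed.

End Polygons.

(** * The Poincaré inequality on convex polygons *)

Section Poincare.
Variable R : realType.
Notation mu := (leb2 R).
Notation mpt := (measurableTypeR R * measurableTypeR R)%type.
Implicit Types (U : set (pt R)) (v w g phi psi : pt R -> R) (a : pt R) (s : seq (R * R * R)).

(** The weak gradient is explicit data here: [wD] picks a representative for one domain only,
    whereas these identities pass to subdomains unchanged. *)
Definition H1 U v g1 g2 : Prop := [/\ L2 U v, L2 U g1, L2 U g2,
  forall phi, test_fun U phi -> ip U v (d1 phi) = - ip U g1 phi &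
  forall phi, test_fun U phi -> ip U v (d2 phi) = - ip U g2 phi].

Lemma bounded_setS (A B : set (pt R)) : A `<=` B -> bounded_set B -> bounded_set A.
Proof.
move=> AB [M [Mr HM]]; exists M; split => // x /HM h y Ay; exact: (h y (AB y Ay)).
Qed.

Lemma L2_restrict U v : measurable (U : set mpt) -> L2 U v -> L2 setT (v \_ U).
Proof.
move=> mU v2; split; first by apply/(measurable_restrictT _ mU); case: v2.
have := v2.2; move=> /(integrable_mkcond _ mU).1.
congr (mu.-integrable _ _); apply/funext => x; rewrite !patchE.
by case: ifP => //; rewrite expr0n.
Qed.

Lemma L2_sub U V v : measurable (U : set mpt) -> measurable (V : set mpt) ->
  V `<=` U -> L2 U v -> L2 V v.
Proof.
move=> mU mV VU [mv iv]; split; first exact: measurable_funS mv.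
exact: integrableS iv.
Qed.

Lemma L2_shift v a : L2 setT v -> L2 setT (fun x => v (x + a)).
Proof.
move=> [mv iv]; split.
  by apply: measurableT_comp => //; exact: measurable_shift.
exact: (integrable_shift a iv).
Qed.

Lemma ip_shift v w a : L2 setT v -> L2 setT w ->
  ip setT (fun x => v (x + a)) (fun x => w (x + a)) = ip setT v w.
Proof.
move=> v2 w2; congr fine.
apply: (integral_shift a (f := fun x => (v x * w x)%:E)).
by apply/measurable_EFinP; apply: measurable_funM; [case: v2|case: w2].
Qed.

Lemma ip_restrict U v w : ip U v w = ip setT (v \_ U) w.
Proof.
rewrite /ip Rintegral_mkcond; apply: eq_Rintegral => x _; rewrite !patchE.
by case: ifP => // _; rewrite mul0r.
Qed.

Lemma ip_testS U V v psi : V `<=` U -> test_fun V psi -> ip U v psi = ip V v psi.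
Proof. by move=> VU tp; rewrite (ip_test _ tp) (ip_test _ (test_funS VU tp)). Qed.

Lemma H1S U V v g1 g2 : measurable (U : set mpt) -> measurable (V : set mpt) ->
  V `<=` U -> H1 U v g1 g2 -> H1 V v g1 g2.
Proof.
move=> mU mV VU [v2 h1 h2 e1 e2]; split; try exact: (L2_sub mU).
- move=> phi tp; rewrite -(ip_testS _ VU (test_fun_d1 tp)) -(ip_testS _ VU tp).
  exact/e1/(test_funS VU).
- move=> phi tp; rewrite -(ip_testS _ VU (test_fun_d2 tp)) -(ip_testS _ VU tp).
  exact/e2/(test_funS VU).
Qed.

Definition shift_aff a (l : R * R * R) : R * R * R :=
  (l.1.1 + l.1.2 * a.1 + l.2 * a.2, l.1.2, l.2).

Lemma aff_shift a l x : aff (shift_aff a l) x = aff l (x + a).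
Proof. by rewrite /aff /shift_aff/=; ring. Qed.

(** Encoded as a polygon of the same kind, so that density of test functions is available on the set
    where both [x] and [x + a] lie in the polygon. *)
Definition overlap a s := poly (s ++ map (shift_aff a) s).

Lemma overlapE a s x : overlap a s x <-> poly s x /\ poly s (x + a).
Proof.
rewrite /overlap /poly /= all_cat all_map.
have -> : all (preim (shift_aff a) (fun l => 0 < aff l x)) s = all (fun l => 0 < aff l (x + a)) s.
  by apply: eq_all => l /=; rewrite aff_shift.
by split => [/andP|[-> ->]].
Qed.

Lemma poly_convex s x a (t : R) : 0 <= t -> t <= 1 -> poly s x -> poly s (x + a) ->
  poly s (x + t *: a).
Proof.
move=> t0 t1 /allP h0 /allP h1; apply/allP => l ls.
have := h0 l ls; have := h1 l ls; rewrite /aff /= /GRing.scale/=.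
move: t0; rewrite le_eqVlt => /predU1P[<- _|t0]; first by rewrite !mul0r !addr0.
move: x.1 x.2 a.1 a.2 => x1 x2 a1 a2 p1 p0.
have -> : l.1.1 + l.1.2 * (x1 + t * a1) + l.2 * (x2 + t * a2) =
  t * (l.1.1 + l.1.2 * (x1 + a1) + l.2 * (x2 + a2)) + (1 - t) * (l.1.1 + l.1.2 * x1 + l.2 * x2) by ring.
by rewrite ltr_pwDl ?mulr_gt0// mulr_ge0 ?subr_ge0// ltW.
Qed.

Lemma ip_cst_int U v : measurable (U : set mpt) -> (mu U < +oo)%E -> L2 U v ->
  mu.-integrable U (EFin \o v).
Proof.
move=> mU fU v2.
have c2 : L2 U (cst 1 : pt R -> R).
  by apply: (@bounded_L2 _ _ mU _ 1) => // x _; rewrite normr1.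
by have := L2_mul_int mU v2 c2; congr (_.-integrable _ _); apply/funext => x /=; rewrite mulr1.
Qed.

Lemma cauchy2 (b1 b2 u1 u2 : R) :
  (b1 * u1 + b2 * u2) ^+ 2 <= (b1 ^+ 2 + b2 ^+ 2) * (u1 ^+ 2 + u2 ^+ 2).
Proof.
rewrite -subr_ge0 (_ : _ - _ = (b1 * u2 - b2 * u1) ^+ 2); first exact: sqr_ge0.
ring.
Qed.

(** The classical bound of a translate difference by the length of [a] times the gradient norm.
    Since [v] has only weak derivatives, the translation is moved onto a test function and the
    pairing is differentiated in the translation parameter; convexity keeps the intermediate
    supports inside the polygon, and duality returns to the norm. *)
Lemma shift_estimate s a v g1 g2 : bounded_set (poly s) -> H1 (poly s) v g1 g2 ->
  norm0 (overlap a s) (fun x => (v \_ (poly s)) (x + a) - (v \_ (poly s)) x) <=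
    Num.sqrt ((a.1 ^+ 2 + a.2 ^+ 2) * (ip (poly s) g1 g1 + ip (poly s) g2 g2)).
Proof.
move=> bU H; pose U := poly s; pose W := v \_ U; pose V := overlap a s.
rewrite -/U -/W -/V.
have {H} [v2 g12 g22 e1 e2] : H1 U v g1 g2 := H.
have mU : measurable (U : set mpt) := measurable_poly s.
have mV : measurable (V : set mpt) := measurable_poly _.
have VU : V `<=` U by move=> x /overlapE[].
have bV : bounded_set V by apply: bounded_setS bU.
have [M UM] := bounded_sub_box bU.
have fU : (mu U < +oo)%E := bounded_mu mU UM.
have W2 : L2 setT W := L2_restrict mU v2.
have Wa2 := L2_shift a W2.
have mT : measurable ([set: pt R] : set mpt) := measurableT.
set B := Num.sqrt _.
have D2 : L2 V (fun x => W (x + a) - W x).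
  by apply: (L2_sub mT mV) => //; exact: (L2B mT Wa2 W2).
apply: (L2_dual_bound mV (poly_cutoff bV) D2); first exact: sqrtr_ge0.
move=> psi tp; have sp : smooth psi by case: tp.
(* The difference [f 1 - f 0] is the pairing to be bounded, and the mean value theorem is applied to
   [f]. *)
pose f t := ip U v (fun x => psi (x - t *: a)).
have psi2 : L2 setT psi := test_L2 mT tp.
have tU (t : R) : 0 <= t -> t <= 1 -> test_fun U (fun x => psi (x - t *: a)).
  move=> t0 t1; apply: (test_fun_shift tp) => x /overlapE[h1 h2].
  exact: poly_convex.
have E : ip V (fun x => W (x + a) - W x) psi = f 1 - f 0.
  have -> : ip V (fun x => W (x + a) - W x) psi = ip setT (fun x => W (x + a) - W x) psi.
    by rewrite (ip_test _ tp).
  rewrite [LHS](ipBl mT Wa2 W2 psi2); congr (_ - _).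
    have -> : f 1 = ip setT W (fun x => psi (x - a)).
      by rewrite /f ip_restrict -/W; congr ip; apply/funext => x; rewrite scale1r.
    rewrite -(ip_shift a W2 (L2_shift (- a) psi2)).
    by congr ip; apply/funext => x; rewrite addrK.
  rewrite /f [RHS]ip_restrict -/W; congr ip; apply/funext => x.
  by rewrite scale0r subr0.
have [C1 C10 HC1] := test_fun_bounded (test_fun_d1 tp).
have [C2 C20 HC2] := test_fun_bounded (test_fun_d2 tp).
pose F t x := v x * psi (x - t *: a).
pose F' t x := - (a.1 * (v x * d1 psi (x - t *: a)) + a.2 * (v x * d2 psi (x - t *: a))).
have dF (t : R) (x : pt R) : is_derive t 1 (F ^~ x) (F' t x).
  have h := is_derive_line x (- a) t (sp 1%N).
  have hc := is_deriveM (@is_derive_cst _ _ _ (v x) t 1) h.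
  move: hc; rewrite scaler0 addr0.
  have xE (u : R) : (x.1 + u * (- a).1, x.2 + u * (- a).2) = x - u *: a.
    by apply: injective_projections; rewrite /= /GRing.scale/= mulrN.
  congr is_derive.
    apply/funext => u; transitivity (v x * psi (x.1 + u * (- a).1, x.2 + u * (- a).2)).
      by [].
    by rewrite xE.
  rewrite xE /F' /GRing.scale/=.
  by ring.
have iF t : mu.-integrable U (EFin \o F t).
  apply: L2_mul_int => //; apply: (L2_sub mT mU) => //.
  exact: (L2_shift (- (t *: a)) psi2).
pose G x := (`|a.1| * C1 + `|a.2| * C2) * `|v x|.
have G0 x : 0 <= G x by rewrite mulr_ge0// addr_ge0// mulr_ge0// ltW.
have iG : mu.-integrable U (EFin \o G).
  have -> : EFin \o G = (fun x => (`|a.1| * C1 + `|a.2| * C2)%:E * `|(EFin \o v) x|)%E by [].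
  apply: integrableZl => //; apply: integrable_abse; exact: ip_cst_int.
have FG t x : `|partial1of2 F t x| <= G x.
  rewrite partial1of2E; have -> : 'D_1 (F ^~ x) t = F' t x by apply: derive_val.
  rewrite /F' normrN (le_trans (ler_normD _ _))// !normrM /G mulrDl.
  by apply: lerD; rewrite -mulrA ler_wpM2l// mulrC ler_wpM2r.
have I01 (t : R) : 0 <= t -> t <= 1 -> [set` `](-1), 2[] t.
  move=> t0 t1; rewrite /= in_itv/=.
  by rewrite (lt_le_trans (ltrN10 R) t0) (le_lt_trans t1)// ltr1n.
have df (t : R) : 0 <= t -> t <= 1 -> is_derive t 1 f (\int[mu]_(x in U) F' t x).
  move=> t0 t1; apply: DeriveDef.
    exact: (derivable_under_integral mU (I01 t t0 t1) (fun x _ => iF x)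
      (fun u x _ _ => @ex_derive _ _ _ _ _ _ _ (dF u x)) G0 iG (fun u x _ _ => FG u x)).
  rewrite -derive1E (differentiation_under_integral mU (I01 t t0 t1) (fun x _ => iF x)
      (fun u x _ _ => @ex_derive _ _ _ _ _ _ _ (dF u x)) G0 iG (fun u x _ _ => FG u x)).
  apply: eq_Rintegral => x _; rewrite partial1of2E; apply: derive_val.
have f'E (t : R) : 0 <= t -> t <= 1 -> \int[mu]_(x in U) F' t x =
    a.1 * ip U g1 (fun x => psi (x - t *: a)) + a.2 * ip U g2 (fun x => psi (x - t *: a)).
  move=> t0 t1; have tt := tU t t0 t1.
  have E1 : d1 (fun x => psi (x - t *: a)) = (fun x => d1 psi (x - t *: a)).
    by apply/funext => x; rewrite (d1_shift (- (t *: a)) x sp).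
  have E2 : d2 (fun x => psi (x - t *: a)) = (fun x => d2 psi (x - t *: a)).
    by apply/funext => x; rewrite (d2_shift (- (t *: a)) x sp).
  have := e1 _ tt; have := e2 _ tt; rewrite E1 E2 => k2 k1.
  have l1 : L2 U (fun x => d1 psi (x - t *: a)) by rewrite -E1; apply: test_L2 mU (test_fun_d1 tt).
  have l2 : L2 U (fun x => d2 psi (x - t *: a)) by rewrite -E2; apply: test_L2 mU (test_fun_d2 tt).
  have -> : \int[mu]_(x in U) F' t x = ip U v ((fun x => - a.1 * d1 psi (x - t *: a)) \- (fun x => a.2 * d2 psi (x - t *: a))).
    by apply: eq_Rintegral => x _; rewrite /F' /=; ring.
  rewrite (ipBr mU (L2Z mU (- a.1) l1) (L2Z mU a.2 l2) v2) (ipZr mU _ l1 v2) (ipZr mU _ l2 v2) k1 k2.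
  by ring.
have bd (t : R) : 0 <= t -> t <= 1 -> `|\int[mu]_(x in U) F' t x| <= B * norm0 V psi.
  move=> t0 t1; rewrite f'E//; have tt := tU t t0 t1.
  have tt2 := test_L2 mU tt.
  have n1 : norm0 U (fun x => psi (x - t *: a)) = norm0 V psi.
    congr Num.sqrt; rewrite (ip_test _ tt) (ip_test _ tp).
    exact: (ip_shift (- (t *: a)) psi2 psi2).
  have c1 := ip_CS mU g12 tt2; have c2 := ip_CS mU g22 tt2; rewrite n1 in c1 c2.
  rewrite (le_trans (ler_normD _ _))// !normrM.
  apply: (@le_trans _ _ ((`|a.1| * norm0 U g1 + `|a.2| * norm0 U g2) * norm0 V psi)).
    by rewrite mulrDl; apply: lerD; rewrite -mulrA ler_wpM2l.
  rewrite ler_wpM2r ?norm0_ge0//.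
  rewrite -ler_sqr ?nnegrE ?sqrtr_ge0//; last by rewrite addr_ge0// mulr_ge0// norm0_ge0.
  rewrite sqr_sqrtr; last by rewrite mulr_ge0// addr_ge0 ?sqr_ge0 ?ip_ge0.
  rewrite -!norm0_sq -[a.1 ^+ 2](real_normK (num_real _)) -[a.2 ^+ 2](real_normK (num_real _)).
  move: (norm0 U g1) (norm0 U g2) `|a.1| `|a.2| => u1 u2 b1 b2.
  exact: cauchy2.
have [||c] := @MVT_segment _ f (fun t => \int[mu]_(x in U) F' t x) 0 1 ler01.
- by move=> t /[!in_itv]/= /andP[t0 t1]; apply: df; exact: ltW.
- apply: derivable_within_continuous => t; rewrite in_itv/= => /andP[t0 t1].
  by have [] := df t t0 t1.
rewrite in_itv/= => /andP[c0 c1]; rewrite subr0 mulr1 => fE.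
by rewrite E fE; exact: bd.
Qed.

End Poincare.

(** * Exchange of two plane integrals *)

Section TonelliPlane.
Variable R : realType.
Notation mpt := (measurableTypeR R * measurableTypeR R)%type.

(** A separate name lets the product measure carry a sigma-finite instance, so that Tonelli applies
    to the plane times itself. *)
Definition leb2sf : set mpt -> \bar R := leb2 R.

HB.instance Definition _ := Measure.copy leb2sf (leb2 R : {measure set mpt -> \bar R}).

Lemma leb2_sigma_finite : sigma_finite [set: mpt] leb2sf.
Proof.
exists (fun n : nat => (box n%:R : set mpt)).
  apply/seteqP; split => // x _.
  exists (Num.truncn (Num.max `|x.1| `|x.2|)).+1 => //.
  have := truncnS_gt (Num.max `|x.1| `|x.2|); rewrite gt_max => /andP[h1 h2].
  by split; rewrite /= in_itv/= -ler_norml ltW.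
by move=> n; split; [exact: measurable_box|exact: mu_box].
Qed.

HB.instance Definition _ := Measure_isSigmaFinite.Build _ _ _ leb2sf leb2_sigma_finite.

Lemma tonelli2 (F : pt mpt -> \bar R) : measurable_fun [set: mpt * mpt] F -> (forall z, (0 <= F z)%E) ->
  (\int[leb2 R]_x \int[leb2 R]_y F (x, y) = \int[leb2 R]_y \int[leb2 R]_x F (x, y))%E.
Proof. by move=> mF F0; exact: (@fubini_tonelli _ _ _ _ _ leb2sf leb2sf F mF F0). Qed.

Lemma tonelli2_meas (F : pt mpt -> \bar R) : measurable_fun [set: mpt * mpt] F -> (forall z, (0 <= F z)%E) ->
  measurable_fun [set: mpt] (fun y => \int[leb2 R]_x F (x, y))%E.
Proof. by move=> mF F0; exact: (@measurable_fun_fubini_tonelli_G _ _ _ _ _ leb2sf F mF F0). Qed.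
End TonelliPlane.

Section Poincare2.
Variable R : realType.
Notation mu := (leb2 R).
Notation mpt := (measurableTypeR R * measurableTypeR R)%type.
Implicit Types (U D : set (pt R)) (v w g phi psi : pt R -> R) (a : pt R) (s : seq (R * R * R)).

Lemma integral_ip U w : measurable (U : set mpt) -> L2 U w ->
  (\int[mu]_(x in U) (w x * w x)%:E = (ip U w w)%:E)%E.
Proof.
move=> mU w2; rewrite /ip /Rintegral fineK//.
exact: integrable_fin_num (L2_mul_int mU w2 w2).
Qed.

Definition one : pt R -> R := fun=> 1.

Lemma L2_cst U (c : R) : measurable (U : set mpt) -> (mu U < +oo)%E -> L2 U (fun=> c).
Proof. by move=> mU fU; apply: (@bounded_L2 _ _ mU _ `|c|). Qed.

Lemma ip_one U : measurable (U : set mpt) -> ip U one one = fine (mu U).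
Proof. by move=> mU; rewrite /ip /one Rintegral_cst// mulr1 mul1r. Qed.

Lemma ip_cstr U v c : measurable (U : set mpt) -> (mu U < +oo)%E -> L2 U v ->
  ip U v (fun=> c) = c * ip U v one.
Proof.
move=> mU fU v2; have o2 : L2 U one := L2_cst 1 mU fU.
by rewrite -(ipZr mU c o2 v2); congr ip; apply/funext => x; rewrite /one mulr1.
Qed.

Lemma ip_sub_cst U v c : measurable (U : set mpt) -> (mu U < +oo)%E -> L2 U v ->
  ip U (fun y => c - v y) (fun y => c - v y) =
  c ^+ 2 * ip U one one - 2 * c * ip U v one + ip U v v.
Proof.
move=> mU fU v2; have c2 : L2 U (fun=> c) := L2_cst c mU fU.
have d2 := L2B mU c2 v2.
rewrite [LHS](ipBl mU c2 v2 d2) (ipBr mU c2 v2 c2) (ipBr mU c2 v2 v2).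
have e1 := ip_cstr c mU fU v2; have e2 := ip_cstr c mU fU c2.
have e3 := ip_cstr c mU fU (L2_cst 1 mU fU : L2 U one).
rewrite (ipC U (fun=> c) v) e1 e2 (ipC U (fun=> c) one) e3.
by rewrite expr2; ring.
Qed.

(** The variance identity: after expanding the square only the area, the squared norm and the
    squared integral of [v] remain. *)
Lemma double_integral U v : measurable (U : set mpt) -> (mu U < +oo)%E -> L2 U v ->
  (\int[mu]_x \int[mu]_y (\1_U x * \1_U y * ((v \_ U) x - (v \_ U) y) ^+ 2)%:E =
   (2 * ip U one one * ip U v v - 2 * ip U v one ^+ 2)%:E)%E.
Proof.
move=> mU fU v2; set I1 := ip U v one; set J := ip U v v; set A := ip U one one.
have o2 : L2 U one := L2_cst 1 mU fU.
transitivity (\int[mu]_(x in U) ((A * (v x * v x) - 2 * I1 * v x + J)%:E))%E.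
  rewrite [RHS]integral_mkcond; apply: eq_integral => x _; rewrite [RHS]patchE.
  case: ifPn => xU; last first.
    by rewrite integral0_eq// => y _; rewrite indicE (negbTE xU) !mul0r.
  transitivity (\int[mu]_(y in U) (((v x - v y) * (v x - v y))%:E))%E.
    rewrite [RHS]integral_mkcond; apply: eq_integral => y _; rewrite [RHS]patchE !indicE !patchE xU mul1r.
    by case: ifPn => _; rewrite ?mul1r ?expr2// mul0r.
  rewrite (integral_ip mU (w := fun y => v x - v y)); last exact: (L2B mU (L2_cst (v x) mU fU) v2).
  by rewrite ip_sub_cst//; congr EFin; rewrite -/A -/J -/I1; ring.
have iv := ip_cst_int mU fU v2; have ivv := L2_mul_int mU v2 v2.
have i1 : mu.-integrable U (EFin \o (fun x => A * (v x * v x))).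
  have -> : EFin \o (fun x => A * (v x * v x)) = (fun x => A%:E * (v x * v x)%:E)%E by [].
  exact: integrableZl.
have i2 : mu.-integrable U (EFin \o (fun x => 2 * I1 * v x)).
  have -> : EFin \o (fun x => 2 * I1 * v x) = (fun x => (2 * I1)%:E * (v x)%:E)%E by [].
  exact: integrableZl.
have i3 : mu.-integrable U (EFin \o (fun x : pt R => J)).
  exact: ip_cst_int (L2_cst J mU fU).
have i12 : mu.-integrable U (EFin \o (fun x => A * (v x * v x) - 2 * I1 * v x)).
  exact: (integrableB mU i1 i2).
have iT : mu.-integrable U (EFin \o (fun x => A * (v x * v x) - 2 * I1 * v x + J)).
  exact: (integrableD mU i12 i3).
rewrite -[LHS]fineK; last exact: integrable_fin_num iT.
congr EFin.
rewrite -[LHS]/(\int[mu]_(x in U) (A * (v x * v x) - 2 * I1 * v x + J)).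
rewrite RintegralD// RintegralB// !RintegralZl// Rintegral_cst//.
rewrite -ip_one// -/A -[\int[mu]_(x in U) (v x * v x)]/J.
have -> : \int[mu]_(x in U) v x = I1.
  by apply: eq_Rintegral => x _; rewrite /one mulr1.
by rewrite expr2; ring.
Qed.

Lemma integral_cst_indic D (k : R) : measurable (D : set mpt) -> 0 <= k ->
  (\int[mu]_a (k%:E * (\1_D a)%:E) = k%:E * mu D)%E.
Proof.
move=> mD k0; rewrite ge0_integralZl//; last by apply/measurable_EFinP; exact: measurable_indic.
by congr (_ * _)%E; rewrite [LHS]integral_indic// setIT.
Qed.

(** Twice the area times the squared deviation from the mean is the double integral of
    [(v x - v y) ^ 2]. With [y = x + a] the integral over [x] is a translate difference, at most
    [h ^ 2] times the squared gradient norm, and only differences [a] in [D] contribute. The factor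
    6 for the measure of [D], divided by 2, gives the constant 3. *)
Lemma poincare s v g1 g2 (h m : R) D : m = ip (poly s) v one / ip (poly s) one one ->
  bounded_set (poly s) -> H1 (poly s) v g1 g2 ->
  0 < ip (poly s) one one ->
  (forall x a, poly s x -> poly s (x + a) -> a.1 ^+ 2 + a.2 ^+ 2 <= h ^+ 2) ->
  measurable (D : set mpt) ->
  (forall x a, poly s x -> poly s (x + a) -> D a) ->
  (mu D <= 6%:E * mu (poly s))%E ->
  ip (poly s) (fun x => v x - m) (fun x => v x - m) <=
   3 * h ^+ 2 * (ip (poly s) g1 g1 + ip (poly s) g2 g2).
Proof.
move=> mE bU H A0 hh mD HD muD.
pose U := poly s; pose W := v \_ U; pose G := ip U g1 g1 + ip U g2 g2; pose A := ip U one one.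
rewrite -/U -/G in hh HD muD A0 *.
have v2 : L2 U v by case: H.
have mU : measurable (U : set mpt) := measurable_poly s.
have [M UM] := bounded_sub_box bU.
have fU : (mu U < +oo)%E := bounded_mu mU UM.
have G0 : 0 <= G by rewrite addr_ge0 ?ip_ge0.
have W2 : L2 setT W := L2_restrict mU v2.
have mW : measurable_fun setT W by case: W2.
have mT : measurable ([set: pt R] : set mpt) := measurableT.
pose F (x y : pt R) : \bar R := (\1_U x * \1_U y * (W x - W y) ^+ 2)%:E.
have F0 x y : (0 <= F x y)%E.
  by rewrite lee_fin mulr_ge0 ?sqr_ge0// mulr_ge0.
pose F2 (z : mpt * mpt) := F z.1 (z.2 + z.1 : pt R).
have mF2 : measurable_fun setT F2.
  apply/measurable_EFinP.
  have m1 (w : pt R -> R) : measurable_fun setT w -> measurable_fun [set: mpt * mpt] (fun z : mpt * mpt => w z.1).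
    by move=> mw; apply: measurableT_comp.
  have madd : measurable_fun [set: mpt * mpt] (fun z : mpt * mpt => (z.2 + z.1 : pt R) : mpt).
    apply/measurable_fun_pairP; split.
      rewrite (_ : _ \o _ = (fun z : mpt * mpt => z.2.1 + z.1.1))//.
      by apply: measurable_funD; apply: measurableT_comp.
    rewrite (_ : _ \o _ = (fun z : mpt * mpt => z.2.2 + z.1.2))//.
    by apply: measurable_funD; apply: measurableT_comp.
  have m2 (w : pt R -> R) : measurable_fun setT w -> measurable_fun [set: mpt * mpt] (fun z : mpt * mpt => w (z.2 + z.1)).
    by move=> mw; apply: (@measurableT_comp _ _ _ _ _ _ (w : mpt -> R)).
  have mi : measurable_fun setT (\1_U : pt R -> R) by apply: measurable_indic.
  apply: measurable_funM; first by apply: measurable_funM; [exact: m1|exact: m2].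
  by apply: measurable_funX; apply: measurable_funB; [exact: m1|exact: m2].
have F20 z : (0 <= F2 z)%E by exact: F0.
(* Substitution [y = x + a] for fixed [x], then exchange of the integrals, so that the translation
   is fixed first. *)
have E1 : (\int[mu]_x \int[mu]_y F x y = \int[mu]_a \int[mu]_x F2 (x, a))%E.
  transitivity (\int[mu]_x \int[mu]_a F2 (x, a))%E; last exact: tonelli2.
  apply: eq_integral => x _.
  rewrite -(ge0_integral_shift x (f := F x))//.
  apply/measurable_EFinP; apply: measurable_funM.
    by apply: measurable_funM => //; apply: measurable_indic.
  by apply: measurable_funX; apply: measurable_funB.
have E2 (a : mpt) : (\int[mu]_x F2 (x, a) <= (h ^+ 2 * G)%:E * (\1_D a)%:E)%E.
  have F2E x : F2 (x, a) = (((fun x => (W (x + a) - W x) * (W (x + a) - W x)) \_ (overlap a s)) x)%:E.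
    rewrite /F2 /F /= patchE !indicE [a + x]addrC; case: ifPn => [|]; rewrite ?inE ?notin_setE => /= hx.
      have [h1 h2] := (overlapE a s x).1 hx.
      by rewrite (mem_set h1) (mem_set h2) !mul1r expr2 -mulrNN !opprB.
    have [h1|h1] := pselect (U x); last by rewrite (memNset h1) !mul0r.
    have [h2|h2] := pselect (U (x + a)); last by rewrite (memNset h2) mulr0 mul0r.
    by exfalso; apply: hx; apply/overlapE.
  have -> : (\int[mu]_x F2 (x, a) = \int[mu]_x (((fun x : pt R => ((W (x + a) - W x) * (W (x + a) - W x))%R) \_ (overlap a s)) x)%:E)%E.
    by apply: eq_integral => x _; exact: F2E.
  have [Da|nDa] := pselect (D a); last first.
    have -> : \1_D a = 0 :> R by rewrite indicE memNset.
    rewrite mule0 integral0_eq; first exact: lexx.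
    move=> x _; rewrite patchE; case: ifPn => [|_]; last by [].
    by rewrite inE => /overlapE[h1 h2]; exfalso; apply: nDa; exact: (HD x).
  rewrite indicE mem_set// mule1.
  have mV : measurable (overlap a s : set mpt) := measurable_poly _.
  have D2 : L2 (overlap a s) (fun x => W (x + a) - W x).
    exact: (L2_sub mT mV (@subsetT _ _) (L2B mT (L2_shift a W2) W2)).
  have -> : (\int[mu]_x (((fun x => (W (x + a) - W x) * (W (x + a) - W x)) \_ (overlap a s)) x)%:E)%E =
     (ip (overlap a s) (fun x => W (x + a) - W x) (fun x => W (x + a) - W x))%:E.
    rewrite -integral_ip// [RHS]integral_mkcond; apply: eq_integral => x _.
    by rewrite !patchE; case: ifP.
  rewrite lee_fin.
  have [Vx|V0] := pselect (exists x, overlap a s x); last first.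
    have -> : overlap a s = set0.
      by rewrite -subset0 => x Vx; apply: V0; exists x.
    by rewrite /ip Rintegral_set0; apply: mulr_ge0; [exact: sqr_ge0|].
  have SE := shift_estimate a bU H.
  have SE2 : norm0 (overlap a s) (fun x => W (x + a) - W x) ^+ 2 <=
      (Num.sqrt ((a.1 ^+ 2 + a.2 ^+ 2) * G)) ^+ 2.
    by apply: lerXn2r SE; rewrite nnegrE ?norm0_ge0 ?sqrtr_ge0.
  rewrite norm0_sq in SE2; apply: (le_trans SE2).
  rewrite sqr_sqrtr; last first.
    by apply: mulr_ge0; [apply: addr_ge0; exact: sqr_ge0|exact: G0].
  apply: ler_wpM2r; first exact: G0.
  case: Vx => x /overlapE[h1 h2]; exact: (hh x).
have E3 : (\int[mu]_x \int[mu]_y F x y <= (h ^+ 2 * G)%:E * (6%:E * mu U))%E.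
  rewrite E1; apply: (@le_trans _ _ (\int[mu]_a ((h ^+ 2 * G)%:E * (\1_D a)%:E))%E).
    have kD : measurable_fun [set: mpt] (EFin \o (fun a : mpt => (h ^+ 2 * G) * \1_D a)).
      by apply/measurable_EFinP; apply: measurable_funM; [exact: measurable_cst|exact: measurable_indic].
    apply: ge0_le_integral.
    - exact: measurableT.
    - by move=> a _; apply: integral_ge0 => x _.
    - exact: tonelli2_meas.
    - exact: kD.
    - by move=> a _; exact: E2.
  have k0 : 0 <= h ^+ 2 * G by apply: mulr_ge0; [exact: sqr_ge0|exact: G0].
  rewrite (integral_cst_indic mD k0).
  by apply: lee_wpmul2l; [rewrite lee_fin|exact: muD].
move: E3; rewrite /F (double_integral mU fU v2).
have -> : mu U = A%:E.
  by rewrite /A (ip_one mU) fineK; [|rewrite ge0_fin_numE; [exact: fU|exact: measure_ge0]].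
rewrite -!EFinM lee_fin -/A => E3.
have -> : ip U (fun x => v x - m) (fun x => v x - m) = ip U v v - ip U v one ^+ 2 / A.
  have -> : ip U (fun x => v x - m) (fun x => v x - m) = ip U (fun x => m - v x) (fun x => m - v x).
    by apply: eq_Rintegral => x _; rewrite -mulrNN !opprB.
  rewrite ip_sub_cst// -/A mE -/U -/A.
  by field; rewrite gt_eqF.
have AA : 0 < 2 * A by rewrite mulr_gt0.
rewrite -/G -(ler_pM2l AA) mulrBr.
rewrite (_ : 2 * A * (ip U v one ^+ 2 / A) = 2 * ip U v one ^+ 2); last by field; rewrite gt_eqF.
by apply: (le_trans E3); rewrite -subr_ge0 (_ : _ - _ = 0)//; ring.
Qed.

End Poincare2.

Arguments one {R}.

(** * Triangles *)

Section Triangle.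
Variable R : realType.
Notation mu := (leb2 R).
Notation mpt := (measurableTypeR R * measurableTypeR R)%type.
Implicit Types (a b c x y z o : pt R).

(** Twice the signed area of the triangle. *)
Definition det a b c : R := (b.1 - a.1) * (c.2 - a.2) - (b.2 - a.2) * (c.1 - a.1).

Lemma detC a b c : det b c a = det a b c.
Proof. by rewrite /det; ring. Qed.

Lemma detC2 a b c : det c a b = det a b c.
Proof. by rewrite /det; ring. Qed.

Lemma detN a b c : det b a c = - det a b c.
Proof. by rewrite /det; ring. Qed.

(** The barycentric coordinate of the last argument [c]: it vanishes on the line through [a] and
    [b]. Rotating the arguments gives the other two coordinates. *)
Definition bary a b c : R * R * R :=
  (((b.2 - a.2) * a.1 - (b.1 - a.1) * a.2) / det a b c,
   - (b.2 - a.2) / det a b c, (b.1 - a.1) / det a b c).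

Lemma aff_bary a b c x : aff (bary a b c) x = det a b x / det a b c.
Proof. by rewrite /aff /bary /=; move: (det a b c) => D; rewrite /det; ring. Qed.

Lemma bary_c a b c : det a b c != 0 -> aff (bary a b c) c = 1.
Proof. by move=> d0; rewrite aff_bary divff. Qed.

Lemma bary_a a b c : aff (bary a b c) a = 0.
Proof. by rewrite aff_bary (_ : det a b a = 0) ?mul0r// /det; ring. Qed.

Lemma bary_b a b c : aff (bary a b c) b = 0.
Proof. by rewrite aff_bary (_ : det a b b = 0) ?mul0r// /det; ring. Qed.

Lemma bary_sum a b c x : det a b c != 0 ->
  aff (bary a b c) x + aff (bary b c a) x + aff (bary c a b) x = 1.
Proof.
move=> d0; rewrite !aff_bary (detC a b c) (detC2 a b c); move: (d0); rewrite /det => d1.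
by field.
Qed.

Lemma bary_comb a b c x : det a b c != 0 ->
  x = aff (bary a b c) x *: c + aff (bary b c a) x *: a + aff (bary c a b) x *: b.
Proof.
move=> d0; rewrite !aff_bary (detC a b c) (detC2 a b c); move: (d0); rewrite /det => d1.
by apply: injective_projections; rewrite /= /GRing.scale/=; field.
Qed.

Lemma aff_comb (l : R * R * R) (r s t : R) x y z : r + s + t = 1 ->
  aff l (r *: x + s *: y + t *: z) = r * aff l x + s * aff l y + t * aff l z.
Proof.
move=> e; rewrite /aff /= /GRing.scale/=.
by rewrite -[X in X + _ + _ = _]mul1r -e; ring.
Qed.

Definition tri a b c := poly [:: bary a b c; bary b c a; bary c a b].

Lemma triP a b c x : tri a b c x <->
  [/\ 0 < aff (bary a b c) x, 0 < aff (bary b c a) x & 0 < aff (bary c a b) x].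
Proof.
by rewrite /tri /poly/= andbT; split => [/and3P[]|[? ? ?]]; last apply/and3P.
Qed.

Lemma tri_rot a b c : tri b c a = tri a b c.
Proof. by apply/seteqP; split => x /triP[? ? ?]; apply/triP. Qed.

Definition ctri a b c : set (pt R) := [set x | [/\ 0 <= aff (bary a b c) x,
  0 <= aff (bary b c a) x & 0 <= aff (bary c a b) x]].

Lemma hullE a b c : det a b c != 0 -> hull (a, b, c) = ctri a b c.
Proof.
move=> d0; have d1 : det b c a != 0 by rewrite (detC a).
have d2 : det c a b != 0 by rewrite (detC2 a).
apply/seteqP; split => x.
- move=> [r [s [t [/= r0 s0 t0 e ->]]]]; rewrite /ctri/= !(aff_comb _ _ _ _ e).
  rewrite !bary_a !bary_b !bary_c// !mulr0 !mulr1 !addr0 !add0r.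
  by split.
- move=> [h1 h2 h3]; exists (aff (bary b c a) x), (aff (bary c a b) x), (aff (bary a b c) x).
  split => //=; first by rewrite -(bary_sum x d0); ring.
  by rewrite {1}(bary_comb x d0) -addrA addrC.
Qed.

Lemma closed_ctri a b c : closed (ctri a b c).
Proof.
rewrite (_ : ctri a b c = [set x | 0 <= aff (bary a b c) x] `&`
  ([set x | 0 <= aff (bary b c a) x] `&` [set x | 0 <= aff (bary c a b) x])).
  by do 2?apply: closedI; exact: closed_aff_ge.
by apply/seteqP; split => x; [move=> []|move=> [? [? ?]]].
Qed.

Lemma measurable_ctri a b c : measurable (ctri a b c : set mpt).
Proof. by apply: closed_measurable2; exact: closed_ctri. Qed.

Lemma tri_sub_ctri a b c : tri a b c `<=` ctri a b c.
Proof. by move=> x /triP[h1 h2 h3]; split; exact: ltW. Qed.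

Lemma ctri_sub_box a b c : det a b c != 0 -> exists M, ctri a b c `<=` box M.
Proof.
move=> d0; pose M := `|a.1| + `|b.1| + `|c.1| + (`|a.2| + `|b.2| + `|c.2|).
exists M => x [h1 h2 h3]; have := bary_sum x d0.
have := bary_comb x d0.
move: h1 h2 h3; move: (aff _ x) (aff _ x) (aff _ x) => t1 t2 t3 h1 h2 h3 -> e.
have t11 : t1 <= 1 by lra.
have t21 : t2 <= 1 by lra.
have t31 : t3 <= 1 by lra.
have bd (u v w : R) : `|t3 * u + t2 * v + t1 * w| <= `|v| + `|w| + `|u|.
  apply: (le_trans (ler_normD _ _)); apply: (le_trans (lerD (ler_normD _ _) (lexx _))).
  rewrite !normrM (ger0_norm h1) (ger0_norm h2) (ger0_norm h3).
  have := ler_piMl (normr_ge0 u) t31; have := ler_piMl (normr_ge0 v) t21.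
  by have := ler_piMl (normr_ge0 w) t11; lra.
split; rewrite /= in_itv/= -ler_norml.
  by apply: (le_trans (bd c.1 a.1 b.1)); rewrite /M lerDl !addr_ge0.
by apply: (le_trans (bd c.2 a.2 b.2)); rewrite /M lerDr !addr_ge0.
Qed.

Lemma bounded_box (M : R) : bounded_set (box M : set (pt R)).
Proof. exact: compact_bounded (@compact_box R M). Qed.

Lemma bounded_tri a b c : det a b c != 0 -> bounded_set (tri a b c).
Proof.
move=> d0; have [M HM] := ctri_sub_box d0.
apply: bounded_setS (bounded_box M); exact: subset_trans (@tri_sub_ctri a b c) HM.
Qed.

Lemma bary_neq0 a b c : det a b c != 0 -> ((bary a b c).1.2, (bary a b c).2) <> (0, 0).
Proof.
move=> d0 [/eqP + /eqP]; rewrite !mulf_eq0 !invr_eq0 (negbTE d0) !orbF oppr_eq0.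
move=> /eqP e2 /eqP e1; move: d0; rewrite /det e1 e2 !mul0r subrr eqxx //.
Qed.

Lemma det_rot_neq0 a b c : det a b c != 0 -> det b c a != 0 /\ det c a b != 0.
Proof. by move=> d0; rewrite (detC a) (detC2 a). Qed.

Lemma ctri_tri_lines a b c x : ctri a b c x -> ~ line0 (bary a b c) x ->
  ~ line0 (bary b c a) x -> ~ line0 (bary c a b) x -> tri a b c x.
Proof.
move=> [h1 h2 h3] n1 n2 n3; apply/triP; split; rewrite lt_neqAle ?h1 ?h2 ?h3 andbT eq_sym;
  exact/eqP.
Qed.

Lemma null_lines a b c : det a b c != 0 ->
  mu (line0 (bary a b c) `|` (line0 (bary b c a) `|` line0 (bary c a b))) = 0%E.
Proof.
move=> d0; have [d1 d2] := det_rot_neq0 d0.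
have m l := @measurable_aff_eq0 R l.
apply: null_set_setU; [exact: m|by apply: measurableU; exact: m|exact: mu_line0 (bary_neq0 d0)|].
by apply: null_set_setU; [exact: m|exact: m|exact: mu_line0 (bary_neq0 d1)|exact: mu_line0 (bary_neq0 d2)].
Qed.

Lemma measurable_lines a b c :
  measurable (line0 (bary a b c) `|` (line0 (bary b c a) `|` line0 (bary c a b)) : set mpt).
Proof. by do 2?apply: measurableU; exact: measurable_aff_eq0. Qed.

Lemma ae_ctri_tri a b c : det a b c != 0 -> {ae mu, forall x, ctri a b c x -> tri a b c x}.
Proof.
move=> d0; apply: (ae_null (measurable_lines a b c) (null_lines d0)) => x nx cx.
by apply: ctri_tri_lines => // h; apply: nx; [left|right; left|right; right].
Qed.

(** The boundary lies on three lines of measure zero. *)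
Lemma mu_ctri a b c : det a b c != 0 -> mu (ctri a b c) = mu (tri a b c).
Proof.
move=> d0.
have mt : measurable (tri a b c : set mpt) := measurable_poly _.
have mc := measurable_ctri a b c.
apply/eqP; rewrite eq_le; apply/andP; split; last first.
  by apply: le_measure; rewrite ?inE//; exact: tri_sub_ctri.
have ml := measurable_lines a b c.
apply: (@le_trans _ _ (mu (tri a b c `|` (line0 (bary a b c) `|` (line0 (bary b c a) `|` line0 (bary c a b)))))).
  apply: le_measure; rewrite ?inE//; first exact: measurableU.
  move=> x cx; have [n|n] := pselect ((line0 (bary a b c) `|` (line0 (bary b c a) `|` line0 (bary c a b))) x).
    by right.
  left; apply: ctri_tri_lines => // h; apply: n; [left|right; left|right; right]; exact: h.
apply: (le_trans (measureU2 _ mt ml)).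
rewrite -[X in (_ <= X)%E]adde0; apply: leeD; first exact: lexx.
by rewrite le_eqVlt; apply/orP; left; apply/eqP; exact: null_lines.
Qed.

Lemma mu_tri_fin a b c : det a b c != 0 -> (mu (tri a b c) < +oo)%E.
Proof.
move=> d0; have [M HM] := ctri_sub_box d0.
apply: (bounded_mu (measurable_poly _) (M := M)); exact: subset_trans (@tri_sub_ctri a b c) HM.
Qed.

Lemma open_mu_gt0 (O : set (pt R)) x : open O -> O x -> (0 < mu O)%E.
Proof.
move=> oO Ox; have /nbhs_ballP[e /= e0 He] : nbhs x O by apply: open_nbhs_nbhs.
pose B : set (pt R) := [set` `]x.1 - e, x.1 + e[] `*` [set` `]x.2 - e, x.2 + e[].
have mB : measurable (B : set mpt) by apply: measurableX; exact: measurable_itv.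
apply: (@lt_le_trans _ _ (mu B)); last first.
  apply: le_measure; rewrite ?inE//; first exact: open_measurable2.
  move=> y [/=]; rewrite !in_itv/= => /andP[h1 h2] /andP[h3 h4].
  by apply: He; split; rewrite /ball/= ltr_norml; apply/andP; split; lra.
rewrite product_measure1E; [|exact: measurable_itv|exact: measurable_itv].
have h (u : R) : (0 < leb1 R [set` `](u - e)%R, (u + e)%R[])%E.
  rewrite lebesgue_measure_itv/= lte_fin ifT; last by lra.
  by rewrite -EFinD lte_fin; lra.
by apply: mule_gt0; exact: h.
Qed.

Lemma mu_tri_gt0 a b c : det a b c != 0 -> (0 < mu (tri a b c))%E.
Proof.
move=> d0; have [d1 d2] := det_rot_neq0 d0.
apply: (@open_mu_gt0 _ (3%:R^-1 *: a + 3%:R^-1 *: b + 3%:R^-1 *: c)).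
  exact: open_poly.
have e : 3%:R^-1 + 3%:R^-1 + 3%:R^-1 = 1 :> R by lra.
apply/triP; rewrite !(aff_comb _ _ _ _ e) !bary_a !bary_b !bary_c//.
Qed.

(* A difference of two points of a triangle is the difference of a point and a
   vertex, in one order or the other. *)
Definition diffset a b c : set (pt R) :=
  ((fun z => z + a) @^-1` ctri a b c `|` ((fun z => z + b) @^-1` ctri a b c `|`
   ((fun z => z + c) @^-1` ctri a b c `|` ((fun z => a - z) @^-1` ctri a b c `|`
   ((fun z => b - z) @^-1` ctri a b c `|` (fun z => c - z) @^-1` ctri a b c))))).

Definition afflin (l : R * R * R) z : R := l.1.2 * z.1 + l.2 * z.2.

Lemma aff_addl l x z : aff l (x + z) = aff l x + afflin l z.
Proof. by rewrite /aff /afflin/=; ring. Qed.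

Lemma aff_addr l x z : aff l (z + x) = aff l x + afflin l z.
Proof. by rewrite addrC aff_addl. Qed.

Lemma aff_sub l x z : aff l (x - z) = aff l x - afflin l z.
Proof. by rewrite /aff /afflin/=; ring. Qed.

(** The increments [m1], [m2], [m3] of the barycentric coordinates sum to zero. If one of them is
    negative, [z] starts at the corresponding vertex and ends in the closed triangle; if two are,
    the same holds for [- z] and the vertex of the third. All increments lie between -1 and 1, which
    keeps the coordinates nonnegative. *)
Lemma tri_diffset a b c x z : det a b c != 0 -> tri a b c x -> tri a b c (x + z) ->
  diffset a b c z.
Proof.
move=> d0 /triP[p1 p2 p3] /triP; rewrite !aff_addl => -[q1 q2 q3].
have [d1 d2] := det_rot_neq0 d0.
have s0 := bary_sum x d0; have := bary_sum (x + z) d0; rewrite !aff_addl => s1.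
rewrite /diffset /ctri /setU /= !aff_sub !(aff_addr _ _ z) !bary_a !bary_b !bary_c// !add0r.
move: p1 p2 p3 q1 q2 q3 s0 s1.
move: (aff (bary a b c) x) (aff (bary b c a) x) (aff (bary c a b) x) (afflin (bary a b c) z)
  (afflin (bary b c a) z) (afflin (bary c a b) z) => l1 l2 l3 m1 m2 m3 *.
have [c1|c1] := leP 0 m1; have [c2|c2] := leP 0 m2; have [c3|c3] := leP 0 m3.
- by left; split; lra.
- by right; left; split; lra.
- by left; split; lra.
- by do 5!right; split; lra.
- by do 2!right; left; split; lra.
- by do 3!right; left; split; lra.
- by do 4!right; left; split; lra.
- by exfalso; lra.
Qed.

Lemma measurable_preshift (A : set (pt R)) a : measurable (A : set mpt) ->
  measurable ((fun z => z + a) @^-1` A : set mpt).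
Proof.
by move=> mA; rewrite -[X in measurable X]setTI; apply: (measurable_shift a) => //; exact: measurableT.
Qed.

Lemma measurable_presub (A : set (pt R)) a : measurable (A : set mpt) ->
  measurable ((fun z => a - z) @^-1` A : set mpt) /\ mu ((fun z => a - z) @^-1` A) = mu A.
Proof.
move=> mA.
have -> : (fun z => a - z) @^-1` A = (fun z => - z) @^-1` ((fun z => z + a) @^-1` A).
  by apply/seteqP; split => z /=; rewrite addrC.
have mB := measurable_preshift a mA.
split; last by rewrite mu_opp// mu_shift.
by rewrite -[X in measurable X]setTI; apply: (@measurable_opp2 R) => //; exact: measurableT.
Qed.

Lemma diffset_mu a b c : det a b c != 0 -> measurable (diffset a b c : set mpt) /\
  (mu (diffset a b c) <= 6%:E * mu (tri a b c))%E.
Proof.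
move=> d0; have mc := measurable_ctri a b c.
have ms z := measurable_preshift z mc.
have md z := (measurable_presub z mc).1.
have es z : mu ((fun y => y + z) @^-1` ctri a b c) = mu (tri a b c).
  by rewrite mu_shift// mu_ctri.
have ed z : mu ((fun y => z - y) @^-1` ctri a b c) = mu (tri a b c).
  by rewrite (measurable_presub z mc).2 mu_ctri.
have U2 (A B : set (pt R)) (k : R) : 0 <= k -> measurable (A : set mpt) -> measurable (B : set mpt) ->
  mu A = mu (tri a b c) -> (mu B <= k%:E * mu (tri a b c))%E ->
  measurable (A `|` B : set mpt) /\ (mu (A `|` B) <= (1 + k)%:E * mu (tri a b c))%E.
  move=> k0 mA mB eA eB; split; first exact: measurableU.
  apply: (le_trans (measureU2 _ mA mB)); rewrite EFinD ge0_muleDl ?lee_fin//.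
  rewrite mul1e; apply: leeD; last exact: eB.
  by rewrite le_eqVlt; apply/orP; left; apply/eqP; exact: eA.
have H1 : (mu ((fun y => (c - y)%R) @^-1` ctri a b c) <= 1%:E * mu (tri a b c))%E by rewrite mul1e ed.
have [m2 H2] := U2 _ _ _ ler01 (md b) (md c) (ed b) H1.
have k2 : 0 <= 1 + 1 :> R by lra.
have [m3 H3] := U2 _ _ _ k2 (md a) m2 (ed a) H2.
have k3 : 0 <= 1 + (1 + 1) :> R by lra.
have [m4 H4] := U2 _ _ _ k3 (ms c) m3 (es c) H3.
have k4 : 0 <= 1 + (1 + (1 + 1)) :> R by lra.
have [m5 H5] := U2 _ _ _ k4 (ms b) m4 (es b) H4.
have k5 : 0 <= 1 + (1 + (1 + (1 + 1))) :> R by lra.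
have [m6 H6] := U2 _ _ _ k5 (ms a) m5 (es a) H5.
split; first exact: m6.
by rewrite (_ : 6 = 1 + (1 + (1 + (1 + (1 + 1)))) :> R)//; ring.
Qed.

End Triangle.

(** * Distances, diameter and circumradius of a triangle *)

Section Metric.
Variable R : realType.
Implicit Types (a b c x y z o : pt R).

Definition sqd x y : R := (x.1 - y.1) ^+ 2 + (x.2 - y.2) ^+ 2.

Lemma sqd_ge0 x y : 0 <= sqd x y.
Proof. by rewrite addr_ge0 ?sqr_ge0. Qed.

Lemma edist_sq x y : edist x y ^+ 2 = sqd x y.
Proof. by rewrite sqr_sqrtr// sqd_ge0. Qed.

Lemma edist_ge0 x y : 0 <= edist x y.
Proof. exact: sqrtr_ge0. Qed.

Lemma edist_le x y (L : R) : 0 <= L -> (edist x y <= L) = (sqd x y <= L ^+ 2).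
Proof. by move=> L0; rewrite -edist_sq ler_sqr ?nnegrE ?edist_ge0. Qed.

Lemma sqdC x y : sqd x y = sqd y x.
Proof. by rewrite /sqd; ring. Qed.

Lemma edistC x y : edist x y = edist y x.
Proof. by congr Num.sqrt; exact: sqdC. Qed.

Lemma circum_exists a b c : det a b c != 0 ->
  exists r o, forall x, x \in vertices (a, b, c) -> edist o x = r.
Proof.
move=> d0.
pose B1 := b.1 - a.1; pose B2 := b.2 - a.2; pose D1 := c.1 - a.1; pose D2 := c.2 - a.2.
pose D := det a b c; have DE : D = B1 * D2 - B2 * D1 by [].
(* Cramer's solution, relative to [a], of the linear system for a point equidistant from the three
   vertices. *)
pose o : pt R := (a.1 + (D2 * (B1 ^+ 2 + B2 ^+ 2) - B2 * (D1 ^+ 2 + D2 ^+ 2)) / (2 * D),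
   a.2 + (B1 * (D1 ^+ 2 + D2 ^+ 2) - D1 * (B1 ^+ 2 + B2 ^+ 2)) / (2 * D)).
exists (edist o a), o => x; rewrite /vertices !inE => /or3P[] /eqP -> //; congr Num.sqrt.
  have -> : b = (a.1 + B1, a.2 + B2) by apply: injective_projections; rewrite /= /B1 /B2; ring.
  rewrite /o /=; move: (d0); rewrite -/D DE => d1; move: B1 B2 D1 D2 d1 {DE D o} => *.
  by field.
have -> : c = (a.1 + D1, a.2 + D2) by apply: injective_projections; rewrite /= /D1 /D2; ring.
rewrite /o /=; move: (d0); rewrite -/D DE => d1; move: B1 B2 D1 D2 d1 {DE D o} => *.
by field.
Qed.

Lemma circumradius_spec a b c : det a b c != 0 -> exists o,
  [/\ edist o a = circumradius (a, b, c), edist o b = circumradius (a, b, c) &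
      edist o c = circumradius (a, b, c)].
Proof.
move=> d0; have [r [ o ho]] := circum_exists d0.
have : [set r | exists o, forall x, x \in vertices (a, b, c) -> edist o x = r] (circumradius (a, b, c)).
  by apply: xgetPex; exists r, o.
move=> [ o' ho']; exists o'; split; apply: ho'; rewrite !inE eqxx ?orbT//.
Qed.

Lemma circumradius_ge0 a b c : det a b c != 0 -> 0 <= circumradius (a, b, c).
Proof.
by move=> /circumradius_spec[ o [ea _ _]]; rewrite -ea; exact: edist_ge0.
Qed.

Lemma circumradius_vertices (K L : triangle R) : vertices K =i vertices L ->
  circumradius K = circumradius L.
Proof.
move=> e; congr (xget 0); apply/seteqP; split => r [ o ho]; exists o => x xK; apply: ho.
  by rewrite e.
by rewrite -e.
Qed.

(** The identity [abc = 4 R area], with [det] twice the area up to sign. With the origin at the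
    circumcentre, everything is a polynomial in the scalar products [p], [q], [t] of the vertex
    vectors and their common squared length [s]. *)
Lemma circum_prod a b c : det a b c != 0 ->
  edist a b * edist b c * edist c a = 2 * circumradius (a, b, c) * `|det a b c|.
Proof.
move=> d0; have [ o [ea eb ec]] := circumradius_spec d0.
have r0 := circumradius_ge0 d0.
set r := circumradius _ in ea eb ec r0 *.
apply/eqP; rewrite -(@eqrXn2 _ 2) ?mulr_ge0 ?edist_ge0//; apply/eqP.
rewrite !exprMn !edist_sq real_normK ?num_real//.
have sa := edist_sq o a; have sb := edist_sq o b; have sc := edist_sq o c.
rewrite ea in sa; rewrite eb in sb; rewrite ec in sc.
pose u1 := a.1 - o.1; pose u2 := a.2 - o.2; pose v1 := b.1 - o.1; pose v2 := b.2 - o.2.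
pose w1 := c.1 - o.1; pose w2 := c.2 - o.2.
have Ea : r ^+ 2 = u1 ^+ 2 + u2 ^+ 2 by rewrite sa /sqd /u1 /u2; ring.
have Eb : r ^+ 2 = v1 ^+ 2 + v2 ^+ 2 by rewrite sb /sqd /v1 /v2; ring.
have Ec : r ^+ 2 = w1 ^+ 2 + w2 ^+ 2 by rewrite sc /sqd /w1 /w2; ring.
have -> : sqd a b = (u1 - v1) ^+ 2 + (u2 - v2) ^+ 2 by rewrite /sqd /u1 /u2 /v1 /v2; ring.
have -> : sqd b c = (v1 - w1) ^+ 2 + (v2 - w2) ^+ 2 by rewrite /sqd /w1 /w2 /v1 /v2; ring.
have -> : sqd c a = (w1 - u1) ^+ 2 + (w2 - u2) ^+ 2 by rewrite /sqd /w1 /w2 /u1 /u2; ring.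
have -> : det a b c = (v1 - u1) * (w2 - u2) - (v2 - u2) * (w1 - u1).
  by rewrite /det /u1 /u2 /v1 /v2 /w1 /w2; ring.
move: (r ^+ 2) u1 u2 v1 v2 w1 w2 Ea Eb Ec => s u1 u2 v1 v2 w1 w2 Ea Eb Ec {sa sb sc}.
pose p := u1 * v1 + u2 * v2; pose q := v1 * w1 + v2 * w2; pose t := w1 * u1 + w2 * u2.
have -> : (u1 - v1) ^+ 2 + (u2 - v2) ^+ 2 = 2 * (s - p).
  by transitivity ((u1 ^+ 2 + u2 ^+ 2) + (v1 ^+ 2 + v2 ^+ 2) - 2 * p); [rewrite /p; ring|rewrite -Ea -Eb; ring].
have -> : (v1 - w1) ^+ 2 + (v2 - w2) ^+ 2 = 2 * (s - q).
  by transitivity ((v1 ^+ 2 + v2 ^+ 2) + (w1 ^+ 2 + w2 ^+ 2) - 2 * q); [rewrite /q; ring|rewrite -Eb -Ec; ring].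
have -> : (w1 - u1) ^+ 2 + (w2 - u2) ^+ 2 = 2 * (s - t).
  by transitivity ((w1 ^+ 2 + w2 ^+ 2) + (u1 ^+ 2 + u2 ^+ 2) - 2 * t); [rewrite /t; ring|rewrite -Ec -Ea; ring].
have D2 : ((v1 - u1) * (w2 - u2) - (v2 - u2) * (w1 - u1)) ^+ 2 =
    3 * s ^+ 2 - p ^+ 2 - q ^+ 2 - t ^+ 2 + 2 * (p * q - t * s) + 2 * (q * t - p * s) + 2 * (t * p - q * s).
  transitivity (((u1 ^+ 2 + u2 ^+ 2) * (v1 ^+ 2 + v2 ^+ 2) - p ^+ 2)
    + ((v1 ^+ 2 + v2 ^+ 2) * (w1 ^+ 2 + w2 ^+ 2) - q ^+ 2)
    + ((w1 ^+ 2 + w2 ^+ 2) * (u1 ^+ 2 + u2 ^+ 2) - t ^+ 2)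
    + 2 * (p * q - t * (v1 ^+ 2 + v2 ^+ 2)) + 2 * (q * t - p * (w1 ^+ 2 + w2 ^+ 2))
    + 2 * (t * p - q * (u1 ^+ 2 + u2 ^+ 2))).
    by rewrite /p /q /t; ring.
  by rewrite -Ea -Eb -Ec; ring.
(* Three vectors of the plane are linearly dependent, so their Gram determinant vanishes; the
   difference of the two sides is -4 times it. *)
have gram : s ^+ 3 + 2 * p * q * t - s * (p ^+ 2 + q ^+ 2 + t ^+ 2) = 0.
  transitivity ((u1 ^+ 2 + u2 ^+ 2) * (v1 ^+ 2 + v2 ^+ 2) * (w1 ^+ 2 + w2 ^+ 2) + 2 * p * q * t
    - (w1 ^+ 2 + w2 ^+ 2) * p ^+ 2 - (u1 ^+ 2 + u2 ^+ 2) * q ^+ 2 - (v1 ^+ 2 + v2 ^+ 2) * t ^+ 2).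
    by rewrite -Ea -Eb -Ec; ring.
  by rewrite /p /q /t; ring.
rewrite {}D2; clearbody p q t.
apply/eqP; rewrite -subr_eq0; apply/eqP.
transitivity (- 4 * (s ^+ 3 + 2 * p * q * t - s * (p ^+ 2 + q ^+ 2 + t ^+ 2))); first by ring.
by rewrite gram mulr0.
Qed.

(** The gap is a combination of squared edge lengths with weights [t1 * t2], [t2 * t3], [t1 * t3].
    This reduces distances inside a triangle to distances between vertices. *)
Lemma sqd_convex (t1 t2 t3 : R) a b c y : 0 <= t1 -> 0 <= t2 -> 0 <= t3 -> t1 + t2 + t3 = 1 ->
  sqd (t1 *: a + t2 *: b + t3 *: c) y <= t1 * sqd a y + t2 * sqd b y + t3 * sqd c y.
Proof.
move=> h1 h2 h3 e; rewrite -subr_ge0.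
have -> : t1 * sqd a y + t2 * sqd b y + t3 * sqd c y - sqd (t1 *: a + t2 *: b + t3 *: c) y =
   t1 * t2 * sqd a b + t2 * t3 * sqd b c + t1 * t3 * sqd a c.
  have -> : t3 = 1 - t1 - t2 by rewrite -e; ring.
  by rewrite /sqd /= /GRing.scale/=; ring.
by rewrite !addr_ge0// mulr_ge0 ?sqd_ge0// mulr_ge0.
Qed.

Lemma hull_dist_le (L : R) a b c x y : sqd a b <= L -> sqd b c <= L -> sqd c a <= L ->
  hull (a, b, c) x -> hull (a, b, c) y -> sqd x y <= L.
Proof.
move=> ab bc ca hx hy; have L0 : 0 <= L := le_trans (sqd_ge0 a b) ab.
have cvx (t1 t2 t3 u v w : R) : 0 <= t1 -> 0 <= t2 -> 0 <= t3 -> t1 + t2 + t3 = 1 ->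
   u <= L -> v <= L -> w <= L -> t1 * u + t2 * v + t3 * w <= L.
  move=> h1 h2 h3 e hu hv hw.
  have := ler_wpM2l h1 hu; have := ler_wpM2l h2 hv; have := ler_wpM2l h3 hw.
  have : t1 * L + t2 * L + t3 * L = L by rewrite -!mulrDl e mul1r.
  by lra.
have sqd0 z : sqd z z = 0 by rewrite /sqd !subrr expr0n addr0.
have st1 v : v \in vertices (a, b, c) -> sqd y v <= L.
  move=> hv; case: hy => r [s [t [r0 s0 t0 e ->]]].
  apply: (le_trans (sqd_convex _ _ _ _ r0 s0 t0 e)) => /=.
  by move: hv; rewrite !inE => /or3P[] /eqP ->; apply: cvx => //; rewrite ?sqd0// sqdC.
case: hx => r [s [t [r0 s0 t0 e ->]]].
apply: (le_trans (sqd_convex _ _ _ _ r0 s0 t0 e)) => /=.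
by apply: cvx => //; rewrite sqdC; apply: st1; rewrite !inE eqxx ?orbT.
Qed.

Lemma hK_ub (K : triangle R) x y : hull K x -> hull K y -> edist x y <= hK K.
Proof.
case: K => [[a b] c] hx hy; apply: ub_le_sup; last by exists x, y.
pose L := sqd a b + sqd b c + sqd c a.
have L0 : 0 <= L.
  by rewrite /L; have := sqd_ge0 a b; have := sqd_ge0 b c; have := sqd_ge0 c a; lra.
exists (Num.sqrt L) => _ [x' [y' [hx' hy' ->]]].
rewrite edist_le ?sqrtr_ge0// sqr_sqrtr//.
apply: (hull_dist_le _ _ _ hx' hy'); rewrite /L;
  have := sqd_ge0 a b; have := sqd_ge0 b c; have := sqd_ge0 c a; lra.
Qed.

Lemma vertex_hull (K : triangle R) x : x \in vertices K -> hull K x.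
Proof.
case: K => [[a b] c]; rewrite !inE /hull/= => /or3P[] /eqP ->.
- by exists 1, 0, 0; split => //; rewrite ?addr0// scale1r !scale0r !addr0.
- by exists 0, 1, 0; split => //; rewrite ?addr0 ?add0r// scale1r !scale0r addr0 add0r.
- by exists 0, 0, 1; split => //; rewrite ?addr0 ?add0r// scale1r !scale0r !add0r.
Qed.

Lemma hK_le (a b c : pt R) (L : R) : edist a b <= L -> edist b c <= L -> edist c a <= L ->
  hK (a, b, c) <= L.
Proof.
move=> ab bc ca; have L0 : 0 <= L := le_trans (edist_ge0 a b) ab.
rewrite !edist_le// in ab bc ca.
apply: ge_sup.
  have ha : hull (a, b, c) a by apply: vertex_hull; rewrite !inE eqxx.
  by exists (edist a a), a, a.
move=> _ [x [y [hx hy ->]]]; rewrite edist_le//; exact: hull_dist_le hx hy.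
Qed.

Lemma hull_rot (a b c : pt R) : hull (b, c, a) = hull (a, b, c).
Proof.
apply/seteqP; split => x [r [s [t [r0 s0 t0 /= e ->]]]].
  by exists t, r, s; split => //=; rewrite -?e; [ring|rewrite addrC addrA].
by exists s, t, r; split => //=; rewrite -?e; [ring|rewrite -addrA addrC].
Qed.

Lemma hK_rot (a b c : pt R) : hK (b, c, a) = hK (a, b, c).
Proof. by rewrite /hK hull_rot. Qed.

Lemma circumradius_rot (a b c : pt R) : circumradius (b, c, a) = circumradius (a, b, c).
Proof. by apply: circumradius_vertices => x; rewrite !inE orbA orbC. Qed.

Lemma longest_edge (a b c : pt R) :
  [\/ hK (a, b, c) <= edist a b, hK (a, b, c) <= edist b c | hK (a, b, c) <= edist c a].
Proof.
have [h1|h1] := leP (edist a b) (edist b c); have [h2|h2] := leP (edist b c) (edist c a);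
  have [h3|h3] := leP (edist a b) (edist c a).
all: try (by apply: Or31; apply: hK_le; lra).
all: try (by apply: Or32; apply: hK_le; lra).
all: by apply: Or33; apply: hK_le; lra.
Qed.

Lemma edist_triangle x y z : edist x z <= edist x y + edist y z.
Proof.
rewrite edist_le ?addr_ge0 ?edist_ge0// sqrrD !edist_sq.
have h : (x.1 - y.1) * (y.1 - z.1) + (x.2 - y.2) * (y.2 - z.2) <= edist x y * edist y z.
  rewrite (le_trans (ler_norm _))// -ler_sqr ?nnegrE ?mulr_ge0 ?edist_ge0//.
  rewrite real_normK ?num_real// exprMn !edist_sq /sqd -subr_ge0.
  rewrite (_ : _ - _ = ((x.1 - y.1) * (y.2 - z.2) - (x.2 - y.2) * (y.1 - z.1)) ^+ 2); last by ring.
  exact: sqr_ge0.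
rewrite mulr2n; move: h; move: (_ * edist y z) => t.
rewrite /sqd; nra.
Qed.

Lemma hK_le_2R a b c : det a b c != 0 -> hK (a, b, c) <= 2 * circumradius (a, b, c).
Proof.
move=> d0; have [ o [ea eb ec]] := circumradius_spec d0.
by apply: hK_le; apply: (le_trans (edist_triangle _ o _)); rewrite [edist _ o]edistC ?ea ?eb ?ec; lra.
Qed.

End Metric.

(** * The Raviart-Thomas interpolant on one triangle *)

Section Interpolant.
Variable R : realType.
Notation mu := (leb2 R).
Notation mpt := (measurableTypeR R * measurableTypeR R)%type.
Implicit Types (a b c x y z : pt R) (v g : pt R -> R).

Definition cx1 c : pt R -> R := fun x => x.1 - c.1.
Definition cx2 c : pt R -> R := fun x => x.2 - c.2.

Definition area a b c : R := ip (tri a b c) one one.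

(* By the divergence theorem for [v (x - c)] this is [det a b c] times the mean of
   [v] on the edge [[a, b]]. *)
Definition moment a b c v g1 g2 : R :=
  2 * ip (tri a b c) v one + ip (tri a b c) g1 (cx1 c) + ip (tri a b c) g2 (cx2 c).

(** The divisor [2 * area] is the moment of the constant function 1 ([moment_one]), so constants
    keep their value. *)
Definition edge_mean a b c v g1 g2 : R := moment a b c v g1 g2 / (2 * area a b c).

Lemma area_rot a b c : area b c a = area a b c.
Proof. by rewrite /area tri_rot. Qed.

Lemma area_gt0 a b c : det a b c != 0 -> 0 < area a b c.
Proof.
move=> d0; rewrite /area ip_one; last exact: measurable_poly.
by rewrite fine_gt0// mu_tri_gt0// mu_tri_fin.
Qed.

(** [g11], [g12] stand for the weak derivatives of [q1], and [g21], [g22] for those of [q2], as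
    [H1v] requires. Carrying them as data lets edge means be formed on any cell. *)
Record field := Field { q1 : pt R -> R; g11 : pt R -> R; g12 : pt R -> R;
  q2 : pt R -> R; g21 : pt R -> R; g22 : pt R -> R }.

Definition H1v (U : set (pt R)) (F : field) : Prop :=
  H1 U (q1 F) (g11 F) (g12 F) /\ H1 U (q2 F) (g21 F) (g22 F).

(** For a positively oriented triangle the numerator is the outward flux through the edge from [a]
    to [b]; divided by [det] it is the coefficient of the basis field [x - c], which has no flux
    through the other two edges. *)
Definition rt_coef a b c (F : field) : R :=
  ((b.2 - a.2) * edge_mean a b c (q1 F) (g11 F) (g12 F)
   - (b.1 - a.1) * edge_mean a b c (q2 F) (g21 F) (g22 F)) / det a b c.

Definition rt_slope a b c F : R := rt_coef a b c F + rt_coef b c a F + rt_coef c a b F.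

Definition rt_const a b c F : pt R :=
  - (rt_coef a b c F *: c + rt_coef b c a F *: a + rt_coef c a b F *: b).

Definition rt_interp a b c F x : pt R := rt_slope a b c F *: x + rt_const a b c F.

Definition gnorm (U : set (pt R)) F : R :=
  norm0 U (g11 F) + norm0 U (g12 F) + (norm0 U (g21 F) + norm0 U (g22 F)).

Section OneTriangle.
Variables (a b c : pt R) (F : field).
Hypothesis d0 : det a b c != 0.
Let U := tri a b c.
Let A := area a b c.
Hypothesis HF : H1v U F.

Let mU : measurable (U : set mpt) := measurable_poly _.
Let fU : (mu U < +oo)%E := mu_tri_fin d0.
Let A0 : 0 < A := area_gt0 d0.

Let L2one : L2 U (@one R) := L2_cst 1 mU fU.

Lemma tri_hull x : U x -> hull (a, b, c) x.
Proof. by move=> /tri_sub_ctri; rewrite hullE. Qed.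

Lemma cx_le z x : hull (a, b, c) z -> U x ->
  `|x.1 - z.1| <= hK (a, b, c) /\ `|x.2 - z.2| <= hK (a, b, c).
Proof.
move=> hz /tri_hull hx; have := hK_ub hx hz.
have h0 := le_trans (edist_ge0 x z) (hK_ub hx hz).
rewrite edist_le// /sqd => e.
split; rewrite -ler_sqr ?nnegrE// real_normK ?num_real//; apply: le_trans e.
  by rewrite lerDl sqr_ge0.
by rewrite lerDr sqr_ge0.
Qed.

Lemma hK_ge0 : 0 <= hK (a, b, c).
Proof.
have ha : hull (a, b, c) a by apply: vertex_hull; rewrite !inE eqxx.
exact: le_trans (edist_ge0 a a) (hK_ub ha ha).
Qed.

Lemma measurable_cx z : measurable_fun U (cx1 z) /\ measurable_fun U (cx2 z).
Proof.
by split; apply: measurable_funTS; apply: measurable_funB.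
Qed.

Lemma L2_cx z : L2 U (cx1 z) /\ L2 U (cx2 z).
Proof.
have [M HM] := bounded_sub_box (bounded_tri d0); have [m1 m2] := measurable_cx z.
have bd (u v : R) : `|u| <= M -> `|u - v| <= M + `|v|.
  by move=> h; rewrite (le_trans (ler_normB _ _))// lerD2r.
by split; [apply: (@bounded_L2 _ _ mU _ (M + `|z.1|))|apply: (@bounded_L2 _ _ mU _ (M + `|z.2|))] => // x
  /HM[/=]; rewrite !in_itv/= -!ler_norml => h1 h2; apply: bd.
Qed.

Lemma norm0_sup v (B : R) : 0 <= B -> measurable_fun U v -> (forall x, U x -> `|v x| <= B) ->
  norm0 U v <= B * Num.sqrt A.
Proof.
move=> B0 mv vB; have v2 : L2 U v by exact: (@bounded_L2 _ _ mU _ B).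
have B2 : L2 U (fun=> B) := L2_cst B mU fU.
rewrite -ler_sqr ?nnegrE ?norm0_ge0 ?mulr_ge0 ?sqrtr_ge0// norm0_sq exprMn sqr_sqrtr; last exact: ltW.
have -> : B ^+ 2 * A = ip U (fun=> B) (fun=> B).
  rewrite (ip_cstr B mU fU B2) (ipC U _ (@one R)) (ip_cstr B mU fU L2one).
  by rewrite -/A mulrA expr2.
apply: le_Rintegral => //; [exact: L2_mul_int|exact: L2_mul_int|] => x Ux.
rewrite -!expr2 -[leLHS]real_normK ?num_real// ler_sqr ?nnegrE//; exact: vB.
Qed.

Lemma norm0_cx z : hull (a, b, c) z ->
  norm0 U (cx1 z) <= hK (a, b, c) * Num.sqrt A /\ norm0 U (cx2 z) <= hK (a, b, c) * Num.sqrt A.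
Proof.
move=> hz; have [m1 m2] := measurable_cx z; have h0 := hK_ge0.
by split; apply: norm0_sup => // x Ux; have [] := cx_le hz Ux.
Qed.

Lemma ip_cx1 g z : L2 U g -> ip U g (cx1 z) = ip U g (cx1 0) - z.1 * ip U g (@one R).
Proof.
move=> g2; have [l1 _] := L2_cx 0.
rewrite -(ip_cstr z.1 mU fU g2) -(ipBr mU l1 (L2_cst z.1 mU fU) g2).
by congr ip; apply/funext => x; rewrite /cx1/= subr0.
Qed.

Lemma ip_cx2 g z : L2 U g -> ip U g (cx2 z) = ip U g (cx2 0) - z.2 * ip U g (@one R).
Proof.
move=> g2; have [_ l1] := L2_cx 0.
rewrite -(ip_cstr z.2 mU fU g2) -(ipBr mU l1 (L2_cst z.2 mU fU) g2).
by congr ip; apply/funext => x; rewrite /cx2/= subr0.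
Qed.

(** The commuting property: [2 * rt_slope], the divergence of the interpolant, is the cell mean of
    the divergence. The integrals of [q1] and [q2] cancel because the edge vectors sum to zero, and
    moments about different vertices differ only by integrals of derivatives. *)
Lemma rt_slopeE : 2 * rt_slope a b c F * A = ip U (g11 F) (@one R) + ip U (g22 F) (@one R).
Proof.
have [[_ l11 l12 _ _] [_ l21 l22 _ _]] := HF.
rewrite /rt_slope /rt_coef /edge_mean /moment (area_rot b c a) (area_rot a b c).
rewrite (tri_rot b c a) (tri_rot a b c) -/U -/A (detC2 a b c) (detC a b c).
rewrite (ip_cx1 a l11) (ip_cx1 b l11) (ip_cx1 c l11) (ip_cx2 a l12) (ip_cx2 b l12) (ip_cx2 c l12) (ip_cx1 a l21) (ip_cx1 b l21) (ip_cx1 c l21) (ip_cx2 a l22) (ip_cx2 b l22) (ip_cx2 c l22).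
have An : A != 0 by rewrite gt_eqF.
move: d0; rewrite /det => d1.
move: A An (ip _ (q1 F) _) (ip _ (q2 F) _) (ip _ (g11 F) (@one R)) (ip _ (g12 F) (@one R))
  (ip _ (g21 F) (@one R)) (ip _ (g22 F) (@one R)) (ip _ (g11 F) _) (ip _ (g12 F) _)
  (ip _ (g21 F) _) (ip _ (g22 F) _) => A' An; intros.
by field; rewrite d1 An.
Qed.

Let r1 x := (rt_interp a b c F x).1 - ip U (q1 F) (@one R) / A.
Let r2 x := (rt_interp a b c F x).2 - ip U (q2 F) (@one R) / A.

Let eps1 z := (ip U (g11 F) (cx1 z) + ip U (g12 F) (cx2 z)) / (2 * A).
Let eps2 z := (ip U (g21 F) (cx1 z) + ip U (g22 F) (cx2 z)) / (2 * A).

(** Constants are interpolated exactly, so only [eps1] and [eps2], edge mean minus cell mean,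
    matter. Developing at [c] leaves, apart from the slope, products of coordinates of the two edges
    at [c] over [det]; coordinates of the edge from [a] to [b] do not occur there. *)
Lemma rt_remainder x :
  r1 x = rt_slope a b c F * (x.1 - c.1) +
    (((c.2 - b.2) * eps1 a - (c.1 - b.1) * eps2 a) * (c.1 - a.1) +
     ((a.2 - c.2) * eps1 b - (a.1 - c.1) * eps2 b) * (c.1 - b.1)) / det a b c /\
  r2 x = rt_slope a b c F * (x.2 - c.2) +
    (((c.2 - b.2) * eps1 a - (c.1 - b.1) * eps2 a) * (c.2 - a.2) +
     ((a.2 - c.2) * eps1 b - (a.1 - c.1) * eps2 b) * (c.2 - b.2)) / det a b c.
Proof.
rewrite /r1 /r2 /rt_interp /rt_const /= /GRing.scale/= /rt_slope /rt_coef /edge_mean /moment.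
rewrite (area_rot b c a) (area_rot a b c) (tri_rot b c a) (tri_rot a b c) -/U -/A.
rewrite (detC2 a b c) (detC a b c) /eps1 /eps2.
have An : A != 0 by rewrite gt_eqF.
move: d0; rewrite /det => d1.
move: A An (ip _ (q1 F) _) (ip _ (q2 F) _) (ip _ (g11 F) (cx1 a)) (ip _ (g12 F) (cx2 a))
  (ip _ (g21 F) (cx1 a)) (ip _ (g22 F) (cx2 a)) (ip _ (g11 F) (cx1 b)) (ip _ (g12 F) (cx2 b))
  (ip _ (g21 F) (cx1 b)) (ip _ (g22 F) (cx2 b)) (ip _ (g11 F) (cx1 c)) (ip _ (g12 F) (cx2 c))
  (ip _ (g21 F) (cx1 c)) (ip _ (g22 F) (cx2 c)) => A' An; intros.
by split; field; rewrite d1 An.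
Qed.

Hypothesis longest : hK (a, b, c) <= edist a b.
Let h := hK (a, b, c).
Let Rc := circumradius (a, b, c).
Let S := gnorm U F.
Let sA := Num.sqrt A.

Let sA0 : 0 < sA.
Proof. by rewrite sqrtr_gt0. Qed.

Let sAA : sA ^+ 2 = A.
Proof. by rewrite sqr_sqrtr// ltW. Qed.

Let h0 : 0 < h.
Proof.
rewrite lt_neqAle hK_ge0 andbT eq_sym; apply/eqP => hz.
have va : a \in vertices (a, b, c) by rewrite !inE eqxx.
have vb : b \in vertices (a, b, c) by rewrite !inE eqxx orbT.
have le0 : edist a b <= 0 by rewrite -hz; apply: hK_ub; exact: vertex_hull.
have ab0 : edist a b = 0 by apply/eqP; rewrite eq_le le0 edist_ge0.
have := circum_prod d0; rewrite ab0 !mul0r => /esym/eqP.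
rewrite !mulf_eq0 normr_eq0 (negbTE d0) orbF (_ : (2 == 0 :> R) = false) ?pnatr_eq0//= => /eqP r0.
have [ctr [ea eb _]] := circumradius_spec d0.
have e0 (z : pt R) : edist ctr z = 0 -> z = ctr.
  move=> /(congr1 (fun u => u ^+ 2)); rewrite edist_sq expr0n/= => /eqP.
  rewrite /sqd paddr_eq0 ?sqr_ge0// !sqrf_eq0 !subr_eq0 => /andP[/eqP k1 /eqP k2].
  by apply: injective_projections.
move: d0; rewrite (e0 a) ?ea// (e0 b) ?eb// /det !subrr !mul0r subrr eqxx //.
Qed.

Let Rc0 : 0 <= Rc := circumradius_ge0 d0.

Let hR : h <= 2 * Rc := hK_le_2R d0.

Let S0 : 0 <= S.
Proof. by rewrite /S /gnorm; do 2?apply: addr_ge0; rewrite ?norm0_ge0// addr_ge0 ?norm0_ge0. Qed.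

Let abs_ip_cx g1 g2 z : L2 U g1 -> L2 U g2 -> norm0 U g1 + norm0 U g2 <= S -> hull (a, b, c) z ->
  `|(ip U g1 (cx1 z) + ip U g2 (cx2 z)) / (2 * A)| <= S * h / (2 * sA).
Proof.
move=> l1 l2 gS hz; have [x1 x2] := L2_cx z; have [n1 n2] := norm0_cx hz.
have A2 : 0 < 2 * A by rewrite mulr_gt0.
rewrite normrM normfV (gtr0_norm A2) ler_pdivrMr//.
have -> : S * h / (2 * sA) * (2 * A) = S * (h * sA).
  by rewrite -sAA; field; rewrite gt_eqF.
apply: (le_trans (ler_normD _ _)).
apply: (@le_trans _ _ ((norm0 U g1 + norm0 U g2) * (h * sA))); last first.
  by rewrite ler_wpM2r// mulr_ge0// ltW.
rewrite mulrDl; apply: lerD.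
  by apply: (le_trans (ip_CS mU l1 x1)); rewrite ler_wpM2l ?norm0_ge0.
by apply: (le_trans (ip_CS mU l2 x2)); rewrite ler_wpM2l ?norm0_ge0.
Qed.

Let gS : [/\ norm0 U (g11 F) + norm0 U (g12 F) <= S, norm0 U (g21 F) + norm0 U (g22 F) <= S &
  norm0 U (g11 F) + norm0 U (g22 F) <= S].
Proof.
rewrite /S /gnorm; have := norm0_ge0 U (g11 F); have := norm0_ge0 U (g12 F).
by have := norm0_ge0 U (g21 F); have := norm0_ge0 U (g22 F); split; lra.
Qed.

Let vh z : z \in vertices (a, b, c) -> hull (a, b, c) z.
Proof. exact: vertex_hull. Qed.

Let ha : hull (a, b, c) a. Proof. by apply: vh; rewrite !inE eqxx. Qed.
Let hb : hull (a, b, c) b. Proof. by apply: vh; rewrite !inE eqxx orbT. Qed.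
Let hc : hull (a, b, c) c. Proof. by apply: vh; rewrite !inE eqxx !orbT. Qed.

Let slope_le : `|rt_slope a b c F| <= S / (2 * sA).
Proof.
have [[_ l11 l12 _ _] [_ l21 l22 _ _]] := HF.
have A2 : 0 < 2 * A by rewrite mulr_gt0.
rewrite -(ler_pM2r A2) -{1}(gtr0_norm A2) -normrM.
have -> : rt_slope a b c F * (2 * A) = 2 * rt_slope a b c F * A by ring.
rewrite rt_slopeE.
have -> : S / (2 * sA) * (2 * A) = S * sA by rewrite -sAA; field; rewrite gt_eqF.
apply: (le_trans (ler_normD _ _)); have [_ _ gg] := gS.
apply: (@le_trans _ _ ((norm0 U (g11 F) + norm0 U (g22 F)) * sA)); last first.
  by rewrite ler_wpM2r// ltW.
rewrite mulrDl -[sA]/(norm0 U (@one R)); apply: lerD; exact: ip_CS.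
Qed.

Let coord_le y z : `|y.1 - z.1| <= edist y z /\ `|y.2 - z.2| <= edist y z.
Proof.
split; rewrite -ler_sqr ?nnegrE ?edist_ge0// real_normK ?num_real// edist_sq /sqd.
  by rewrite lerDl sqr_ge0.
by rewrite lerDr sqr_ge0.
Qed.

Let corner_le (u1 u2 v1 v2 w1 e p q : R) : 0 <= e -> 0 <= p -> 0 <= q ->
  `|u1| <= p -> `|u2| <= p -> `|v1| <= e -> `|v2| <= e -> `|w1| <= q ->
  `|(u1 * v1 - u2 * v2) * w1| <= 2 * (e * (p * q)).
Proof.
move=> e0 p0 q0 hu1 hu2 hv1 hv2 hw; rewrite normrM.
have -> : 2 * (e * (p * q)) = (p * e + p * e) * q by ring.
apply: ler_pM => //; apply: (le_trans (ler_normB _ _)); rewrite !normrM.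
by apply: lerD; apply: ler_pM.
Qed.

(** One unit of [S * Rc / sA] comes from the slope, using [h <= 2 * Rc], and two from each of the
    two corner terms. *)
Let r_le x : U x -> `|r1 x| <= 5 * S * Rc / sA /\ `|r2 x| <= 5 * S * Rc / sA.
Proof.
move=> Ux; have [-> ->] := rt_remainder x.
have [[_ l11 l12 _ _] [_ l21 l22 _ _]] := HF.
have [s1 s2 _] := gS.
have e1a := abs_ip_cx l11 l12 s1 ha; have e2a := abs_ip_cx l21 l22 s2 ha.
have e1b := abs_ip_cx l11 l12 s1 hb; have e2b := abs_ip_cx l21 l22 s2 hb.
set e := S * h / (2 * sA) in e1a e2a e1b e2b.
have e0 : 0 <= e by rewrite /e divr_ge0 // mulr_ge0 // ltW.
have [cb1 cb2] := coord_le c b; have [ca1 ca2] := coord_le c a.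
have [ac1 ac2] := coord_le a c.
rewrite (edistC c b) in cb1 cb2; rewrite (edistC a c) in ac1 ac2.
(* By [circum_prod] the product of the three edges is [2 * Rc] times the absolute determinant, and
   the first edge is at least [h]: here the circumradius takes the place of an angle condition. *)
have pq : edist b c * edist c a / `|det a b c| <= 2 * Rc / h.
  have dp : 0 < `|det a b c| by rewrite normr_gt0.
  rewrite ler_pdivlMr// mulrAC ler_pdivrMr// -/Rc -circum_prod//.
  rewrite -mulrA mulrC; apply: ler_wpM2r; first by rewrite mulr_ge0 ?edist_ge0.
  exact: longest.
have eh : e * (2 * Rc / h) = S * Rc / sA.
  by rewrite /e; field; rewrite !gt_eqF.
have T (u1 u2 u3 u4 w1 w2 : R) : `|u1| <= edist b c -> `|u2| <= edist b c -> `|u3| <= edist c a ->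
    `|u4| <= edist c a -> `|w1| <= edist c a -> `|w2| <= edist b c ->
    `|((u1 * eps1 a - u2 * eps2 a) * w1 + (u3 * eps1 b - u4 * eps2 b) * w2) / det a b c| <= 4 * (S * Rc / sA).
  move=> k1 k2 k3 k4 k5 k6; rewrite normrM normfV.
  have c1 := corner_le e0 (edist_ge0 b c) (edist_ge0 c a) k1 k2 e1a e2a k5.
  have c2 := corner_le e0 (edist_ge0 c a) (edist_ge0 b c) k3 k4 e1b e2b k6.
  apply: (@le_trans _ _ (4 * (e * (edist b c * edist c a / `|det a b c|)))); last first.
    by rewrite -eh ler_pM2l// ler_wpM2l.
  have -> : 4 * (e * (edist b c * edist c a / `|det a b c|)) =
     (2 * (e * (edist b c * edist c a)) + 2 * (e * (edist c a * edist b c))) / `|det a b c|.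
    by move: (`|det a b c|^-1) (edist b c) (edist c a) => i p q; ring.
  rewrite ler_wpM2r ?invr_ge0//; apply: (le_trans (ler_normD _ _)); exact: lerD.
have sl (u : R) : `|u| <= h -> `|rt_slope a b c F * u| <= S * Rc / sA.
  move=> hu; rewrite normrM; apply: (@le_trans _ _ (S / (2 * sA) * h)).
    exact: ler_pM.
  have -> : S / (2 * sA) * h = S / sA * (h / 2) by field; rewrite gt_eqF.
  have -> : S * Rc / sA = S / sA * Rc by field; rewrite gt_eqF.
  rewrite ler_wpM2l ?divr_ge0 ?(ltW sA0)//.
  by rewrite ler_pdivrMr// mulrC.
have [xc1 xc2] := cx_le hc Ux.
have fin (u v : R) : `|u| <= S * Rc / sA -> `|v| <= 4 * (S * Rc / sA) -> `|u + v| <= 5 * S * Rc / sA.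
  move=> hu hv; have -> : 5 * S * Rc / sA = S * Rc / sA + 4 * (S * Rc / sA) by ring.
  by apply: (le_trans (ler_normD _ _)); exact: lerD.
by split; apply: fin; [exact: sl|exact: T|exact: sl|exact: T].
Qed.

Let measurable_rt : measurable_fun U (fun x => (rt_interp a b c F x).1) /\
  measurable_fun U (fun x => (rt_interp a b c F x).2).
Proof.
split.
  rewrite (_ : (fun x => _) = (fun x => rt_slope a b c F * x.1 + (rt_const a b c F).1))//.
  by apply: measurable_funTS; apply: measurable_funD => //; apply: measurable_funM.
rewrite (_ : (fun x => _) = (fun x => rt_slope a b c F * x.2 + (rt_const a b c F).2))//.
by apply: measurable_funTS; apply: measurable_funD => //; apply: measurable_funM.
Qed.

Let poincare_tri v k1 k2 : H1 U v k1 k2 -> norm0 U k1 + norm0 U k2 <= S ->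
  norm0 U (fun x => v x - ip U v one / A) <= 4 * Rc * S.
Proof.
move=> Hv kS; have [mD muD] := diffset_mu d0.
have hh x z : U x -> U (x + z) -> z.1 ^+ 2 + z.2 ^+ 2 <= h ^+ 2.
  move=> Ux Uz; have := hK_ub (tri_hull Uz) (tri_hull Ux).
  rewrite edist_le ?(ltW h0)// => hs; apply: le_trans hs.
  rewrite (_ : sqd _ _ = z.1 ^+ 2 + z.2 ^+ 2)// /sqd /=; ring.
pose w x := v x - ip U v one / A.
have P : ip U w w <= 3 * h ^+ 2 * (ip U k1 k1 + ip U k2 k2) :=
  poincare erefl (bounded_tri d0) Hv A0 hh mD (fun x z => tri_diffset d0) muD.
rewrite -/w.
rewrite -ler_sqr ?nnegrE ?norm0_ge0 ?mulr_ge0//.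
rewrite norm0_sq; apply: (le_trans P); rewrite -!norm0_sq.
apply: (@le_trans _ _ (3 * h ^+ 2 * S ^+ 2)).
  apply: ler_wpM2l; first by apply: mulr_ge0 => //; exact: sqr_ge0.
  have n1 := norm0_ge0 U k1; have n2 := norm0_ge0 U k2.
  apply: (@le_trans _ _ ((norm0 U k1 + norm0 U k2) ^+ 2)); last first.
    by rewrite ler_sqr// nnegrE addr_ge0.
  by rewrite sqrrD -addrA lerD2l lerDr mulrn_wge0// mulr_ge0.
rewrite exprMn ler_wpM2r ?sqr_ge0//.
have : h ^+ 2 <= (2 * Rc) ^+ 2 by rewrite ler_sqr ?nnegrE ?mulr_ge0// ltW.
by rewrite !exprMn; have := sqr_ge0 Rc; lra.
Qed.

(** Triangle inequality through the cell mean: 4 from Poincaré, as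
    [3 * h ^ 2 <= 12 * Rc ^ 2 <= 16 * Rc ^ 2], and 5 from [r_le]. *)
Lemma rt_error_longest :
  norm0 U (fun x => q1 F x - (rt_interp a b c F x).1) <= 9 * Rc * S /\
  norm0 U (fun x => q2 F x - (rt_interp a b c F x).2) <= 9 * Rc * S.
Proof.
have [s1 s2 _] := gS; have [H1' H2'] := HF; have [m1 m2] := measurable_rt.
have p1 := poincare_tri H1' s1; have p2 := poincare_tri H2' s2.
have B0 : 0 <= 5 * S * Rc / sA by rewrite !mulr_ge0 ?invr_ge0 ?(ltW sA0).
have mr1 : measurable_fun U r1 by apply: measurable_funB.
have mr2 : measurable_fun U r2 by apply: measurable_funB.
have n1 := norm0_sup B0 mr1 (fun x Ux => (r_le Ux).1).
have n2 := norm0_sup B0 mr2 (fun x Ux => (r_le Ux).2).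
have BE : 5 * S * Rc / sA * Num.sqrt A = 5 * S * Rc by rewrite -/sA mulfVK// gt_eqF.
rewrite BE in n1 n2.
have l1 : L2 U r1 by apply: (@bounded_L2 _ _ mU _ (5 * S * Rc / sA)) => // x Ux; exact: (r_le Ux).1.
have l2 : L2 U r2 by apply: (@bounded_L2 _ _ mU _ (5 * S * Rc / sA)) => // x Ux; exact: (r_le Ux).2.
have [k1 k2] : L2 U (q1 F) /\ L2 U (q2 F) by split; [case: H1'|case: H2'].
have w1 : L2 U (fun x => q1 F x - ip U (q1 F) one / A) by apply: (L2B mU k1 (L2_cst _ mU fU)).
have w2 : L2 U (fun x => q2 F x - ip U (q2 F) one / A) by apply: (L2B mU k2 (L2_cst _ mU fU)).
split.
- have -> : (fun x => q1 F x - (rt_interp a b c F x).1) = (fun x => q1 F x - ip U (q1 F) one / A) \- r1.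
    by apply/funext => x; rewrite /r1 /=; ring.
  apply: (le_trans (norm0B mU w1 l1)); have := lerD p1 n1.
  by rewrite (_ : 9 * Rc * S = 4 * Rc * S + 5 * S * Rc)//; ring.
- have -> : (fun x => q2 F x - (rt_interp a b c F x).2) = (fun x => q2 F x - ip U (q2 F) one / A) \- r2.
    by apply/funext => x; rewrite /r2 /=; ring.
  apply: (le_trans (norm0B mU w2 l2)); have := lerD p2 n2.
  by rewrite (_ : 9 * Rc * S = 4 * Rc * S + 5 * S * Rc)//; ring.
Qed.

End OneTriangle.

Lemma rt_interp_rot a b c F : rt_interp b c a F = rt_interp a b c F.
Proof.
apply/funext => x; rewrite /rt_interp /rt_slope /rt_const; congr (_ *: _ + - _).
  by rewrite addrC addrA.
by rewrite addrC addrA.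
Qed.

(** Interpolant, diameter and circumradius are invariant under rotation of the vertices, so the
    longest edge may be put first. *)
Lemma rt_error a b c F : det a b c != 0 -> H1v (tri a b c) F ->
  norm0 (tri a b c) (fun x => q1 F x - (rt_interp a b c F x).1) <=
    9 * circumradius (a, b, c) * gnorm (tri a b c) F /\
  norm0 (tri a b c) (fun x => q2 F x - (rt_interp a b c F x).2) <=
    9 * circumradius (a, b, c) * gnorm (tri a b c) F.
Proof.
move=> d0 HF; have [d1 d2] := det_rot_neq0 d0.
have [h|h|h] := longest_edge a b c.
- exact: rt_error_longest.
- have := @rt_error_longest b c a F d1; rewrite (tri_rot a b c) (hK_rot a b c).
  by rewrite (rt_interp_rot a b c) (circumradius_rot a b c); exact.
- have := @rt_error_longest c a b F d2; rewrite (tri_rot b c a) (tri_rot a b c) (hK_rot b c a) (hK_rot a b c).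
  rewrite (rt_interp_rot b c a) (rt_interp_rot a b c).
  by rewrite (circumradius_rot b c a) (circumradius_rot a b c); exact.
Qed.

End Interpolant.

(** * Continuity of the normal flux across edges *)

Section Partition.
Variable R : realType.
Notation mu := (leb2 R).
Notation mpt := (measurableTypeR R * measurableTypeR R)%type.

Lemma Rintegral_indic (U A : set (pt R)) f : measurable (U : set mpt) ->
  measurable (A : set mpt) -> A `<=` U -> mu.-integrable U (EFin \o f) ->
  mu.-integrable U (EFin \o (fun x => f x * \1_A x)) /\
  \int[mu]_(x in U) (f x * \1_A x) = \int[mu]_(x in A) f x.
Proof.
move=> mU mA AU fi; have E : (fun x => f x * \1_A x) = f \_ A.
  apply/funext => x; rewrite patchE indicE; case: ifPn => xA; first by rewrite mulr1.
  by rewrite mulr0.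
split; last first.
  rewrite E /Rintegral; congr fine; rewrite [RHS]integral_mkcond [LHS]integral_mkcond.
  apply: eq_integral => x _; rewrite !patchE.
  case: ifPn => [|xU]; first by case: ifPn.
  case: ifPn => [|//]; rewrite inE => /AU; move: xU; rewrite notin_setE => h1 h2; exact: (False_ind _ (h1 h2)).
have -> : EFin \o (fun x => f x * \1_A x) = (EFin \o f) \_ A.
  by rewrite E; apply/funext => x; rewrite /= !patchE; case: ifP.
have /(integrable_mkcond _ mA) fA : mu.-integrable A (EFin \o f) by exact: integrableS fi.
exact: integrableS fA.
Qed.

Lemma Rintegral_partition (I : eqType) (s : seq I) (F : I -> set (pt R)) (U : set (pt R)) f :
  measurable (U : set mpt) -> mu.-integrable U (EFin \o f) ->
  (forall i, i \in s -> measurable (F i : set mpt) /\ F i `<=` U) ->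
  {ae mu, forall x, U x -> \sum_(i <- s) \1_(F i) x = 1 :> R} ->
  \int[mu]_(x in U) f x = \sum_(i <- s) \int[mu]_(x in F i) f x.
Proof.
move=> mU fi sF ae1.
have [si sE] : mu.-integrable U (EFin \o (fun x => \sum_(i <- s) f x * \1_(F i) x)) /\
    \int[mu]_(x in U) (\sum_(i <- s) f x * \1_(F i) x) = \sum_(i <- s) \int[mu]_(x in F i) f x.
  elim: s sF {ae1} => [|i s ih] sF.
    split.
      rewrite (_ : _ \o _ = cst 0%E); first exact: integrable0.
      by apply/funext => x; rewrite /= big_nil.
    rewrite big_nil (_ : (fun x => _) = cst 0) ?Rintegral_cst// ?mul0r//.
    by apply/funext => x; rewrite /= big_nil.
  have [j1 j2] := ih (fun k ks => sF k (mem_behead (ks : k \in behead (i :: s)))).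
  have [mi iU] := sF i (mem_head _ _); have [k1 k2] := Rintegral_indic mU mi iU fi.
  rewrite (_ : (fun x => \sum_(k <- i :: s) f x * \1_(F k) x) =
     (fun x => f x * \1_(F i) x) \+ (fun x => \sum_(k <- s) f x * \1_(F k) x)); last first.
    by apply/funext => x; rewrite big_cons.
  split; last by rewrite RintegralD// j2 k2 big_cons.
  rewrite (_ : EFin \o _ = (EFin \o (fun x => f x * \1_(F i) x)) \+ (EFin \o (fun x => \sum_(k <- s) f x * \1_(F k) x))).
    exact: integrableD.
  by apply/funext => x.
rewrite -sE; congr fine; apply: ae_eq_integral => //.
- by case/integrableP: fi.
- by case/integrableP: si.
- apply: ae_imp ae1 => x h Ux; congr EFin; rewrite -mulr_sumr h ?mulr1//.
Qed.

End Partition.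

(** * Testing with a field that is broken along a line *)

Section FluxAcrossLine.
Variable R : realType.
Notation mu := (leb2 R).
Notation mpt := (measurableTypeR R * measurableTypeR R)%type.

Definition sc (k c : R) (l : R * R * R) : R * R * R := (k * l.1.1 - c, k * l.1.2, k * l.2).

Lemma aff_sc k c l x : aff (sc k c l) x = k * aff l x - c.
Proof. by rewrite /aff /sc /=; ring. Qed.

Lemma d1_step l x : d1 (fun x => step (aff l x)) x = l.1.2 * @step' R (aff l x).
Proof. by apply: derive_val; apply: is_derive_comp_aff1; exact: step_derive. Qed.

Lemma d2_step l x : d2 (fun x => step (aff l x)) x = l.2 * @step' R (aff l x).
Proof. by apply: derive_val; apply: is_derive_comp_aff2; exact: step_derive. Qed.

Lemma smooth_step l : smooth (fun x : pt R => step (aff l x)).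
Proof. apply: smooth_comp_aff; exact: step_smooth. Qed.

(** For [m > 0] this is [P] where [m * aff l] is at least 1 and [Q] where [aff l] is at most 0: a
    smooth substitute for the broken field, sharper as [m] grows. *)
Definition blend (m : R) l (P Q : pt R -> R) : pt R -> R :=
  fun x => step (aff (sc m 0 l) x) * (P x - Q x) + Q x.

Lemma smoothB (f g : pt R -> R) : smooth f -> smooth g -> smooth (fun x : pt R => f x - g x).
Proof.
move=> sf sg; rewrite (_ : (fun x => _) = (fun x => f x + (-1) * g x)).
  by apply: smoothD => //; apply: smoothM => //; exact: smooth_cst.
by apply/funext => x; rewrite mulN1r.
Qed.

Lemma d1_cst (c : R) x : d1 (fun _ : pt R => c) x = 0.
Proof. by apply: derive_val; exact: is_derive_cst. Qed.

Lemma d2_cst (c : R) x : d2 (fun _ : pt R => c) x = 0.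
Proof. by apply: derive_val; exact: is_derive_cst. Qed.

Lemma d1B (f g : pt R -> R) x : smooth f -> smooth g -> d1 (fun x : pt R => f x - g x) x = d1 f x - d1 g x.
Proof.
move=> sf sg; rewrite (_ : (fun x => _) = (fun x => f x + (fun _ => -1) x * g x)).
  rewrite d1D ?d1M ?d1_cst//; [ring|exact: smooth_cst|].
  by apply: smoothM => //; exact: smooth_cst.
by apply/funext => y; rewrite mulN1r.
Qed.

Lemma d2B (f g : pt R -> R) x : smooth f -> smooth g -> d2 (fun x : pt R => f x - g x) x = d2 f x - d2 g x.
Proof.
move=> sf sg; rewrite (_ : (fun x => _) = (fun x => f x + (fun _ => -1) x * g x)).
  rewrite d2D ?d2M ?d2_cst//; [ring|exact: smooth_cst|].
  by apply: smoothM => //; exact: smooth_cst.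
by apply/funext => y; rewrite mulN1r.
Qed.

Lemma smooth_blend m l P Q : smooth P -> smooth Q -> smooth (blend m l P Q).
Proof.
move=> sP sQ; apply: smoothD => //; apply: smoothM; [exact: smooth_step|exact: smoothB].
Qed.

Lemma d1_blend m l P Q x : smooth P -> smooth Q -> d1 (blend m l P Q) x =
  m * l.1.2 * @step' R (m * aff l x) * (P x - Q x) +
  step (m * aff l x) * (d1 P x - d1 Q x) + d1 Q x.
Proof.
move=> sP sQ; rewrite /blend d1D//; last by apply: smoothM; [exact: smooth_step|exact: smoothB].
rewrite d1M; [|exact: smooth_step|exact: smoothB].
by rewrite d1_step d1B// aff_sc subr0.
Qed.

Lemma d2_blend m l P Q x : smooth P -> smooth Q -> d2 (blend m l P Q) x =
  m * l.2 * @step' R (m * aff l x) * (P x - Q x) +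
  step (m * aff l x) * (d2 P x - d2 Q x) + d2 Q x.
Proof.
move=> sP sQ; rewrite /blend d2D//; last by apply: smoothM; [exact: smooth_step|exact: smoothB].
rewrite d2M; [|exact: smooth_step|exact: smoothB].
by rewrite d2_step d2B// aff_sc subr0.
Qed.

Lemma le_sum6 (k1 k2 k3 k4 k5 k6 : R) : 0 <= k1 -> 0 <= k2 -> 0 <= k3 -> 0 <= k4 -> 0 <= k5 -> 0 <= k6 ->
  let k := k1 + k2 + k3 + k4 + k5 + k6 in
  [/\ k1 <= k, k2 <= k, k3 <= k, k4 <= k & k5 <= k] /\ k6 <= k.
Proof. by move=> p1 p2 p3 p4 p5 p6 k; rewrite {}/k; split; [split|]; lra. Qed.

Lemma cont_bounded_box (f : pt R -> R) (M : R) : continuous f -> exists2 B : R, 0 <= B & forall x, box M x -> `|f x| <= B.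
Proof.
move=> cf; have : compact (f @` box M).
  apply: continuous_compact; last exact: compact_box.
  exact: continuous_subspaceT.
move=> /compact_bounded[B [_ HB]]; exists (`|B| + 1); first by rewrite addr_ge0.
move=> x bx; apply: (HB (`|B| + 1)); last by exists x.
by rewrite (le_lt_trans (ler_norm _))// ltrDl.
Qed.

Variables (O : set (pt R)) (l : R * R * R) (P1 P2 Q1 Q2 v g1 g2 : pt R -> R) (B : R).
Hypothesis mO : measurable (O : set mpt).
Hypothesis bO : bounded_set O.
Hypothesis l0 : (l.1.2, l.2) <> (0, 0).
Hypotheses (sP1 : smooth P1) (sP2 : smooth P2) (sQ1 : smooth Q1) (sQ2 : smooth Q2).
Hypothesis Hv : H1 O v g1 g2.
Hypothesis tT : forall m : R, 1 <= m -> test_fun O (blend m l P1 Q1) /\ test_fun O (blend m l P2 Q2).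
(** The normal component of [P - Q] vanishes to first order on the line. This compensates the
    derivative of [step (m * aff l)], which is of order [m] on a strip of width of order [1 / m]. *)
Hypothesis jump : forall x, O x ->
  `|l.1.2 * (P1 x - Q1 x) + l.2 * (P2 x - Q2 x)| <= B * `|aff l x|.

Let chi x : R := \1_[set x | 0 < aff l x] x.
Let A x := v x * (d1 P1 x + d2 P2 x) + g1 x * P1 x + g2 x * P2 x.
Let C x := v x * (d1 Q1 x + d2 Q2 x) + g1 x * Q1 x + g2 x * Q2 x.

Let E (n : nat) x := n.+1%:R * @step' R (n.+1%:R * aff l x) *
  (l.1.2 * (P1 x - Q1 x) + l.2 * (P2 x - Q2 x)).
Let S (n : nat) x := step (n.+1%:R * aff l x) : R.
Let u (n : nat) x := v x * E n x + S n x * (A x - C x) + C x.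

Let uE n x : u n x =
  (v x * d1 (blend n.+1%:R l P1 Q1) x + g1 x * blend n.+1%:R l P1 Q1 x) +
  (v x * d2 (blend n.+1%:R l P2 Q2) x + g2 x * blend n.+1%:R l P2 Q2 x).
Proof.
rewrite d1_blend// d2_blend// /blend aff_sc subr0 /u /S /E /A /C.
set t := _ * aff l x; move: (step t) (@step' R t) (d1 P1 x) (d1 Q1 x) (d2 P2 x) (d2 Q2 x) (P1 x) (Q1 x) (P2 x) (Q2 x) (v x) (g1 x) (g2 x).
move=> *; ring.
Qed.

(** By [uE] the integrand is the sum of the two weak-derivative identities tested with the
    components of the blended field. *)
Let u_int0 n : \int[mu]_(x in O) u n x = 0.
Proof.
have [v2 g12 g22 e1 e2] := Hv.
have [t1 t2] : test_fun O (blend n.+1%:R l P1 Q1) /\ test_fun O (blend n.+1%:R l P2 Q2).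
  by apply: tT; rewrite ler1n.
have tt1 := test_fun_d1 t1; have tt2 := test_fun_d2 t2.
rewrite (_ : u n = (fun x => (v x * d1 (blend n.+1%:R l P1 Q1) x + g1 x * blend n.+1%:R l P1 Q1 x) +
  (v x * d2 (blend n.+1%:R l P2 Q2) x + g2 x * blend n.+1%:R l P2 Q2 x))); last first.
  by apply/funext => x; rewrite uE.
have i1 := L2_mul_int mO v2 (test_L2 mO tt1); have i2 := L2_mul_int mO g12 (test_L2 mO t1).
have i3 := L2_mul_int mO v2 (test_L2 mO tt2); have i4 := L2_mul_int mO g22 (test_L2 mO t2).
have D1 := RintegralD mO i1 i2; have D2 := RintegralD mO i3 i4.
rewrite RintegralD//; first last.
- exact: (integrableD mO i3 i4).
- exact: (integrableD mO i1 i2).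
rewrite D1 D2.
have := e1 _ t1; have := e2 _ t2; rewrite /ip => -> ->.
by rewrite !addNr addr0.
Qed.

Let mP (f : pt R -> R) : smooth f -> measurable_fun O f.
Proof. by move=> sf; apply: measurable_funTS; apply: continuous_measurable2; exact: smooth_cont. Qed.

Let mvg : [/\ measurable_fun O v, measurable_fun O g1 & measurable_fun O g2].
Proof. by case: Hv => -[m1 _] [m2 _] [m3 _] _ _. Qed.

Let mA : measurable_fun O A.
Proof.
have [m1 m2 m3] := mvg; apply: measurable_funD; [apply: measurable_funD|]; apply: measurable_funM => //.
- by apply: measurable_funD; apply: mP; [exact: smooth_d1|exact: smooth_d2].
- exact: mP.
- exact: mP.
Qed.

Let mC : measurable_fun O C.
Proof.
have [m1 m2 m3] := mvg; apply: measurable_funD; [apply: measurable_funD|]; apply: measurable_funM => //.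
- by apply: measurable_funD; apply: mP; [exact: smooth_d1|exact: smooth_d2].
- exact: mP.
- exact: mP.
Qed.

Let bounds : exists2 K : R, 0 <= K & forall x, O x ->
  [/\ `|d1 P1 x + d2 P2 x| <= K, `|d1 Q1 x + d2 Q2 x| <= K &
    [/\ `|P1 x| <= K, `|P2 x| <= K, `|Q1 x| <= K & `|Q2 x| <= K]].
Proof.
have [M OM] := bounded_sub_box bO.
have cD (f g : pt R -> R) : smooth f -> smooth g -> continuous (fun x => d1 f x + d2 g x).
  by move=> sf sg; apply: smooth_cont; apply: smoothD; [exact: smooth_d1|exact: smooth_d2].
have [k1 p1 h1] := cont_bounded_box M (cD _ _ sP1 sP2).
have [k2 p2 h2] := cont_bounded_box M (cD _ _ sQ1 sQ2).
have [k3 p3 h3] := cont_bounded_box M (smooth_cont sP1).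
have [k4 p4 h4] := cont_bounded_box M (smooth_cont sP2).
have [k5 p5 h5] := cont_bounded_box M (smooth_cont sQ1).
have [k6 p6 h6] := cont_bounded_box M (smooth_cont sQ2).
exists (k1 + k2 + k3 + k4 + k5 + k6) => [|x /OM bx]; first by rewrite !addr_ge0.
have [[l1 l2 l3 l4 l5] l6] := le_sum6 p1 p2 p3 p4 p5 p6.
have := h1 _ bx; have := h2 _ bx; have := h3 _ bx; have := h4 _ bx; have := h5 _ bx; have := h6 _ bx.
by move=> /le_trans q6 /le_trans q5 /le_trans q4 /le_trans q3 /le_trans q2 /le_trans q1; split;
  [exact: q1|exact: q2|split; [exact: q3|exact: q4|exact: q5|exact: q6]].
Qed.

Let AC_le (a c1 c2 w w1 w2 K : R) : 0 <= K -> `|a| <= K -> `|c1| <= K -> `|c2| <= K ->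
  `|w * a + w1 * c1 + w2 * c2| <= K * (`|w| + `|w1| + `|w2|).
Proof.
move=> K0 ha h1 h2; apply: (le_trans (ler_normD _ _)).
rewrite !mulrDr; apply: lerD; last by rewrite normrM mulrC ler_wpM2r.
by apply: (le_trans (ler_normD _ _)); apply: lerD; rewrite normrM mulrC ler_wpM2r.
Qed.

Let u_dom : exists2 K : R, 0 <= K & forall n x, O x -> `|u n x| <= K * (`|v x| + `|g1 x| + `|g2 x|).
Proof.
have [K K0 HK] := bounds; have [M M0 HM] := @step'_bounded R.
have B0 : 0 <= `|B| by [].
exists (M * `|B| + 3 * K) => [|n x Ox]; first by rewrite addr_ge0 ?mulr_ge0// ltW.
have [k1 k2 [k3 k4 k5 k6]] := HK _ Ox.
have hA := AC_le (v x) (g1 x) (g2 x) K0 k1 k3 k4; have hC := AC_le (v x) (g1 x) (g2 x) K0 k2 k5 k6.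
rewrite -/(A x) in hA; rewrite -/(C x) in hC.
set G := `|v x| + `|g1 x| + `|g2 x| in hA hC *.
have vG : `|v x| <= G by rewrite /G -addrA lerDl addr_ge0.
have S1 : `|S n x * (A x - C x)| <= 2 * (K * G).
  rewrite normrM ger0_norm ?step_ge0//; apply: (@le_trans _ _ (`|A x - C x|)).
    by rewrite ler_piMl// step_le1.
  by apply: (le_trans (ler_normB _ _)); rewrite mulr_natl mulr2n; exact: lerD.
(* Outside [0 <= t <= 1] the factor [step'] vanishes; inside, [t <= 1] bounds the factor [n.+1%:R]
   times [aff l x] that [jump] produces. *)
have E1 : `|E n x| <= M * `|B|.
  rewrite /E; set t := n.+1%:R * aff l x.
  have [t1|t1] := ltP 1 t; first by rewrite step'_ge1// mulr0 mul0r normr0 mulr_ge0// ltW.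
  have [t0|t0] := ltP t 0; first by rewrite step'_le0// mulr0 mul0r normr0 mulr_ge0// ltW.
  rewrite [_ * @step' R t]mulrC -mulrA normrM; apply: ler_pM => //.
  rewrite normrM (ger0_norm (ler0n _ _)).
  apply: (@le_trans _ _ (n.+1%:R * (`|B| * `|aff l x|))).
    apply: ler_wpM2l => //; apply: (le_trans (jump Ox)); apply: ler_wpM2r => //; exact: ler_norm.
  rewrite mulrCA -[leRHS]mulr1; apply: ler_wpM2l => //.
  by rewrite -[X in X * _](ger0_norm (ler0n R n.+1)) -normrM -/t ger0_norm.
have vE : `|v x * E n x| <= G * (M * `|B|) by rewrite normrM; apply: ler_pM.
apply: (le_trans (ler_normD _ _)); apply: (@le_trans _ _ (G * (M * `|B|) + 2 * (K * G) + K * G)).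
  by apply: lerD => //; apply: (le_trans (ler_normD _ _)); exact: lerD.
by rewrite le_eqVlt; apply/orP; left; apply/eqP; ring.
Qed.

(** Limit of the vanishing integrals of [u n]. Off the line the singular part [E n] is eventually
    zero and [S n] tends to the indicator of the positive side; [u_dom] provides the domination. *)
Lemma flux_line : mu.-integrable O (EFin \o (fun x => chi x * A x + (1 - chi x) * C x)) /\
  \int[mu]_(x in O) (chi x * A x + (1 - chi x) * C x) = 0.
Proof.
have [K K0 HK] := u_dom; have [v2 g12 g22 _ _] := Hv.
have fO : (mu O < +oo)%E by have [M OM] := bounded_sub_box bO; exact: bounded_mu OM.
have [mv mg1 mg2] := mvg.
have mchi : measurable_fun O chi.
  by apply: measurable_funTS; apply: measurable_indic; exact: measurable_aff_gt0.
have mlim : measurable_fun O (fun x => chi x * A x + (1 - chi x) * C x).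
  by apply: measurable_funD; apply: measurable_funM => //; apply: measurable_funB.
have ms n : measurable_fun O (fun x => @step' R (n.+1%:R * aff l x)).
  rewrite (_ : (fun x => _) = (fun x => @step' R (aff (sc n.+1%:R 0 l) x))).
    by apply: mP; apply: smooth_comp_aff; exact: step'_smooth.
  by apply/funext => x; rewrite aff_sc subr0.
have mS n : measurable_fun O (S n).
  rewrite (_ : S n = (fun x => step (aff (sc n.+1%:R 0 l) x))).
    by apply: mP; exact: smooth_step.
  by apply/funext => x; rewrite aff_sc subr0.
have mE n : measurable_fun O (E n).
  apply: measurable_funM; first exact: measurable_funM.
  by apply: measurable_funD; apply: measurable_funM => //; apply: measurable_funB; exact: mP.
have mu_ n : measurable_fun O (u n).
  apply: measurable_funD => //; apply: measurable_funD; apply: measurable_funM => //.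
  exact: measurable_funB.
have iG : mu.-integrable O (EFin \o (fun x => K * (`|v x| + `|g1 x| + `|g2 x|))).
  have ia w : L2 O w -> mu.-integrable O (EFin \o (fun x => `|w x|)).
    by move=> w2; exact: (integrable_norm (ip_cst_int mO fO w2)).
  have k1 := integrableD mO (integrableD mO (ia _ v2) (ia _ g12)) (ia _ g22).
  have := integrableZl mO K k1; congr (_.-integrable _ _).
split.
  have [K' K'0 HK'] := bounds.
  have iG' : mu.-integrable O (EFin \o (fun x => K' * (`|v x| + `|g1 x| + `|g2 x|))).
    have ia w : L2 O w -> mu.-integrable O (EFin \o (fun x => `|w x|)).
      by move=> w2; exact: (integrable_norm (ip_cst_int mO fO w2)).
    have k1 := integrableD mO (integrableD mO (ia _ v2) (ia _ g12)) (ia _ g22).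
    have := integrableZl mO K' k1; congr (_.-integrable _ _).
  apply: (le_integrable mO _ _ iG') => [|x Ox]; first exact/measurable_EFinP.
  have [k1 k2 [k3 k4 k5 k6]] := HK' _ Ox; rewrite /= lee_fin.
  have G0 : 0 <= K' * (`|v x| + `|g1 x| + `|g2 x|) by rewrite mulr_ge0// addr_ge0// addr_ge0.
  rewrite [leRHS]ger0_norm// /chi indicE; case: (x \in _).
    by rewrite mul1r subrr mul0r addr0; exact: AC_le.
  by rewrite mul0r subr0 mul1r add0r; exact: AC_le.
have cv : \int[mu]_(x in O) u n x @[n --> \oo] --> \int[mu]_(x in O) (chi x * A x + (1 - chi x) * C x).
  apply: (Rintegral_dct mO mu_ mlim _ iG) => //.
  apply: (ae_null (measurable_aff_eq0 l) (mu_line0 l0)) => x lx Ox.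
  have -> : chi x * A x + (1 - chi x) * C x = v x * 0 + chi x * (A x - C x) + C x by ring.
  have chiE : chi x = if 0 < aff l x then 1 else 0.
    rewrite /chi indicE; case: ifPn => h; first by rewrite mem_set.
    by rewrite memNset// => h'; move: h; rewrite h'.
  apply: cvgD; last exact: cvg_cst.
  apply: cvgD; apply: cvgM; try exact: cvg_cst; last first.
    rewrite chiE; have := @cvg_step R (aff l x); rewrite -cvg_shiftS; exact.
  have [n0|n0|n0] := ltgtP (aff l x) 0; last by [].
    apply: cvg_near_cst; apply: nearW => n; rewrite /E step'_le0 ?mulr0 ?mul0r//.
    by rewrite pmulr_rlt0.
  apply: cvg_near_cst; near=> n; rewrite /E step'_ge1 ?mulr0 ?mul0r//.
  rewrite -ltr_pdivrMr// mul1r; apply: (@lt_trans _ _ n%:R); last by rewrite ltr_nat.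
  by near: n; exact: nbhs_infty_gtr.
have c0 : \int[mu]_(x in O) u n x @[n --> \oo] --> (0 : R).
  rewrite (_ : (fun n => _) = cst 0); [exact: cvg_cst|exact/funext].
exact: (cvg_unique _ cv c0).
Unshelve. all: by end_near. Qed.

End FluxAcrossLine.

Section CutoffField.
Variable R : realType.
Notation mu := (leb2 R).
Notation mpt := (measurableTypeR R * measurableTypeR R)%type.
Implicit Types (a b c x : pt R) (n : R).

(* Although the derivatives of the cut-off are of order [n], the
   divergence of [eta *: (x - c)] is bounded uniformly in [n], because the
   derivative of [aff l] in the direction [x - c] is [aff l x] if [aff l c = 0]. *)
Definition eta n a b c x : R := step (n * aff (bary b c a) x - 1) * step (n * aff (bary c a b) x - 1).

(** The derivative of [eta] in the direction [x - c]; [div_cutfield] is the product rule with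
    [div (x - c) = 2]. *)
Definition psi n a b c x : R :=
  n * aff (bary b c a) x * @step' R (n * aff (bary b c a) x - 1) * step (n * aff (bary c a b) x - 1) +
  step (n * aff (bary b c a) x - 1) * (n * aff (bary c a b) x * @step' R (n * aff (bary c a b) x - 1)).

Lemma etaE n a b c : eta n a b c = (fun x => step (aff (sc n 1 (bary b c a)) x) * step (aff (sc n 1 (bary c a b)) x)).
Proof. by apply/funext => x; rewrite /eta !aff_sc. Qed.

Lemma smooth_eta n a b c : smooth (eta n a b c).
Proof. by rewrite etaE; apply: smoothM; exact: smooth_step. Qed.

Lemma cx1E c : cx1 c = aff (- c.1, 1, 0).
Proof. by apply/funext => x; rewrite /cx1 /aff /=; ring. Qed.

Lemma cx2E c : cx2 c = aff (- c.2, 0, 1).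
Proof. by apply/funext => x; rewrite /cx2 /aff /=; ring. Qed.

Lemma smooth_cx c : smooth (cx1 c) /\ smooth (cx2 c).
Proof. by rewrite cx1E cx2E; split; exact: smooth_aff. Qed.

Definition cutfield n a b c (X : pt R -> R) : pt R -> R := fun x => eta n a b c x * X x.

Lemma smooth_cutfield n a b c X : smooth X -> smooth (cutfield n a b c X).
Proof. by move=> sX; apply: smoothM => //; exact: smooth_eta. Qed.

Lemma div_cutfield n a b c x :
  d1 (cutfield n a b c (cx1 c)) x + d2 (cutfield n a b c (cx2 c)) x = 2 * eta n a b c x + psi n a b c x.
Proof.
have [s1 s2] := smooth_cx c; have se := smooth_eta n a b c.
rewrite /cutfield d1M// d2M// cx1E cx2E d1_aff d2_aff -cx1E -cx2E etaE.
have ss l := @smooth_step R l.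
have sE l : ((sc n 1 l).1.2 = n * l.1.2) * ((sc n 1 l).2 = n * l.2) by [].
rewrite d1M// d2M// !d1_step !d2_step !sE /psi !aff_sc.
have la : (bary b c a).1.2 * cx1 c x + (bary b c a).2 * cx2 c x = aff (bary b c a) x.
  by rewrite -[RHS]subr0 -[X in _ - X](bary_b b c a) /aff /cx1 /cx2; ring.
have lb : (bary c a b).1.2 * cx1 c x + (bary c a b).2 * cx2 c x = aff (bary c a b) x.
  by rewrite -[RHS]subr0 -[X in _ - X](bary_a c a b) /aff /cx1 /cx2; ring.
move: la lb; move: (aff (bary b c a) x) (aff (bary c a b) x) => L L' la lb.
move: (step (n * L - 1)) (@step' R (n * L - 1)) (step (n * L' - 1)) (@step' R (n * L' - 1)) => t1 t2 t3 t4.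
rewrite -la -lb.
move: (cx1 c x) (cx2 c x) (bary b c a).1.2 (bary b c a).2 (bary c a b).1.2 (bary c a b).2 => *.
rewrite /=; ring.
Qed.

Lemma eta_ge0 n a b c x : 0 <= eta n a b c x.
Proof. by rewrite mulr_ge0 ?step_ge0. Qed.

Lemma eta_le1 n a b c x : eta n a b c x <= 1.
Proof. by rewrite mulr_ile1 ?step_ge0 ?step_le1. Qed.

(** [step' (t - 1)] lives on [1 <= t <= 2], so [t * step' (t - 1)] is at most [2 * M] at every scale
    [n], and [psi] has two such terms. *)
Lemma psi_bounded : exists2 M : R, 0 < M & forall n a b c x, `|psi n a b c x| <= M.
Proof.
have [M M0 HM] := @step'_bounded R; exists (4 * M) => [|n a b c x]; first by rewrite mulr_gt0.
have key (t s : R) : 0 <= s -> s <= 1 -> `|t * @step' R (t - 1) * s| <= 2 * M.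
  move=> s0 s1; rewrite normrM (ger0_norm s0); apply: (@le_trans _ _ (`|t * @step' R (t - 1)|)).
    by rewrite ler_piMr.
  have [t2|t2] := ltP 1 (t - 1); first by rewrite step'_ge1// mulr0 normr0 mulr_ge0// ltW.
  have [t1|t1] := ltP (t - 1) 0; first by rewrite step'_le0// mulr0 normr0 mulr_ge0// ltW.
  by rewrite normrM; apply: ler_pM => //; rewrite ger0_norm; lra.
rewrite /psi (_ : 4 * M = 2 * M + 2 * M); last by ring.
apply: (le_trans (ler_normD _ _)); apply: lerD; last rewrite mulrC; apply: key; rewrite ?step_ge0 ?step_le1//.
Qed.

(** Inside the triangle both coordinates are positive, so [eta] is eventually 1 and [psi] eventually
    0. The uniform bound on [psi] provides domination although the gradient of [eta] blows up. *)
Lemma tri_limit a b c v g1 g2 : det a b c != 0 -> L2 (tri a b c) v -> L2 (tri a b c) g1 -> L2 (tri a b c) g2 ->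
  \int[mu]_(x in tri a b c) (v x * (2 * eta n.+1%:R a b c x + psi n.+1%:R a b c x) +
     g1 x * cutfield n.+1%:R a b c (cx1 c) x + g2 x * cutfield n.+1%:R a b c (cx2 c) x) @[n --> \oo]
  --> moment a b c v g1 g2.
Proof.
move=> d0 v2 g12 g22; set U := tri a b c.
have mU : measurable (U : set mpt) := measurable_poly _.
have fU : (mu U < +oo)%E := mu_tri_fin d0.
have [mv _] := v2; have [mg1 _] := g12; have [mg2 _] := g22.
have [x1 x2] := @L2_cx R a b c d0 c; have [mx1 _] := x1; have [mx2 _] := x2.
have mP (f : pt R -> R) : smooth f -> measurable_fun U f.
  by move=> sf; apply: measurable_funTS; apply: continuous_measurable2; exact: smooth_cont.
have i1 := ip_cst_int mU fU v2.
have i2 := L2_mul_int mU g12 x1; have i3 := L2_mul_int mU g22 x2.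
have -> : moment a b c v g1 g2 = \int[mu]_(x in U) (2 * v x + g1 x * cx1 c x + g2 x * cx2 c x).
  have i12 : mu.-integrable U (EFin \o (fun x => 2 * v x)) by exact: (integrableZl mU 2 i1).
  rewrite RintegralD//; last exact: (integrableD mU i12 i2).
  rewrite RintegralD// RintegralZl// /moment.
  congr (2 * _ + _ + _); rewrite /ip -/U; congr fine; apply: eq_integral => x _; by rewrite mulr1.
have [M M0 HM] := psi_bounded.
have [K [k1 k2]] : exists K, (forall x, U x -> `|cx1 c x| <= K) /\ (forall x, U x -> `|cx2 c x| <= K).
  have hc : hull (a, b, c) c by apply: vertex_hull; rewrite !inE eqxx !orbT.
  by exists (hK (a, b, c)); split => x Ux; have [] := cx_le d0 hc Ux.
have ia w : L2 U w -> mu.-integrable U (EFin \o (fun x => `|w x|)).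
  by move=> w2; exact: (integrable_norm (ip_cst_int mU fU w2)).
have iG : mu.-integrable U (EFin \o (fun x => (2 + M) * `|v x| + `|K| * `|g1 x| + `|K| * `|g2 x|)).
  have j1 := integrableZl mU (2 + M) (ia _ v2); have j2 := integrableZl mU `|K| (ia _ g12).
  have j3 := integrableZl mU `|K| (ia _ g22).
  have := integrableD mU (integrableD mU j1 j2) j3; congr (_.-integrable _ _).
apply: (Rintegral_dct mU _ _ _ iG).
- move=> n; have [s1 s2] := smooth_cx c.
  apply: measurable_funD; [apply: measurable_funD|]; apply: measurable_funM => //.
  + rewrite (_ : (fun x => _) = (fun x => d1 (cutfield n.+1%:R a b c (cx1 c)) x + d2 (cutfield n.+1%:R a b c (cx2 c)) x)).
      by apply: measurable_funD; apply: mP; [apply: smooth_d1|apply: smooth_d2]; exact: smooth_cutfield.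
    by apply/funext => x; rewrite div_cutfield.
  + by apply: mP; exact: smooth_cutfield.
  + by apply: mP; exact: smooth_cutfield.
- by apply: measurable_funD; [apply: measurable_funD|]; apply: measurable_funM.
- apply: ae_all => x /triP[_ la lb].
  apply: cvg_near_cst; near=> n.
  have ha : 2 < n.+1%:R * aff (bary b c a) x.
    rewrite -ltr_pdivrMr//; apply: (@lt_trans _ _ n%:R); last by rewrite ltr_nat.
    by near: n; exact: nbhs_infty_gtr.
  have hb : 2 < n.+1%:R * aff (bary c a b) x.
    rewrite -ltr_pdivrMr//; apply: (@lt_trans _ _ n%:R); last by rewrite ltr_nat.
    by near: n; exact: nbhs_infty_gtr.
  have [h1 h2] : 1 < n.+1%:R * aff (bary b c a) x - 1 /\ 1 < n.+1%:R * aff (bary c a b) x - 1.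
    by split; lra.
  rewrite /cutfield /psi /eta (step_ge1 (ltW h1)) (step_ge1 (ltW h2)) (step'_ge1 h1) (step'_ge1 h2).
  ring.
- move=> n x Ux.
  apply: (le_trans (ler_normD _ _)); apply: lerD; [apply: (le_trans (ler_normD _ _)); apply: lerD|].
  + rewrite normrM mulrC; apply: ler_wpM2r => //; apply: (le_trans (ler_normD _ _)).
    apply: lerD => //; rewrite normrM !ger0_norm ?eta_ge0//.
    by have := eta_le1 n.+1%:R a b c x; lra.
  + rewrite normrM mulrC; apply: ler_wpM2r => //; rewrite normrM ger0_norm ?eta_ge0//.
    apply: (@le_trans _ _ (`|cx1 c x|)); first by rewrite ler_piMl// eta_le1.
    exact: (le_trans (k1 _ Ux) (ler_norm _)).
  + rewrite normrM mulrC; apply: ler_wpM2r => //; rewrite normrM ger0_norm ?eta_ge0//.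
    apply: (@le_trans _ _ (`|cx2 c x|)); first by rewrite ler_piMl// eta_le1.
    exact: (le_trans (k2 _ Ux) (ler_norm _)).
Unshelve. all: by end_near. Qed.

End CutoffField.

(** * Equality of the fluxes seen from the two sides of an edge *)

Section FluxMatch.
Variable R : realType.
Notation mu := (leb2 R).
Notation mpt := (measurableTypeR R * measurableTypeR R)%type.

Lemma step_lip : exists2 M : R, 0 < M & forall s t : R, `|step s - step t| <= M * `|s - t|.
Proof.
have [M M0 HM] := @step'_bounded R; exists M => // s t.
have [c _ E] := MVT_ball t (s - t) (@step_derive R).
by move: E; rewrite subrKC => ->; rewrite normrM ler_wpM2r.
Qed.

Lemma d1Z (k : R) (f : pt R -> R) x : smooth f -> d1 (fun x => k * f x) x = k * d1 f x.
Proof.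
move=> sf; have := d1M x (smooth_cst k) sf; rewrite d1_cst mul0r add0r; exact.
Qed.

Lemma d2Z (k : R) (f : pt R -> R) x : smooth f -> d2 (fun x => k * f x) x = k * d2 f x.
Proof.
move=> sf; have := d2M x (smooth_cst k) sf; rewrite d2_cst mul0r add0r; exact.
Qed.

Lemma aff_interp (l : R * R * R) (a b c x : pt R) : det a b c != 0 -> aff l x =
  aff (bary a b c) x * aff l c + aff (bary b c a) x * aff l a + aff (bary c a b) x * aff l b.
Proof. by move=> d0; rewrite {1}(bary_comb x d0) aff_comb// bary_sum. Qed.

(** The numerator of [bary a b c]. It does not involve the third vertex, hence is common to the
    triangles on both sides of the edge. *)
Definition lin (a b : pt R) : R * R * R :=
  ((b.2 - a.2) * a.1 - (b.1 - a.1) * a.2, - (b.2 - a.2), b.1 - a.1).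

Lemma aff_lin a b x : aff (lin a b) x = det a b x.
Proof. by rewrite /aff /lin /det /=; ring. Qed.

Variables a b c c' : pt R.
Hypotheses (D0 : 0 < det a b c) (D'0 : 0 < det b a c').

Let dn : det a b c != 0. Proof. by rewrite gt_eqF. Qed.
Let dn' : det b a c' != 0. Proof. by rewrite gt_eqF. Qed.

(** The intersection of the half-planes given by the four outer edges, an open neighbourhood of the
    open common edge. It fills the gap between the two open triangles and so makes [patch] a
    legitimate domain for test functions. *)
Definition bridge : set (pt R) := poly [:: bary b c a; bary c a b; bary a c' b; bary c' b a].
Definition patch : set (pt R) := tri a b c `|` (tri b a c' `|` bridge).

Lemma bridgeP x : bridge x <-> [/\ 0 < aff (bary b c a) x, 0 < aff (bary c a b) x,
  0 < aff (bary a c' b) x & 0 < aff (bary c' b a) x].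
Proof.
rewrite /bridge /poly /= andbT; split; first by case/and4P.
by case=> *; apply/and4P; split.
Qed.

Lemma open_patch : open patch.
Proof. by apply: openU; [|apply: openU]; exact: open_poly. Qed.

Let lin_tri x : tri a b c x -> 0 < det a b x.
Proof. by move=> /triP[+ _ _]; rewrite aff_bary pmulr_lgt0// invr_gt0. Qed.

Let lin_tri' x : tri b a c' x -> det a b x < 0.
Proof. by move=> /triP[+ _ _]; rewrite aff_bary pmulr_lgt0 ?invr_gt0// detN oppr_gt0. Qed.

Lemma bridge_hull : bridge `<=` hull (a, b, c) `|` hull (b, a, c').
Proof.
move=> x /bridgeP[h1 h2 h3 h4]; rewrite !hullE//.
have [h|h] := leP 0 (det a b x); [left|right]; split; try exact: ltW; rewrite aff_bary.
  by rewrite divr_ge0// ltW.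
by rewrite divr_ge0 ?ltW// detN oppr_gt0.
Qed.

Lemma patch_hull : patch `<=` hull (a, b, c) `|` hull (b, a, c').
Proof.
by move=> x [/tri_hull|[/tri_hull|/bridge_hull]] h; [left|right|]; try exact: h; apply: h.
Qed.

Lemma bounded_patch : bounded_set patch.
Proof.
have [M HM] := ctri_sub_box dn; have [M' HM'] := ctri_sub_box dn'.
apply: (bounded_setS _ (bounded_box (Num.max M M'))) => x /patch_hull; rewrite !hullE//.
have bm N : N <= Num.max M M' -> box N `<=` (box (Num.max M M') : set (pt R)).
  move=> hN y [/=]; rewrite !in_itv/= => /andP[p q] /andP[r s].
  by split; rewrite /= in_itv/=; apply/andP; split; lra.
by case=> [/HM|/HM']; apply: bm; rewrite le_max lexx ?orbT.
Qed.

Lemma patch_cover x : patch x -> ~ line0 (lin a b) x ->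
  (0 < det a b x /\ tri a b c x) \/ (det a b x < 0 /\ tri b a c' x).
Proof.
move=> px; rewrite /line0/= aff_lin => l0.
case: px => [h|[h|/bridgeP[h1 h2 h3 h4]]]; [by left; split; [exact: lin_tri|]|by right; split; [exact: lin_tri'|]|].
have [n0|n0|//] := ltgtP (det a b x) 0.
  by right; split => //; apply/triP; split => //; rewrite aff_bary divr_gt0// detN oppr_gt0.
by left; split => //; apply/triP; split => //; rewrite aff_bary divr_gt0.
Qed.

Let ka := aff (bary c' b a) c.
Let kb := aff (bary a c' b) c.

(** The coordinates of [a] in the two triangles agree on the line through [a] and [b], so they
    differ by a multiple of [det a b x]; evaluating at [c] identifies [ka]. *)
Let jump_a x : aff (bary c' b a) x = det a b x / det a b c * ka + aff (bary b c a) x.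
Proof.
have [e1 e2] := det_rot_neq0 dn'.
rewrite (aff_interp (bary c' b a) x dn) aff_bary bary_c// bary_b mulr0 addr0 mulr1 //.
Qed.

Let jump_b x : aff (bary a c' b) x = det a b x / det a b c * kb + aff (bary c a b) x.
Proof.
have [e1 e2] := det_rot_neq0 dn'.
rewrite (aff_interp (bary a c' b) x dn) aff_bary bary_c// bary_a mulr0 addr0 mulr1 //.
Qed.

Section FixedScale.
Variable n : R.
Hypothesis n0 : 0 < n.

(** Steepness of the transition: on the strip [0 <= M * det a b x <= 1] the coordinates with respect
    to the two triangles differ by less than [1 / n], so the support of the second cut-off does not
    leave [bridge]. *)
Let M : R := n * (1 + (`|ka| + `|kb|) / det a b c).
Let M0 : 0 < M.
Proof.
have k0 : 0 <= (`|ka| + `|kb|) / det a b c by apply: divr_ge0; [exact: addr_ge0|exact: ltW].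
by rewrite /M; apply: mulr_gt0 => //; apply: (lt_le_trans ltr01); rewrite lerDl.
Qed.

Let l := sc M 0 (lin a b).
Let lE x : aff l x = M * det a b x. Proof. by rewrite aff_sc aff_lin subr0. Qed.

(** Up to the cut-off, the fields [(x - c) / det a b c] and [- (x - c') / det b a c'] have the same
    normal component on the line through [a] and [b]; this is what the normalising factors and the
    sign of [Q] are for. *)
Let P (X : pt R -> pt R -> R) x := (det a b c)^-1 * cutfield n a b c (X c) x.
Let Q (X : pt R -> pt R -> R) x := (det b a c')^-1 * - cutfield n b a c' (X c') x.

(** [C1] carries the part of the blend coming from [P] and [C2] the part from [Q]; the latter
    reaches across the line by the width of the transition strip. *)
Let C1 : set (pt R) := [set x | 0 <= aff (lin a b) x] `&`
  ([set x | n^-1 <= aff (bary b c a) x] `&` [set x | n^-1 <= aff (bary c a b) x]).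
Let C2 : set (pt R) := [set x | 0 <= aff (sc (- M) (-1) (lin a b)) x] `&`
  ([set x | n^-1 <= aff (bary a c' b) x] `&` [set x | n^-1 <= aff (bary c' b a) x]).

Let C12_patch : C1 `|` C2 `<=` patch.
Proof.
have ni : 0 < n^-1 by rewrite invr_gt0.
move=> x; rewrite /C1 /C2 /= aff_sc aff_lin opprK => -[[h1 [h2 h3]]|[h1 [h2 h3]]].
  have h2' := lt_le_trans ni h2; have h3' := lt_le_trans ni h3.
  have [h|h] := ltP 0 (det a b x).
    by left; apply/triP; split => //; rewrite aff_bary divr_gt0.
  have e0 : det a b x = 0 by apply/eqP; rewrite eq_le h h1.
  right; right; apply/bridgeP; split => //; first by rewrite jump_b e0 !mul0r add0r.
  by rewrite jump_a e0 !mul0r add0r.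
have h2' := lt_le_trans ni h2; have h3' := lt_le_trans ni h3.
have [h|h] := ltP (det a b x) 0.
  right; left; apply/triP; split => //; rewrite aff_bary divr_gt0// detN oppr_gt0//.
have small k : `|k| <= `|ka| + `|kb| -> det a b x / det a b c * k < n^-1.
  move=> hk; apply: (le_lt_trans (ler_norm _)); rewrite normrM ger0_norm; last first.
    by rewrite divr_ge0// ltW.
  rewrite -(ltr_pM2r M0) {2}/M mulKf ?gt_eqF//.
  apply: (@le_lt_trans _ _ (`|k| / det a b c)); last first.
    by rewrite (le_lt_trans (y := (`|ka| + `|kb|) / det a b c))// ?ltrDr// ler_pM2r// invr_gt0.
  have -> : det a b x / det a b c * `|k| * M = (M * det a b x) * (`|k| / det a b c) by ring.
  by rewrite ler_piMl ?divr_ge0 ?(ltW D0)//; move: h1; rewrite mulNr addrC subr_ge0.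
right; right; apply/bridgeP; split => //.
  have := small ka; rewrite lerDl => /(_ (normr_ge0 _)); move: h3; rewrite jump_a; lra.
have := small kb; rewrite lerDr => /(_ (normr_ge0 _)); move: h2; rewrite jump_b; lra.
Qed.

Let compact_C : compact (C1 `|` C2).
Proof.
have [N HN] := bounded_sub_box bounded_patch.
apply: (subclosed_compact _ (@compact_box R N)); last first.
  by move=> x /C12_patch /HN.
by apply: closedU; (apply: closedI; [|apply: closedI]); exact: closed_aff_ge.
Qed.

Let eta_supp p q r x : eta n p q r x != 0 -> n^-1 <= aff (bary q r p) x /\ n^-1 <= aff (bary r p q) x.
Proof.
rewrite /eta mulf_eq0 negb_or => /andP[/step_gt0 h1 /step_gt0 h2].
by split; rewrite -[leLHS]mul1r ler_pdivrMr// mulrC ltW// -subr_gt0.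
Qed.

Let smPQ X : (forall z, smooth (X z)) -> smooth (P X) /\ smooth (Q X).
Proof.
move=> sX; split; apply: smoothM; try exact: smooth_cst; first exact: smooth_cutfield.
rewrite (_ : (fun x => _) = (fun x => (-1) * cutfield n b a c' (X c') x)).
  by apply: smoothM; [exact: smooth_cst|exact: smooth_cutfield].
by apply/funext => x; rewrite mulN1r.
Qed.

Let test_blend X (m : R) : (forall z, smooth (X z)) -> 1 <= m -> test_fun patch (blend m l (P X) (Q X)).
Proof.
move=> sX m1; have [sP sQ] := smPQ sX; have m0 := lt_le_trans ltr01 m1.
apply: (test_funP _ compact_C C12_patch); first exact: smooth_blend.
move=> x; rewrite /blend aff_sc lE subr0.
set s := step _ => h.
have : (s * P X x != 0) || ((1 - s) * Q X x != 0).
  rewrite -negb_and; apply: contraNN h => /andP[/eqP e1 /eqP e2].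
  by rewrite mulrBr e1; move: e2; rewrite mulrBl mul1r => e2; rewrite sub0r addrC e2.
case/orP => h'; [left|right].
- have hs : 0 < m * (M * det a b x).
    by apply: step_gt0; apply: contraNneq h'; rewrite -/s => ->; rewrite mul0r.
  have /eta_supp[h1 h2] : eta n a b c x != 0.
    by apply: contraNneq h'; rewrite /P /cutfield => ->; rewrite mul0r !mulr0.
  by split; [rewrite /= aff_lin; move: hs; rewrite pmulr_rgt0// pmulr_rgt0// => /ltW|split].
- have hs : 1 - s != 0 by apply: contraNneq h' => ->; rewrite mul0r.
  have /eta_supp[h1 h2] : eta n b a c' x != 0.
    by apply: contraNneq h'; rewrite /Q /cutfield => ->; rewrite mul0r oppr0 !mulr0.
  split; last by split.
  rewrite /= aff_sc aff_lin opprK.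
  have : m * (M * det a b x) < 1.
    by rewrite ltNge; apply: contra hs => hs; rewrite /s step_ge1// subrr.
  have [p|p] := leP (M * det a b x) 0; first by lra.
  by move=> h3; have : M * det a b x <= m * (M * det a b x) by [rewrite ler_peMl// ltW]; lra.
Qed.

(** The cut-offs coincide on the line because the coordinates do, and [step] is Lipschitz. *)
Let eta_jump : exists2 B : R, 0 <= B & forall x, `|eta n b a c' x - eta n a b c x| <= B * `|det a b x|.
Proof.
have [K K0 HK] := step_lip.
exists (K * n * ((`|ka| + `|kb|) / det a b c)).
  apply: mulr_ge0; first by rewrite mulr_ge0 // ltW.
  by apply: divr_ge0; [exact: addr_ge0|exact: ltW].
move=> x; rewrite /eta.
have ja := HK (n * aff (bary c' b a) x - 1) (n * aff (bary b c a) x - 1).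
have jb := HK (n * aff (bary a c' b) x - 1) (n * aff (bary c a b) x - 1).
have ea : n * aff (bary c' b a) x - 1 - (n * aff (bary b c a) x - 1) = n * (det a b x / det a b c * ka).
  by rewrite jump_a; ring.
have eb : n * aff (bary a c' b) x - 1 - (n * aff (bary c a b) x - 1) = n * (det a b x / det a b c * kb).
  by rewrite jump_b; ring.
rewrite ea in ja; rewrite eb in jb.
have nk k : `|n * (det a b x / det a b c * k)| = n * (`|k| / det a b c) * `|det a b x|.
  by rewrite !normrM normfV (gtr0_norm n0) (gtr0_norm D0); ring.
rewrite nk in ja; rewrite nk in jb.
set s1 := step _ in jb *; set s2 := step _ in ja *; set t1 := step _ in ja *; set t2 := step _ in jb *.
have -> : s1 * s2 - t1 * t2 = (s1 - t2) * s2 + t2 * (s2 - t1) by ring.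
apply: (le_trans (ler_normD _ _)).
apply: (@le_trans _ _ (K * (n * (`|kb| / det a b c) * `|det a b x|) + K * (n * (`|ka| / det a b c) * `|det a b x|))).
  apply: lerD; rewrite normrM.
    by apply: le_trans jb; rewrite ler_piMr// ger0_norm ?step_ge0 ?step_le1.
  by apply: le_trans ja; rewrite ler_piMl// ger0_norm ?step_ge0 ?step_le1.
by rewrite le_eqVlt; apply/orP; left; apply/eqP; ring.
Qed.

(** Along the gradient of [lin a b], [x - c] gives [det a b x - det a b c] and [x - c'] gives
    [det a b x + det b a c']. The constant parts leave only the difference of the cut-offs; the rest
    carries a factor [det a b x]. *)
Let jump : exists B, forall x, patch x ->
  `|l.1.2 * (P (@cx1 R) x - Q (@cx1 R) x) + l.2 * (P (@cx2 R) x - Q (@cx2 R) x)| <= B * `|aff l x|.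
Proof.
have [B B0 HB] := eta_jump.
exists ((det a b c)^-1 + (det b a c')^-1 + B) => x _.
have -> : l.1.2 * (P (@cx1 R) x - Q (@cx1 R) x) + l.2 * (P (@cx2 R) x - Q (@cx2 R) x) =
   M * (det a b x * (eta n a b c x / det a b c + eta n b a c' x / det b a c') +
     (eta n b a c' x - eta n a b c x)).
  move: dn dn'; rewrite /P /Q /cutfield /l /cx1 /cx2.
  move: (eta n a b c x) (eta n b a c' x) => e e'; rewrite /sc /lin /det /= => d1 d2.
  by field; rewrite d1 d2.
rewrite lE normrM [X in _ <= _ * X]normrM (gtr0_norm M0) [leRHS]mulrCA ler_pM2l//.
apply: (le_trans (ler_normD _ _)); rewrite [leRHS]mulrDl; apply: lerD => //.
rewrite normrM mulrC; apply: ler_wpM2r => //.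
apply: (le_trans (ler_normD _ _)); apply: lerD; rewrite ger0_norm ?divr_ge0 ?eta_ge0 ?(ltW D0) ?(ltW D'0)//.
  by rewrite ler_piMl ?invr_ge0 ?(ltW D0)// eta_le1.
by rewrite ler_piMl ?invr_ge0 ?(ltW D'0)// eta_le1.
Qed.

Let mpatch : measurable (patch : set mpt).
Proof. exact: open_measurable2 open_patch. Qed.

Let lin_neq0 : (l.1.2, l.2) <> (0, 0).
Proof.
rewrite /l /sc /lin /= => -[/eqP h1 /eqP h2]; move: dn; rewrite /det.
move: h1; rewrite mulf_eq0 (gt_eqF M0) oppr_eq0 => /eqP ->.
move: h2; rewrite mulf_eq0 (gt_eqF M0) => /eqP ->.
by rewrite !mul0r subrr eqxx.
Qed.

(** [flux_line] gives a zero integral over [patch], which splits over the two triangles as the line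
    is null; the minus sign in [Q] turns the zero sum into an equality. *)
Lemma flux_cutoff v g1 g2 : H1 patch v g1 g2 ->
  (det a b c)^-1 * \int[mu]_(x in tri a b c) (v x * (2 * eta n a b c x + psi n a b c x) +
     g1 x * cutfield n a b c (cx1 c) x + g2 x * cutfield n a b c (cx2 c) x) =
  (det b a c')^-1 * \int[mu]_(x in tri b a c') (v x * (2 * eta n b a c' x + psi n b a c' x) +
     g1 x * cutfield n b a c' (cx1 c') x + g2 x * cutfield n b a c' (cx2 c') x).
Proof.
move=> Hv; have [B HB] := jump.
have s1 z : smooth (@cx1 R z) := (smooth_cx z).1; have s2 z : smooth (@cx2 R z) := (smooth_cx z).2.
have [sP1 sQ1] := smPQ s1; have [sP2 sQ2] := smPQ s2.
have [fi] := flux_line mpatch bounded_patch lin_neq0 sP1 sP2 sQ1 sQ2 Hv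
  (fun m m1 => conj (test_blend s1 m1) (test_blend s2 m1)) HB.
set f := (X in EFin \o X) in fi *; rewrite -/f => f0.
have sE x : (0 < aff l x) = (0 < det a b x) by rewrite lE pmulr_rgt0.
have chiE x : \1_[set x0 | 0 < aff l x0] x = (0 < det a b x)%R%:R :> R.
  rewrite indicE; congr (_%:R); congr nat_of_bool; rewrite -sE.
  by apply/idP/idP; [rewrite inE|move=> h; rewrite inE].
have cs1 := smooth_cutfield n a b c (s1 c); have cs2 := smooth_cutfield n a b c (s2 c).
have cs1' := smooth_cutfield n b a c' (s1 c'); have cs2' := smooth_cutfield n b a c' (s2 c').
have QE X : Q X = (fun x => - (det b a c')^-1 * cutfield n b a c' (X c') x).
  by apply/funext => x; rewrite /Q mulrN mulNr.
have fK x : tri a b c x -> v x * (2 * eta n a b c x + psi n a b c x) +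
     g1 x * cutfield n a b c (cx1 c) x + g2 x * cutfield n a b c (cx2 c) x = det a b c * f x.
  move=> /lin_tri h; rewrite /f chiE h mul1r subrr mul0r addr0.
  rewrite (d1Z _ _ cs1) (d2Z _ _ cs2) -mulrDr div_cutfield /P.
  by move: (cutfield _ _ _ _ (cx1 c) x) (cutfield _ _ _ _ (cx2 c) x) => u1 u2; field.
have fL x : tri b a c' x -> v x * (2 * eta n b a c' x + psi n b a c' x) +
     g1 x * cutfield n b a c' (cx1 c') x + g2 x * cutfield n b a c' (cx2 c') x = - det b a c' * f x.
  move=> /lin_tri' h; rewrite /f chiE ltNge (ltW h) mul0r add0r subr0 mul1r !QE.
  rewrite (d1Z _ _ cs1') (d2Z _ _ cs2') -mulrDr div_cutfield.
  by move: (cutfield _ _ _ _ (cx1 c') x) (cutfield _ _ _ _ (cx2 c') x) => u1 u2; field.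
have mK : measurable (tri a b c : set mpt) := measurable_poly _.
have mL : measurable (tri b a c' : set mpt) := measurable_poly _.
have sK : tri a b c `<=` patch by move=> x; left.
have sL : tri b a c' `<=` patch by move=> x; right; left.
have iK : mu.-integrable (tri a b c) (EFin \o f) := integrableS mpatch mK sK fi.
have iL : mu.-integrable (tri b a c') (EFin \o f) := integrableS mpatch mL sL fi.
rewrite (@eq_Rintegral _ _ _ mu (tri a b c) (fun x => det a b c * f x)); last first.
  by move=> x; rewrite inE => /fK.
rewrite (@eq_Rintegral _ _ _ mu (tri b a c') (fun x => - det b a c' * f x)); last first.
  by move=> x; rewrite inE => /fL.
rewrite !RintegralZl// mulNr mulrN !mulKf//.
have := @Rintegral_partition R bool [:: true; false] (fun t => if t then tri a b c else tri b a c') _ f mpatch fi.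
rewrite big_cons big_cons big_nil addr0 f0 => H; apply/eqP; rewrite -subr_eq0 opprK H => [//| [] _ //|].
apply: (ae_null (measurable_aff_eq0 (lin a b)) _) => [|x lx px].
  apply: mu_line0 => -[/eqP h1 /eqP h2]; move: dn; rewrite /det.
  by move: h1; rewrite oppr_eq0 => /eqP ->; move: h2 => /eqP ->; rewrite !mul0r subrr eqxx.
rewrite big_cons big_cons big_nil addr0 !indicE.
case: (patch_cover px lx) => -[h hx].
  by rewrite mem_set// memNset ?addr0// => /lin_tri'; rewrite ltNge (ltW h).
by rewrite memNset ?mem_set ?add0r// => /lin_tri; rewrite ltNge (ltW h).
Qed.

End FixedScale.

Lemma flux_match v g1 g2 : H1 patch v g1 g2 ->
  moment a b c v g1 g2 / det a b c = moment b a c' v g1 g2 / det b a c'.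
Proof.
move=> Hv; have mpatch : measurable (patch : set mpt) := open_measurable2 open_patch.
have mK : measurable (tri a b c : set mpt) := measurable_poly _.
have mL : measurable (tri b a c' : set mpt) := measurable_poly _.
have sK : tri a b c `<=` patch by move=> x; left.
have sL : tri b a c' `<=` patch by move=> x; right; left.
have [k1 k2 k3 _ _] := H1S mpatch mK sK Hv; have [l1 l2 l3 _ _] := H1S mpatch mL sL Hv.
pose F (n : nat) := \int[mu]_(x in tri a b c) (v x * (2 * eta n.+1%:R a b c x + psi n.+1%:R a b c x) +
  g1 x * cutfield n.+1%:R a b c (cx1 c) x + g2 x * cutfield n.+1%:R a b c (cx2 c) x).
pose G (n : nat) := \int[mu]_(x in tri b a c') (v x * (2 * eta n.+1%:R b a c' x + psi n.+1%:R b a c' x) +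
  g1 x * cutfield n.+1%:R b a c' (cx1 c') x + g2 x * cutfield n.+1%:R b a c' (cx2 c') x).
have FG : (fun n => (det a b c)^-1 * F n) = (fun n => (det b a c')^-1 * G n).
  by apply/funext => n; exact: flux_cutoff.
have c1 : (det a b c)^-1 * F n @[n --> \oo] --> (det a b c)^-1 * moment a b c v g1 g2.
  by apply: cvgM; [exact: cvg_cst|exact: tri_limit].
have c2 : (det a b c)^-1 * F n @[n --> \oo] --> (det b a c')^-1 * moment b a c' v g1 g2.
  by rewrite FG; apply: cvgM; [exact: cvg_cst|exact: tri_limit].
rewrite [LHS]mulrC [RHS]mulrC; exact: (cvg_unique _ c1 c2).
Qed.

End FluxMatch.

(** * Edges on the boundary of the domain *)

Section BoundaryFlux.
Variable R : realType.
Notation mu := (leb2 R).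
Notation mpt := (measurableTypeR R * measurableTypeR R)%type.

Lemma ip_eq0l (U : set (pt R)) v w : (forall x, U x -> v x = 0) -> ip U v w = 0.
Proof.
move=> v0; rewrite /ip /Rintegral (@eq_integral _ _ _ mu U (cst 0%E)) ?integral0// => x.
by rewrite inE => /v0 ->; rewrite mul0r.
Qed.

Lemma H1_test (U V : set (pt R)) phi : measurable (U : set mpt) -> test_fun V phi ->
  H1 U phi (d1 phi) (d2 phi).
Proof.
move=> mU tp; have sp : smooth phi by case: tp.
split; [exact: test_L2 tp|exact: test_L2 (test_fun_d1 tp)|exact: test_L2 (test_fun_d2 tp)| |].
  by move=> psi; exact: ibp1.
by move=> psi; exact: ibp2.
Qed.

Lemma H1_one (U : set (pt R)) : measurable (U : set mpt) -> (mu U < +oo)%E ->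
  H1 U one (fun=> 0) (fun=> 0).
Proof.
move=> mU fU; have s1 : smooth (@one R) := smooth_cst 1.
split; [exact: L2_cst|exact: L2_cst|exact: L2_cst| |] => phi tp.
  by rewrite ibp1// ip_eq0l ?ip_eq0l// => x _; rewrite /one d1_cst.
by rewrite ibp2// ip_eq0l ?ip_eq0l// => x _; rewrite /one d2_cst.
Qed.

(** The tube lemma: compactness of the parameter interval makes the width of the free strip uniform
    along the segment. *)
Lemma compact_strip (S : set (pt R)) (p d e : pt R) : closed S ->
  (forall t : R, 0 <= t <= 1 -> ~ S (p + t *: d)) ->
  exists2 eps : R, 0 < eps & forall t s : R, 0 <= t <= 1 -> `|s| < eps -> ~ S (p + t *: d - s *: e).
Proof.
move=> cS hS; have := @segment_compact R 0 1; rewrite compact_near_coveringP => nc.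
have [|eps e0 He] := nc R (nbhs (0 : R)) (fun s t => ~ S (p + t *: d - s *: e)) _.
  move=> t; rewrite /= in_itv/= => tt; have oS := closed_openC cS.
  pose g (z : R * R) : pt R := p + z.1 *: d - z.2 *: e.
  have cg : {for (t, 0), continuous g}.
    apply: cvgB; last by apply: cvgZr_tmp; exact: cvg_snd.
    by apply: cvgD; [exact: cvg_cst|apply: cvgZr_tmp; exact: cvg_fst].
  have := cg (~` S); apply; rewrite /g /= scale0r subr0.
  by apply: open_nbhs_nbhs; split => //; exact: hS.
exists eps => // t s ht hs; apply: (He s) => /=; last by rewrite in_itv.
by rewrite sub0r normrN.
Qed.

(** A test function vanishes near such an edge, so the edge is treated as common to the given
    triangle and one on which the function is zero, and [flux_match] applies. *)
Lemma flux_boundary (Omega : set (pt R)) (a b c : pt R) phi : 0 < det a b c -> test_fun Omega phi ->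
  segment a b `&` Omega = set0 -> moment a b c phi (d1 phi) (d2 phi) = 0.
Proof.
move=> D0 tp ab; have [sp cp sO] := tp.
have cS : closed (supp phi) by exact: closed_closure.
have [|eps e0 He] := @compact_strip (supp phi) a (b - a) (c - a) cS.
  move=> t tt /sO Op; have : (segment a b `&` Omega) (a + t *: (b - a)).
    by split => //; exists t => //=; rewrite in_itv.
  by rewrite ab.
(* A thin triangle on the outer side of [[a, b]] misses the support of [phi]. *)
pose k := eps / 2; have k0 : 0 < k by rewrite divr_gt0.
pose c' : pt R := a - k *: (c - a).
have D' : 0 < det b a c'.
  have -> : det b a c' = k * det a b c by rewrite /det /c' /= /GRing.scale/=; ring.
  exact: mulr_gt0.
have dn' : det b a c' != 0 by rewrite gt_eqF.
have out x : tri b a c' x -> ~ supp phi x.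
  move=> /triP[h1 h2 h3]; have h4 := bary_sum x dn'; rewrite (bary_comb x dn').
  set r := aff (bary b a c') x in h1 h4 *; set s := aff (bary a c' b) x in h2 h4 *.
  set t := aff (bary c' b a) x in h3 h4 *.
  have -> : r *: c' + s *: b + t *: a = a + s *: (b - a) - (r * k) *: (c - a).
    have -> : t = 1 - r - s by lra.
    by apply: injective_projections; rewrite /c' /= /GRing.scale/=; ring.
  apply: He; first by lra.
  rewrite ger0_norm; last by rewrite mulr_ge0// ltW.
  apply: (@le_lt_trans _ _ k); first by rewrite ler_piMl ?(ltW k0)//; lra.
  by rewrite /k; lra.
have mp : measurable (patch a b c c' : set mpt) by apply: open_measurable2; exact: open_patch.
have := flux_match D0 D' (H1_test mp tp).
have -> : moment b a c' phi (d1 phi) (d2 phi) = 0.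
  rewrite /moment !ip_eq0l ?mulr0 ?addr0// => x /out h; [exact: d_near0|exact: d_near0|exact: supp0].
rewrite mul0r => /eqP; rewrite mulf_eq0 invr_eq0 (gt_eqF D0) orbF => /eqP; exact.
Qed.

End BoundaryFlux.

(** * Combinatorics of triangulations *)

Section Mesh.
Variable R : realType.
Notation mu := (leb2 R).
Notation mpt := (measurableTypeR R * measurableTypeR R)%type.
Implicit Types (K L : triangle R) (a b c x : pt R).

Definition triK K := tri K.1.1 K.1.2 K.2.
Definition detK K := det K.1.1 K.1.2 K.2.

Definition orient K : triangle R := if 0 < detK K then K else (K.1.2, K.1.1, K.2).

Lemma orient_det K : nondegenerate K -> 0 < detK (orient K).
Proof.
case: K => -[a b] c; rewrite /nondegenerate /orient /detK /= => d0.
have [h|h] := ltP 0 (det a b c) => //=.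
by rewrite detN oppr_gt0 lt_neqAle h andbT.
Qed.

Lemma orient_vertices K : vertices (orient K) =i vertices K.
Proof.
move=> x; rewrite /orient; case: ifP => // _; rewrite !inE /=.
by rewrite orbCA.
Qed.

Lemma orient_hull K : hull (orient K) = hull K.
Proof.
rewrite /orient; case: ifP => // _; apply/seteqP; split => x [r [s [t [r0 s0 t0 e ->]]]];
  exists s, r, t; split => //=; rewrite ?[s + r]addrC//; by rewrite [_ *: _ + _ in RHS]addrC.
Qed.

Lemma orient_hK K : hK (orient K) = hK K.
Proof. by rewrite /hK orient_hull. Qed.

Lemma orient_circumradius K : circumradius (orient K) = circumradius K.
Proof.
rewrite /circumradius; congr xget; apply/seteqP; split => r [z h]; exists z => x hx; apply: h.
  by rewrite orient_vertices.
by rewrite -orient_vertices.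
Qed.

(** A list may repeat a triangle, also with permuted vertices. Keeping one positively oriented
    representative of each hull makes sums over cells meaningful and lets neighbours traverse a
    common edge in opposite directions. *)
Lemma mesh_normal (T : seq (triangle R)) : (forall K, K \in T -> nondegenerate K) ->
  exists T' : seq (triangle R), [/\ uniq T',
    forall K, K \in T' -> 0 < detK K /\ exists2 L, L \in T & K = orient L,
    forall K L, K \in T' -> L \in T' -> hull K = hull L -> K = L &
    forall L, L \in T -> exists2 K, K \in T' & hull K = hull L].
Proof.
elim: T => [|K T ih] nT; first by exists [::]; split.
have [T' [u1 u2 u3 u4]] := ih (fun L LT => nT L (mem_behead (LT : L \in behead (K :: T)))).
have [[L LT' e]|no] := pselect (exists2 L, L \in T' & hull L = hull K).
  exists T'; split => // [L' /u2[d [M MT ->]]|L'].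
    by split; [exact: orient_det (nT _ (mem_behead (MT : M \in behead (K :: T))))|exists M; rewrite ?inE ?MT ?orbT].
  by rewrite inE => /predU1P[->|/u4//]; exists L.
exists (orient K :: T'); split => //.
- rewrite /= u1 andbT; apply/negP => h; apply: no; exists (orient K) => //; exact: orient_hull.
- move=> L; rewrite inE => /predU1P[->|/u2[d [M MT e]]].
    by split; [apply: orient_det; apply: nT; rewrite mem_head|exists K; rewrite ?mem_head].
  by split => //; exists M => //; rewrite inE MT orbT.
- move=> L M; rewrite !inE => /predU1P[->|LT] /predU1P[->|MT] //.
  + by rewrite orient_hull => e; case: no; exists M.
  + by rewrite orient_hull => e; case: no; exists L.
  + exact: u3.
- move=> L; rewrite inE => /predU1P[->|/u4[M MT e]].
    by exists (orient K); rewrite ?mem_head ?orient_hull.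
  by exists M => //; rewrite inE MT orbT.
Qed.

Lemma ae_seq (I : eqType) (s : seq I) (P : I -> pt R -> Prop) :
  (forall i, i \in s -> {ae mu, forall x, P i x}) -> {ae mu, forall x, forall i, i \in s -> P i x}.
Proof.
elim: s => [|i s ih] H; first by apply: ae_all.
have h1 := H i (mem_head _ _); have h2 := ih (fun j js => H j (mem_behead (js : j \in behead (i :: s)))).
by apply: ae_imp2 h1 h2 => x k1 k2 j; rewrite inE => /predU1P[->//|/k2].
Qed.

(* On an edge one of the three barycentric coordinates vanishes. *)
Lemma tri_vertex_segment a b c x y z : det a b c != 0 -> x \in vertices (a, b, c) ->
  y \in vertices (a, b, c) -> segment x y z -> ~ tri a b c z.
Proof.
move=> d0; have [d1 d2] := det_rot_neq0 d0; rewrite !inE => hx hy [t _ <-].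
suff [l [lx ly H]] : exists l : R * R * R, [/\ aff l x = 0, aff l y = 0 & forall w, tri a b c w -> 0 < aff l w].
  move=> /H; have -> : edge_at x y t = (1 - t) *: x + t *: y + 0 *: y.
    by apply: injective_projections; rewrite /edge_at /= /GRing.scale/=; ring.
  by rewrite aff_comb ?lx ?ly ?mulr0 ?addr0 ?ltxx//; ring.
have la : [/\ aff (bary b c a) b = 0, aff (bary b c a) c = 0 & forall w, tri a b c w -> 0 < aff (bary b c a) w].
  by split; [exact: bary_a|exact: bary_b|move=> w /triP[]].
have lb : [/\ aff (bary c a b) c = 0, aff (bary c a b) a = 0 & forall w, tri a b c w -> 0 < aff (bary c a b) w].
  by split; [exact: bary_a|exact: bary_b|move=> w /triP[]].
have lc : [/\ aff (bary a b c) a = 0, aff (bary a b c) b = 0 & forall w, tri a b c w -> 0 < aff (bary a b c) w].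
  by split; [exact: bary_a|exact: bary_b|move=> w /triP[]].
case: la lb lc => la1 la2 la3 [lb1 lb2 lb3] [lc1 lc2 lc3].
by case/or3P: hx => /eqP ->; case/or3P: hy => /eqP ->;
  by [exists (bary b c a); split|exists (bary c a b); split|exists (bary a b c); split].
Qed.

Lemma segment_xx x : segment x x x.
Proof.
by exists 0; [rewrite /= in_itv/= lexx ler01|rewrite /edge_at scale0r addr0].
Qed.

(** Serves to choose a point on an edge away from all mesh vertices. *)
Lemma real_avoid (s : seq R) (u v : R) : u < v -> exists t, [/\ u < t, t < v & t \notin s].
Proof.
elim: s u v => [|x s ih] u v uv.
  by exists ((u + v) / 2); split => //; lra.
have [xu|ux] := leP x u.
  by have [t [h1 h2 h3]] := ih u v uv; exists t; split => //; rewrite inE negb_or h3 gt_eqF// (le_lt_trans xu).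
have um : u < Num.min x v by rewrite lt_min ux uv.
have [t [h1 h2 h3]] := ih _ _ um.
exists t; move: h2; rewrite lt_min => /andP[h2 h4]; split => //.
by rewrite inE negb_or h3 lt_eqF.
Qed.

Section Triangulation.
Variables (Omega : set (pt R)) (T : seq (triangle R)).
Hypotheses (oO : open Omega) (regO : Omega = interior (closure Omega)).
Hypothesis pT : proper_triangulation Omega T.
Variable T' : seq (triangle R).
Hypotheses (uT' : uniq T')
  (T'T : forall K, K \in T' -> 0 < detK K /\ exists2 L, L \in T & K = orient L)
  (injT' : forall K L, K \in T' -> L \in T' -> hull K = hull L -> K = L)
  (TT' : forall L, L \in T -> exists2 K, K \in T' & hull K = hull L).

Lemma mesh_cover x : closure Omega x -> exists2 K, K \in T' & hull K x.
Proof.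
by case: pT => _ -> _ [L LT hx]; have [K KT e] := TT' LT; exists K; rewrite ?e.
Qed.

Lemma hull_closure K : K \in T' -> hull K `<=` closure Omega.
Proof.
move=> /T'T[_ [L LT ->]] x; rewrite orient_hull => hx.
by case: pT => _ -> _; exists L.
Qed.

(** The absence of slits enters here; it is what puts the open patch around a shared edge inside
    [Omega]. *)
Lemma open_sub_Omega (A : set (pt R)) : open A -> A `<=` closure Omega -> A `<=` Omega.
Proof. by move=> oA AO; rewrite regO -open_subsetE. Qed.

Lemma detK_neq0 K : K \in T' -> det K.1.1 K.1.2 K.2 != 0.
Proof. by case/T'T => d _; rewrite gt_eqF. Qed.

Lemma triK_hull K : K \in T' -> triK K `<=` hull K.
Proof. by move=> /detK_neq0; case: K => -[a b] c /= d0 x; exact: tri_hull. Qed.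

Lemma triK_Omega K : K \in T' -> triK K `<=` Omega.
Proof.
move=> KT; apply: open_sub_Omega; first exact: open_poly.
by move=> x /(triK_hull KT); exact: hull_closure.
Qed.

(** A common vertex is viewed as the degenerate segment with [x = y], which merges the cases of a
    proper triangulation. *)
Lemma mesh_meet K L : K \in T' -> L \in T' -> K != L -> forall z, hull K z -> hull L z ->
  exists x y, [/\ x \in vertices K /\ y \in vertices K, x \in vertices L /\ y \in vertices L,
    segment x y z & x = y \/ x != y].
Proof.
move=> KT LT KL z Kz Lz.
have [_ [K0 K0T eK]] := T'T KT; have [_ [L0 L0T eL]] := T'T LT.
have ne : hull K0 <> hull L0.
  move=> e; move: KL; rewrite (injT' KT LT) ?eqxx//.
  by rewrite eK eL !orient_hull.
move: Kz Lz; rewrite eK eL !orient_hull => Kz Lz.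
case: pT => _ _ /(_ _ _ K0T L0T ne)[e|[x [xK xL e]]|[x [y [xy [xK yK] [xL yL] e]]]].
- by have : (hull K0 `&` hull L0) z by []; rewrite e.
- have : (hull K0 `&` hull L0) z by []; rewrite e => ->.
  by exists x, x; rewrite !orient_vertices; split => //; [exact: segment_xx|left].
- have : (hull K0 `&` hull L0) z by []; rewrite e => sz.
  by exists x, y; rewrite !orient_vertices; split => //; right.
Qed.

Lemma triK_disjoint K L : K \in T' -> L \in T' -> K != L -> forall z, triK K z -> ~ hull L z.
Proof.
move=> KT LT KL z Kz Lz.
have [x [y [[xK yK] _ s _]]] := mesh_meet KT LT KL (triK_hull KT Kz) Lz.
move: (detK_neq0 KT) Kz xK yK; rewrite /triK; case: K KT KL => -[a b] c /= _ _ d0 Kz xK yK.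
exact: (tri_vertex_segment d0 xK yK s).
Qed.

(** The closed cells cover the domain, their boundaries lie on finitely many null lines, and a point
    of an open cell belongs to no other hull. *)
Lemma mesh_ae : {ae mu, forall x, Omega x -> \sum_(K <- T') \1_(triK K) x = 1 :> R}.
Proof.
have : {ae mu, forall x, forall K, K \in T' -> hull K x -> triK K x}.
  apply: ae_seq => K KT; have := ae_ctri_tri (detK_neq0 KT); apply: ae_imp => x h.
  by have := @hullE R K.1.1 K.1.2 K.2 (detK_neq0 KT); case: K h KT => -[a b] c /= h _ ->.
apply: ae_imp => x h Ox; have [K KT hx] := mesh_cover (subset_closure Ox).
rewrite (bigD1_seq K)//= indicE mem_set ?big1_seq ?addr0//; last exact: h.
move=> L /andP[LK LT]; rewrite indicE memNset// => Lx.
exact: (triK_disjoint LT KT LK Lx).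
Qed.

End Triangulation.
End Mesh.

(** * Oriented edges of the mesh and their partners *)

Section Flags.
Variable R : realType.
Notation mu := (leb2 R).
Implicit Types (K L : triangle R) (a b c x : pt R).

Lemma edge_facts K e : e \in edges K ->
  [/\ triK e = triK K, detK e = detK K, hull e = hull K & vertices e =i vertices K].
Proof.
case: K => -[a b] c; rewrite !inE /= => /or3P[] /eqP ->; rewrite /triK /detK /=.
- by split.
- by split; [exact: tri_rot|exact: detC|exact: hull_rot|move=> x; rewrite !inE orbA orbC].
- split; [by rewrite (tri_rot b c a) (tri_rot a b c)|exact: detC2| |].
    by rewrite (hull_rot b c a) (hull_rot a b c).
  by move=> x; rewrite !inE orbC orbA.
Qed.

Lemma det_distinct a b c : det a b c != 0 -> [/\ a != b, b != c & c != a].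
Proof.
by move=> d0; split; apply: contraNneq d0 => ->; rewrite /det ?subrr ?mul0r ?mulr0 ?subrr //;
  apply/eqP; ring.
Qed.

Lemma edge_of_vertices L a b : a != b -> a \in vertices L -> b \in vertices L ->
  exists c, (a, b, c) \in edges L \/ (b, a, c) \in edges L.
Proof.
case: L => -[u v] w ab; rewrite !inE /= => ha hb.
suff H : [\/ a = u /\ b = v \/ b = u /\ a = v, a = v /\ b = w \/ b = v /\ a = w |
   a = w /\ b = u \/ b = w /\ a = u].
  case: H => -[] [-> ->]; [exists w|exists w|exists u|exists u|exists v|exists v];
    [left|right|left|right|left|right]; by rewrite !inE eqxx ?orbT.
move: ab; case/or3P: ha => /eqP ->; case/or3P: hb => /eqP ->; rewrite ?eqxx // => _.
- by constructor 1; left.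
- by constructor 3; right.
- by constructor 1; right.
- by constructor 2; left.
- by constructor 3; left.
- by constructor 2; right.
Qed.

Lemma edge_inj K a b c c' : detK K != 0 -> (a, b, c) \in edges K -> (a, b, c') \in edges K -> c = c'.
Proof.
case: K => -[u v] w; rewrite /detK /= => /det_distinct[/eqP uv /eqP vw /eqP wu]; rewrite !inE /=.
by case/or3P => /eqP e; case/or3P => /eqP e'; congruence.
Qed.

Lemma uniq_edges K : detK K != 0 -> uniq (edges K).
Proof.
case: K => -[u v] w; rewrite /detK /= => /det_distinct[uv vw wu]; rewrite /= !inE !xpair_eqE.
by rewrite negb_or (negbTE uv) /= (eq_sym u w) (negbTE wu)/= (negbTE vw).
Qed.

Lemma uniq_flatten (I J : eqType) (s : seq I) (f : I -> seq J) : uniq s ->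
  (forall i, i \in s -> uniq (f i)) ->
  (forall i j, i \in s -> j \in s -> forall y : J, y \in f i -> y \in f j -> i = j) ->
  uniq (flatten (map f s)).
Proof.
elim: s => //= i s ih /andP[is_ us] uf inj; rewrite cat_uniq uf ?mem_head//=.
rewrite ih//; first last.
- by move=> j k js ks; apply: inj; rewrite inE ?js ?ks orbT.
- by move=> j js; apply: uf; rewrite inE js orbT.
rewrite andbT; apply/hasPn => x /flatten_mapP[j js xj]; apply/negP => /= xi.
move: is_; rewrite (inj i j (mem_head _ _) _ x xi xj) ?js// inE js orbT//.
Qed.

Lemma near_seq (I : eqType) (s : seq I) (p : pt R) (P : I -> set (pt R)) :
  (forall i, i \in s -> nbhs p (P i)) -> nbhs p [set x | forall i, i \in s -> P i x].
Proof.
elim: s => [|i s ih] H; first by apply: filterS (@filterT _ (nbhs p) _).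
have h1 := H i (mem_head _ _); have h2 := ih (fun j js => H j (mem_behead (js : j \in behead (i :: s)))).
by apply: filterS2 h1 h2 => x k1 k2 j; rewrite inE => /predU1P[->//|/k2].
Qed.

Lemma lt_sum4 (k1 k2 k3 k4 : R) : 0 <= k1 -> 0 <= k2 -> 0 <= k3 -> 0 <= k4 ->
  let k := 1 + k1 + k2 + k3 + k4 in 0 < k /\ [/\ k1 < k, k2 < k, k3 < k & k4 < k].
Proof. by move=> p1 p2 p3 p4 k; rewrite {}/k; split; [|split]; lra. Qed.

Lemma edge_atE a b c (t : R) : edge_at a b t = (1 - t) *: a + t *: b + 0 *: c.
Proof. by apply: injective_projections; rewrite /edge_at /= /GRing.scale/=; ring. Qed.

Lemma aff_edge (l : R * R * R) a b t : aff l (edge_at a b t) = (1 - t) * aff l a + t * aff l b.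
Proof. by rewrite (edge_atE a b 0) aff_comb ?mul0r ?addr0//; ring. Qed.

Lemma cont_ray (p d : pt R) (N : set (pt R)) (t0 : R) : nbhs (p + t0 *: d) N ->
  exists2 eps : R, 0 < eps & forall t, `|t - t0| < eps -> N (p + t *: d).
Proof.
move=> nN; have cg : {for t0, continuous (fun t : R => p + t *: d)}.
  by apply: cvgD; [exact: cvg_cst|apply: cvgZr_tmp; exact: cvg_id].
have /nbhs_ballP[eps e0 He] := cg _ nN.
by exists eps => // t ht; apply: He; rewrite /ball/= distrC.
Qed.

Section Mesh.
Variables (Omega : set (pt R)) (T : seq (triangle R)).
Hypotheses (oO : open Omega) (regO : Omega = interior (closure Omega)).
Hypothesis pT : proper_triangulation Omega T.
Variable T' : seq (triangle R).
Hypotheses (uT' : uniq T')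
  (T'T : forall K, K \in T' -> 0 < detK K /\ exists2 L, L \in T & K = orient L)
  (injT' : forall K L, K \in T' -> L \in T' -> hull K = hull L -> K = L)
  (TT' : forall L, L \in T -> exists2 K, K \in T' & hull K = hull L).

(** Oriented edges with their opposite vertex; by [flag_unique] the oriented edge alone determines
    the entry, so it can serve as a key for cancellation. *)
Definition flags : seq (triangle R) := flatten (map (@edges R) T').

Lemma closed_hull K : detK K != 0 -> closed (hull K).
Proof. by case: K => -[a b] c d0; rewrite hullE//; exact: closed_ctri. Qed.

(** Two positively oriented triangles on the same oriented edge lie on the same side of it, hence
    share a point [z] near its midpoint, while distinct cells are disjoint. *)
Lemma flag_unique K L a b c c' : K \in T' -> L \in T' -> (a, b, c) \in edges K ->
  (a, b, c') \in edges L -> K = L /\ c = c'.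
Proof.
move=> KT LT eK eL; have [dK _] := T'T KT; have [dL _] := T'T LT.
have [tK dK' _ _] := edge_facts eK; have [tL dL' hL _] := edge_facts eL.
have D0 : 0 < det a b c by rewrite -[det a b c]/(detK (a, b, c)) dK'.
have D0' : 0 < det a b c' by rewrite -[det a b c']/(detK (a, b, c')) dL'.
have n0 : det a b c != 0 by rewrite gt_eqF.
have n0' : det a b c' != 0 by rewrite gt_eqF.
have [KL|KL] := eqVneq K L.
  by split => //; move: eL; rewrite -KL; apply: edge_inj eK; rewrite gt_eqF.
have [r1 r2] := det_rot_neq0 n0; have [r1' r2'] := det_rot_neq0 n0'.
(* At the midpoint the coordinates of [a] and [b] equal 1/2 in both triangles. [S] exceeds the four
   rates of change, so a displacement by [1 / (2 * S)] changes them by less than 1/2. *)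
pose k l := `|afflin l (c - a)|.
pose S := 1 + k (bary b c a) + k (bary c a b) + k (bary b c' a) + k (bary c' a b).
have [S0 kS] : 0 < S /\ [/\ k (bary b c a) < S, k (bary c a b) < S, k (bary b c' a) < S & k (bary c' a b) < S].
  exact: (lt_sum4 (normr_ge0 _) (normr_ge0 _) (normr_ge0 _) (normr_ge0 _)).
pose s := (2 * S)^-1; have s0 : 0 < s by rewrite invr_gt0 mulr_gt0.
pose z := edge_at a b 2^-1 + s *: (c - a).
have pos l : aff l a + aff l b = 1 -> k l < S -> 0 < aff l z.
  move=> hl hk; rewrite aff_addl aff_edge.
  have -> : afflin l (s *: (c - a)) = s * afflin l (c - a).
    by rewrite /afflin /= /GRing.scale/=; ring.
  have : `|s * afflin l (c - a)| < 2^-1.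
    rewrite normrM (gtr0_norm s0) -/(k l); apply: (@lt_le_trans _ _ (s * S)); first by rewrite ltr_pM2l.
    by rewrite /s invfM mulrVK// unitfE gt_eqF.
  rewrite ltr_norml => /andP[h _]; lra.
case: kS => k1 k2 k3 k4.
have ez (l : R * R * R) : aff l a = 0 -> aff l b = 0 -> aff l z = s * (aff l c).
  move=> la lb; rewrite aff_addl aff_edge la lb !mulr0 !add0r.
  have -> : afflin l (s *: (c - a)) = s * (aff l c - aff l a).
    by rewrite /afflin /aff /= /GRing.scale/=; ring.
  by rewrite la subr0.
have zK : tri a b c z.
  apply/triP; split.
  - by rewrite ez ?bary_a ?bary_b// bary_c// mulr1.
  - by apply: pos; rewrite // bary_c// bary_a addr0.
  - by apply: pos; rewrite // bary_c// bary_b add0r.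
have zL : tri a b c' z.
  apply/triP; split.
  - by rewrite ez ?bary_a ?bary_b// aff_bary mulr_gt0// divr_gt0.
  - by apply: pos; rewrite // bary_c// bary_a addr0.
  - by apply: pos; rewrite // bary_c// bary_b add0r.
have KK : triK K z by rewrite -tK.
case: (triK_disjoint pT T'T injT' KT LT KL KK).
by rewrite -hL; exact: tri_hull.
Qed.

Lemma uniq_flags : uniq flags.
Proof.
apply: uniq_flatten => // [K KT|K L KT LT [[a b] c] h1 h2].
  by apply: uniq_edges; rewrite gt_eqF//; case: (T'T KT).
exact: (flag_unique KT LT h1 h2).1.
Qed.

(** Just beyond a point [p] of the edge there is a cell [L]. If [p] is no vertex and the step is
    short, [L] also contains [p], so [K] and [L] share a whole edge through [p]; its ends can only
    be [a] and [b], and [L], positively oriented on the far side, traverses it backwards. *)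
Lemma flag_partner K a b c : K \in T' -> (a, b, c) \in edges K -> segment a b `&` Omega <> set0 ->
  exists2 c', (b, a, c') \in flags & 0 < det b a c'.
Proof.
move=> KT eK ne; have [dK _] := T'T KT; have [tK dK' hK' vK] := edge_facts eK.
have D0 : 0 < det a b c by rewrite -[det a b c]/(detK (a, b, c)) dK'.
have n0 : det a b c != 0 by rewrite gt_eqF.
have [r1 r2] := det_rot_neq0 n0.
have [p0 [[t0 /=]]] : exists p, (segment a b `&` Omega) p.
  by apply/not_existsP => h; apply: ne; apply/seteqP; split => x // /h.
rewrite in_itv/= => /andP[t00 t01] <- {p0} Op0.
have [eps e0 He] := cont_ray (open_nbhs_nbhs (conj oO Op0)).
(* [t] is the coordinate of [b] at [p]; avoiding its values at all mesh vertices keeps [p] away from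
   them. *)
have [t [tu tv ts]] : exists t, [/\ Num.max 0 (t0 - eps) < t, t < Num.min 1 (t0 + eps) &
   t \notin map (aff (bary c a b)) (flatten (map (@vertices R) T'))].
  by apply: real_avoid; rewrite gt_max !lt_min; apply/andP; split; apply/andP; split; lra.
move: tu tv; rewrite gt_max lt_min => /andP[tgt0 tu] /andP[tlt1 tv].
pose p := edge_at a b t.
have Op : Omega p by apply: He; rewrite ltr_norml; apply/andP; split; lra.
have pb : aff (bary c a b) p = t by rewrite aff_edge bary_b bary_c// mulr0 add0r mulr1.
have pa : aff (bary b c a) p = 1 - t by rewrite aff_edge bary_a bary_c// mulr0 addr0 mulr1.
have pc : aff (bary a b c) p = 0 by rewrite aff_edge bary_a bary_b !mulr0 addr0.
have pv L : L \in T' -> p \notin vertices L.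
  move=> LT; apply: contra ts => pL; rewrite -pb; apply: map_f.
  by apply/flatten_mapP; exists L.
(* Only finitely many closed hulls miss [p], so a whole neighbourhood of [p] misses them too. *)
have nN : nbhs p [set x | Omega x /\ forall L, L \in T' -> ~ hull L p -> ~ hull L x].
  have n1 : nbhs p Omega := open_nbhs_nbhs (conj oO Op).
  apply: filterI n1 _; apply: (@near_seq _ T' p (fun L x => ~ hull L p -> ~ hull L x)) => L LT.
  have [h|h] := pselect (hull L p); first by apply: filterS (@filterT _ (nbhs p) _).
  have cL : open (~` hull L).
    by apply: closed_openC; apply: closed_hull; rewrite gt_eqF//; case: (T'T LT).
  by apply: filterS (open_nbhs_nbhs (conj cL h)) => x.
have pE : p = p + 0 *: (a - c) by rewrite scale0r addr0.
rewrite pE in nN; have [del d0 Hd] := cont_ray nN.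
pose s := del / 2; have s0 : 0 < s by rewrite divr_gt0.
have [Ox far] : Omega (p + s *: (a - c)) /\ forall L, L \in T' -> ~ hull L p -> ~ hull L (p + s *: (a - c)).
  have [|h1 h2] := Hd s; first by rewrite subr0 gtr0_norm// /s; lra.
  by split => // L LT; have := h2 L LT; rewrite -pE.
set x := p + s *: (a - c) in Ox far.
have dx : det a b x < 0.
  have -> : det a b x = det a b p - s * det a b c by rewrite /x /det /= /GRing.scale/=; ring.
  have : det a b p = 0.
    by have := pc; rewrite aff_bary => /eqP; rewrite mulf_eq0 invr_eq0 (negbTE n0) orbF => /eqP.
  by move=> ->; rewrite sub0r oppr_lt0 mulr_gt0.
have [L LT Lx] := mesh_cover pT TT' (subset_closure Ox).
have Lp : hull L p by apply: contrapT => h; exact: (far L LT h).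
have Kp : hull K p.
  by rewrite -hK' hullE//; split; rewrite ?pa ?pb ?pc ?subr_ge0// ltW.
have KL : K != L.
  apply/eqP => e; move: Lx; rewrite -e -hK' hullE// => -[+ _ _].
  by rewrite aff_bary pmulr_lge0 ?invr_gt0// leNgt dx.
have [y [z [[yK zK] [yL zL] [w _ wp] yz]]] := mesh_meet pT T'T injT' KT LT KL Kp Lp.
have {}yz : y != z.
  case: yz => // yz; move: (pv L LT); rewrite -wp yz.
  by rewrite /edge_at subrr scaler0 addr0 zL.
have aw l : aff l p = (1 - w) * aff l y + w * aff l z by rewrite -wp aff_edge.
move: yK zK; rewrite -!vK !inE /= => yK zK.
have la q : [|| q == a, q == b | q == c] -> q != a -> aff (bary b c a) q = 0.
  by case/or3P => /eqP ->; rewrite ?eqxx ?bary_a ?bary_b.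
have lb q : [|| q == a, q == b | q == c] -> q != b -> aff (bary c a b) q = 0.
  by case/or3P => /eqP ->; rewrite ?eqxx ?bary_a ?bary_b.
(* If neither end of the common segment were [a], the coordinate of [a] would vanish at [p], where
   it is [1 - t]. *)
have aL : a \in vertices L.
  have [<-//|ya] := eqVneq y a; have [<-//|za] := eqVneq z a.
  have := aw (bary b c a); rewrite pa la// la// !mulr0 addr0 => e; move: tlt1; by rewrite -subr_gt0 e ltxx.
have bL : b \in vertices L.
  have [<-//|yb] := eqVneq y b; have [<-//|zb] := eqVneq z b.
  have := aw (bary c a b); rewrite pb lb// lb// !mulr0 addr0 => te; move: tgt0; by rewrite te ltxx.
have [ab _ _] := det_distinct n0.
have [c' [h|h]] := edge_of_vertices ab aL bL.
  (* With this orientation [L] would lie on the side of [K], although it contains [x] on the other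
     side. *)
  have [_ dL hL _] := edge_facts h; have [dL0 _] := T'T LT.
  have d' : 0 < det a b c' by rewrite -[det a b c']/(detK (a, b, c')) dL.
  move: Lx; rewrite -hL hullE ?gt_eqF// => -[+ _ _].
  by rewrite aff_bary pmulr_lge0 ?invr_gt0// leNgt dx.
exists c'; first by apply/flatten_mapP; exists L.
have [_ dL _ _] := edge_facts h; have [dL0 _] := T'T LT.
by rewrite -[det b a c']/(detK (b, a, c')) dL.
Qed.

Lemma flag_patch K L a b c c' : K \in T' -> L \in T' -> (a, b, c) \in edges K -> (b, a, c') \in edges L ->
  patch a b c c' `<=` Omega.
Proof.
move=> KT LT eK eL; have [_ dK hK' _] := edge_facts eK; have [_ dL hL' _] := edge_facts eL.
have [dK0 _] := T'T KT; have [dL0 _] := T'T LT.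
apply: (open_sub_Omega regO); first exact: open_patch.
move=> x /patch_hull []; rewrite ?hK' ?hL'.
- by rewrite -[det a b c]/(detK (a, b, c)) dK.
- by rewrite -[det b a c']/(detK (b, a, c')) dL.
- exact: (hull_closure pT T'T KT).
- exact: (hull_closure pT T'T LT).
Qed.

End Mesh.
End Flags.

Section FlagSum.
Variable R : realType.

Lemma big_unique (I : eqType) (s : seq I) (P : pred I) (F : I -> R) i : uniq s -> i \in s -> P i ->
  (forall j, j \in s -> P j -> j = i) -> \sum_(j <- s | P j) F j = F i.
Proof.
move=> us is_ Pi H; rewrite big_mkcond (bigD1_seq i)//= Pi big1_seq ?addr0// => j /andP[ji js].
by case: ifP => // /(H j js) e; rewrite e eqxx in ji.
Qed.

(** The double sum over opposite pairs, evaluated in two orders, is both the sum and its negative.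
    The alternative [F i = 0] accommodates boundary edges. *)
Lemma antisym_sum (I J : eqType) (s : seq I) (key : I -> J * J) (F : I -> R) : uniq s ->
  (forall i j, i \in s -> j \in s -> key i = key j -> i = j) ->
  (forall i, i \in s -> F i = 0 \/
     exists2 j, j \in s & key j = ((key i).2, (key i).1) /\ F j = - F i) ->
  \sum_(i <- s) F i = 0.
Proof.
move=> us inj H; pose opp i j := key j == ((key i).2, (key i).1).
have oppC i j : opp i j = opp j i.
  by rewrite /opp; case: (key i) (key j) => [a b] [c d] /=; rewrite !xpair_eqE andbC (eq_sym d) (eq_sym c).
have E i : i \in s -> \sum_(j <- s | opp i j) F j = - F i.
  move=> is_; have uo j k : j \in s -> k \in s -> opp i j -> opp i k -> k = j.
    by move=> js ks /eqP h1 /eqP h2; apply: inj => //; rewrite h1 h2.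
  have [F0|[j js [kj Fj]]] := H i is_; last first.
    by rewrite (big_unique _ us js) /opp ?kj ?eqxx// => k ks hk; apply: uo => //; rewrite /opp kj.
  (* A vanishing term may still have an opposite one, but the partner of the latter is then [i]
     itself, which forces it to vanish too. *)
  rewrite F0 oppr0 big1_seq// => j /andP[oij js].
  have [//|[k ks [kk Fk]]] := H j js.
  have e : k = i.
    apply: inj => //; rewrite kk; move: oij => /eqP ->; by case: (key i).
  by move: Fk; rewrite e F0 => /esym/eqP; rewrite oppr_eq0 => /eqP.
have E' i : i \in s -> \sum_(j <- s | opp i j) F i = F i.
  move=> is_; have [F0|[j js [kj Fj]]] := H i is_.
    by rewrite F0 big1.
  rewrite (big_unique (fun=> F i) us js) /opp ?kj ?eqxx// => k ks /eqP hk.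
  by apply: inj => //; rewrite hk kj.
have e1 : \sum_(i <- s) \sum_(j <- s | opp i j) F j = - \sum_(i <- s) F i.
  by rewrite -sumrN big_seq [RHS]big_seq; apply: eq_bigr.
have e2 : \sum_(i <- s) \sum_(j <- s | opp i j) F j = \sum_(i <- s) F i.
  rewrite (exchange_big_dep xpredT)//= big_seq [RHS]big_seq; apply: eq_bigr => j js.
  by rewrite -[RHS](E' j js); apply: eq_bigl => i; exact: oppC.
by move: e1; rewrite e2; lra.
Qed.

End FlagSum.

Section Piecewise.
Variable R : realType.
Notation mu := (leb2 R).
Notation mpt := (measurableTypeR R * measurableTypeR R)%type.
Implicit Types (K L : triangle R) (a b c x : pt R).

Lemma measurable_triK K : measurable (triK K : set mpt).
Proof. exact: measurable_poly. Qed.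

Lemma L2_indic (U V : set (pt R)) f : measurable (U : set mpt) -> measurable (V : set mpt) ->
  L2 V f -> L2 U (fun x => \1_V x * f x).
Proof.
move=> mU mV /(L2_restrict mV)/(L2_sub measurableT mU (@subsetT _ _)).
congr (L2 U _); apply/funext => x; rewrite patchE indicE.
by case: ifP; rewrite ?mul1r ?mul0r.
Qed.

Section Pieces.
Variables (Omega : set (pt R)) (S : seq (triangle R)).
Hypothesis mO : measurable (Omega : set mpt).
Hypothesis uS : uniq S.
Hypothesis subS : forall K, K \in S -> triK K `<=` Omega.
Hypothesis disS : forall K L, K \in S -> L \in S -> K != L -> forall z, triK K z -> ~ triK L z.
Hypothesis aeS : {ae mu, forall x, Omega x -> \sum_(K <- S) \1_(triK K) x = 1 :> R}.

Definition pw (f : triangle R -> pt R -> R) x : R := \sum_(K <- S) \1_(triK K) x * f K x.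

Lemma pwE f K x : K \in S -> triK K x -> pw f x = f K x.
Proof.
move=> KS Kx; rewrite /pw (bigD1_seq K)//= indicE mem_set// mul1r big1_seq ?addr0// => L /andP[LK LS].
rewrite indicE memNset ?mul0r//; apply: (disS KS LS) => //; by rewrite eq_sym.
Qed.

Lemma L2_pw f : (forall K, K \in S -> L2 (triK K) (f K)) -> L2 Omega (pw f).
Proof.
move=> H; rewrite /pw; elim: S H => [|K s ih] H.
  rewrite (_ : (fun x => _) = (fun=> 0)); last by apply/funext => x; rewrite big_nil.
  split; first exact: measurable_cst.
  rewrite (_ : (fun x => _) = cst 0%E); first exact: integrable0.
  by apply/funext => x; rewrite expr0n.
rewrite (_ : (fun x => _) = (fun x => \1_(triK K) x * f K x) \+ (fun x => \sum_(L <- s) \1_(triK L) x * f L x)).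
  apply: (L2D mO); first by apply: L2_indic => //; [exact: measurable_triK|apply: H; rewrite mem_head].
  by apply: ih => L Ls; apply: H; rewrite inE Ls orbT.
by apply/funext => x; rewrite big_cons.
Qed.

Lemma ip_mesh v w : L2 Omega v -> L2 Omega w -> ip Omega v w = \sum_(K <- S) ip (triK K) v w.
Proof.
move=> v2 w2; apply: Rintegral_partition => //; first exact: L2_mul_int.
by move=> K KS; split; [exact: measurable_triK|exact: subS].
Qed.

Lemma ip_congr (U : set (pt R)) (v w v' w' : pt R -> R) : (forall x, U x -> v x = v' x) ->
  (forall x, U x -> w x = w' x) -> ip U v w = ip U v' w'.
Proof.
by move=> h1 h2; rewrite /ip; apply: eq_Rintegral => x; rewrite inE => Ux; rewrite h1// h2.
Qed.

Lemma ip_pw f w : (forall K, K \in S -> L2 (triK K) (f K)) -> L2 Omega w ->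
  ip Omega (pw f) w = \sum_(K <- S) ip (triK K) (f K) w.
Proof.
move=> f2 w2; rewrite ip_mesh//; last exact: L2_pw.
rewrite big_seq [RHS]big_seq; apply: eq_bigr => K KS.
by apply: ip_congr => // x; exact: pwE.
Qed.

Lemma mesh_ae_tri (P : pt R -> Prop) : (forall K, K \in S -> {ae mu, forall x, triK K x -> P x}) ->
  {ae mu, forall x, Omega x -> P x}.
Proof.
move=> /ae_seq; apply: ae_imp2 aeS => x h1 h2 Ox.
have [K KS Kx] : exists2 K, K \in S & triK K x.
  apply: contrapT => no; have := h1 Ox; rewrite big1_seq => [/eqP|K /andP[_ KS]].
    by rewrite eq_sym oner_eq0.
  by rewrite indicE memNset// => Kx; apply: no; exists K.
exact: h2 Kx.
Qed.

Lemma L2_triK v K : K \in S -> L2 Omega v -> L2 (triK K) v.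
Proof. by move=> KS; apply: L2_sub => //; [exact: measurable_triK|exact: subS]. Qed.

End Pieces.
End Piecewise.

(** * The global interpolant *)

Section GlobalInterpolant.
Variable R : realType.
Notation mu := (leb2 R).
Notation mpt := (measurableTypeR R * measurableTypeR R)%type.
Implicit Types (K L : triangle R) (a b c x : pt R) (F : field R).

Lemma norm0v_ip (U : set (pt R)) q : norm0v U q ^+ 2 = ip U (fst_of q) (fst_of q) + ip U (snd_of q) (snd_of q).
Proof. by rewrite norm0v_sq !norm0_sq. Qed.

Lemma sum4_sq (x y z w : R) : (x + y + (z + w)) ^+ 2 <= 4 * (x ^+ 2 + y ^+ 2 + (z ^+ 2 + w ^+ 2)).
Proof.
rewrite -subr_ge0 (_ : _ - _ = (x - y) ^+ 2 + (x - z) ^+ 2 + (x - w) ^+ 2 +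
  ((y - z) ^+ 2 + (y - w) ^+ 2 + (z - w) ^+ 2)); last by ring.
by rewrite !addr_ge0 ?sqr_ge0.
Qed.

(** 648 is [2 * 81 * 4]: two components, the square of the local constant 9, and the factor of
    [sum4_sq]. *)
Lemma cell_bound (r x y z w X Y Z W E1 E2 : R) : x ^+ 2 = X -> y ^+ 2 = Y -> z ^+ 2 = Z -> w ^+ 2 = W ->
  E1 <= 81 * r ^+ 2 * (x + y + (z + w)) ^+ 2 -> E2 <= 81 * r ^+ 2 * (x + y + (z + w)) ^+ 2 ->
  E1 + E2 <= 648 * r ^+ 2 * (X + Y + (Z + W)).
Proof.
move=> <- <- <- <- h1 h2; apply: (le_trans (lerD h1 h2)); rewrite -mulrDl.
have -> : 81 * r ^+ 2 + 81 * r ^+ 2 = 162 * r ^+ 2 by ring.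
have -> : 648 * r ^+ 2 * (x ^+ 2 + y ^+ 2 + (z ^+ 2 + w ^+ 2)) =
  162 * r ^+ 2 * (4 * (x ^+ 2 + y ^+ 2 + (z ^+ 2 + w ^+ 2))) by ring.
by apply: ler_wpM2l; [exact: (mulr_ge0 (ler0n R 162) (sqr_ge0 r))|exact: sum4_sq].
Qed.

Lemma L2_rt a b c F : det a b c != 0 ->
  L2 (tri a b c) (fun x => (rt_interp a b c F x).1) /\ L2 (tri a b c) (fun x => (rt_interp a b c F x).2).
Proof.
move=> d0; have mU : measurable (tri a b c : set mpt) := measurable_poly _.
have fU := mu_tri_fin d0; have [l1 l2] := @L2_cx R a b c d0 0.
split.
  have := L2D mU (L2Z mU (rt_slope a b c F) l1) (L2_cst (rt_const a b c F).1 mU fU).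
  by congr (L2 _ _); apply/funext => x; rewrite /= /cx1 subr0.
have := L2D mU (L2Z mU (rt_slope a b c F) l2) (L2_cst (rt_const a b c F).2 mU fU).
by congr (L2 _ _); apply/funext => x; rewrite /= /cx2 subr0.
Qed.

(** The divergence theorem for the interpolant times [v] on one triangle, with the edge integrals of
    [v] written as moments: each basis field has flux through a single edge. *)
Lemma rt_interp_moment a b c F v g1 g2 : det a b c != 0 ->
  L2 (tri a b c) g1 -> L2 (tri a b c) g2 ->
  rt_coef a b c F * moment a b c v g1 g2 + rt_coef b c a F * moment b c a v g1 g2 +
  rt_coef c a b F * moment c a b v g1 g2 =
  ip (tri a b c) (fun x => (rt_interp a b c F x).1) g1 +
  ip (tri a b c) (fun x => (rt_interp a b c F x).2) g2 +
  2 * rt_slope a b c F * ip (tri a b c) v one.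
Proof.
move=> d0 l1 l2; have mU : measurable (tri a b c : set mpt) := measurable_poly _.
have fU := mu_tri_fin d0; have [x1 x2] := @L2_cx R a b c d0 0.
rewrite /moment (tri_rot b c a) (tri_rot a b c); set U := tri a b c.
rewrite (ip_cx1 d0 a l1) (ip_cx1 d0 b l1) (ip_cx1 d0 c l1) (ip_cx2 d0 a l2) (ip_cx2 d0 b l2) (ip_cx2 d0 c l2).
have e1 : ip U (fun x => (rt_interp a b c F x).1) g1 =
    rt_slope a b c F * ip U g1 (cx1 0) + (rt_const a b c F).1 * ip U g1 one.
  rewrite ipC -(ip_cstr _ mU fU l1) -(ipZr mU _ x1 l1) -(ipDr mU (L2Z mU _ x1) (L2_cst _ mU fU) l1).
  by congr ip; apply/funext => x; rewrite /= /cx1 subr0.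
have e2 : ip U (fun x => (rt_interp a b c F x).2) g2 =
    rt_slope a b c F * ip U g2 (cx2 0) + (rt_const a b c F).2 * ip U g2 one.
  rewrite ipC -(ip_cstr _ mU fU l2) -(ipZr mU _ x2 l2) -(ipDr mU (L2Z mU _ x2) (L2_cst _ mU fU) l2).
  by congr ip; apply/funext => x; rewrite /= /cx2 subr0.
rewrite e1 e2 /rt_const /rt_slope /= /GRing.scale/=.
move: (rt_coef a b c F) (rt_coef b c a F) (rt_coef c a b F) (ip U v one) (ip U g1 one) (ip U g2 one)
  (ip U g1 (cx1 0)) (ip U g2 (cx2 0)) => *; ring.
Qed.

Lemma moment_one a b c : moment a b c one (fun=> 0) (fun=> 0) = 2 * area a b c.
Proof. by rewrite /moment !(@ip_eq0l _ _ (fun=> 0))// !addr0. Qed.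

(** By [flux_match] each moment is the same multiple of [det] on both sides; applied to the constant
    1 this covers the areas in [edge_mean] as well. Reversal of the edge vector yields the sign. *)
Lemma flux_antisym a b c c' F v g1 g2 : 0 < det a b c -> 0 < det b a c' ->
  H1v (patch a b c c') F -> H1 (patch a b c c') v g1 g2 ->
  rt_coef b a c' F * moment b a c' v g1 g2 = - (rt_coef a b c F * moment a b c v g1 g2).
Proof.
move=> D0 D0' [H1' H2'] Hv.
have op : open (patch a b c c') by exact: open_patch.
have mp : measurable (patch a b c c' : set mpt) := open_measurable2 op.
have fp : (mu (patch a b c c') < +oo)%E.
  by have [M HM] := bounded_sub_box (bounded_patch D0 D0'); exact: bounded_mu HM.
have m1 := flux_match D0 D0' H1'; have m2 := flux_match D0 D0' H2'.
have m3 := flux_match D0 D0' Hv; have := flux_match D0 D0' (H1_one mp fp).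
rewrite !moment_one => m4.
have n0 : det a b c != 0 by rewrite gt_eqF.
have n0' : det b a c' != 0 by rewrite gt_eqF.
have A0 := area_gt0 n0; have A0' := area_gt0 n0'.
rewrite /rt_coef /edge_mean.
move: m1 m2 m3 m4; set D := det a b c in n0 *; set D' := det b a c' in n0' *.
set A := area a b c in A0 *; set A' := area b a c' in A0' *.
move: (moment b a c' v g1 g2) (moment a b c v g1 g2) (moment a b c (q1 F) (g11 F) (g12 F))
  (moment a b c (q2 F) (g21 F) (g22 F)) (moment b a c' (q1 F) (g11 F) (g12 F))
  (moment b a c' (q2 F) (g21 F) (g22 F)) => w' w u1 u2 u1' u2' m1 m2 m3 m4.
have -> : u1' = u1 / D * D' by rewrite m1 divfK.
have -> : u2' = u2 / D * D' by rewrite m2 divfK.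
have -> : w' = w / D * D' by rewrite m3 divfK.
have -> : A' = A / D * D'.
  by have : 2 * A' = 2 * A / D * D' by [rewrite m4 divfK]; lra.
by field; rewrite n0 n0' gt_eqF.
Qed.

Section Global.
Variables (Omega : set (pt R)) (S : seq (triangle R)) (F : field R).
Hypotheses (oO : open Omega) (uS : uniq S).
Hypothesis detS : forall K, K \in S -> 0 < detK K.
Hypothesis subS : forall K, K \in S -> triK K `<=` Omega.
Hypothesis disS : forall K L, K \in S -> L \in S -> K != L -> forall z, triK K z -> ~ triK L z.
Hypothesis aeS : {ae mu, forall x, Omega x -> \sum_(K <- S) \1_(triK K) x = 1 :> R}.
Hypothesis uF : uniq (flags S).
Hypothesis injF : forall e f, e \in flags S -> f \in flags S -> e.1 = f.1 -> e = f.
Hypothesis partF : forall a b c, (a, b, c) \in flags S -> segment a b `&` Omega = set0 \/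
  exists2 c', (b, a, c') \in flags S & patch a b c c' `<=` Omega.
Hypothesis HF : H1v Omega F.

Let mO : measurable (Omega : set mpt) := open_measurable2 oO.

Definition glob1 : pt R -> R := pw S (fun K x => (rt_interp K.1.1 K.1.2 K.2 F x).1).
Definition glob2 : pt R -> R := pw S (fun K x => (rt_interp K.1.1 K.1.2 K.2 F x).2).
Definition glob_div : pt R -> R := pw S (fun K => fun=> 2 * rt_slope K.1.1 K.1.2 K.2 F).
Definition glob x : pt R := (glob1 x, glob2 x).

Let detS0 K : K \in S -> det K.1.1 K.1.2 K.2 != 0.
Proof. by move=> /detS; rewrite /detK => /gt_eqF ->. Qed.

Lemma L2v_glob : L2v Omega glob.
Proof. by split; apply: L2_pw => // K /detS0/(L2_rt F)[]. Qed.

Lemma L2_glob_div : L2 Omega glob_div.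
Proof.
apply: L2_pw => // K KS; apply: L2_cst; first exact: measurable_triK.
exact: mu_tri_fin (detS0 KS).
Qed.

Let flag_det a b c : (a, b, c) \in flags S -> 0 < det a b c.
Proof.
move=> /flatten_mapP[K KS /edge_facts[_ + _ _]].
by rewrite /detK /= => ->; exact: detS.
Qed.

Let moment_sum0 phi : test_fun Omega phi ->
  \sum_(e <- flags S) rt_coef e.1.1 e.1.2 e.2 F * moment e.1.1 e.1.2 e.2 phi (d1 phi) (d2 phi) = 0.
Proof.
move=> tp; apply: (antisym_sum uF injF) => -[[a b] c] ef /=.
have D0 := flag_det ef; case: (partF ef) => [b0|[c' ef' pO]].
  by left; rewrite (flux_boundary D0 tp b0) mulr0.
right; exists (b, a, c') => //; split => //=; have D0' := flag_det ef'.
have mp : measurable (patch a b c c' : set mpt) by apply: open_measurable2; exact: open_patch.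
apply: flux_antisym => //; last exact: H1_test tp.
by case: HF => h1 h2; split; exact: H1S h1 || exact: H1S h2.
Qed.

(** On each cell [rt_interp_moment] rewrites the defining identity as three edge terms, and over the
    whole mesh these sum to zero. *)
Lemma glob_weak_div : is_weak_div Omega glob glob_div.
Proof.
split; first exact: L2_glob_div.
move=> phi tp; have t1 := test_L2 mO (test_fun_d1 tp); have t2 := test_L2 mO (test_fun_d2 tp).
have t0 := test_L2 mO tp.
have tv : L2v Omega (fun x => (d1 phi x, d2 phi x)) := conj t1 t2.
rewrite (ipv_sum mO L2v_glob tv).
have i1 := ip_pw mO uS subS disS aeS (fun K KS => (L2_rt F (detS0 KS)).1) t1.
have i2 := ip_pw mO uS subS disS aeS (fun K KS => (L2_rt F (detS0 KS)).2) t2.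
have i0 := ip_pw (f := fun K => fun=> 2 * rt_slope K.1.1 K.1.2 K.2 F) mO uS subS disS aeS
  (fun K KS => L2_cst _ (measurable_triK K) (mu_tri_fin (detS0 KS))) t0.
rewrite [ip _ glob_div _]i0 [X in X + _]i1 [X in _ + X]i2.
apply/eqP; rewrite -subr_eq0 opprK -!big_split /=; apply/eqP.
rewrite -[RHS](moment_sum0 tp) big_flatten big_map big_seq [RHS]big_seq; apply: eq_bigr => -[[a b] c] KS.
rewrite /edges /= !big_cons big_nil addr0 /=.
have d0 := detS0 KS; have mU : measurable (tri a b c : set mpt) := measurable_poly _.
have sU : tri a b c `<=` Omega := subS KS.
rewrite addrA (rt_interp_moment F phi d0 (L2_sub mO mU sU t1) (L2_sub mO mU sU t2)).
congr (_ + _); rewrite ipC (ip_cstr _ mU (mu_tri_fin d0))//; exact: L2_sub t0.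
Qed.

Lemma glob_Hdiv : Hdiv Omega glob.
Proof. by split; [exact: L2v_glob|exists glob_div; exact: glob_weak_div]. Qed.

Lemma glob_error (r : R) : (forall K, K \in S -> circumradius K <= r) ->
  norm0v Omega (fun x => (q1 F x - glob1 x, q2 F x - glob2 x)) ^+ 2 <=
    648 * r ^+ 2 * (ip Omega (g11 F) (g11 F) + ip Omega (g12 F) (g12 F) +
      (ip Omega (g21 F) (g21 F) + ip Omega (g22 F) (g22 F))).
Proof.
move=> hr; have [l1 l2] := L2v_glob; have [[k1 k11 k12 _ _] [k2 k21 k22 _ _]] := HF.
rewrite norm0v_ip.
have e1 : L2 Omega (fst_of (fun x => (q1 F x - glob1 x, q2 F x - glob2 x))) := L2B mO k1 l1.
have e2 : L2 Omega (snd_of (fun x => (q1 F x - glob1 x, q2 F x - glob2 x))) := L2B mO k2 l2.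
have M v w := ip_mesh mO subS aeS (v := v) (w := w).
rewrite !M// -!big_split /= mulr_sumr big_seq [leRHS]big_seq; apply: ler_sum => K KS.
have d0 := detS0 KS; have HK : H1v (triK K) F.
  have mK := measurable_triK K; case: HF => h1 h2.
  by split; [exact: H1S (subS KS) h1|exact: H1S (subS KS) h2].
have [] := rt_error d0 HK; rewrite -[tri _ _ _]/(triK K) => r1 r2.
have r0 := circumradius_ge0 d0; have hrK := hr K KS.
move: r1 r2 r0; rewrite (_ : (K.1.1, K.1.2, K.2) = K); last by case: (K) => -[].
set U := triK K; set G := gnorm U F; move=> r1 r2 r0.
have G0 : 0 <= G by rewrite /G /gnorm !addr_ge0 ?norm0_ge0.
have n1 : ip U (fst_of (fun x => (q1 F x - glob1 x, q2 F x - glob2 x)))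
   (fst_of (fun x => (q1 F x - glob1 x, q2 F x - glob2 x))) <= 81 * r ^+ 2 * G ^+ 2.
  have -> : 81 * r ^+ 2 * G ^+ 2 = (9 * r * G) ^+ 2 by ring.
  rewrite -norm0_sq ler_sqr ?nnegrE ?norm0_ge0 ?mulr_ge0 ?(le_trans r0 hrK)//.
  have -> : norm0 U (fst_of (fun x => (q1 F x - glob1 x, q2 F x - glob2 x))) =
      norm0 U (fun x => q1 F x - (rt_interp K.1.1 K.1.2 K.2 F x).1).
    by congr Num.sqrt; apply: ip_congr => x Ux; rewrite /fst_of/= /glob1 (pwE uS disS _ KS).
  by apply: (le_trans r1); rewrite ler_wpM2r// ler_wpM2l.
have n2 : ip U (snd_of (fun x => (q1 F x - glob1 x, q2 F x - glob2 x)))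
   (snd_of (fun x => (q1 F x - glob1 x, q2 F x - glob2 x))) <= 81 * r ^+ 2 * G ^+ 2.
  have -> : 81 * r ^+ 2 * G ^+ 2 = (9 * r * G) ^+ 2 by ring.
  rewrite -norm0_sq ler_sqr ?nnegrE ?norm0_ge0 ?mulr_ge0 ?(le_trans r0 hrK)//.
  have -> : norm0 U (snd_of (fun x => (q1 F x - glob1 x, q2 F x - glob2 x))) =
      norm0 U (fun x => q2 F x - (rt_interp K.1.1 K.1.2 K.2 F x).2).
    by congr Num.sqrt; apply: ip_congr => x Ux; rewrite /snd_of/= /glob2 (pwE uS disS _ KS).
  by apply: (le_trans r2); rewrite ler_wpM2r// ler_wpM2l.
rewrite /G /gnorm in n1 n2.
exact: (cell_bound (norm0_sq U (g11 F)) (norm0_sq U (g12 F)) (norm0_sq U (g21 F)) (norm0_sq U (g22 F)) n1 n2).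
Qed.

End Global.
End GlobalInterpolant.

(** * Weak solutions *)

Section WeakSolutions.
Variable R : realType.
Notation mu := (leb2 R).
Notation mpt := (measurableTypeR R * measurableTypeR R)%type.
Implicit Types (K L : triangle R) (x : pt R) (v g f u d : pt R -> R) (p q : pt R -> pt R).

Variables (Omega : set (pt R)) (S : seq (triangle R)).
Hypothesis oO : open Omega.
Hypothesis detS : forall K, K \in S -> 0 < detK K.
Hypothesis subS : forall K, K \in S -> triK K `<=` Omega.
Hypothesis aeS : {ae mu, forall x, Omega x -> \sum_(K <- S) \1_(triK K) x = 1 :> R}.

Let mO : measurable (Omega : set mpt) := open_measurable2 oO.

(** Cut-offs were built for convex polygons, not for [Omega]; testing inside each open cell suffices
    because the cells fill [Omega] almost everywhere. *)
Lemma test_uniq_mesh v : L2 Omega v -> (forall psi, test_fun Omega psi -> ip Omega v psi = 0) ->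
  {ae mu, forall x, Omega x -> v x = 0}.
Proof.
move=> v2 H; apply: (mesh_ae_tri aeS) => K KS.
have d0 : det K.1.1 K.1.2 K.2 != 0 by rewrite gt_eqF//; exact: detS.
have mK := measurable_triK K.
apply: (test_uniq mK (poly_cutoff (bounded_tri d0))) => [|psi tp]; first exact: (L2_triK mO subS KS v2).
by rewrite -(ip_testS v (subS KS) tp) H//; exact: (test_funS (subS KS) tp).
Qed.

Lemma test_eq_mesh v w : L2 Omega v -> L2 Omega w ->
  (forall psi, test_fun Omega psi -> ip Omega v psi = ip Omega w psi) ->
  {ae mu, forall x, Omega x -> v x = w x}.
Proof.
move=> v2 w2 H; have E psi : test_fun Omega psi -> ip Omega (v \- w) psi = 0.
  by move=> tp; rewrite ipBl//; [rewrite H// subrr|exact: test_L2 tp].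
apply: ae_imp (test_uniq_mesh (L2B mO v2 w2) E) => x h Ox.
by apply/eqP; rewrite -subr_eq0; apply/eqP; exact: h.
Qed.

Lemma weak_div_unique q d d' : is_weak_div Omega q d -> is_weak_div Omega q d' ->
  {ae mu, forall x, Omega x -> d x = d' x}.
Proof.
move=> [d2 H] [d2' H']; apply: test_eq_mesh => // psi tp.
by apply: oppr_inj; rewrite -H// -H'.
Qed.

Lemma wdivP q : Hdiv Omega q -> is_weak_div Omega q (wdiv Omega q).
Proof. by move=> [_ [d hd]]; apply: (@xgetPex _ _ [set d | is_weak_div Omega q d]); exists d. Qed.

Lemma wDP a v g : is_weak_deriv Omega a v g -> is_weak_deriv Omega a v (wD Omega a v).
Proof. by move=> h; apply: (@xgetPex _ _ [set g | is_weak_deriv Omega a v g]); exists g. Qed.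

Lemma wD_unique a v g : is_weak_deriv Omega a v g ->
  {ae mu, forall x, Omega x -> wD Omega a v x = g x}.
Proof.
move=> h; have [w2 H] := wDP h; have [g2 H'] := h; apply: test_eq_mesh => // psi tp.
have s0 : (-1) ^+ (a.1 + a.2) != 0 :> R by rewrite expf_neq0// oppr_eq0 oner_eq0.
by apply: (mulfI s0); rewrite -H// -H'.
Qed.

Lemma norm0_wD a v g : is_weak_deriv Omega a v g -> norm0 Omega (wD Omega a v) = norm0 Omega g.
Proof. by move=> h; apply: (norm0_ae mO (wDP h).1 h.1); exact: wD_unique. Qed.

Lemma seminorm_sq k v : seminorm k Omega v ^+ 2 =
  \sum_(i < k.+1) norm0 Omega (wD Omega (nat_of_ord i, (k - i)%N) v) ^+ 2.
Proof. by rewrite sqr_sqrtr// sumr_ge0// => i _; exact: sqr_ge0. Qed.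

Lemma normH_sq k v : normH k Omega v ^+ 2 = \sum_(m < k.+1) seminorm m Omega v ^+ 2.
Proof. by rewrite sqr_sqrtr// sumr_ge0// => i _; exact: sqr_ge0. Qed.

Lemma normH_ge0 k v : 0 <= normH k Omega v.
Proof. exact: sqrtr_ge0. Qed.

Lemma sum_ord123 (g : nat -> nat -> R) : [/\ \sum_(i < 1) g i (0 - i)%N = g 0%N 0%N,
  \sum_(i < 2) g i (1 - i)%N = g 0%N 1%N + g 1%N 0%N &
  \sum_(i < 3) g i (2 - i)%N = g 0%N 2%N + (g 1%N 1%N + g 2%N 0%N)].
Proof. by rewrite !big_ord_recl !big_ord0 !addr0. Qed.

Lemma seminorm0_sq v : seminorm 0 Omega v ^+ 2 = norm0 Omega (wD Omega (0, 0)%N v) ^+ 2.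
Proof. by rewrite seminorm_sq; case: (sum_ord123 (fun i j => norm0 Omega (wD Omega (i, j) v) ^+ 2)) => h _ _; exact: h. Qed.

Lemma seminorm1_sq v : seminorm 1 Omega v ^+ 2 =
  norm0 Omega (wD Omega (0, 1)%N v) ^+ 2 + norm0 Omega (wD Omega (1, 0)%N v) ^+ 2.
Proof. by rewrite seminorm_sq; case: (sum_ord123 (fun i j => norm0 Omega (wD Omega (i, j) v) ^+ 2)) => _ h _; exact: h. Qed.

Lemma seminorm2_sq v : seminorm 2 Omega v ^+ 2 = norm0 Omega (wD Omega (0, 2)%N v) ^+ 2 +
  (norm0 Omega (wD Omega (1, 1)%N v) ^+ 2 + norm0 Omega (wD Omega (2, 0)%N v) ^+ 2).
Proof. by rewrite seminorm_sq; case: (sum_ord123 (fun i j => norm0 Omega (wD Omega (i, j) v) ^+ 2)) => _ _ h; exact: h. Qed.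

Lemma normH1_sq v : normH 1 Omega v ^+ 2 = seminorm 0 Omega v ^+ 2 + seminorm 1 Omega v ^+ 2.
Proof. by rewrite normH_sq; case: (sum_ord123 (fun i _ => seminorm i Omega v ^+ 2)) => _ h _; exact: h. Qed.

Lemma normH2_sq v : normH 2 Omega v ^+ 2 =
  seminorm 0 Omega v ^+ 2 + (seminorm 1 Omega v ^+ 2 + seminorm 2 Omega v ^+ 2).
Proof. by rewrite normH_sq; case: (sum_ord123 (fun i _ => seminorm i Omega v ^+ 2)) => _ _ h; exact: h. Qed.

Lemma normH1_sqE v : normH 1 Omega v ^+ 2 = norm0 Omega (wD Omega (0, 0)%N v) ^+ 2 +
  (norm0 Omega (wD Omega (0, 1)%N v) ^+ 2 + norm0 Omega (wD Omega (1, 0)%N v) ^+ 2).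
Proof. by rewrite -seminorm1_sq -seminorm0_sq; exact: normH1_sq. Qed.

Lemma sq_sum_eq0 (t x y z : R) : t ^+ 2 = x ^+ 2 + (y ^+ 2 + z ^+ 2) -> x = 0 -> y = 0 -> z = 0 -> t = 0.
Proof.
move=> h x0 y0 z0; move: h; rewrite x0 y0 z0 expr0n /= !addr0 => /eqP; rewrite sqrf_eq0 => /eqP; exact.
Qed.

Lemma normH1_ge v : [/\ norm0 Omega (wD Omega (0, 0)%N v) <= normH 1 Omega v,
  norm0 Omega (wD Omega (1, 0)%N v) <= normH 1 Omega v & norm0 Omega (wD Omega (0, 1)%N v) <= normH 1 Omega v].
Proof.
have e := normH1_sqE v.
split; rewrite -ler_sqr ?nnegrE ?norm0_ge0 ?normH_ge0// e.
- by rewrite lerDl addr_ge0 ?sqr_ge0.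
- by rewrite addrA lerDr addr_ge0 ?sqr_ge0.
- by rewrite addrCA lerDl addr_ge0 ?sqr_ge0.
Qed.

Lemma weak_deriv0 v : L2 Omega v -> is_weak_deriv Omega (0, 0)%N v v.
Proof. by move=> v2; split => // phi tp; rewrite expr0 mul1r. Qed.

Lemma weak_deriv_test a phi : test_fun Omega phi -> (a.1 + a.2 <= 1)%N ->
  is_weak_deriv Omega a phi (pderiv a phi).
Proof.
move=> tp; have sp : smooth phi by case: tp.
case: a => [[|[|//]] [|[|//]]] //= _; rewrite /pderiv /=.
- by apply: weak_deriv0; exact: test_L2 tp.
- split; first exact: test_L2 (test_fun_d2 tp).
  by move=> psi ts; rewrite /pderiv/= expr1 mulN1r; exact: ibp2.
- split; first exact: test_L2 (test_fun_d1 tp).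
  by move=> psi ts; rewrite /pderiv/= expr1 mulN1r; exact: ibp1.
Qed.

Lemma weak_derivB a v w g h : L2 Omega v -> L2 Omega w -> is_weak_deriv Omega a v g ->
  is_weak_deriv Omega a w h -> (forall phi, test_fun Omega phi -> test_fun Omega (pderiv a phi)) ->
  is_weak_deriv Omega a (v \- w) (g \- h).
Proof.
move=> v2 w2 [g2 Hg] [h2 Hh] tD; split; first exact: L2B.
move=> phi tp; rewrite ipBl//; last exact: test_L2 (tD _ tp).
rewrite ipBl//; last exact: test_L2 tp.
by rewrite Hg// Hh// mulrBr.
Qed.

Lemma test_pderiv a phi : test_fun Omega phi -> test_fun Omega (pderiv a phi).
Proof.
move=> tp; rewrite /pderiv; elim: (a.1) => [|n ih] /=; last exact: test_fun_d1.
by elim: (a.2) => [//|n ih] /=; exact: test_fun_d2.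
Qed.

Lemma sum3_shift (r s t r' s' t' : R) : r' + s' = - t' -> r + s + t = r - r' + (s - s') + (t - t').
Proof. lra. Qed.

(** For the approximating test functions this is the definition of the weak divergence, and the
    discrepancy [X] is bounded by a constant times their distance to [u] in the H^1 norm. *)
Lemma H10_grad u (q : pt R -> pt R) d : H10 Omega u -> L2v Omega q -> is_weak_div Omega q d ->
  ipv Omega (wgrad Omega u) q = - ip Omega u d.
Proof.
move=> [[u2 Hu] [phi [tphi cphi]]] [q12 q22] [d2' Hd].
have [g1 w1] := Hu (1, 0)%N isT; have [g2 w2] := Hu (0, 1)%N isT.
have [G12 _] := wDP w1; have [G22 _] := wDP w2.
set G1 := wD Omega (1, 0)%N u in G12; set G2 := wD Omega (0, 1)%N u in G22.
have Gv : L2v Omega (wgrad Omega u) := conj G12 G22.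
have qv : L2v Omega q := conj q12 q22.
set C := norm0 Omega (fst_of q) + norm0 Omega (snd_of q) + norm0 Omega d.
have C0 : 0 <= C by rewrite !addr_ge0 ?norm0_ge0.
pose X := ipv Omega (wgrad Omega u) q + ip Omega u d.
have bound n : `|X| <= C * normH 1 Omega (u \- phi n).
  have tp := tphi n; have t0 := test_L2 mO tp.
  have t1 := test_L2 mO (test_fun_d1 tp); have t2 := test_L2 mO (test_fun_d2 tp).
  have [N0 N1 N2] := normH1_ge (u \- phi n).
  rewrite (norm0_wD (weak_derivB u2 t0 (weak_deriv0 u2) (weak_deriv0 t0) (@test_pderiv _))) in N0.
  rewrite (norm0_wD (weak_derivB u2 t0 (wDP w1) (weak_deriv_test (a := (1, 0)%N) tp isT) (@test_pderiv _))) in N1.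
  rewrite (norm0_wD (weak_derivB u2 t0 (wDP w2) (weak_deriv_test (a := (0, 1)%N) tp isT) (@test_pderiv _))) in N2.
  have -> : X = ip Omega (G1 \- d1 (phi n)) (fst_of q) + ip Omega (G2 \- d2 (phi n)) (snd_of q) +
      ip Omega (u \- phi n) d.
    have eX : X = ip Omega G1 (fst_of q) + ip Omega G2 (snd_of q) + ip Omega u d.
      by congr (_ + _); exact: (ipv_sum mO Gv qv).
    have tv : L2v Omega (fun x => (d1 (phi n) x, d2 (phi n) x)) := conj t1 t2.
    have eD : ip Omega (fst_of q) (d1 (phi n)) + ip Omega (snd_of q) (d2 (phi n)) = - ip Omega d (phi n).
      by rewrite -(Hd _ tp); apply/esym; exact: (ipv_sum mO qv tv).
    rewrite eX (ipBl mO G12 t1 q12) (ipBl mO G22 t2 q22) (ipBl mO u2 t0 d2').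
    rewrite (ipC _ (d1 (phi n))) (ipC _ (d2 (phi n))) (ipC _ (phi n)).
    exact: sum3_shift eD.
  have k1 := ip_CS mO (L2B mO G12 t1) q12; have k2 := ip_CS mO (L2B mO G22 t2) q22.
  have k3 := ip_CS mO (L2B mO u2 t0) d2'.
  rewrite /C !mulrDl; apply: (le_trans (ler_normD _ _)); apply: lerD.
    apply: (le_trans (ler_normD _ _)); apply: lerD.
      by apply: (le_trans k1); rewrite mulrC; exact: (ler_wpM2l (norm0_ge0 _ _) N1).
    by apply: (le_trans k2); rewrite mulrC; exact: (ler_wpM2l (norm0_ge0 _ _) N2).
  by apply: (le_trans k3); rewrite mulrC; exact: (ler_wpM2l (norm0_ge0 _ _) N0).
have c0 : C * normH 1 Omega (u \- phi n) @[n --> \oo] --> (0 : R).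
  by rewrite -[X in _ --> X](mulr0 C); apply: cvgM; [exact: cvg_cst|exact: cphi].
have X0 : `|X| <= 0.
  rewrite -(cvg_lim (@Rhausdorff R) c0); apply: limr_ge; first by apply/cvg_ex; exists 0.
  exact: nearW.
by apply/eqP; rewrite -subr_eq0 opprK -normr_le0.
Qed.

Lemma normH1_0 : normH 1 Omega (fun=> 0) = 0.
Proof.
have z2 : L2 Omega (fun=> 0 : R).
  by rewrite (_ : (fun=> 0) = pw [::] (fun K => fun=> 0)); [exact: L2_pw|apply/funext => x; rewrite /pw big_nil].
have w0 a : is_weak_deriv Omega a (fun=> 0) (fun=> 0).
  by split => // phi _; rewrite !ip_eq0l ?mulr0.
have n0 : norm0 Omega (fun=> 0) = 0 by rewrite /norm0 ip_eq0l ?sqrtr0.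
have e a : norm0 Omega (wD Omega a (fun=> 0)) = 0 by rewrite (norm0_wD (w0 a)).
exact: (sq_sum_eq0 (normH1_sqE (fun=> 0)) (e (0, 0)%N) (e (0, 1)%N) (e (1, 0)%N)).
Qed.

Lemma test_H10 phi : test_fun Omega phi -> H10 Omega phi.
Proof.
move=> tp; split.
  split; first exact: test_L2 tp.
  by move=> a ha; exists (pderiv a phi); exact: weak_deriv_test.
exists (fun=> phi); split => //.
rewrite (_ : (fun n : nat => _) = fun=> 0); first exact: cvg_cst.
apply/funext => n; rewrite -[RHS]normH1_0; congr (normH 1 Omega _).
by apply/funext => x /=; rewrite subrr.
Qed.

(** Test functions belong to [H10], and their chosen weak gradient agrees almost everywhere with the
    classical one. *)
Lemma poisson_weak_div f u : L2 Omega f -> weak_poisson Omega f u ->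
  L2v Omega (wgrad Omega u) /\ is_weak_div Omega (wgrad Omega u) (fun x => - f x).
Proof.
move=> f2 [[[u2 Hu] _] Hp].
have [g1 w1] := Hu (1, 0)%N isT; have [g2 w2] := Hu (0, 1)%N isT.
have G2 : L2v Omega (wgrad Omega u) by split; [exact: (wDP w1).1|exact: (wDP w2).1].
split => //; split; first exact: L2N.
move=> phi tp; have t1 := test_L2 mO (test_fun_d1 tp); have t2 := test_L2 mO (test_fun_d2 tp).
have y1 := weak_deriv_test (a := (1, 0)%N) tp isT; have y2 := weak_deriv_test (a := (0, 1)%N) tp isT.
have Wv : L2v Omega (wgrad Omega phi) := conj (wDP y1).1 (wDP y2).1.
have tv : L2v Omega (fun x => (d1 phi x, d2 phi x)) := conj t1 t2.
have gE : {ae mu, forall x, Omega x -> (d1 phi x, d2 phi x) = wgrad Omega phi x}.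
  by apply: ae_imp2 (wD_unique y1) (wD_unique y2) => x h1 h2 Ox; congr pair; apply/esym; [exact: h1|exact: h2].
have ->: ipv Omega (wgrad Omega u) (fun x => (d1 phi x, d2 phi x)) = ipv Omega (wgrad Omega u) (wgrad Omega phi).
  by apply: (ipv_ae mO G2 G2 tv Wv _ gE); exact: ae_all.
by rewrite (ipNl mO f2 (test_L2 mO tp)) opprK; exact: Hp _ (test_H10 tp).
Qed.

End WeakSolutions.

(** * Error estimates *)

Section Estimates.
Variable R : realType.
Notation mu := (leb2 R).
Notation mpt := (measurableTypeR R * measurableTypeR R)%type.
Implicit Types (K L : triangle R) (x : pt R) (v g f u d w D : pt R -> R) (p q : pt R -> pt R).

Lemma poincare_hK (a b c : pt R) v k1 k2 : det a b c != 0 -> H1 (tri a b c) v k1 k2 ->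
  ip (tri a b c) (fun x => v x - ip (tri a b c) v one / area a b c)
     (fun x => v x - ip (tri a b c) v one / area a b c) <=
  3 * hK (a, b, c) ^+ 2 * (ip (tri a b c) k1 k1 + ip (tri a b c) k2 k2).
Proof.
move=> d0 Hv; have [mD muD] := diffset_mu d0.
have hh x z : tri a b c x -> tri a b c (x + z) -> z.1 ^+ 2 + z.2 ^+ 2 <= hK (a, b, c) ^+ 2.
  move=> Ux Uz; have h0 := hK_ge0 a b c; have := hK_ub (tri_hull d0 Uz) (tri_hull d0 Ux).
  rewrite edist_le// => hs; apply: le_trans hs.
  rewrite (_ : sqd _ _ = z.1 ^+ 2 + z.2 ^+ 2)// /sqd /=; ring.
exact: (poincare erefl (bounded_tri d0) Hv (area_gt0 d0) hh mD (fun x z => tri_diffset d0) muD).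
Qed.

Lemma le_of_sq (s t : R) : 0 <= s -> 0 <= t -> s ^+ 2 <= s * t -> s <= t.
Proof.
move=> s0 t0; have [->//|sn] := eqVneq s 0; rewrite expr2 ler_pM2l// lt_neqAle eq_sym sn; exact: s0.
Qed.

Lemma sq_le (s t k : R) : 0 <= t -> 0 <= k -> s ^+ 2 <= k ^+ 2 * t ^+ 2 -> s <= k * t.
Proof.
move=> t0 k0; rewrite -exprMn => h; apply: (le_trans (ler_norm s)).
by rewrite -ler_sqr ?nnegrE ?mulr_ge0// real_normK ?num_real.
Qed.

Lemma weak_sign (r s t : R) : r = (-1) ^+ 1 * s -> r = (-1) ^+ 2 * t -> s = - t.
Proof. rewrite expr1 sqrrN expr1n mulN1r mul1r => -> /esym ->; by rewrite opprK. Qed.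

Lemma div_sum (v A B x y z : R) : v = A + B -> A = - x -> B = - y -> z = x + y -> v = - z.
Proof. by move=> -> -> -> ->; rewrite opprD. Qed.

Lemma sub_swap (x y s t : R) : s + x = 0 -> t = - y -> x - y = - (s - t).
Proof. lra. Qed.

Lemma sub_merge (x y z : R) : y - z = 0 -> x - z = x - y.
Proof. lra. Qed.

Lemma gg_merge (gg gd pu pG uhd phG : R) : gd = - gg -> gd = pu - uhd -> pG + pu = 0 -> phG + uhd = 0 ->
  gg = pG - phG.
Proof. lra. Qed.

Lemma hess_sum (N a b t x y z X Y Z : R) : N ^+ 2 = a ^+ 2 + (b ^+ 2 + t ^+ 2) ->
  t ^+ 2 = x ^+ 2 + (y ^+ 2 + z ^+ 2) -> x ^+ 2 = X -> y ^+ 2 = Y -> z ^+ 2 = Z ->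
  Z + Y + (Y + X) <= 2 * N ^+ 2.
Proof.
move=> -> -> <- <- <-; have := sqr_ge0 a; have := sqr_ge0 b; have := sqr_ge0 x; have := sqr_ge0 z; lra.
Qed.

Lemma grad_sum (N a b t x y X Y : R) : N ^+ 2 = a ^+ 2 + (t ^+ 2 + b ^+ 2) ->
  t ^+ 2 = x ^+ 2 + y ^+ 2 -> x ^+ 2 = X -> y ^+ 2 = Y -> Y + X <= N ^+ 2.
Proof. move=> -> -> <- <-; have := sqr_ge0 a; have := sqr_ge0 b; lra. Qed.

Lemma hess_bound (U : set (pt R)) u : ip U (wD U (2, 0)%N u) (wD U (2, 0)%N u) +
    ip U (wD U (1, 1)%N u) (wD U (1, 1)%N u) + (ip U (wD U (1, 1)%N u) (wD U (1, 1)%N u) +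
    ip U (wD U (0, 2)%N u) (wD U (0, 2)%N u)) <= 2 * normH 2 U u ^+ 2.
Proof.
exact: (hess_sum (normH2_sq U u) (seminorm2_sq U u) (norm0_sq U (wD U (0, 2)%N u))
  (norm0_sq U (wD U (1, 1)%N u)) (norm0_sq U (wD U (2, 0)%N u))).
Qed.

Lemma grad_bound (U : set (pt R)) u : ip U (wD U (1, 0)%N u) (wD U (1, 0)%N u) +
    ip U (wD U (0, 1)%N u) (wD U (0, 1)%N u) <= normH 2 U u ^+ 2.
Proof.
exact: (grad_sum (normH2_sq U u) (seminorm1_sq U u) (norm0_sq U (wD U (0, 1)%N u))
  (norm0_sq U (wD U (1, 0)%N u))).
Qed.

Variables (Omega : set (pt R)) (T S : seq (triangle R)).
Hypothesis oO : open Omega.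
Hypothesis bO : bounded_set Omega.
Hypothesis uS : uniq S.
Hypothesis detS : forall K, K \in S -> 0 < detK K.
Hypothesis subS : forall K, K \in S -> triK K `<=` Omega.
Hypothesis disS : forall K L, K \in S -> L \in S -> K != L -> forall z, triK K z -> ~ triK L z.
Hypothesis aeS : {ae mu, forall x, Omega x -> \sum_(K <- S) \1_(triK K) x = 1 :> R}.
Hypothesis uF : uniq (flags S).
Hypothesis injF : forall e e1 : triangle R, e \in flags S -> e1 \in flags S -> e.1 = e1.1 -> e = e1.
Hypothesis partF : forall a b c, (a, b, c) \in flags S -> segment a b `&` Omega = set0 \/
  exists2 c', (b, a, c') \in flags S & patch a b c c' `<=` Omega.
Hypothesis TS : forall L, L \in T -> exists2 K, K \in S & hull K = hull L.
Hypothesis ST : forall K, K \in S -> exists2 L, L \in T & hull L = hull K.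

Let mO : measurable (Omega : set mpt) := open_measurable2 oO.

Let fO : (mu Omega < +oo)%E.
Proof. by have [M OM] := bounded_sub_box bO; exact: bounded_mu OM. Qed.

Let detS0 K : K \in S -> det K.1.1 K.1.2 K.2 != 0.
Proof. by move=> /detS; rewrite /detK => /gt_eqF ->. Qed.

Let mK K : measurable (triK K : set mpt) := measurable_triK K.

Let fK K : K \in S -> (mu (triK K) < +oo)%E.
Proof. by move=> /detS0/mu_tri_fin. Qed.

Let hull_tri K : K \in S -> {ae mu, forall x, hull K x -> triK K x}.
Proof.
move=> KS; have := ae_ctri_tri (detS0 KS); apply: ae_imp => x h.
have := hullE (detS0 KS); rewrite (_ : (K.1.1, K.1.2, K.2) = K); last by case: (K) => -[].
by move=> ->.
Qed.

Let tri_sub_hull K : K \in S -> triK K `<=` hull K.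
Proof.
move=> KS x; have := tri_hull (detS0 KS) (x := x).
by rewrite (_ : (K.1.1, K.1.2, K.2) = K)//; case: (K) => -[].
Qed.

(** The discrete spaces are defined on the closed hulls of [T], whereas the analysis runs on the
    open cells of [S]; this lemma and the next three pass between the two up to null sets. *)
Lemma S_C_tri D : S_C Omega T D -> forall K, K \in S -> exists c : R, {ae mu, forall x, triK K x -> D x = c}.
Proof.
move=> [_ H] K KS; have [L LT e] := ST KS; have [c hc] := H L LT; exists c.
by apply: ae_imp hc => x h /(tri_sub_hull KS); rewrite -e; exact: h.
Qed.

Lemma S_C_of_tri D : L2 Omega D -> (forall K, K \in S -> exists c : R, {ae mu, forall x, triK K x -> D x = c}) ->
  S_C Omega T D.
Proof.
move=> D2 H; split => // L /TS[K KS e]; have [c hc] := H K KS; exists c.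
by apply: ae_imp2 (hull_tri KS) hc => x h1 h2; rewrite -e => /h1.
Qed.

Lemma S_RT_tri q : S_RT Omega T q -> forall K, K \in S ->
  exists (k : R) (b : pt R), {ae mu, forall x, triK K x -> q x = k *: x + b}.
Proof.
move=> [_ H] K KS; have [L LT e] := ST KS; have [k [b hc]] := H L LT; exists k, b.
by apply: ae_imp hc => x h /(tri_sub_hull KS); rewrite -e; exact: h.
Qed.

Lemma S_RT_of_tri q : Hdiv Omega q -> (forall K, K \in S ->
  exists (k : R) (b : pt R), {ae mu, forall x, triK K x -> q x = k *: x + b}) -> S_RT Omega T q.
Proof.
move=> D2 H; split => // L /TS[K KS e]; have [k [b hc]] := H K KS; exists k, b.
by apply: ae_imp2 (hull_tri KS) hc => x h1 h2; rewrite -e => /h1.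
Qed.

Lemma weak_divB q q' d d' : L2v Omega q -> L2v Omega q' -> is_weak_div Omega q d ->
  is_weak_div Omega q' d' -> is_weak_div Omega (q \- q') (d \- d').
Proof.
move=> q2 q2' [d2' H] [d2'' H']; split; first exact: L2B.
move=> phi tp; have t1 := test_L2 mO (test_fun_d1 tp); have t2 := test_L2 mO (test_fun_d2 tp).
have tv : L2v Omega (fun x => (d1 phi x, d2 phi x)) := conj t1 t2.
by rewrite (ipvBl mO q2 q2' tv) H// H'// (ipBl mO d2' d2'' (test_L2 mO tp)) opprB addrC opprK.
Qed.

Lemma HdivB q q' : Hdiv Omega q -> Hdiv Omega q' -> Hdiv Omega (q \- q').
Proof.
move=> [q2 [d hd]] [q2' [d' hd']]; split; first exact: L2vB.
by exists (d \- d'); exact: weak_divB.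
Qed.

Lemma S_RTB q q' : S_RT Omega T q -> S_RT Omega T q' -> S_RT Omega T (q \- q').
Proof.
move=> hq hq'; apply: S_RT_of_tri => [|K KS]; first by apply: HdivB; [case: hq|case: hq'].
have [k [b h]] := S_RT_tri hq KS; have [k' [b' h']] := S_RT_tri hq' KS.
exists (k - k'), (b - b'); apply: ae_imp2 h h' => x h1 h2 Kx /=.
by rewrite h1// h2// scalerBl opprD addrACA.
Qed.

Lemma S_CB v w : S_C Omega T v -> S_C Omega T w -> S_C Omega T (v \- w).
Proof.
move=> hv hw; apply: S_C_of_tri => [|K KS]; first by apply: L2B => //; [case: hv|case: hw].
have [k h] := S_C_tri hv KS; have [k' h'] := S_C_tri hw KS.
by exists (k - k'); apply: ae_imp2 h h' => x h1 h2 Kx /=; rewrite h1// h2.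
Qed.

Lemma S_C_pw (k : triangle R -> R) : S_C Omega T (pw S (fun K => fun=> k K)).
Proof.
apply: S_C_of_tri => [|K KS].
  by apply: L2_pw => // K KS; apply: L2_cst; [exact: mK|exact: fK].
by exists (k K); apply: ae_all => x Kx; exact: (pwE uS disS _ KS Kx).
Qed.

(** A piecewise constant sees only the cell integrals of the other factor, so identities against
    such functions reduce to single cells. *)
Lemma ip_S_C w D : L2 Omega w -> S_C Omega T D ->
  exists c : triangle R -> R, forall w', L2 Omega w' -> ip Omega w' D = \sum_(K <- S) c K * ip (triK K) w' one.
Proof.
move=> w2 hD; have D2 : L2 Omega D by case: hD.
have /choice[c hc] : forall K, exists c : R, K \in S -> {ae mu, forall x, triK K x -> D x = c}.
  move=> K; have [KS|KS] := boolP (K \in S); last by exists 0.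
  by have [c h] := S_C_tri hD KS; exists c.
exists c => w' w'2; rewrite (ip_mesh mO subS aeS w'2 D2) big_seq [RHS]big_seq; apply: eq_bigr => K KS.
have wK := L2_triK mO subS KS w'2; have DK := L2_triK mO subS KS D2.
rewrite -(ip_cstr _ (mK K) (fK KS) wK); apply: (ip_ae (mK K) wK wK DK (L2_cst _ (mK K) (fK KS))).
  exact: ae_all.
exact: hc.
Qed.

(** The weak divergence is defined globally; testing with functions supported in one open cell,
    where [q] is affine, identifies it there as [2 * k]. *)
Lemma S_C_wdiv q : S_RT Omega T q -> S_C Omega T (wdiv Omega q).
Proof.
move=> hq; have Hq : Hdiv Omega q by case: hq.
have [d2' Hd] := wdivP Hq; have [[q12 q22] _] := Hq.
apply: S_C_of_tri => // K KS; have [k [b h]] := S_RT_tri hq KS; exists (2 * k).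
have d0 := detS0 KS; have dK := L2_triK mO subS KS d2'.
have cK := L2_cst (2 * k) (mK K) (fK KS).
have wK := L2B (mK K) dK cK.
suff : {ae mu, forall x, triK K x -> (wdiv Omega q \- (fun=> 2 * k)) x = 0}.
  by apply: ae_imp => x h0 Kx; apply/eqP; rewrite -subr_eq0; apply/eqP; exact: h0.
apply: (test_uniq (mK K) (poly_cutoff (bounded_tri d0)) wK) => psi tp.
have tO := test_funS (subS KS) tp; have pK := test_L2 (mK K) tp.
have p1K := test_L2 (mK K) (test_fun_d1 tp); have p2K := test_L2 (mK K) (test_fun_d2 tp).
rewrite (ipBl (mK K) dK cK pK) -(ip_testS _ (subS KS) tp).
have := Hd _ tO.
have tv : L2v Omega (fun x => (d1 psi x, d2 psi x)) := conj (test_L2 mO (test_fun_d1 tO)) (test_L2 mO (test_fun_d2 tO)).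
have Qv : L2v Omega q := conj q12 q22.
have -> : ipv Omega q (fun x => (d1 psi x, d2 psi x)) =
    ip (triK K) (fst_of q) (d1 psi) + ip (triK K) (snd_of q) (d2 psi).
  rewrite (ipv_sum mO Qv tv); congr (_ + _).
    exact: (ip_testS _ (subS KS) (test_fun_d1 tp)).
  exact: (ip_testS _ (subS KS) (test_fun_d2 tp)).
have l1 := smooth_aff (b.1, k, 0); have l2 := smooth_aff (b.2, 0, k).
have L2aff l : L2 (triK K) (aff l).
  have [x1 x2] := @L2_cx R _ _ _ d0 0.
  have := L2D (mK K) (L2_cst l.1.1 (mK K) (fK KS)) (L2D (mK K) (L2Z (mK K) l.1.2 x1) (L2Z (mK K) l.2 x2)).
  by congr (L2 _ _); apply/funext => x; rewrite /= /aff /cx1 /cx2 !subr0 addrA.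
have -> : ip (triK K) (fst_of q) (d1 psi) = - ip (triK K) (fun=> k) psi.
  rewrite (ip_ae (mK K) (L2_triK mO subS KS q12) (L2aff (b.1, k, 0)) p1K p1K _ (ae_all (fun _ _ => erefl))).
    rewrite (ibp1 l1 tp); congr (- ip _ _ _); apply/funext => x; exact: d1_aff.
  by apply: ae_imp h => x hx Kx; rewrite /fst_of hx// /aff /= /GRing.scale/=; ring.
have -> : ip (triK K) (snd_of q) (d2 psi) = - ip (triK K) (fun=> k) psi.
  rewrite (ip_ae (mK K) (L2_triK mO subS KS q22) (L2aff (b.2, 0, k)) p2K p2K _ (ae_all (fun _ _ => erefl))).
    rewrite (ibp2 l2 tp); congr (- ip _ _ _); apply/funext => x; exact: d2_aff.
  by apply: ae_imp h => x hx Kx; rewrite /snd_of hx// /aff /= /GRing.scale/=; ring.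
have c1 := L2_cst k (mK K) (fK KS).
have -> : ip (triK K) (fun=> 2 * k) psi = 2 * ip (triK K) (fun=> k) psi by rewrite -(ipZl (mK K) _ c1 pK).
lra.
Qed.

Definition hess_field u : field R := Field (wD Omega (1, 0)%N u) (wD Omega (2, 0)%N u) (wD Omega (1, 1)%N u)
  (wD Omega (0, 1)%N u) (wD Omega (1, 1)%N u) (wD Omega (0, 2)%N u).

(** Second weak derivatives of [u] act as first derivatives of its gradient. As [pderiv] applies
    [d2] before [d1], the mixed derivative in the second component needs [schwarz]. *)
Lemma H1v_hess u : Hk 2 Omega u -> H1v Omega (hess_field u).
Proof.
move=> [u2 Hu].
have W a : (a.1 + a.2 <= 2)%N -> is_weak_deriv Omega a u (wD Omega a u).
  by move=> /Hu[g hg]; exact: wDP hg.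
have [k10 e10] := W (1, 0)%N isT; have [k01 e01] := W (0, 1)%N isT.
have [k20 e20] := W (2, 0)%N isT; have [k11 e11] := W (1, 1)%N isT.
have [k02 e02] := W (0, 2)%N isT.
have sw phi : test_fun Omega phi -> d1 (d2 phi) = d2 (d1 phi).
  by case=> sp _ _; apply: schwarz; exact: sp.
split; [apply: (And5 k10 k20 k11)|apply: (And5 k01 k11 k02)] => phi tp.
- exact: weak_sign (e10 _ (test_fun_d1 tp)) (e20 _ tp).
- exact: weak_sign (e10 _ (test_fun_d2 tp)) (e11 _ tp).
- have := e01 _ (test_fun_d1 tp); rewrite /pderiv/= -sw// => e; exact: weak_sign e (e11 _ tp).
- exact: weak_sign (e01 _ (test_fun_d2 tp)) (e02 _ tp).
Qed.

Lemma laplace_ae f u : L2 Omega f -> weak_poisson Omega f u -> Hk 2 Omega u ->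
  {ae mu, forall x, Omega x -> wD Omega (2, 0)%N u x + wD Omega (0, 2)%N u x = - f x}.
Proof.
move=> f2 hp hu; have [W2 Wd] := poisson_weak_div oO detS subS aeS f2 hp.
have [[a1 a2 a3 a4 a5] [b1 b2 b3 b4 b5]] := H1v_hess hu.
apply: (weak_div_unique oO detS subS aeS) Wd; split; first exact: (L2D mO a2 b3).
move=> phi tp; have tv : L2v Omega (fun x => (d1 phi x, d2 phi x)) :=
  conj (test_L2 mO (test_fun_d1 tp)) (test_L2 mO (test_fun_d2 tp)).
exact: (div_sum (ipv_sum mO W2 tv) (a4 _ tp) (b5 _ tp) (ipDl mO a2 b3 (test_L2 mO tp))).
Qed.

Lemma ip_ae0 v d : L2 Omega v -> L2 Omega d -> {ae mu, forall x, Omega x -> d x = 0} -> ip Omega v d = 0.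
Proof.
move=> v2 d2' h; have z2 : L2 Omega (fun=> 0 : R) := L2_cst 0 mO fO.
by rewrite (ip_ae mO v2 v2 d2' z2 (ae_all (fun _ _ => erefl)) h) ipC ip_eq0l.
Qed.

Lemma glob_S_RT F : H1v Omega F -> S_RT Omega T (glob S F).
Proof.
move=> HF; apply: S_RT_of_tri; first exact: (glob_Hdiv oO uS detS subS disS aeS uF injF partF HF).
move=> K KS; exists (rt_slope K.1.1 K.1.2 K.2 F), (rt_const K.1.1 K.1.2 K.2 F).
apply: ae_all => x Kx; rewrite /glob /glob1 /glob2 !(pwE uS disS _ KS Kx).
by rewrite -/(rt_interp K.1.1 K.1.2 K.2 F x); case: (rt_interp _ _ _ _ _).
Qed.

(** The commuting property [rt_slopeE], cell by cell: against piecewise constants the interpolant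
    has the exact divergence. *)
Lemma glob_div_S_C F D : H1v Omega F -> S_C Omega T D ->
  ip Omega (glob_div S F) D = ip Omega (fun x => g11 F x + g22 F x) D.
Proof.
move=> HF hD; have [[_ a2 _ _ _] [_ _ b3 _ _]] := HF.
have l1 : L2 Omega (fun x => g11 F x + g22 F x) := L2D mO a2 b3.
have l2 : L2 Omega (glob_div S F) := L2_glob_div F oO detS.
have [c hc] := ip_S_C l1 hD; rewrite (hc _ l1) (hc _ l2) big_seq [RHS]big_seq.
apply: eq_bigr => K KS; congr (_ * _).
have HK : H1v (triK K) F.
  by case: HF => h1 h2; split; [exact: H1S (subS KS) h1|exact: H1S (subS KS) h2].
have [[_ k1 _ _ _] [_ _ k2 _ _]] := HK.
have o2 : L2 (triK K) one := L2_cst 1 (mK K) (fK KS).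
have -> : ip (triK K) (fun x => g11 F x + g22 F x) one = ip (triK K) (g11 F) one + ip (triK K) (g22 F) one.
  exact: (ipDl (mK K) k1 k2 o2).
rewrite -(rt_slopeE (detS0 KS) HK) -(ipZl (mK K) _ o2 o2).
by apply: ip_congr => // x Kx; rewrite /glob_div (pwE uS disS _ KS Kx) /one mulr1.
Qed.

Variables (C12 r h : R).
Hypothesis reg : regularity Omega C12.
Hypotheses (r0 : 0 <= r) (h0 : 0 <= h).
Hypothesis hr : forall K, K \in S -> circumradius K <= r.
Hypothesis hh : forall K, K \in S -> hK K <= h.

Let reg_abs g w : normH 2 Omega w <= C12 * norm0 Omega g -> normH 2 Omega w ^+ 2 <= (`|C12| * norm0 Omega g) ^+ 2.
Proof.
move=> hw; rewrite ler_sqr ?nnegrE ?normH_ge0 ?mulr_ge0 ?norm0_ge0//.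
by apply: (le_trans hw); apply: ler_wpM2r; [exact: norm0_ge0|exact: ler_norm].
Qed.

(** [36 ^ 2 = 648 * 2], where the 2 appears because the mixed derivative occurs in both components
    of the gradient but only once in the seminorm. *)
Lemma interp_RT g : L2 Omega g -> exists w, [/\ weak_poisson Omega g w, Hk 2 Omega w,
   normH 2 Omega w ^+ 2 <= (`|C12| * norm0 Omega g) ^+ 2,
   norm0v Omega (wgrad Omega w \- glob S (hess_field w)) <= 36 * r * (`|C12| * norm0 Omega g) &
   norm0v Omega (wgrad Omega w) <= `|C12| * norm0 Omega g].
Proof.
move=> g2; have [w [hp hu hw]] := reg g2; exists w; have hw2 := reg_abs hw.
have B0 : 0 <= `|C12| * norm0 Omega g by rewrite mulr_ge0 ?norm0_ge0.
split => //.
- apply: sq_le; [exact: B0|exact: (mulr_ge0 (ler0n R 36) r0)|].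
  have k0 : 0 <= 648 * r ^+ 2 := mulr_ge0 (ler0n R 648) (sqr_ge0 r).
  apply: (le_trans (glob_error oO uS detS subS disS aeS (H1v_hess hu) hr)).
  apply: (@le_trans _ _ (648 * r ^+ 2 * (2 * normH 2 Omega w ^+ 2))).
    exact: (ler_wpM2l k0 (hess_bound Omega w)).
  have -> : (36 * r) ^+ 2 * (`|C12| * norm0 Omega g) ^+ 2 = 648 * r ^+ 2 * (2 * (`|C12| * norm0 Omega g) ^+ 2).
    by ring.
  exact: (ler_wpM2l k0 (ler_wpM2l (ler0n R 2) hw2)).
- rewrite -[X in _ <= X]mul1r; apply: sq_le; [exact: B0|exact: ler01|].
  rewrite expr1n mul1r; apply: le_trans hw2; rewrite norm0v_ip; exact: grad_bound.
Qed.

(** The L^2 projection onto piecewise constants; its orthogonality is [ip_mean]. *)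
Definition cell_mean v : pt R -> R :=
  pw S (fun K => fun=> ip (triK K) v one / area K.1.1 K.1.2 K.2).

Lemma S_C_mean v : S_C Omega T (cell_mean v).
Proof. exact: S_C_pw. Qed.

Lemma ip_mean v D : L2 Omega v -> S_C Omega T D -> ip Omega (cell_mean v) D = ip Omega v D.
Proof.
move=> v2 hD; have P2 : L2 Omega (cell_mean v) by case: (S_C_mean v).
have [c hc] := ip_S_C v2 hD; rewrite (hc _ P2) (hc _ v2) big_seq [RHS]big_seq.
apply: eq_bigr => K KS; congr (_ * _); have o2 : L2 (triK K) one := L2_cst 1 (mK K) (fK KS).
set m := ip (triK K) v one / area K.1.1 K.1.2 K.2.
have -> : ip (triK K) (cell_mean v) one = ip (triK K) (fun x => m * one x) one.
  by apply: ip_congr => // x Kx; rewrite /cell_mean (pwE uS disS _ KS Kx) /one mulr1.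
by rewrite (ipZl (mK K) _ o2 o2) /m divfK// gt_eqF// area_gt0// detS0.
Qed.

Lemma poincare_mesh v k1 k2 : H1 Omega v k1 k2 ->
  norm0 Omega (v \- cell_mean v) ^+ 2 <= 3 * h ^+ 2 * (ip Omega k1 k1 + ip Omega k2 k2).
Proof.
move=> Hv; have [v2 k12 k22 _ _] := Hv; have P2 : L2 Omega (cell_mean v) by case: (S_C_mean v).
have e2 := L2B mO v2 P2; rewrite norm0_sq (ip_mesh mO subS aeS e2 e2).
rewrite (ip_mesh mO subS aeS k12 k12) (ip_mesh mO subS aeS k22 k22) -big_split mulr_sumr.
rewrite big_seq [leRHS]big_seq; apply: ler_sum => K KS.
have HK : H1 (triK K) v k1 k2 := H1S mO (mK K) (subS KS) Hv.
set m := ip (triK K) v one / area K.1.1 K.1.2 K.2.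
have -> : ip (triK K) (v \- cell_mean v) (v \- cell_mean v) = ip (triK K) (fun x => v x - m) (fun x => v x - m).
  by apply: ip_congr => x Kx /=; rewrite /cell_mean (pwE uS disS _ KS Kx).
apply: (le_trans (poincare_hK (detS0 KS) HK)).
apply: ler_wpM2r; first by apply: addr_ge0; exact: ip_ge0.
have hk0 := hK_ge0 K.1.1 K.1.2 K.2; have := hh KS.
move: hk0; rewrite (_ : (K.1.1, K.1.2, K.2) = K); last by case: (K) => -[].
by move=> hk0 hk; apply: ler_wpM2l => //; rewrite ler_sqr ?nnegrE.
Qed.

(** The factor 2 rounds up the square root of the Poincaré constant 3. *)
Lemma projection_error g w : Hk 2 Omega w -> normH 2 Omega w ^+ 2 <= (`|C12| * norm0 Omega g) ^+ 2 ->
  norm0 Omega (w \- cell_mean w) <= 2 * h * (`|C12| * norm0 Omega g).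
Proof.
move=> hw hN; have B0 : 0 <= `|C12| * norm0 Omega g by rewrite mulr_ge0 ?norm0_ge0.
have [w2 Hw] := hw; have [g1 e1] := Hw (1, 0)%N isT; have [g2 e2] := Hw (0, 1)%N isT.
have [k1 f1] := wDP e1; have [k2 f2] := wDP e2.
have HW : H1 Omega w (wD Omega (1, 0)%N w) (wD Omega (0, 1)%N w).
  apply: (And5 w2 k1 k2) => phi tp.
    by have := f1 _ tp; rewrite expr1 mulN1r.
  by have := f2 _ tp; rewrite expr1 mulN1r.
apply: sq_le; [exact: B0|exact: (mulr_ge0 (ler0n R 2) h0)|].
apply: (le_trans (poincare_mesh HW)).
apply: (@le_trans _ _ (3 * h ^+ 2 * normH 2 Omega w ^+ 2)).
  exact: (ler_wpM2l (mulr_ge0 (ler0n R 3) (sqr_ge0 h)) (grad_bound Omega w)).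
apply: (@le_trans _ _ (4 * h ^+ 2 * normH 2 Omega w ^+ 2)).
  have k34 : (3 : R) <= 4 by rewrite ler_nat.
  exact: (ler_wpM2r (sqr_ge0 _) (ler_wpM2r (sqr_ge0 h) k34)).
have -> : (2 * h) ^+ 2 * (`|C12| * norm0 Omega g) ^+ 2 = 4 * h ^+ 2 * (`|C12| * norm0 Omega g) ^+ 2 by ring.
exact: (ler_wpM2l (mulr_ge0 (ler0n R 4) (sqr_ge0 h)) hN).
Qed.

(** Transfers the regularity of the Poisson solution to the mixed one. The difference of the fluxes
    has zero divergence and is therefore orthogonal to itself; the difference of the potentials is
    tested with the gradient of the Poisson solution that has this difference as data. *)
Lemma mixed_unique f p u w : L2 Omega f -> mixed_solution Omega f p u -> weak_poisson Omega f w ->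
  norm0v Omega (p \- wgrad Omega w) = 0 /\ norm0 Omega (u \- w) = 0.
Proof.
move=> f2 [Hp u2 m1 m2] hw; have [W2 Wd] := poisson_weak_div oO detS subS aeS f2 hw.
have Hw : H10 Omega w by case: hw.
have w2 : L2 Omega w by case: Hw => -[].
have HW : Hdiv Omega (wgrad Omega w) by split => //; exists (fun x => - f x).
have p2 : L2v Omega p by case: Hp.
have pd := wdivP Hp; have pd2 : L2 Omega (wdiv Omega p) by case: pd.
have mf2 := L2N mO f2.
set W := wgrad Omega w in W2 Wd HW *.
have Hg q : Hdiv Omega q -> ipv Omega W q = - ip Omega w (wdiv Omega q).
  by move=> Hq; apply: (H10_grad oO detS subS aeS Hw _ (wdivP Hq)); case: Hq.
have ed := weak_divB p2 W2 pd Wd; have e2 := L2vB mO p2 W2.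
have He := HdivB Hp HW; set e := p \- W in ed e2 He *.
set dl := wdiv Omega p \- _ in ed; have dl2 : L2 Omega dl by case: ed.
(* [dl] is the divergence of [p] plus [f], and it is itself admissible in the second mixed
   equation. *)
have dl0 : ip Omega dl dl = 0.
  rewrite {1}/dl (ipBl mO pd2 mf2 dl2) (ipNl mO f2 dl2) opprK; exact: m2.
have dlae := ip_eq0_ae mO dl2 dl0.
have we0 : {ae mu, forall x, Omega x -> wdiv Omega e x = 0}.
  by apply: ae_imp2 (weak_div_unique oO detS subS aeS (wdivP He) ed) dlae => x h1 h2 Ox; rewrite h1// h2.
have we2 : L2 Omega (wdiv Omega e) by case: (wdivP He).
have pe : ipv Omega p e = 0.
  by have := m1 _ He; rewrite (ip_ae0 u2 we2 we0) addr0.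
have We : ipv Omega W e = 0 by rewrite (Hg _ He) (ip_ae0 w2 we2 we0) oppr0.
have ee : ipv Omega e e = 0 by rewrite {1}/e (ipvBl mO p2 W2 e2) pe We subrr.
have Ne : norm0v Omega e = 0.
  have := norm0v_sq_ipv mO e2; rewrite ee; move: (norm0v Omega e) => t /eqP; rewrite sqrf_eq0 => /eqP; exact.
split => //.
set g := u \- w; have g2 : L2 Omega g := L2B mO u2 w2.
have [z [hz _ _ _ _]] := interp_RT g2.
have [Z2 Zd] := poisson_weak_div oO detS subS aeS g2 hz; set Z := wgrad Omega z in Z2 Zd.
have HZ : Hdiv Omega Z by split => //; exists (fun x => - g x).
have dZ2 : L2 Omega (wdiv Omega Z) by case: (wdivP HZ).
have E1 : ip Omega g (wdiv Omega Z) = - ip Omega g g.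
  rewrite -(ipNr mO g2 g2); apply: (ip_ae mO g2 g2 dZ2 (L2N mO g2)); first exact: ae_all.
  exact: (weak_div_unique oO detS subS aeS (wdivP HZ) Zd).
have E2 : ip Omega g (wdiv Omega Z) = - ipv Omega e Z.
  rewrite /g (ipBl mO u2 w2 dZ2) /e (ipvBl mO p2 W2 Z2); exact: sub_swap (m1 _ HZ) (Hg _ HZ).
have E3 : ipv Omega e Z = 0.
  by apply/eqP; rewrite -normr_le0; apply: (le_trans (ipv_CS mO e2 Z2)); rewrite Ne mul0r.
have gg : ip Omega g g = 0 by apply: oppr_inj; rewrite -E1 E2 E3.
by rewrite /norm0 gg sqrtr0.
Qed.

(** Interpolation preserves the divergence against piecewise constants, and the exact divergence of
    the gradient is [- g]. *)
Lemma wdiv_glob g w D : L2 Omega g -> weak_poisson Omega g w -> Hk 2 Omega w -> S_C Omega T D ->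
  ip Omega (wdiv Omega (glob S (hess_field w))) D = - ip Omega g D.
Proof.
move=> g2 hw hk hD; have HF := H1v_hess hk; have D2 : L2 Omega D by case: hD.
have HG : Hdiv Omega (glob S (hess_field w)) by case: (glob_S_RT HF).
have wG := glob_weak_div oO uS detS subS disS aeS uF injF partF HF.
have d2 : L2 Omega (wdiv Omega (glob S (hess_field w))) by case: (wdivP HG).
have gd2 : L2 Omega (glob_div S (hess_field w)) by case: wG.
have [[_ a2 _ _ _] [_ _ b3 _ _]] := HF.
rewrite (ip_ae mO d2 gd2 D2 D2 (weak_div_unique oO detS subS aeS (wdivP HG) wG) (ae_all (fun _ _ => erefl))).
rewrite (glob_div_S_C HF hD) -(ipNl mO g2 D2).
apply: (ip_ae mO (L2D mO a2 b3) (L2N mO g2) D2 D2 _ (ae_all (fun _ _ => erefl))).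
exact: laplace_ae.
Qed.

Lemma norm0vC q q' : norm0v Omega (q \- q') = norm0v Omega (q' \- q).
Proof.
rewrite /norm0v; congr (Num.sqrt (_ ^+ 2 + _ ^+ 2)); rewrite -[RHS]norm0N; congr norm0;
  by apply/funext => x; rewrite /fst_of /snd_of /= opprB.
Qed.

(** * The flux error and the duality argument for the potential *)

Section Errors.
Variables (f u uh : pt R -> R) (p ph : pt R -> pt R).
Hypotheses (f2 : L2 Omega f) (Hex : mixed_solution Omega f p u) (HRT : RT_solution Omega T f ph uh).

(** Against piecewise constants both [G] and [ph] have divergence [- f], and the divergence of
    [G - ph] is piecewise constant, hence zero. So [G - ph] is orthogonal to [p - ph], and
    Cauchy-Schwarz leaves the interpolation error [p - G]. *)
Lemma flux_error : norm0v Omega (p \- ph) <= 36 * r * (`|C12| * norm0 Omega f).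
Proof.
have [Hp u2 m1 m2] := Hex; have [hph huh n1 n2] := HRT.
have [w [hw hk _ err _]] := interp_RT f2; have HF := H1v_hess hk.
have [Np _] := mixed_unique f2 Hex hw.
have [W2 _] := poisson_weak_div oO detS subS aeS f2 hw.
have hG := glob_S_RT HF; set G := glob S (hess_field w) in err hG.
have Hph : Hdiv Omega ph by case: hph.
have HG : Hdiv Omega G by case: hG.
have p2 : L2v Omega p by case: Hp.
have ph2 : L2v Omega ph by case: Hph.
have G2 : L2v Omega G by case: HG.
have uh2 : L2 Omega uh by case: huh.
have hq := S_RTB hG hph; have Hq : Hdiv Omega (G \- ph) by case: hq.
have hD := S_C_wdiv hq; set D := wdiv Omega (G \- ph) in hD.
have D2 : L2 Omega D by case: hD.
have dG2 : L2 Omega (wdiv Omega G) by case: (wdivP HG).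
have dp2 : L2 Omega (wdiv Omega ph) by case: (wdivP Hph).
have DE := weak_div_unique oO detS subS aeS (wdivP Hq) (weak_divB G2 ph2 (wdivP HG) (wdivP Hph)).
have DD : ip Omega D D = 0.
  rewrite (ip_ae mO D2 (L2B mO dG2 dp2) D2 D2 DE (ae_all (fun _ _ => erefl))) (ipBl mO dG2 dp2 D2).
  rewrite (wdiv_glob f2 hw hk hD); have := n2 _ hD => /eqP; rewrite addr_eq0 => /eqP ->.
  by rewrite subrr.
have D0 := ip_eq0_ae mO D2 DD.
have pq : ipv Omega p (G \- ph) = 0 by have := m1 _ Hq; rewrite (ip_ae0 u2 D2 D0) addr0.
have phq : ipv Omega ph (G \- ph) = 0 by have := n1 _ hq; rewrite (ip_ae0 uh2 D2 D0) addr0.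
have q2 : L2v Omega (G \- ph) by case: Hq.
have e2 := L2vB mO p2 ph2; have k2 := L2vB mO p2 G2.
have eq0 : ipv Omega (p \- ph) (G \- ph) = 0 by rewrite (ipvBl mO p2 ph2 q2) pq phq subrr.
have B0 : 0 <= 36 * r * (`|C12| * norm0 Omega f).
  by apply: mulr_ge0; [exact: (mulr_ge0 (ler0n R 36) r0)|rewrite mulr_ge0 ?norm0_ge0].
have E : norm0v Omega (p \- ph) ^+ 2 = ipv Omega (p \- ph) (p \- G).
  rewrite (norm0v_sq_ipv mO e2) {2}(_ : p \- ph = (fun x => (p \- G) x + (G \- ph) x)).
    have := ipvBr mO k2 q2 e2; move: eq0.
    rewrite (ipvBr mO G2 ph2 e2) (ipvBr mO p2 G2 e2) => h1 _.
    rewrite (_ : (fun x => _) = p \- ph); first by rewrite (ipvBr mO p2 ph2 e2); move: h1; exact: sub_merge.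
    by apply/funext => x /=; rewrite addrA subrK.
  by apply/funext => x /=; rewrite addrA subrK.
have le1 : norm0v Omega (p \- ph) <= norm0v Omega (p \- G).
  apply: le_of_sq; [exact: norm0v_ge0|exact: norm0v_ge0|rewrite E].
  by apply: (le_trans (ler_norm _)); exact: ipv_CS.
apply: (le_trans le1); apply: le_trans err.
have t1 := L2vB mO p2 W2; have t2 := L2vB mO W2 G2.
have := norm0vD mO t1 t2; rewrite Np add0r; congr (norm0v Omega _ <= _).
by apply/funext => x /=; rewrite addrA subrK.
Qed.

(** The error passes through [w] and its cell means. The remaining discrete part [g] is the data of
    a dual Poisson problem whose interpolated flux [G] satisfies [ip g g = ipv (p - ph) G]. The norm
    of [G] is at most that of the dual flux plus its interpolation error, and [r <= kr] makes this
    bound independent of the mesh. *)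
Lemma potential_error (kr : R) : r <= kr -> norm0 Omega (u \- uh) <=
  2 * h * (`|C12| * norm0 Omega f) + 36 * r * (`|C12| * norm0 Omega f) * ((1 + 36 * kr) * `|C12|).
Proof.
move=> rk; have [Hp u2 m1 m2] := Hex; have [hph huh n1 n2] := HRT.
have [w [hw hk hN _ _]] := interp_RT f2.
have [_ Nu] := mixed_unique f2 Hex hw.
have w2 : L2 Omega w by case: hk.
have p2 : L2v Omega p by case: Hp.
have ph2 : L2v Omega ph by case: hph => -[].
have uh2 : L2 Omega uh by case: huh.
have hP := S_C_mean w; have P2 : L2 Omega (cell_mean w) by case: hP.
have hg := S_CB hP huh; set g := cell_mean w \- uh in hg.
have g2 : L2 Omega g by case: hg.
have [z [hz zk _ zerr zn]] := interp_RT g2; have hG := glob_S_RT (H1v_hess zk).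
have Z2 := (poisson_weak_div oO detS subS aeS g2 hz).1.
have wG : forall D, S_C Omega T D -> _ := fun D => wdiv_glob g2 hz zk (D := D).
set G := glob S (hess_field z) in zerr hG wG.
have HG : Hdiv Omega G by case: hG.
have G2 : L2v Omega G by case: HG.
have hD := S_C_wdiv hG; have D2 : L2 Omega (wdiv Omega G) by case: hD.
have e2 := L2vB mO p2 ph2.
have uw : ip Omega u (wdiv Omega G) = ip Omega w (wdiv Omega G).
  apply/eqP; rewrite -subr_eq0 -(ipBl mO u2 w2 D2) -normr_le0.
  by apply: (le_trans (ip_CS mO (L2B mO u2 w2) D2)); rewrite Nu mul0r.
(* The divergence of [G] is piecewise constant, so the cell means of [w] may be replaced by [w] and
   then by [u]; both mixed formulations accept [G] as a test field. *)
have gg : ip Omega g g = ipv Omega (p \- ph) G.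
  have h1 := wG _ hg; rewrite ipC in h1.
  have h2 := ipBl mO P2 uh2 D2; rewrite -/g (ip_mean w2 hD) -uw in h2.
  rewrite (ipvBl mO p2 ph2 G2); exact: (gg_merge h1 h2 (m1 _ HG) (n1 _ hG)).
have c0 : 0 <= `|C12| by [].
have NG : norm0v Omega G <= (1 + 36 * kr) * `|C12| * norm0 Omega g.
  have t2 := L2vB mO G2 Z2; have := norm0vD mO Z2 t2.
  rewrite (norm0vC G) => tr.
  have GE : wgrad Omega z \+ (G \- wgrad Omega z) = G by apply/funext => x /=; rewrite addrC subrK.
  rewrite GE in tr; apply: (le_trans tr); apply: (le_trans (lerD zn zerr)).
  have -> : `|C12| * norm0 Omega g + 36 * r * (`|C12| * norm0 Omega g) = (1 + 36 * r) * (`|C12| * norm0 Omega g).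
    by ring.
  rewrite -mulrA; apply: ler_wpM2r; first by rewrite mulr_ge0 ?norm0_ge0.
  by rewrite lerD2l; apply: ler_wpM2l.
have k0 : 0 <= (1 + 36 * kr) * `|C12|.
  by apply: mulr_ge0 => //; apply: addr_ge0 => //; apply: mulr_ge0 => //; exact: le_trans rk.
have Ng : norm0 Omega g <= 36 * r * (`|C12| * norm0 Omega f) * ((1 + 36 * kr) * `|C12|).
  apply: (@le_trans _ _ (norm0v Omega (p \- ph) * ((1 + 36 * kr) * `|C12|))); last first.
    exact: (ler_wpM2r k0 flux_error).
  apply: le_of_sq; [exact: norm0_ge0|exact: (mulr_ge0 (norm0v_ge0 _ _) k0)|].
  rewrite norm0_sq gg; apply: (le_trans (ler_norm _)); apply: (le_trans (ipv_CS mO e2 G2)).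
  rewrite mulrCA [norm0 Omega g * _]mulrC; exact: (ler_wpM2l (norm0v_ge0 _ _) NG).
have tr1 := norm0D mO (L2B mO u2 w2) (L2B mO w2 uh2).
have tr2 := norm0D mO (L2B mO w2 P2) g2.
have E1 : (u \- w) \+ (w \- uh) = u \- uh by apply/funext => x /=; rewrite addrA subrK.
have E2 : (w \- cell_mean w) \+ g = w \- uh by apply/funext => x /=; rewrite addrA subrK.
rewrite E1 Nu add0r in tr1; rewrite E2 in tr2.
apply: (le_trans tr1); apply: (le_trans tr2); apply: lerD Ng; exact: projection_error.
Qed.

End Errors.
End Estimates.

Lemma mesh_max (R : realType) (f : triangle R -> R) (T : seq (triangle R)) :
  0 <= \big[Num.max/0]_(K <- T) f K /\ forall K, K \in T -> f K <= \big[Num.max/0]_(K <- T) f K.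
Proof.
elim: T => [|L T [ih0 ih]]; first by rewrite big_nil.
rewrite big_cons; split=> [|K]; first by rewrite le_max ih0 orbT.
by rewrite inE le_max => /predU1P[->|/ih ->]; rewrite ?lexx ?orbT.
Qed.

(** 38 is 36 for the flux error plus 2 for the projection error, and [36 * k] accounts for the
    duality term. *)
Lemma absorb_constants (R : realType) (c k r h F N N' : R) : 0 <= c -> 0 <= k -> 0 <= r -> 0 <= h -> 0 <= F ->
  N <= 36 * r * (c * F) -> N' <= 2 * h * (c * F) + 36 * r * (c * F) * k ->
  N <= c * (38 + 36 * k) * r * F /\ N' <= c * (38 + 36 * k) * (r + h) * F.
Proof.
move=> c0 k0 r0 h0 F0 hN hN'; have rX : 0 <= r * (c * F) by rewrite !mulr_ge0.
have hX : 0 <= h * (c * F) by rewrite !mulr_ge0.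
have krX : 0 <= k * (r * (c * F)) by rewrite mulr_ge0.
have khX : 0 <= k * (h * (c * F)) by rewrite mulr_ge0.
by split; nra.
Qed.

Theorem corollary12 (R : realType) (C21 C22 C12 : R)
    (C21_gt0 : 0 < C21) (C22_gt0 : 0 < C22)
    (hC21 : forall K : triangle R, standard_triangle K ->
       (B21 K <= (C21 * hK K)%:E)%E)
    (hC22 : forall K : triangle R, standard_triangle K ->
       (B22 K <= (C22 * circumradius K)%:E)%E) :
  exists C : R,
    forall Omega : set (pt R), polygonal_domain Omega -> regularity Omega C12 ->
    forall T : seq (triangle R), proper_triangulation Omega T ->
    C22 * mesh_R T <= 1 ->
    forall f : pt R -> R, L2 Omega f ->
    forall (p : pt R -> pt R) (u : pt R -> R), mixed_solution Omega f p u ->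
    forall (ph : pt R -> pt R) (uh : pt R -> R), RT_solution Omega T f ph uh ->
    norm0v Omega (p \- ph) <= C * mesh_R T * norm0 Omega f /\
    norm0 Omega (u \- uh) <= C * (mesh_R T + mesh_h T) * norm0 Omega f.
Proof.
(* [k] bounds the interpolated dual flux relative to its data, with [C22^-1] as upper bound of the
   circumradius. The absolute value supplies the sign needed when bounds are multiplied by the
   regularity constant. *)
pose k := (1 + 36 * C22^-1) * `|C12|; exists (`|C12| * (38 + 36 * k)).
move=> Omega [[oO _] _ bO regO _] reg T pT small f f2 p u Hex ph uh HRT.
have nd : forall K, K \in T -> Defs.nondegenerate K by case: pT.
have [S [uS hS inj TS]] := mesh_normal nd.
have detS K : K \in S -> 0 < detK K by case/hS.
have subS K (KS : K \in S) : triK K `<=` Omega := triK_Omega regO pT hS KS.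
have disS K L : K \in S -> L \in S -> K != L -> forall z, triK K z -> ~ triK L z.
  move=> KS LS KL z Kz Lz; apply: (triK_disjoint pT hS inj KS LS KL Kz).
  exact: (triK_hull hS LS Lz).
have aeS := mesh_ae pT uS hS inj TS.
have uF := uniq_flags pT uS hS inj.
have injF e e1 : e \in flags S -> e1 \in flags S -> e.1 = e1.1 -> e = e1.
  case: e e1 => [[a b] c] [[a' b'] c'] /flatten_mapP[K KS eK] /flatten_mapP[L LS eL] /= [ea eb].
  rewrite -ea -eb in eL *; by have [_ ->] := flag_unique pT hS inj KS LS eK eL.
have partF a b c : (a, b, c) \in flags S -> segment a b `&` Omega = set0 \/
    exists2 c', (b, a, c') \in flags S & patch a b c c' `<=` Omega.
  move=> /flatten_mapP[K KS eK]; have [e|ne] := pselect (segment a b `&` Omega = set0); first by left.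
  have [c' fc' _] := flag_partner oO pT hS inj TS KS eK ne; right; exists c' => //.
  by move: fc' => /flatten_mapP[L LS eL]; exact: (flag_patch regO pT hS KS LS eK eL).
have ST K : K \in S -> exists2 L, L \in T & hull L = hull K.
  by move=> /hS[_ [L LT ->]]; exists L; rewrite ?orient_hull.
have [r0 hr] := mesh_max (@circumradius R) T; have [h0 hh] := mesh_max (@hK R) T.
have hr' K : K \in S -> circumradius K <= mesh_R T.
  by move=> /hS[_ [L LT ->]]; rewrite orient_circumradius; exact: hr.
have hh' K : K \in S -> hK K <= mesh_h T.
  by move=> /hS[_ [L LT ->]]; rewrite orient_hK; exact: hh.
have rk : mesh_R T <= C22^-1 by rewrite -[leRHS]mul1r ler_pdivlMr// mulrC.
have e1 := flux_error oO bO uS detS subS disS aeS uF injF partF TS ST reg r0 hr' f2 Hex HRT.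
have e2 := potential_error oO bO uS detS subS disS aeS uF injF partF TS ST reg r0 h0 hr' hh' f2 Hex HRT rk.
have k0 : 0 <= k.
  by apply: mulr_ge0 => //; apply: addr_ge0 => //; apply: mulr_ge0 => //; rewrite invr_ge0 ltW.
exact: (absorb_constants (normr_ge0 C12) k0 r0 h0 (norm0_ge0 Omega f) e1 e2).
Qed.
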